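(* Let $b_0=0<b_1<\dots<b_k<b_{k+1}<\cdots$ with $b_k\nearrow1$, let $0<\beta_1<\beta_2<\cdots$ be integers, and assume that (i) $\displaystyle\frac{4+2\beta_1}{2b_1}<\frac{\beta_2-\beta_1}{2(b_2-b_1)}<\frac{\beta_3-\beta_2}{2(b_3-b_2)}<\cdots<\frac{\beta_{k+1}-\beta_k}{2(b_{k+1}-b_k)}<\cdots$; (ii) $\displaystyle\frac{4+2\beta_1}{2b_1}\le\frac{4+\beta_1+\beta_k}{2b_k}$ for all $k\ge1$, and for every $p=1,2,3,\dots$, $\displaystyle\frac{\beta_{p+1}-\beta_p}{2(b_{p+1}-b_p)}\le\frac{\beta_{k+1}-\beta_p}{2(b_{k+1}-b_p)}$ for all $k\ge p$. Let $\{B_k\}_{k=0}^\infty\subset\mathbb C\setminus\{0\}$ with $|B_k|\le1$ for all $k$ and with the $|B_k|$ chosen sufficiently small (that is, there are $\varepsilon_k>0$ depending only on $\{b_j\}$ and $\{\beta_j\}$ such that the conclusion holds whenever $0<|B_k|\le\varepsilon_k$ for all $k$). Define $V\in L^\infty_c(\mathbb R;\mathbb C)$ by $V(x)=B_k(x-b_k)^{\beta_{k+1}}(b_{k+1}-x)^{\beta_{k+1}}$ for $x\in[b_k,b_{k+1}]$, $k\ge 0$, and $V(x)=0$ for $x\in\mathbb R\setminus(0,1)$. Put $t_1:=\frac{4+2\beta_1}{2b_1}$ and $t_k:=\frac{\beta_k-\beta_{k-1}}{2(b_k-b_{k-1})}$ for $k\ge2$. Then for each $k=1,2,3,\dots$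 there is a sequence of resonances of $-\frac{d^2}{dx^2}+V$ asymptotic to $\{\operatorname{Im}\lambda=-t_k\log(1+|\lambda|),\ \operatorname{Re}\lambda>0\}$, with linear density $\frac1\pi(b_k-b_{k-1})$.
   Context: Resonances are the poles of the meromorphic continuation of $R_V(\lambda)=(-\frac{d^2}{dx^2}+V-\lambda^2)^{-1}:L^2_c\to H^2_{loc}$ from $\operatorname{Im}\lambda\gg1$ to $\lambda\in\mathbb C$, repeated according to multiplicity (the rank of $\oint_{\lambda_0}R_V(\zeta)\,d\zeta$ at $\lambda_0\ne 0$). A sequence of resonances $\{\lambda_m\}$ (each used at most as many times as its multiplicity) with $\operatorname{Re}\lambda_m\to+\infty$ is asymptotic to $\{\operatorname{Im}\lambda=-t\log(1+|\lambda|),\operatorname{Re}\lambda>0\}$ if $-\operatorname{Im}\lambda_m/\log\operatorname{Re}\lambda_m\to t$; it has linear density $D$ if $\lim_{r\to\infty}\frac1r\#\{m:|\lambda_m|<r\}=D$. *)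

(* Defs.v *)
From HB Require Import structures.
From mathcomp Require Import all_boot all_order all_algebra.
From mathcomp Require Import finmap.
From mathcomp Require Import all_classical all_reals all_analysis.
From mathcomp Require Import complex.

Set Implicit Arguments.
Unset Strict Implicit.
Unset Printing Implicit Defensive.

Import Order.TTheory GRing.Theory Num.Theory.
Import numFieldNormedType.Exports.

Local Open Scope classical_set_scope.
Local Open Scope complex_scope.
Local Open Scope ring_scope.

Section Resonances.
Variable R : realType.

Local Notation C := R[i].
Local Notation mu := (@lebesgue_measure R).

Definition cmod (z : C) : R := ComplexField.Normc.normc z.

Definition cmeasurable (f : R -> C) : Prop :=
  measurable_fun setT (fun x => complex.Re (f x)) /\
  measurable_fun setT (fun x => complex.Im (f x)).

Definition cintegral (D : set R) (f : R -> C) : C :=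
  (\int[mu]_(x in D) complex.Re (f x))%R +i*
  (\int[mu]_(x in D) complex.Im (f x))%R.

Definition sqL2 (D : set R) (f : R -> C) : \bar R :=
  (\int[mu]_(x in D) ((cmod (f x)) ^+ 2)%:E)%E.

Definition box (M : R) : set R := `[- M, M].

Definition L2 (f : R -> C) : Prop :=
  cmeasurable f /\ (sqL2 setT f < +oo)%E.

Definition L2loc (f : R -> C) : Prop :=
  cmeasurable f /\ forall M : R, (sqL2 (box M) f < +oo)%E.

Definition L2_supp (M : R) (f : R -> C) : Prop :=
  L2 f /\ forall x, M < `|x| -> f x = 0.

Definition L2c (f : R -> C) : Prop := exists M : R, L2_supp M f.

(* [u] is absolutely continuous on compact intervals with derivative [v],
   provided [v] is locally integrable. *)
Definition primitive_of (v u : R -> C) : Prop :=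
  forall x y : R, x <= y -> u y - u x = cintegral `[x, y] v.

(* In one dimension [u] is in H^2_loc iff its continuous representative is C^1
   with u' locally absolutely continuous and u'' in L^2_loc.  Elements of
   H^2_loc are represented by their continuous representative; [u1] is u' and
   [u2], determined almost everywhere, is u''. *)
Definition H2loc_derivs (u u1 u2 : R -> C) : Prop :=
  [/\ primitive_of u1 u, primitive_of u2 u1 & L2loc u2].

Definition H2_derivs (u u1 u2 : R -> C) : Prop :=
  [/\ H2loc_derivs u u1 u2, L2 u, L2 u1 & L2 u2].

Definition sqH2 (D : set R) (u u1 u2 : R -> C) : \bar R :=
  (sqL2 D u + sqL2 D u1 + sqL2 D u2)%E.

(* Operators L^2_c -> H^2_loc are represented by maps on functions; only their
   values on L^2_c are relevant. *)
Definition oper := (R -> C) -> (R -> C).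

(* The norm of T : L^2([-M, M]) -> H^2(]-M, M[) is at most [c]. *)
Definition opnorm_le (T : oper) (M c : R) : Prop :=
  forall f, L2_supp M f ->
  exists u1 u2, H2loc_derivs (T f) u1 u2 /\
    (sqH2 (box M) (T f) u1 u2 <= (c ^+ 2)%:E * sqL2 setT f)%E.

Definition linear_oper (T : oper) : Prop :=
  forall (a : C) f g, L2c f -> L2c g ->
  forall x, T (fun y => a * f y + g y) x = a * T f x + T g x.

Definition bounded_oper (T : oper) : Prop :=
  linear_oper T /\ forall M : R, exists c : R, opnorm_le T M c.

Definition oper_rank (T : oper) (n : nat) : Prop :=
  exists e : 'I_n -> R -> C,
  [/\ forall i, exists f, L2c f /\ e i =1 T f,
      forall a : 'I_n -> C,
        (forall x, \sum_(i < n) a i * e i x = 0) -> forall i, a i = 0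
    & forall f, L2c f ->
        exists a : 'I_n -> C, forall x, T f x = \sum_(i < n) a i * e i x].

Definition finite_rank (T : oper) : Prop := exists n, oper_rank T n.

Definition oper_holomorphic_on (A : C -> oper) (z0 : C) (r : R) : Prop :=
  forall z, cmod (z - z0) < r ->
  bounded_oper (A z) /\
  exists A' : oper, bounded_oper A' /\
    forall M eps : R, 0 < eps ->
    exists delta : R, 0 < delta /\
      forall w, 0 < cmod (w - z) < delta ->
      opnorm_le (fun f x => (A w f x - A z f x) / (w - z) - A' f x) M eps.

Definition laurent (T : C -> oper) (z0 : C) (r : R)
    (J : nat) (A : nat -> oper) (A0 : C -> oper) : Prop :=
  [/\ 0 < r,
      oper_holomorphic_on A0 z0 r,
      forall j, (0 < j <= J)%N -> bounded_oper (A j) /\ finite_rank (A j)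
    & forall z, 0 < cmod (z - z0) < r -> forall f, L2c f -> forall x,
        T z f x = \sum_(1 <= j < J.+1) A j f x / (z - z0) ^+ j + A0 z f x].

Definition meromorphic_family (T : C -> oper) : Prop :=
  forall z0, exists r J A A0, laurent T z0 r J A A0.

Definition is_pole (T : C -> oper) (z0 : C) : Prop :=
  exists r J A A0, [/\ laurent T z0 r J A A0, (0 < J)%N
    & exists f, L2c f /\ exists x, A J f x != 0].

Definition contour_oper (T : C -> oper) (z0 : C) (r : R) : oper :=
  fun f x => cintegral `[0, 2 * pi]
    (fun s : R => let e : C := cos s +i* sin s in
       T (z0 + r%:C * e) f x * ((0 +i* r) * e)).

Definition pole_multiplicity (T : C -> oper) (z0 : C) (n : nat) : Prop :=
  exists r0 : R, 0 < r0 /\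
    forall r : R, 0 < r < r0 -> oper_rank (contour_oper T z0 r) n.

(* [u] is in H^2(R) and solves - u'' + V u - z^2 u = f. *)
Definition H2_solution (V : R -> C) (z : C) (f u : R -> C) : Prop :=
  exists u1 u2, H2_derivs u u1 u2 /\
    {ae mu, forall x, - u2 x + V x * u x - z ^+ 2 * u x = f x}.

Definition is_resolvent (V : R -> C) (z : C) (T : oper) : Prop :=
  forall f, L2c f ->
    H2_solution V z f (T f) /\ forall u, H2_solution V z f u -> u =1 T f.

(* By analytic continuation this determines [T] on L^2_c off a discrete set. *)
Definition resolvent_continuation (V : R -> C) (T : C -> oper) : Prop :=
  meromorphic_family T /\
  exists c : R, forall z, c < complex.Im z -> is_resolvent V z (T z).

(* The value 0 is excluded: the multiplicity there is not given by the rank of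
   the residue, and it is irrelevant when Re lam_m -> +oo. *)
Definition resonance_sequence (V : R -> C) (lam : nat -> C) : Prop :=
  exists T, resolvent_continuation V T /\
    forall m, [/\ lam m != 0, is_pole T (lam m)
      & exists n, pole_multiplicity T (lam m) n /\
          ([set j | lam j = lam m] #<= `I_n)%card].

Definition asymptotic_to_log_curve (t : R) (lam : nat -> C) : Prop :=
  (fun m => complex.Re (lam m)) @ \oo --> +oo /\
  (fun m => - complex.Im (lam m) / ln (complex.Re (lam m))) @ \oo --> t.

(* [fset_set] of an infinite set is empty, so finiteness is required. *)
Definition linear_density (D : R) (lam : nat -> C) : Prop :=
  (forall r : R, finite_set [set m | cmod (lam m) < r]) /\
  (fun r : R => r^-1 * (#|` fset_set [set m | cmod (lam m) < r]|)%:R)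
    @ +oo --> D.

End Resonances.

(* Main.v *)
(* Let phi solve phi'' = (V - l^2) phi with phi = exp (- i l x) for x <= 0, and let
   W(l) = exp (i l x) (phi' - i l phi)(x) for x >= 1.  Variation of parameters gives
   the resolvent with W as denominator; W is entire, and a simple zero of W is a
   pole of multiplicity 1.

   On each piece [b_j, b_(j+1)] the potential is a polynomial, so the Riccati
   equation attached to phi'' = (V - l^2) phi has approximate solutions that are
   polynomials in x and 1 / l.  They do not match at the nodes b_j, where V vanishes
   to finite order only, and these jumps give
     - W(l) / (2 i l) = 1 + sum_j c_j exp (2 i l b_j) / (2 i l)^(4 + beta_1 + beta_j)
   up to relatively small errors.  The smallness of the B_k makes the estimates
   uniform over the infinitely many pieces; only the first N nodes count, because V
   has more than N vanishing derivatives at the others.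

   On Im l = - t_k log |l| the monotonicity of the slopes makes the terms of index
   k - 1 and k of the same size and all the others negligible.  Near the points
   m pi / (b_k - b_(k-1)), suitably shifted, the normalized W is therefore a small
   perturbation of 1 - exp (2 i (b_k - b_(k-1)) z), and has a simple zero there. *)
Require Import Defs.
From mathcomp Require Import all_boot all_order all_algebra.
From mathcomp Require Import all_classical all_reals all_analysis.
From mathcomp Require Import measurable_realfun.
From mathcomp Require Import complex.
From mathcomp Require Import ring lra.

Set Implicit Arguments.
Unset Strict Implicit.
Unset Printing Implicit Defensive.

Import Order.TTheory GRing.Theory Num.Theory.
Import numFieldNormedType.Exports.

Local Open Scope classical_set_scope.
Local Open Scope complex_scope.
Local Open Scope ring_scope.

(** * Complex numbers and the exponential *)

Arguments cmod : simpl never.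

Section ComplexModulus.
Variable R : realType.
Local Notation C := R[i].
Implicit Types (x y z w : C) (a b : R).

(** Uniformity shapes the proof. The continuation must be holomorphic as a family of operators into
    H^2 of bounded intervals, so dependence on the spectral parameter is carried by Taylor
    expansions whose remainders are uniform in the source and in the point. A source is only square
    integrable; adding a primitive of it to u' leaves a first order system with continuous
    coefficients. A term of the expansion of the Wronskian is a double reflection: at 0, of order
    -(beta_1 + 1), and at the node, of order -(beta_j + 1); two divisions by 2 i l complete the
    exponent. The order N of the Riccati approximation is dictated by the curve, whereas its
    constants depend on the piece. A diagonal choice settles this: the k-th amplitude tames the
    constants of all orders up to k, so for a given N only finitely many pieces have constants above
    1. The t_k are the slopes of a convex polygon over the nodes, and at each slope exactly two
    vertices are extremal: these are the two dominant terms. Zeros come from a contraction, and a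
    linear lower bound around each of them makes it simple. *)

Lemma cmod_ge0 z : 0 <= cmod z.
Proof. by case: z => a b; exact: sqrtr_ge0. Qed.

Lemma cmod0 : cmod (0 : C) = 0.
Proof. exact: ComplexField.Normc.normc0. Qed.

Lemma cmod1 : cmod (1 : C) = 1.
Proof. exact: ComplexField.Normc.normc1. Qed.

Lemma cmodM z w : cmod (z * w) = cmod z * cmod w.
Proof. exact: ComplexField.Normc.normcM. Qed.

Lemma cmodV z : cmod z^-1 = (cmod z)^-1.
Proof. exact: ComplexField.Normc.normcV. Qed.

Lemma cmod_div z w : cmod (z / w) = cmod z / cmod w.
Proof. by rewrite cmodM cmodV. Qed.

Lemma cmodN z : cmod (- z) = cmod z.
Proof. by case: z => a b; rewrite /cmod /= !sqrrN. Qed.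

Lemma cmodD z w : cmod (z + w) <= cmod z + cmod w.
Proof. exact: le_normcD. Qed.

Lemma cmodB z w : cmod (z - w) <= cmod z + cmod w.
Proof. by rewrite (le_trans (cmodD _ _))// cmodN. Qed.

Lemma cmod_distC z w : cmod (z - w) = cmod (w - z).
Proof. by rewrite -cmodN opprB. Qed.

Lemma cmod_eq0 z : (cmod z == 0) = (z == 0).
Proof.
apply/eqP/eqP => [|->]; last exact: cmod0.
exact: ComplexField.Normc.eq0_normc.
Qed.

Lemma cmod_gt0 z : (0 < cmod z) = (z != 0).
Proof. by rewrite lt_def cmod_ge0 andbT cmod_eq0. Qed.

Lemma cmodX z n : cmod (z ^+ n) = cmod z ^+ n.
Proof. by elim: n => [|n IH]; rewrite ?expr0 ?cmod1// !exprS cmodM IH. Qed.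

Lemma cmodC a : cmod a%:C = `|a|.
Proof. by rewrite /cmod /= expr0n addr0 sqrtr_sqr. Qed.

Lemma cmod_i : cmod ('i : C) = 1.
Proof. by rewrite /cmod /= expr0n expr1n add0r sqrtr1. Qed.

Lemma cmod_nat n : cmod (n%:R : C) = n%:R.
Proof.
have -> : (n%:R : C) = (n%:R : R)%:C by rewrite rmorph_nat.
by rewrite cmodC normr_nat.
Qed.

Lemma cmod_Re z : `|complex.Re z| <= cmod z.
Proof.
case: z => a b; rewrite /cmod /= -sqrtr_sqr ler_wsqrtr//.
by rewrite lerDl sqr_ge0.
Qed.

Lemma cmod_Im z : `|complex.Im z| <= cmod z.
Proof.
case: z => a b; rewrite /cmod /= -sqrtr_sqr ler_wsqrtr//.
by rewrite lerDr sqr_ge0.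
Qed.

Lemma cmod_sqr z : cmod z ^+ 2 = complex.Re z ^+ 2 + complex.Im z ^+ 2.
Proof. by case: z => a b; rewrite /cmod /= sqr_sqrtr// addr_ge0 ?sqr_ge0. Qed.

Lemma cmod_ReIm z : cmod z <= `|complex.Re z| + `|complex.Im z|.
Proof.
rewrite -(ler_pXn2r (n := 2))// ?nnegrE ?cmod_ge0 ?addr_ge0//.
rewrite cmod_sqr sqrrD !real_normK ?num_real// -addrA lerD2l lerDr.
by rewrite mulrn_wge0// mulr_ge0.
Qed.

Lemma cmod_dist z w : `|cmod z - cmod w| <= cmod (z - w).
Proof.
have h x y : cmod x - cmod y <= cmod (x - y).
  by rewrite lerBlDr -{1}(subrK y x) cmodD.
by rewrite ler_norml h andbT lerNl opprB cmod_distC h.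
Qed.

Lemma cmod_sum (I : Type) (r : seq I) (P : pred I) (F : I -> C) :
  cmod (\sum_(i <- r | P i) F i) <= \sum_(i <- r | P i) cmod (F i).
Proof.
elim/big_ind2 : _ => [|a z b w h1 h2|//]; first by rewrite cmod0.
by rewrite (le_trans (cmodD _ _))// lerD.
Qed.

Lemma ReD z w : complex.Re (z + w) = complex.Re z + complex.Re w.
Proof. by case: z w => [a b] [c d]. Qed.
Lemma ImD z w : complex.Im (z + w) = complex.Im z + complex.Im w.
Proof. by case: z w => [a b] [c d]. Qed.
Lemma ReN z : complex.Re (- z) = - complex.Re z.
Proof. by case: z. Qed.
Lemma ImN z : complex.Im (- z) = - complex.Im z.
Proof. by case: z. Qed.
Lemma ReM z w : complex.Re (z * w) =
  complex.Re z * complex.Re w - complex.Im z * complex.Im w.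
Proof. by case: z w => [a b] [c d]. Qed.
Lemma ImM z w : complex.Im (z * w) =
  complex.Re z * complex.Im w + complex.Im z * complex.Re w.
Proof. by case: z w => [a b] [c d]. Qed.

Lemma complex_eq z w :
  complex.Re z = complex.Re w -> complex.Im z = complex.Im w -> z = w.
Proof. by case: z w => [a b] [c d] /= -> ->. Qed.

(** Stands in for passing to a limit when an identity is proved by approximation. *)
Lemma cmod_small_eq0 z (K : R) :
  (forall e : R, 0 < e -> cmod z <= K * e) -> z = 0.
Proof.
move=> h; apply/eqP; rewrite -cmod_eq0 eq_le cmod_ge0 andbT.
apply/ler_addgt0Pl => e e0; rewrite addr0.
have K0 : 0 < `|K| + 1 by rewrite ltr_wpDl.
have := h _ (divr_gt0 e0 K0) => /le_trans; apply.
rewrite mulrCA ger_pMr//.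
by rewrite ler_pdivrMr// mul1r (le_trans (ler_norm _))// lerDl.
Qed.

Definition cexp (z : C) : C :=
  (expR (complex.Re z) * cos (complex.Im z)) +i*
  (expR (complex.Re z) * sin (complex.Im z)).

Lemma cexp0 : cexp 0 = 1.
Proof. by rewrite /cexp /= expR0 cos0 sin0 !mul1r. Qed.

Lemma cexpD z w : cexp (z + w) = cexp z * cexp w.
Proof.
rewrite /cexp ReD ImD expRD cosD sinD.
by apply: complex_eq; rewrite ?ReM ?ImM /=; ring.
Qed.

Lemma cmod_cexp z : cmod (cexp z) = expR (complex.Re z).
Proof.
rewrite /cexp /cmod /= !exprMn -mulrDr cos2Dsin2 mulr1 sqrtr_sqr.
by rewrite ger0_norm// expR_ge0.
Qed.

Lemma cexp_neq0 z : cexp z != 0.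
Proof. by rewrite -cmod_gt0 cmod_cexp expR_gt0. Qed.

Lemma cexpN z : cexp (- z) = (cexp z)^-1.
Proof.
apply: (mulfI (cexp_neq0 z)).
by rewrite -cexpD subrr cexp0 mulfV// cexp_neq0.
Qed.

Lemma cexpB z w : cexp (z - w) = cexp z / cexp w.
Proof. by rewrite cexpD cexpN. Qed.

Lemma cexpMn z n : cexp (n%:R * z) = cexp z ^+ n.
Proof.
elim: n => [|n IH]; first by rewrite mul0r cexp0.
by rewrite -natr1 mulrDl mul1r cexpD IH exprSr.
Qed.

(** The argument is [acos (Re z / |z|)] up to the sign of the imaginary part. A logarithm is needed
    to find the shift [q] that adjusts modulus and phase of the two dominant terms. *)
Lemma cexp_surj z : z != 0 -> exists w, cexp w = z.
Proof.
rewrite -cmod_gt0 => z0.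
pose u := complex.Re z / cmod z; pose v := complex.Im z / cmod z.
have uv : u ^+ 2 + v ^+ 2 = 1.
  rewrite /u /v !expr_div_n -mulrDl -cmod_sqr divff//.
  by rewrite expf_neq0// gt_eqF.
have u1 : -1 <= u <= 1.
  rewrite -ler_norml -(ler_pXn2r (n := 2))// ?nnegrE//.
  by rewrite real_normK ?num_real// expr1n -uv lerDl sqr_ge0.
have hre t : cos t = u -> sin t = v -> cexp (ln (cmod z) +i* t) = z.
  move=> ct st; rewrite /cexp /= lnK ?posrE// ct st.
  by apply: complex_eq => /=; rewrite /u /v mulrCA divff ?gt_eqF// mulr1.
have ca : cos (acos u) = u by rewrite acosK// in_itv.
have sa : sin (acos u) = Num.sqrt (1 - u ^+ 2) by rewrite sin_acos.
have sv : Num.sqrt (1 - u ^+ 2) = `|v|.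
  by rewrite -uv addrAC subrr add0r sqrtr_sqr.
have [v0|v0] := leP 0 v.
  by exists (ln (cmod z) +i* acos u); apply: hre; rewrite // sa sv ger0_norm.
exists (ln (cmod z) +i* - acos u); apply: hre; first by rewrite cosN.
by rewrite sinN sa sv ltr0_norm// opprK.
Qed.

End ComplexModulus.

(** * Calculus for complex functions of a real variable *)

Section ComplexDerivative.
Variable R : realType.
Local Notation C := R[i].
Implicit Types (f g : R -> C) (x y : R).

Lemma is_derive_ext (f g : R -> R) x d d' :
  f =1 g -> d = d' -> is_derive x (1 : R) f d -> is_derive x (1 : R) g d'.
Proof. by move=> /funext <- <-. Qed.

Lemma is_derive_continuous (f : R -> R) x d :
  is_derive x (1 : R) f d -> {for x, continuous f}.
Proof.
move=> h; apply: differentiable_continuous.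
exact/derivable1_diffP/ex_derive.
Qed.

Lemma continuous_ext (f g : R -> R) : f =1 g -> continuous f -> continuous g.
Proof. by move=> /funext ->. Qed.

Lemma derive_le_dist (g h dg dh : R -> R) a b : a <= b ->
  (forall x, a <= x <= b -> is_derive x (1 : R) g (dg x)) ->
  (forall x, a <= x <= b -> is_derive x (1 : R) h (dh x)) ->
  (forall x, a <= x <= b -> dg x <= dh x) -> g b - g a <= h b - h a.
Proof.
move=> ab hg hh gh.
have hd x : a <= x <= b -> is_derive x (1 : R) (fun t => h t - g t) (dh x - dg x).
  by move=> xab; have := hg _ xab; have := hh _ xab => ? ?; apply: is_deriveB.
have [| |c] := @MVT_segment _ (fun t => h t - g t) (fun x => dh x - dg x) a b ab.
- move=> x; rewrite in_itv/= => /andP[ax xb]; apply: hd.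
  by rewrite (ltW ax) (ltW xb).
- apply: continuous_in_subspaceT => x; rewrite inE /= in_itv/= => xab.
  exact: is_derive_continuous (hd x xab).
- rewrite in_itv/= => cab e.
  have : 0 <= (dh c - dg c) * (b - a).
    by rewrite mulr_ge0 ?subr_ge0// gh.
  by rewrite -e; lra.
Qed.

(** Differentiation in the real variable [x] only; dependence on the spectral parameter is expressed
    by power series. *)
Definition cder f x (d : C) : Prop :=
  is_derive x (1 : R) (fun t => complex.Re (f t)) (complex.Re d) /\
  is_derive x (1 : R) (fun t => complex.Im (f t)) (complex.Im d).

Definition ccont f : Prop :=
  continuous (fun t => complex.Re (f t)) /\
  continuous (fun t => complex.Im (f t)).

Lemma cder_ext f g x d d' : f =1 g -> d = d' -> cder f x d -> cder g x d'.
Proof. by move=> /funext <- <-. Qed.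

Lemma cder_eq f x d d' : cder f x d -> d = d' -> cder f x d'.
Proof. by move=> h <-. Qed.

Lemma cder_cst (c : C) x : cder (fun _ => c) x 0.
Proof. by split; exact: is_derive_cst. Qed.

Lemma cderD f g x d e : cder f x d -> cder g x e ->
  cder (fun t => f t + g t) x (d + e).
Proof.
move=> [f1 f2] [g1 g2]; split.
  by apply: is_derive_ext (is_deriveD f1 g1) => [t|]; rewrite ReD.
by apply: is_derive_ext (is_deriveD f2 g2) => [t|]; rewrite ImD.
Qed.

Lemma cderN f x d : cder f x d -> cder (fun t => - f t) x (- d).
Proof.
move=> [f1 f2]; split.
  by apply: is_derive_ext (is_deriveN f1) => [t|]; rewrite ReN.
by apply: is_derive_ext (is_deriveN f2) => [t|]; rewrite ImN.
Qed.

Lemma cderB f g x d e : cder f x d -> cder g x e ->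
  cder (fun t => f t - g t) x (d - e).
Proof. by move=> h1 h2; apply: cderD => //; exact: cderN. Qed.

Lemma cderM f g x d e : cder f x d -> cder g x e ->
  cder (fun t => f t * g t) x (d * g x + f x * e).
Proof.
move=> [f1 f2] [g1 g2]; split.
  apply: is_derive_ext (is_deriveB (is_deriveM f1 g1) (is_deriveM f2 g2)) => [t|].
    by rewrite ReM.
  by rewrite !(ReD, ReM) /GRing.scale /=; ring.
apply: is_derive_ext (is_deriveD (is_deriveM f1 g2) (is_deriveM f2 g1)) => [t|].
  by rewrite ImM.
by rewrite !(ImD, ImM) /GRing.scale /=; ring.
Qed.

Lemma cderZ (c : C) f x d : cder f x d -> cder (fun t => c * f t) x (c * d).
Proof.
by move=> h; apply: cder_eq (cderM (cder_cst c x) h) _; rewrite mul0r add0r.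
Qed.

Lemma cder_real (g : R -> R) x d : is_derive x (1 : R) g d ->
  cder (fun t => (g t)%:C) x d%:C.
Proof. by move=> h; split => //; exact: is_derive_cst. Qed.

Lemma cder_id x : cder (fun t => t%:C) x 1.
Proof. by apply: cder_eq (cder_real (is_derive_id x 1)) _. Qed.

Lemma cder_lin (c : C) x : cder (fun t => c * t%:C) x c.
Proof. by apply: cder_eq (cderZ c (cder_id x)) _; rewrite mulr1. Qed.

Lemma cder_cexp f x d : cder f x d ->
  cder (fun t => cexp (f t)) x (d * cexp (f x)).
Proof.
move=> [f1 f2].
have e1 : is_derive x (1 : R) (fun t => expR (complex.Re (f t)))
    (expR (complex.Re (f x)) * complex.Re d).
  exact: (@is_derive1_comp _ expR (fun t => complex.Re (f t))).
have e2 : is_derive x (1 : R) (fun t => cos (complex.Im (f t)))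
    (- sin (complex.Im (f x)) * complex.Im d).
  exact: (@is_derive1_comp _ cos (fun t => complex.Im (f t))).
have e3 : is_derive x (1 : R) (fun t => sin (complex.Im (f t)))
    (cos (complex.Im (f x)) * complex.Im d).
  exact: (@is_derive1_comp _ sin (fun t => complex.Im (f t))).
split; rewrite /cexp /=.
  apply: (is_derive_ext _ _ (is_deriveM e1 e2)) => //.
  by rewrite ReM /GRing.scale /=; ring.
apply: (is_derive_ext _ _ (is_deriveM e1 e3)) => //.
by rewrite ImM /GRing.scale /=; ring.
Qed.

Lemma cder_cexpl (c : C) x :
  cder (fun t => cexp (c * t%:C)) x (c * cexp (c * x%:C)).
Proof. exact: (cder_cexp (cder_lin c x)). Qed.

Lemma cder_poly (p : {poly C}) x :
  cder (fun t => p.[t%:C]) x (p^`()).[x%:C].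
Proof.
elim/poly_ind: p => [|p c IH].
  by rewrite deriv0 horner0; apply: cder_ext (cder_cst 0 x) => // t; rewrite horner0.
rewrite derivD derivM derivX derivC addr0 mulr1.
apply: cder_ext (cderD (cderM IH (cder_id x)) (cder_cst c x)).
  by move=> t; rewrite !hornerE.
by rewrite hornerD hornerM hornerX addr0 mulr1.
Qed.

Lemma cder_ccont f (df : R -> C) : (forall x, cder f x (df x)) -> ccont f.
Proof.
by move=> h; split => x; [have [/is_derive_continuous] := h x|
  have [_ /is_derive_continuous] := h x].
Qed.

Lemma ccont_ext f g : f =1 g -> ccont f -> ccont g.
Proof. by move=> /funext ->. Qed.

Lemma ccont_cst (c : C) : ccont (fun _ => c).
Proof. by split => x; exact: cvg_cst. Qed.

Lemma ccontD f g : ccont f -> ccont g -> ccont (fun t => f t + g t).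
Proof.
move=> [f1 f2] [g1 g2]; split.
  apply: (@continuous_ext (fun t => complex.Re (f t) + complex.Re (g t))).
    by move=> t; rewrite ReD.
  by move=> x; apply: cvgD; [exact: f1|exact: g1].
apply: (@continuous_ext (fun t => complex.Im (f t) + complex.Im (g t))).
  by move=> t; rewrite ImD.
by move=> x; apply: cvgD; [exact: f2|exact: g2].
Qed.

Lemma ccontM f g : ccont f -> ccont g -> ccont (fun t => f t * g t).
Proof.
move=> [f1 f2] [g1 g2]; split.
  apply: (@continuous_ext (fun t => complex.Re (f t) * complex.Re (g t) -
                                   complex.Im (f t) * complex.Im (g t))).
    by move=> t; rewrite ReM.
  by move=> x; apply: cvgB; apply: cvgM;
    [exact: f1|exact: g1|exact: f2|exact: g2].
apply: (@continuous_ext (fun t => complex.Re (f t) * complex.Im (g t) +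
                                 complex.Im (f t) * complex.Re (g t))).
  by move=> t; rewrite ImM.
by move=> x; apply: cvgD; apply: cvgM;
  [exact: f1|exact: g2|exact: f2|exact: g1].
Qed.

Lemma ccontZ (c : C) f : ccont f -> ccont (fun t => c * f t).
Proof. exact: (ccontM (ccont_cst c)). Qed.

Lemma ccontN f : ccont f -> ccont (fun t => - f t).
Proof.
by move=> h; apply: ccont_ext (ccontZ (-1) h) => t; rewrite mulN1r.
Qed.

Lemma ccontB f g : ccont f -> ccont g -> ccont (fun t => f t - g t).
Proof. by move=> hf hg; apply: ccontD => //; exact: ccontN. Qed.

Lemma ccont_sum n (F : nat -> R -> C) : (forall i, (i < n)%N -> ccont (F i)) ->
  ccont (fun t => \sum_(i < n) F i t).
Proof.
elim: n => [|n IH] h.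
  by apply: ccont_ext (ccont_cst 0) => t; rewrite big_ord0.
apply: (@ccont_ext (fun t => \sum_(i < n) F i t + F n t)).
  by move=> t; rewrite big_ord_recr.
by apply: ccontD; [apply: IH => i ilt; apply: h; exact: leq_trans ilt _|exact: h].
Qed.

Lemma ccont_real (g : R -> R) : continuous g -> ccont (fun t => (g t)%:C).
Proof. by move=> h; split => // x; exact: cvg_cst. Qed.

Lemma ccont_bounded f a b : ccont f ->
  exists2 K, 0 <= K & forall x, a <= x <= b -> cmod (f x) <= K.
Proof.
move=> [f1 f2]; have [ab|ba] := leP a b; last first.
  by exists 0 => // x /andP[ax xb]; have := le_trans ax xb; rewrite leNgt ba.
have hc : continuous (fun t => `|complex.Re (f t)| + `|complex.Im (f t)|).
  move=> x; apply: cvgD; apply: cvg_norm; [exact: f1|exact: f2].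
have [c _ hK] := EVT_max ab (continuous_subspaceT hc).
exists (`|complex.Re (f c)| + `|complex.Im (f c)|); first by rewrite addr_ge0.
move=> x xab; rewrite (le_trans (cmod_ReIm _))//.
by apply: hK; rewrite in_itv.
Qed.

(* Rotating [f b - f a] onto the positive axis reduces this to a real function. *)
Lemma cder_dist_le f (df : R -> C) (h dh : R -> R) a b : a <= b ->
  (forall x, a <= x <= b -> cder f x (df x)) ->
  (forall x, a <= x <= b -> is_derive x (1 : R) h (dh x)) ->
  (forall x, a <= x <= b -> cmod (df x) <= dh x) ->
  cmod (f b - f a) <= h b - h a.
Proof.
move=> ab hf hh fh; set D := f b - f a.
have [D0|D0] := eqVneq D 0.
  rewrite D0 cmod0.
  have := @derive_le_dist (cst 0) h (cst 0) dh a b ab.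
  rewrite /cst subrr; apply => // x xab.
  exact: le_trans (cmod_ge0 _) (fh _ xab).
have nD0 : cmod D != 0 by rewrite cmod_eq0.
pose u : C := (complex.Re D / cmod D) +i* (- (complex.Im D / cmod D)).
have u1 : cmod u = 1.
  apply/eqP; rewrite -(eqrXn2 (n := 2)) ?cmod_ge0//.
  rewrite cmod_sqr /= sqrrN !expr_div_n -mulrDl -cmod_sqr divff ?expf_neq0//.
  by rewrite expr1n.
have uD : complex.Re (u * D) = cmod D.
  rewrite ReM /=.
  have -> : complex.Re D / cmod D * complex.Re D - - (complex.Im D / cmod D) * complex.Im D =
    (complex.Re D ^+ 2 + complex.Im D ^+ 2) / cmod D by ring.
  by rewrite -cmod_sqr expr2 mulfK.
have hg x : a <= x <= b ->
    is_derive x (1 : R) (fun t => complex.Re (u * f t)) (complex.Re (u * df x)).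
  by move=> xab; have [] := cderZ u (hf _ xab).
have -> : cmod D = complex.Re (u * f b) - complex.Re (u * f a).
  by rewrite -uD /D mulrBr ReD ReN.
apply: (derive_le_dist ab hg hh) => x xab.
rewrite (le_trans (ler_norm _))// (le_trans (cmod_Re _))//.
by rewrite cmodM u1 mul1r fh.
Qed.

Lemma cder_dist_cst f (df : R -> C) (K : R) a b : a <= b ->
  (forall x, a <= x <= b -> cder f x (df x)) ->
  (forall x, a <= x <= b -> cmod (df x) <= K) ->
  cmod (f b - f a) <= K * (b - a).
Proof.
move=> ab hf hK; rewrite mulrBr.
apply: (@cder_dist_le f df (fun x => K * x) (fun _ => K)) => // x _.
apply: is_derive_ext (is_deriveM (is_derive_cst K x (1 : R)) (is_derive_id x (1 : R))) => //.
by rewrite /GRing.scale /= mulr0 addr0 mulr1.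
Qed.

Lemma cder0_eq f a b : (forall x, a <= x <= b -> cder f x 0) ->
  forall x y, a <= x <= b -> a <= y <= b -> f x = f y.
Proof.
move=> h; suff H x y : x <= y -> a <= x <= b -> a <= y <= b -> f x = f y.
  move=> x y xab yab; have [xy|/ltW xy] := leP x y; first exact: H.
  exact/esym/H.
move=> xy /andP[ax xb] /andP[ay yb]; apply/esym/eqP.
rewrite -subr_eq0 -cmod_eq0 eq_le cmod_ge0 andbT -[leRHS](mul0r (y - x)).
apply: (@cder_dist_cst f (cst 0)) => // t /andP[xt ty]; last by rewrite cmod0.
by apply: h; rewrite (le_trans ax xt) (le_trans ty yb).
Qed.

Local Notation mu := (@lebesgue_measure R).

Lemma continuous_integrable_itv (g : R -> R) a b : continuous g ->
  mu.-integrable `[a, b] (EFin \o g).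
Proof.
move=> cg; apply: continuous_compact_integrable; first exact: segment_compact.
exact: continuous_subspaceT.
Qed.

(** The fundamental theorem is applied from the base point [- (n + 1)]; the resulting primitives,
    normalised at 0, agree wherever two of them make sense, so [n] may be allowed to depend on
    [x]. *)
Lemma continuous_primitive (g : R -> R) : continuous g ->
  exists G : R -> R, forall x, is_derive x (1 : R) G (g x).
Proof.
move=> cg.
pose G n x : R := (\int[mu]_(t in `[- n.+1%:R, x]) g t)%R -
                  (\int[mu]_(t in `[- n.+1%:R, 0%R]) g t)%R.
have dG n x : - n.+1%:R < x -> is_derive x (1 : R) (G n) (g x).
  move=> nx.
  have [] := @continuous_FTC1_closed R g (- n.+1%:R) x (x + 1) _
    (continuous_integrable_itv _ _ cg) nx (cg x); first by rewrite ltrDl.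
  rewrite derive1E => d1 d2.
  have h : is_derive x (1 : R) (fun x => (\int[mu]_(t in `[- n.+1%:R, x]) g t)%R) (g x).
    exact: DeriveDef.
  by apply: is_derive_ext (is_deriveB h (is_derive_cst _ x (1 : R))) => //; rewrite subr0.
have GG m n x : (m <= n)%N -> - m.+1%:R < x -> G m x = G n x.
  move=> mn mx.
  have l0 : - m.+1%:R < (0 : R) by rewrite oppr_lt0 ltr0n.
  have nm : - n.+1%:R <= - m.+1%:R :> R by rewrite lerN2 ler_nat.
  pose f := fun t => (G m t - G n t)%:C.
  have hf t : - m.+1%:R < t -> cder f t 0.
    move=> mt; have h1 := dG m t mt; have h2 := dG n t (le_lt_trans nm mt).
    by apply: cder_eq (cder_real (is_deriveB h1 h2)) _; rewrite subrr.
  have f00 : f 0 = 0 by rewrite /f /G !subrr.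
  have : f x = f 0.
    apply: (@cder0_eq f (Num.min x 0) (Num.max x 0)).
    - move=> t /andP[tx _]; apply: hf; apply: lt_le_trans tx.
      by rewrite lt_min mx l0.
    - by rewrite ge_min lexx le_max lexx.
    - by rewrite ge_min lexx orbT le_max lexx orbT.
  by rewrite f00 /f => -[] /eqP; rewrite subr_eq0 => /eqP.
pose N (x : R) := Num.truncn `|x|.
have hN x : - (N x).+1%:R < x.
  by rewrite ltrNl (le_lt_trans (ler_norm _))// normrN truncnS_gt.
exists (fun x => G (N x) x) => x.
(* One index more than [N x]: points [t] close to [x] satisfy [N t <= N x + 1], so a single
   primitive describes the glued function near [x]. *)
have := dG (N x).+1 x (lt_trans _ (hN x)); rewrite ltrN2 ltr_nat ltnS leqnn => /(_ isT).
apply: near_eq_is_derive.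
near=> t.
have tx : `|t - x| < 1.
  by rewrite distrC; near: t; exact: (@cvgr_dist_lt _ _ _ (nbhs x) _ id x).
apply/esym/GG; last exact: hN.
rewrite -ltnS -(ltr_nat R).
apply: (@le_lt_trans _ _ `|t|); first by rewrite truncn_le.
rewrite -[t](subrK x) (le_lt_trans (ler_normD _ _))//.
by rewrite -natr1 addrC ltrD// truncnS_gt.
Unshelve. all: by end_near. Qed.

Lemma ccont_primitive f x0 : ccont f ->
  exists F : R -> C, F x0 = 0 /\ forall x, cder F x (f x).
Proof.
move=> [/continuous_primitive[F hF] /continuous_primitive[G hG]].
exists (fun x => (F x - F x0) +i* (G x - G x0)); split.
  by rewrite !subrr.
move=> x; have h1 := hF x; have h2 := hG x; split => /=.
  by apply: is_derive_ext (is_deriveB h1 (is_derive_cst (F x0) x (1 : R))) => //;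
    rewrite subr0.
by apply: is_derive_ext (is_deriveB h2 (is_derive_cst (G x0) x (1 : R))) => //;
  rewrite subr0.
Qed.

End ComplexDerivative.

(** * Linear differential equations *)

Section LinearODE.
Variable R : realType.
Local Notation C := R[i].
Implicit Types (f u p : R -> C) (x y : R).

(** The Bielecki weight: relative to it integration from [x0] is a contraction once [kap] is large,
    so that Picard iteration converges on the whole line at once. *)
Definition wexp (kap x0 x : R) : R := expR (kap * `|x - x0|).

Lemma wexp_ge0 kap x0 x : 0 <= wexp kap x0 x.
Proof. exact: expR_ge0. Qed.

Lemma wexp_ge1 kap x0 x : 0 <= kap -> 1 <= wexp kap x0 x.
Proof. by move=> k0; rewrite -expR0 ler_expR mulr_ge0. Qed.

Lemma is_derive_expR_lin (k c : R) x :
  is_derive x (1 : R) (fun t => expR (k * (t - c))) (k * expR (k * (x - c))).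
Proof.
have h : is_derive x (1 : R) (fun t : R => k * (t - c)) k.
  apply: is_derive_ext (is_deriveM (is_derive_cst k x (1 : R))
    (is_deriveB (is_derive_id x (1 : R)) (is_derive_cst c x (1 : R)))) => //.
  by rewrite /GRing.scale /=; ring.
have := @is_derive1_comp _ expR (fun t : R => k * (t - c)) x _ _ (is_derive_expR _) h.
by rewrite mulrC.
Qed.

Lemma is_derive_mull (k : R) (g : R -> R) x d :
  is_derive x (1 : R) g d -> is_derive x (1 : R) (fun t => k * g t) (k * d).
Proof.
move=> h; apply: is_derive_ext (is_deriveM (is_derive_cst k x (1 : R)) h) => //.
by rewrite /GRing.scale /=; ring.
Qed.

(** Integrating the weight reproduces it with a gain of [1 / kap]. The two sides of [x0] are treated
    separately because of the absolute value in the weight. *)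
Lemma wexp_dist_le f (df : R -> C) (kap c X x0 : R) : 0 < kap -> 0 <= c ->
  (forall x, `|x - x0| <= X -> cder f x (df x)) ->
  (forall x, `|x - x0| <= X -> cmod (df x) <= c * wexp kap x0 x) ->
  forall x, `|x - x0| <= X -> cmod (f x - f x0) <= c / kap * wexp kap x0 x.
Proof.
move=> k0 c0 hf hd x xX; have [x0x|xx0] := leP x0 x.
  have ax t : x0 <= t <= x -> `|t - x0| <= X.
    move=> /andP[h1 h2]; apply: le_trans xX.
    by rewrite !ger0_norm ?subr_ge0// lerB.
  have := @cder_dist_le R f df (fun t => c / kap * expR (kap * (t - x0)))
    (fun t => c / kap * (kap * expR (kap * (t - x0)))) _ _ x0x.
  move=> /(_ (fun t h => hf t (ax t h))) h; apply: le_trans (h _ _) _ => [t _|t tx|].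
  - exact/is_derive_mull/is_derive_expR_lin.
  - have := hd t (ax t tx); rewrite /wexp ger0_norm ?subr_ge0; last by case/andP: tx.
    by rewrite mulrA divfK ?gt_eqF.
  - rewrite /wexp ger0_norm ?subr_ge0// subrr mulr0 expR0.
    by rewrite gerBl mulr1 divr_ge0// ltW.
have ax t : x <= t <= x0 -> `|t - x0| <= X.
  move=> /andP[h1 h2]; apply: le_trans xX.
  rewrite (ler0_norm (x := t - x0)) ?subr_le0// ler0_norm ?subr_le0 ?(ltW xx0)//.
  by rewrite lerN2 lerB.
have := @cder_dist_le R f df (fun t => - (c / kap) * expR (- kap * (t - x0)))
  (fun t => - (c / kap) * (- kap * expR (- kap * (t - x0)))) _ _ (ltW xx0).
move=> /(_ (fun t h => hf t (ax t h))) h; rewrite cmod_distC.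
apply: le_trans (h _ _) _ => [t _|t tx|].
- exact/is_derive_mull/is_derive_expR_lin.
- have := hd t (ax t tx); rewrite /wexp ler0_norm ?subr_le0; last by case/andP: tx.
  by rewrite [_ * (- kap * _)]mulrA mulrNN divfK ?gt_eqF// mulrN mulNr.
- rewrite /wexp ler0_norm ?subr_le0 ?(ltW xx0)// subrr mulr0 expR0 mulr1 mulNr opprK mulNr mulrN.
  by rewrite addrC gerBl divr_ge0// ltW.
Qed.

(** The term [g1] lets [p] be u' plus a primitive of a merely square integrable source, which keeps
    all coefficients continuous. *)
Definition odesol (Q g1 g2 u p : R -> C) : Prop :=
  forall x, cder u x (p x + g1 x) /\ cder p x (Q x * u x + g2 x).

Lemma exists_half_pow (K e : R) : 0 < e -> exists n, K / 2 ^+ n <= e.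
Proof.
move=> e0; exists (Num.truncn (`|K| / e)).+1.
rewrite ler_pdivrMr ?exprn_gt0// (le_trans (ler_norm _))// mulrC -ler_pdivrMr//.
rewrite (le_trans (ltW (truncnS_gt _)))//.
by rewrite -natrX ler_nat ltnW// ltn_expl.
Qed.

Section Estimate.
Variables (Q g1 g2 u p : R -> C) (x0 q c kap a X : R).
Hypotheses (kap_ge : 2 * (1 + q) <= kap) (q0 : 0 <= q) (c0 : 0 <= c).
Hypothesis hsol : odesol Q g1 g2 u p.
Hypothesis hQ : forall x, `|x - x0| <= X -> cmod (Q x) <= q.
Hypothesis hg1 : forall x, `|x - x0| <= X -> cmod (g1 x) <= c * wexp kap x0 x.
Hypothesis hg2 : forall x, `|x - x0| <= X -> cmod (g2 x) <= c * wexp kap x0 x.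
Hypotheses (hu : cmod (u x0) <= a) (hp : cmod (p x0) <= a).

(** Since [2 (1 + q) <= kap], one integration of the system halves the constant [L] and adds the
    contribution of the data. *)
Lemma ode_step (L : R) : 0 <= L ->
  (forall x, `|x - x0| <= X -> cmod (u x) <= L * wexp kap x0 x /\
     cmod (p x) <= L * wexp kap x0 x) ->
  forall x, `|x - x0| <= X ->
    cmod (u x) <= (a + c / kap + L / 2) * wexp kap x0 x /\
    cmod (p x) <= (a + c / kap + L / 2) * wexp kap x0 x.
Proof.
move=> L0 hL x xX.
have k0 : 0 < kap by rewrite (lt_le_trans _ kap_ge)// mulr_gt0// ltr_wpDr.
have a0 : 0 <= a by rewrite (le_trans (cmod_ge0 _) hu).
have w0 := wexp_ge0 kap x0 x; have w1 := wexp_ge1 x0 x (ltW k0).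
have kL (l : R) : l <= (1 + q) * L -> (l + c) / kap <= c / kap + L / 2.
  move=> lL; rewrite ler_pdivrMr// mulrDl divfK ?gt_eqF// addrC lerD2l.
  by have := ler_wpM2l L0 kap_ge; lra.
have fin (v : C) (l : R) : 0 <= l -> l <= (1 + q) * L -> forall v0, cmod v0 <= a ->
    cmod (v - v0) <= (l + c) / kap * wexp kap x0 x ->
    cmod v <= (a + c / kap + L / 2) * wexp kap x0 x.
  move=> l0 lL v0 hv0 hv.
  rewrite -[v](subrK v0) (le_trans (cmodD _ _))//.
  rewrite -addrA mulrDl [leRHS]addrC; apply: lerD.
    by rewrite (le_trans hv)// ler_wpM2r// kL.
  by rewrite (le_trans hv0)// ler_peMr.
split.
  apply: (fin _ L) hu _ => //; first by rewrite ler_peMl// lerDl.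
  apply: (@wexp_dist_le u (fun t => p t + g1 t) kap _ X) => //; first by rewrite addr_ge0.
    by move=> t _; have [] := hsol t.
  move=> t tX; rewrite (le_trans (cmodD _ _))// mulrDl lerD// ?hg1//.
  by have [] := hL t tX.
apply: (fin _ (q * L)) hp _ => //; first by rewrite mulr_ge0.
  by rewrite ler_wpM2r// lerDr.
apply: (@wexp_dist_le p (fun t => Q t * u t + g2 t) kap _ X) => //.
  by rewrite addr_ge0// mulr_ge0.
  by move=> t _; have [] := hsol t.
move=> t tX; rewrite (le_trans (cmodD _ _))// mulrDl lerD// ?hg2//.
rewrite cmodM -mulrA ler_pM ?cmod_ge0 ?hQ//.
by have [] := hL t tX.
Qed.

(** A Gronwall bound by iteration: compactness supplies some constant [K], and [n] rounds of
    [ode_step] reduce its share to [K / 2 ^ n]. *)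
Lemma ode_estimate x : `|x - x0| <= X ->
  cmod (u x) <= 2 * (a + c / kap) * wexp kap x0 x /\
  cmod (p x) <= 2 * (a + c / kap) * wexp kap x0 x.
Proof.
move=> xX.
have k0 : 0 < kap by rewrite (lt_le_trans _ kap_ge)// mulr_gt0// ltr_wpDr.
have a0 : 0 <= a by rewrite (le_trans (cmod_ge0 _) hu).
have cu : ccont u := cder_ccont (fun t => (hsol t).1).
have cp : ccont p := cder_ccont (fun t => (hsol t).2).
have [K1 K10 hK1] := ccont_bounded (x0 - X) (x0 + X) cu.
have [K2 K20 hK2] := ccont_bounded (x0 - X) (x0 + X) cp.
have bnd t : `|t - x0| <= X -> x0 - X <= t <= x0 + X.
  by rewrite ler_norml => /andP[h1 h2]; apply/andP; split; lra.
have s0 : 0 <= a + c / kap by rewrite addr_ge0 ?divr_ge0// ltW.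
pose K := K1 + K2.
have K0 : 0 <= K by rewrite addr_ge0.
have hn n : forall t, `|t - x0| <= X ->
    cmod (u t) <= (2 * (a + c / kap) + K / 2 ^+ n) * wexp kap x0 t /\
    cmod (p t) <= (2 * (a + c / kap) + K / 2 ^+ n) * wexp kap x0 t.
  elim: n => [|n IH] t tX.
    have w1 := wexp_ge1 x0 t (ltW k0).
    have KK : K <= (2 * (a + c / kap) + K / 2 ^+ 0) * wexp kap x0 t.
      rewrite expr0 divr1 -[leLHS]mulr1 ler_pM// lerDr mulr_ge0//.
    split; apply: le_trans KK.
      by rewrite (le_trans (hK1 _ (bnd _ tX)))// lerDl.
    by rewrite (le_trans (hK2 _ (bnd _ tX)))// lerDr.
  have L0 : 0 <= 2 * (a + c / kap) + K / 2 ^+ n by rewrite addr_ge0 ?divr_ge0 ?mulr_ge0.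
  have := ode_step L0 IH tX.
  have -> : a + c / kap + (2 * (a + c / kap) + K / 2 ^+ n) / 2 =
    2 * (a + c / kap) + K / 2 ^+ n.+1.
    by rewrite exprS invfM; field; rewrite expf_neq0//= gt_eqF.
  by [].
have lim (v : R) : (forall n, v <= (2 * (a + c / kap) + K / 2 ^+ n) * wexp kap x0 x) ->
    v <= 2 * (a + c / kap) * wexp kap x0 x.
  move=> hv; apply/ler_addgt0Pl => e e0.
  have [n hn'] := exists_half_pow (K * wexp kap x0 x) e0.
  by rewrite (le_trans (hv n))// mulrDl addrC lerD2r mulrAC.
by split; apply: lim => n; have [] := hn n x xX.
Qed.

End Estimate.

Lemma odesolB (Q g1 g2 h1 h2 u p v r : R -> C) :
  odesol Q g1 g2 u p -> odesol Q h1 h2 v r ->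
  odesol Q (fun x => g1 x - h1 x) (fun x => g2 x - h2 x)
    (fun x => u x - v x) (fun x => p x - r x).
Proof.
move=> h h' x; have [a1 a2] := h x; have [b1 b2] := h' x; split.
  by apply: cder_eq (cderB a1 b1) _; ring.
by apply: cder_eq (cderB a2 b2) _; ring.
Qed.

Lemma odesolD (Q g1 g2 h1 h2 u p v r : R -> C) :
  odesol Q g1 g2 u p -> odesol Q h1 h2 v r ->
  odesol Q (fun x => g1 x + h1 x) (fun x => g2 x + h2 x)
    (fun x => u x + v x) (fun x => p x + r x).
Proof.
move=> h h' x; have [a1 a2] := h x; have [b1 b2] := h' x; split.
  by apply: cder_eq (cderD a1 b1) _; ring.
by apply: cder_eq (cderD a2 b2) _; ring.
Qed.

Lemma odesolZ (k : C) (Q g1 g2 u p : R -> C) : odesol Q g1 g2 u p ->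
  odesol Q (fun x => k * g1 x) (fun x => k * g2 x) (fun x => k * u x) (fun x => k * p x).
Proof.
move=> h x; have [a1 a2] := h x; split.
  by apply: cder_eq (cderZ k a1) _; ring.
by apply: cder_eq (cderZ k a2) _; ring.
Qed.

Lemma odesol_ext (Q Q' g1 g2 h1 h2 u p v r : R -> C) :
  Q =1 Q' -> g1 =1 h1 -> g2 =1 h2 -> u =1 v -> p =1 r ->
  odesol Q g1 g2 u p -> odesol Q' h1 h2 v r.
Proof. by move=> /funext-> /funext-> /funext-> /funext-> /funext->. Qed.

Lemma ode_zero_on (Q g1 g2 u p : R -> C) (X x0 : R) : ccont Q ->
  odesol Q g1 g2 u p ->
  (forall x, `|x - x0| <= X -> g1 x = 0) -> (forall x, `|x - x0| <= X -> g2 x = 0) ->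
  u x0 = 0 -> p x0 = 0 -> forall x, `|x - x0| <= X -> u x = 0 /\ p x = 0.
Proof.
move=> cQ hs hg1 hg2 u0 p0 x xX.
have [q q0 hq] := ccont_bounded (x0 - X) (x0 + X) cQ.
have := @ode_estimate Q g1 g2 u p x0 q 0 (2 * (1 + q)) 0 X (lexx _) q0 (lexx _) hs.
rewrite u0 p0 cmod0 mul0r addr0 mulr0 => H.
have [|||||h1 h2] := H _ _ _ _ _ _ xX => //.
- move=> t; rewrite ler_norml => /andP[h1 h2]; apply: hq.
  by apply/andP; split; lra.
- by move=> t tX; rewrite hg1// cmod0 mul0r.
- by move=> t tX; rewrite hg2// cmod0 mul0r.
split; apply/eqP; rewrite -cmod_eq0 eq_le cmod_ge0 andbT.
  by rewrite (le_trans h1)// mul0r.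
by rewrite (le_trans h2)// mul0r.
Qed.

Lemma ode_uniq (Q g1 g2 u p v r : R -> C) x0 : ccont Q ->
  odesol Q g1 g2 u p -> odesol Q g1 g2 v r -> u x0 = v x0 -> p x0 = r x0 ->
  forall x, u x = v x /\ p x = r x.
Proof.
move=> cQ h1 h2 e1 e2 x.
have [|||||a b] := @ode_zero_on Q _ _ _ _ `|x - x0| x0 cQ (odesolB h1 h2) _ _ _ _ x.
- by move=> t _; rewrite subrr.
- by move=> t _; rewrite subrr.
- by rewrite e1 subrr.
- by rewrite e2 subrr.
- by [].
by split; apply/eqP; rewrite -subr_eq0 ?a ?b.
Qed.

(** The intervals of radius [2 D / 2 ^ n] about [s n] are nested; the limit is the supremum of their
    left ends. *)
Lemma real_geom_lim (s : nat -> R) (D : R) :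
  (forall n, `|s n.+1 - s n| <= D / 2 ^+ n) ->
  exists l, forall n, `|l - s n| <= 2 * D / 2 ^+ n.
Proof.
move=> h.
have D0 : 0 <= D by have := h 0%N; rewrite expr0 divr1; exact: le_trans.
have hD n : D / 2 ^+ n.+1 = D / 2 ^+ n / 2 by rewrite exprS invfM; ring.
have lo n m : s n - 2 * D / 2 ^+ n <= s (n + m)%N - 2 * D / 2 ^+ (n + m).
  elim: m => [|m IH]; first by rewrite addn0.
  rewrite (le_trans IH)// addnS -!mulrA hD.
  have := h (n + m)%N; rewrite ler_norml => /andP[h1 _]; lra.
have up n m : s (n + m)%N + 2 * D / 2 ^+ (n + m) <= s n + 2 * D / 2 ^+ n.
  elim: m => [|m IH]; first by rewrite addn0.
  rewrite (le_trans _ IH)// addnS -!mulrA hD.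
  have := h (n + m)%N; rewrite ler_norml => /andP[_ h1]; lra.
have e0 n : 0 <= 2 * D / 2 ^+ n by rewrite divr_ge0 ?mulr_ge0 ?exprn_ge0.
have lu n m : s n - 2 * D / 2 ^+ n <= s m + 2 * D / 2 ^+ m.
  rewrite (le_trans (lo n m))// (le_trans _ (up m n))// [(m + n)%N]addnC.
  by have := e0 (n + m)%N; lra.
pose S := [set s n - 2 * D / 2 ^+ n | n in [set: nat]].
exists (sup S) => n.
rewrite ler_distl; apply/andP; split.
  apply: ub_le_sup; last by exists n.
  by exists (s 0%N + 2 * D / 2 ^+ 0) => _ [k _ <-].
apply: ge_sup; first by exists (s 0%N - 2 * D / 2 ^+ 0), 0%N.
by move=> _ [k _ <-].
Qed.

Lemma complex_geom_lim (s : nat -> C) (D : R) :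
  (forall n, cmod (s n.+1 - s n) <= D / 2 ^+ n) ->
  exists l, forall n, cmod (l - s n) <= 4 * D / 2 ^+ n.
Proof.
move=> h.
have [|a ha] := @real_geom_lim (fun n => complex.Re (s n)) D.
  by move=> n; rewrite -ReN -ReD (le_trans (cmod_Re _)).
have [|b hb] := @real_geom_lim (fun n => complex.Im (s n)) D.
  by move=> n; rewrite -ImN -ImD (le_trans (cmod_Im _)).
exists (a +i* b) => n; rewrite (le_trans (cmod_ReIm _))// ReD ImD ReN ImN /=.
by rewrite (le_trans (lerD (ha n) (hb n)))// -!mulrA; lra.
Qed.

Lemma real_unif_cont (g : R -> R) :
  (forall X e : R, 0 < e -> exists2 h : R -> R, continuous h &
     forall x, `|x| <= X -> `|g x - h x| <= e) -> continuous g.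
Proof.
move=> H x; apply/cvgrPdist_lt => e e0.
have e3 : 0 < e / 4 by rewrite divr_gt0.
have [h ch hg] := H (`|x| + 1) _ e3.
have := ch x => /cvgrPdist_lt /(_ _ e3) hx.
near=> t.
have tx : `|x - t| < 1.
  by near: t; exact: (@cvgr_dist_lt _ _ _ (nbhs x) _ id x).
have ht : `|h x - h t| < e / 4 by near: t.
have h1 : `|g x - h x| <= e / 4 by apply: hg; rewrite lerDl.
have h2 : `|g t - h t| <= e / 4.
  apply: hg; rewrite -[t](subrK x) (le_trans (ler_normD _ _))// addrC.
  by rewrite lerD2l distrC ltW.
rewrite (_ : g x - g t = (g x - h x) + (h x - h t) - (g t - h t)); last by ring.
rewrite (le_lt_trans (ler_normB _ _))// (le_lt_trans (lerD (ler_normD _ _) (lexx _)))//.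
by lra.
Unshelve. all: by end_near. Qed.

Lemma ccont_unif f :
  (forall X e : R, 0 < e -> exists2 h : R -> C, ccont h &
     forall x, `|x| <= X -> cmod (f x - h x) <= e) -> ccont f.
Proof.
move=> H; split; apply: real_unif_cont => X e e0.
  have [h [ch _] hf] := H X e e0; exists (fun t => complex.Re (h t)) => // x xX.
  by rewrite -ReN -ReD (le_trans (cmod_Re _))// hf.
have [h [_ ch] hf] := H X e e0; exists (fun t => complex.Im (h t)) => // x xX.
by rewrite -ImN -ImD (le_trans (cmod_Im _))// hf.
Qed.

Section Existence.
Variables (Q g1 g2 : R -> C) (x0 q c kap : R) (a b : C).
Hypotheses (kap_ge : 2 * (1 + q) <= kap) (q0 : 0 <= q) (c0 : 0 <= c).
Hypotheses (cQ : ccont Q) (cg1 : ccont g1) (cg2 : ccont g2).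
Hypothesis hQ : forall x, cmod (Q x) <= q.
Hypothesis hg1 : forall x, cmod (g1 x) <= c * wexp kap x0 x.
Hypothesis hg2 : forall x, cmod (g2 x) <= c * wexp kap x0 x.

(** A total choice of the primitive vanishing at [x0]; a discontinuous function is returned
    unchanged as a dummy value, a case that the iterates never meet. *)
Let prim (f : R -> C) : R -> C :=
  if pselect (ccont f) is left h then projT1 (cid (ccont_primitive x0 h)) else f.

Let primP f : ccont f -> prim f x0 = 0 /\ forall x, cder (prim f) x (f x).
Proof.
by move=> cf; rewrite /prim; case: pselect => // h; exact: (projT2 (cid (ccont_primitive x0 h))).
Qed.

Let it : nat -> (R -> C) * (R -> C) := fix it n :=
  if n is m.+1 then
    (fun x => a + prim (fun t => (it m).2 t + g1 t) x,
     fun x => b + prim (fun t => Q t * (it m).1 t + g2 t) x)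
  else (fun _ => a, fun _ => b).

Let it_cont n : ccont (it n).1 /\ ccont (it n).2.
Proof.
elim: n => [|n [IH1 IH2]]; first by split; exact: ccont_cst.
have [_ h1] := primP (ccontD IH2 cg1).
have [_ h2] := primP (ccontD (ccontM cQ IH1) cg2).
by split; apply: ccontD (ccont_cst _) (cder_ccont _) => x; [exact: h1|exact: h2].
Qed.

Let k0 : 0 < kap.
Proof. by rewrite (lt_le_trans _ kap_ge)// mulr_gt0// ltr_wpDr. Qed.

Let D := cmod a + cmod b + c.

Let D0 : 0 <= D. Proof. by rewrite !addr_ge0 ?cmod_ge0. Qed.

Let prim_dist f g (K : R) : 0 <= K -> ccont f -> ccont g ->
  (forall x, cmod (f x - g x) <= K * wexp kap x0 x) ->
  forall x, cmod (prim f x - prim g x) <= K / kap * wexp kap x0 x.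
Proof.
move=> K0 cf cg h x; have [f0 df] := primP cf; have [g0 dg] := primP cg.
have := @wexp_dist_le (fun t => prim f t - prim g t) (fun t => f t - g t) kap K
  `|x - x0| x0 k0 K0.
rewrite f0 g0 subrr => /(_ _ _ x (lexx _)); rewrite subr0; apply.
  by move=> t _; exact: cderB.
by move=> t _; exact: h.
Qed.

Let kq (K : R) : 0 <= K -> K / kap <= K / 2 /\ q * K / kap <= K / 2.
Proof.
move=> K0; have := mulr_ge0 q0 K0 => qK.
split; rewrite ler_pdivrMr// mulrAC ler_pdivlMr//.
  by rewrite ler_wpM2l// (le_trans _ kap_ge)// mulrDr mulr1 lerDl mulr_ge0.
rewrite -mulrA mulrCA ler_wpM2l// (le_trans _ kap_ge)//.
by have q0' := q0; lra.
Qed.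

(** Each Picard step gains at least a factor 2 in the weighted norm: [1 / kap] in the first
    component and [q / kap] in the second are both at most 1/2. *)
Let it_diff n x :
  cmod ((it n.+1).1 x - (it n).1 x) <= D / 2 ^+ n * wexp kap x0 x /\
  cmod ((it n.+1).2 x - (it n).2 x) <= D / 2 ^+ n * wexp kap x0 x.
Proof.
elim: n x => [|n IH] x.
  have [cu cp] := it_cont 0%N.
  have w1 y := wexp_ge1 x0 y (ltW k0).
  rewrite /= expr0 divr1.
  have e1 (y z : C) : y + z - y = z by ring.
  rewrite !e1.
  have fin f (K : R) : 0 <= K -> ccont f -> K / kap <= D ->
    (forall y, cmod (f y) <= K * wexp kap x0 y) -> cmod (prim f x) <= D * wexp kap x0 x.
    move=> K0 cf KD hf; have [f0 df] := primP cf.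
    have := @wexp_dist_le (prim f) f kap K `|x - x0| x0 k0 K0 (fun t _ => df t)
      (fun t _ => hf t) x (lexx _).
    by rewrite f0 subr0 => /le_trans; apply; rewrite ler_wpM2r// wexp_ge0.
  have a0 := cmod_ge0 a; have b0 := cmod_ge0 b; have qa := mulr_ge0 q0 a0.
  have kge : 2 + 2 * q <= kap by rewrite (le_trans _ kap_ge)// mulrDr mulr1.
  split.
    apply: (fin _ (cmod b + c)) (ccontD cp cg1) _ _; first by rewrite addr_ge0.
      rewrite ler_pdivrMr// /D.
      have k1 : 0 <= kap - 1 by have q0' := q0; lra.
      by have := mulr_ge0 (addr_ge0 (addr_ge0 a0 b0) c0) k1; lra.
    move=> y; rewrite mulrDl (le_trans (cmodD _ _))// lerD ?hg1//.
    by rewrite ler_peMr.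
  apply: (fin _ (q * cmod a + c)) (ccontD (ccontM cQ cu) cg2) _ _; first by rewrite addr_ge0.
    have k1 : 0 <= kap - 1 by have q0' := q0; lra.
    have k2 : 0 <= kap - q by have q0' := q0; lra.
    rewrite ler_pdivrMr// /D.
    by have := mulr_ge0 b0 (ltW k0); have := mulr_ge0 a0 k2; have := mulr_ge0 c0 k1; lra.
  move=> y; rewrite mulrDl (le_trans (cmodD _ _))// lerD ?hg2//.
  rewrite cmodM -mulrA ler_pM ?cmod_ge0// ler_peMr//.
have [cu cp] := it_cont n; have [cu' cp'] := it_cont n.+1.
have e1 (y z t : C) : y + z - (y + t) = z - t by ring.
rewrite [(it n.+2).1]/= [(it n.+2).2]/= [in X in cmod (_ - X)]/= [in X in _ /\ cmod (_ - X) <= _]/= !e1.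
have Dn : 0 <= D / 2 ^+ n by rewrite divr_ge0// exprn_ge0.
have [kq1 kq2] := kq Dn.
have hD : D / 2 ^+ n.+1 = D / 2 ^+ n / 2 by rewrite exprS invfM; ring.
rewrite hD; split.
  apply: le_trans (prim_dist Dn (ccontD cp' cg1) (ccontD cp cg1) _ x) _ => [y|].
    by rewrite (_ : _ - _ = (it n.+1).2 y - (it n).2 y); [have [] := IH y|ring].
  by rewrite ler_wpM2r// wexp_ge0.
apply: le_trans (prim_dist (mulr_ge0 q0 Dn) (ccontD (ccontM cQ cu') cg2)
    (ccontD (ccontM cQ cu) cg2) _ x) _ => [y|].
  rewrite (_ : _ - _ = Q y * ((it n.+1).1 y - (it n).1 y)); last by ring.
  by rewrite cmodM -[leRHS]mulrA ler_pM ?cmod_ge0 ?hQ//; have [] := IH y.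
by rewrite ler_wpM2r// wexp_ge0.
Qed.

Lemma ode_exists : exists u p, [/\ odesol Q g1 g2 u p, u x0 = a & p x0 = b].
Proof.
have hl x : exists lr : C * C, forall n,
    cmod (lr.1 - (it n).1 x) <= 4 * (D * wexp kap x0 x) / 2 ^+ n /\
    cmod (lr.2 - (it n).2 x) <= 4 * (D * wexp kap x0 x) / 2 ^+ n.
  have [|l hl] := @complex_geom_lim (fun n => (it n).1 x) (D * wexp kap x0 x).
    by move=> n; have [h _] := it_diff n x; rewrite mulrAC.
  have [|r hr] := @complex_geom_lim (fun n => (it n).2 x) (D * wexp kap x0 x).
    by move=> n; have [_ h] := it_diff n x; rewrite mulrAC.
  by exists (l, r) => n; split; [exact: hl|exact: hr].
have /choice[L hL] := hl.
pose u x := (L x).1; pose p x := (L x).2.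
have wX (X x : R) : `|x| <= X -> wexp kap x0 x <= expR (kap * (X + `|x0|)).
  move=> xX; rewrite ler_expR ler_wpM2l// ?(ltW k0)//.
  by rewrite (le_trans (ler_normB _ _))// lerD2r.
have unif (v : R -> C) (vn : nat -> R -> C) : (forall n, ccont (vn n)) ->
    (forall n x, cmod (v x - vn n x) <= 4 * (D * wexp kap x0 x) / 2 ^+ n) -> ccont v.
  move=> cv hv; apply: ccont_unif => X e e0.
  have [n hn] := exists_half_pow (4 * (D * expR (kap * (X + `|x0|)))) e0.
  exists (vn n) => // x xX; rewrite (le_trans (hv n x))// (le_trans _ hn)//.
  rewrite ler_wpM2r ?invr_ge0 ?exprn_ge0// ler_wpM2l// ler_wpM2l//.
  exact: wX.
have cu : ccont u.
  by apply: (unif u (fun n => (it n).1)) => n; [have [] := it_cont n|move=> x; have [] := hL x n].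
have cp : ccont p.
  by apply: (unif p (fun n => (it n).2)) => n; [have [] := it_cont n|move=> x; have [] := hL x n].
have lim0 (z : C) (K : R) : (forall n, cmod z <= K / 2 ^+ n) -> z = 0.
  move=> hz; apply: (@cmod_small_eq0 _ _ 1) => e e0; rewrite mul1r.
  by have [n hn] := exists_half_pow K e0; exact: le_trans (hz n) hn.
have D4 n : 0 <= 4 * D / 2 ^+ n by rewrite divr_ge0 ?mulr_ge0 ?exprn_ge0.
(* The limit solves the integral equation because both sides differ from the iterate of index
   [n + 1] by a multiple of [2 ^- n]. *)
have eu x : u x = a + prim (fun t => p t + g1 t) x.
  apply/eqP; rewrite -subr_eq0; apply/eqP.
  apply: (lim0 _ (8 * (D * wexp kap x0 x))) => n.
  have [_ cpn] := it_cont n.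
  have h1 := (hL x n.+1).1.
  have h2 : cmod ((it n.+1).1 x - (a + prim (fun t => p t + g1 t) x)) <=
      4 * D / 2 ^+ n / kap * wexp kap x0 x.
    rewrite (_ : _ - _ = prim (fun t => (it n).2 t + g1 t) x - prim (fun t => p t + g1 t) x);
      last by rewrite /=; ring.
    apply: (prim_dist (D4 n) (ccontD cpn cg1) (ccontD cp cg1)) => y.
    rewrite (_ : _ - _ = (it n).2 y - p y); last by ring.
    by rewrite cmod_distC (le_trans (hL y n).2)// !mulrA mulrAC.
  have [kq1 _] := kq (D4 n).
  have h3 : 4 * D / 2 ^+ n / kap * wexp kap x0 x <= 4 * D / 2 ^+ n / 2 * wexp kap x0 x.
    by rewrite ler_wpM2r// wexp_ge0.
  rewrite -[_ - _](subrKA ((it n.+1).1 x)) (le_trans (cmodD _ _))//.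
  apply: le_trans (lerD h1 (le_trans h2 h3)) _.
  rewrite exprS invfM.
  have : 0 <= D * wexp kap x0 x / 2 ^+ n by rewrite divr_ge0 ?exprn_ge0// mulr_ge0 ?wexp_ge0.
  lra.
have ep x : p x = b + prim (fun t => Q t * u t + g2 t) x.
  apply/eqP; rewrite -subr_eq0; apply/eqP.
  apply: (lim0 _ (8 * (D * wexp kap x0 x))) => n.
  have [cun _] := it_cont n.
  have h1 := (hL x n.+1).2.
  have h2 : cmod ((it n.+1).2 x - (b + prim (fun t => Q t * u t + g2 t) x)) <=
      q * (4 * D / 2 ^+ n) / kap * wexp kap x0 x.
    rewrite (_ : _ - _ = prim (fun t => Q t * (it n).1 t + g2 t) x -
      prim (fun t => Q t * u t + g2 t) x); last by rewrite /=; ring.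
    apply: (prim_dist (mulr_ge0 q0 (D4 n)) (ccontD (ccontM cQ cun) cg2)
      (ccontD (ccontM cQ cu) cg2)) => y.
    rewrite (_ : _ - _ = Q y * ((it n).1 y - u y)); last by ring.
    rewrite cmodM -[leRHS]mulrA ler_pM ?cmod_ge0 ?hQ//.
    by rewrite cmod_distC (le_trans (hL y n).1)// !mulrA mulrAC.
  have [_ kq1] := kq (D4 n).
  have h3 : q * (4 * D / 2 ^+ n) / kap * wexp kap x0 x <= 4 * D / 2 ^+ n / 2 * wexp kap x0 x.
    by rewrite ler_wpM2r// wexp_ge0.
  rewrite -[_ - _](subrKA ((it n.+1).2 x)) (le_trans (cmodD _ _))//.
  apply: le_trans (lerD h1 (le_trans h2 h3)) _.
  rewrite exprS invfM.
  have : 0 <= D * wexp kap x0 x / 2 ^+ n by rewrite divr_ge0 ?exprn_ge0// mulr_ge0 ?wexp_ge0.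
  lra.
have [z1 d1] := primP (ccontD cp cg1).
have [z2 d2] := primP (ccontD (ccontM cQ cu) cg2).
exists u, p; split; last 2 first.
- by rewrite eu z1 addr0.
- by rewrite ep z2 addr0.
move=> x; split.
  apply: (@cder_ext _ (fun x => a + prim (fun t => p t + g1 t) x)) (cderD (cder_cst a x) (d1 x)).
    by move=> t; rewrite eu.
  by rewrite add0r.
apply: (@cder_ext _ (fun x => b + prim (fun t => Q t * u t + g2 t) x)) (cderD (cder_cst b x) (d2 x)).
  by move=> t; rewrite ep.
by rewrite add0r.
Qed.

End Existence.

End LinearODE.

(** * Families of entire functions *)

Section EntireFamilies.
Variable R : realType.
Local Notation C := R[i].

Definition psum (a : nat -> C) (N : nat) (t : C) : C := \sum_(n < N) a n * t ^+ n.

Lemma psumS a N t : psum a N.+1 t = psum a N t + a N * t ^+ N.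
Proof. by rewrite /psum big_ord_recr. Qed.

Lemma psum0 a t : psum a 0 t = 0. Proof. by rewrite /psum big_ord0. Qed.

Lemma psumD a b N t : psum (fun n => a n + b n) N t = psum a N t + psum b N t.
Proof. by rewrite /psum -big_split; apply: eq_bigr => i _; rewrite mulrDl. Qed.

Definition cauchy_prod (a b : nat -> C) (n : nat) : C :=
  \sum_(k < n.+1) a k * b (n - k)%N.

Lemma psum_cauchy a b N t :
  psum (cauchy_prod a b) N t = \sum_(k < N) a k * t ^+ k * psum b (N - k) t.
Proof.
elim: N => [|N IH]; first by rewrite psum0 big_ord0.
rewrite psumS IH big_ord_recr /= subSn// subnn psumS psum0 add0r expr0 mulr1.
rewrite [X in _ = X + _](_ : _ = \sum_(k < N) a k * t ^+ k * psum b (N - k) t +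
    \sum_(k < N) a k * b (N - k)%N * t ^+ N); last first.
  rewrite -big_split; apply: eq_bigr => k _ /=.
  rewrite subSn ?(ltnW (ltn_ord k))// psumS mulrDr; congr (_ + _).
  by rewrite mulrACA -exprD subnKC// ltnW.
rewrite /cauchy_prod big_ord_recr /= subnn mulrDl -addrA; congr (_ + (_ + _)).
  by rewrite big_distrl.
by rewrite mulrAC.
Qed.

Section Families.
Variable I : Type.
Implicit Types (D : I -> Prop) (wt : I -> R) (F G : C -> I -> C).

(** Taylor expansion at [z0] valid with every radius [rho], hence of an entire function, with a
    constant independent of the index. The index will carry the source and the point, and the weight
    the norm of the source: uniformity in this sense is what turns scalar expansions into expansions
    in operator norm. *)
Definition ent D wt (z0 : C) F (a : nat -> I -> C) : Prop :=
  forall rho : R, 1 <= rho -> exists2 K : R, 0 <= K & forall i, D i ->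
  (forall n, cmod (a n i) * rho ^+ n <= K * wt i) /\
  forall N t, cmod t <= rho ->
    cmod (F (z0 + t) i - psum (a ^~ i) N t) <= K * wt i * (cmod t / rho) ^+ N.

Definition entire D wt F : Prop := forall z0, exists a, ent D wt z0 F a.

End Families.

(** Coefficients chosen from the scalar function alone; by [ent_uniq] they coincide with those of
    any family that contains it. Functions without an expansion get 0. *)
Definition tcoef (z0 : C) (F : C -> C) : nat -> C :=
  if pselect (exists a, ent (fun _ : unit => True) (fun _ => 1) z0 (fun z _ => F z)
    (fun n _ => a n)) is left h then projT1 (cid h) else fun _ => 0.

(** By strong induction on [n]: once the lower coefficients agree, the difference of the n-th ones
    times [t ^ n] is bounded by two remainders of order [n + 1], and [t] may be a small positive
    real. *)
Lemma ent_uniq (I J : Type) (D : I -> Prop) (E : J -> Prop) wt wt' z0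
    (F : C -> I -> C) (G : C -> J -> C) a b i j :
  ent D wt z0 F a -> ent E wt' z0 G b -> D i -> E j ->
  (forall z, F z i = G z j) -> forall n, a n i = b n j.
Proof.
move=> hF hG Di Ej FG.
have [K K0 /(_ i Di)[_ hK]] := hF 1 (lexx _).
have [L L0 /(_ j Ej)[_ hL]] := hG 1 (lexx _).
suff H n : (forall k, (k < n)%N -> a k i = b k j) -> a n i = b n j.
  by move=> n; have [m] := ubnP n; elim: m n => // m IH n nm; apply: H => k kn;
    apply: IH; exact: leq_trans kn nm.
move=> IH; apply/eqP; rewrite -subr_eq0; apply/eqP.
apply: (@cmod_small_eq0 _ _ (K * wt i + L * wt' j)) => e e0.
pose d := Num.min e 1.
have d0 : 0 < d by rewrite lt_min e0 ltr01.
have d1 : d <= 1 by rewrite ge_min lexx orbT.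
have de : d <= e by rewrite ge_min lexx.
pose t : C := d%:C.
have ct : cmod t = d by rewrite cmodC gtr0_norm.
have h1 := hK n.+1 t; have h2 := hL n.+1 t.
rewrite ct divr1 in h1 h2.
have h3 : (a n i - b n j) * t ^+ n =
    (G (z0 + t) j - psum (b ^~ j) n.+1 t) - (F (z0 + t) i - psum (a ^~ i) n.+1 t).
  rewrite !psumS FG (_ : psum (a ^~ i) n t = psum (b ^~ j) n t); first by ring.
  by apply: eq_bigr => k _; rewrite IH.
have KL0 : 0 <= K * wt i + L * wt' j.
  have x1 := h1 d1; have x2 := h2 d1.
  have dn : 0 < d ^+ n.+1 by rewrite exprn_gt0.
  have := le_trans (cmod_ge0 _) x1; rewrite pmulr_lge0// => y1.
  by have := le_trans (cmod_ge0 _) x2; rewrite pmulr_lge0// => y2; exact: addr_ge0.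
have : cmod (a n i - b n j) * d ^+ n <= (K * wt i + L * wt' j) * d ^+ n.+1.
  rewrite -ct -cmodX -cmodM h3 ct mulrDl [leRHS]addrC (le_trans (cmodB _ _))//.
  by rewrite lerD ?h1 ?h2.
rewrite exprS mulrA ler_pM2r ?exprn_gt0// => /le_trans; apply.
by rewrite ler_wpM2l.
Qed.

Section FamilyLemmas.
Variable I : Type.
Implicit Types (D : I -> Prop) (wt : I -> R) (F G : C -> I -> C).

Lemma ent_single D wt z0 F a i : ent D wt z0 F a -> D i ->
  ent (fun _ : unit => True) (fun _ => 1) z0 (fun z _ => F z i) (fun n _ => a n i).
Proof.
move=> h Di rho r1; have [K K0 /(_ i Di) [h1 h2]] := h rho r1.
have Kw : 0 <= K * wt i.
  by have := h1 0%N; exact: le_trans (mulr_ge0 (cmod_ge0 _) (exprn_ge0 _ (le_trans ler01 r1))).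
exists (K * wt i) => // _ _; rewrite mulr1; split; first exact: h1.
exact: h2.
Qed.

Lemma tcoefE D wt z0 F a i : ent D wt z0 F a -> D i ->
  forall n, tcoef z0 (F ^~ i) n = a n i.
Proof.
move=> h Di n; rewrite /tcoef; case: pselect => [h'|[]]; last first.
  by exists (a ^~ i); exact: ent_single h Di.
exact: (ent_uniq (i := tt) (j := i) (projT2 (cid h')) h).
Qed.

Lemma ent_tcoef D wt z0 F : (exists a, ent D wt z0 F a) ->
  ent D wt z0 F (fun n i => tcoef z0 (F ^~ i) n).
Proof.
move=> [a h] rho r1; have [K K0 hK] := h rho r1; exists K => // i Di.
have e : (fun n => tcoef z0 (F ^~ i) n) = a ^~ i.
  by apply/funext => n; exact: tcoefE h Di n.
have [h1 h2] := hK i Di; split; last by rewrite [X in psum X]e.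
by move=> n; rewrite (tcoefE h Di).
Qed.

Lemma entireP D wt F : entire D wt F ->
  forall z0, ent D wt z0 F (fun n i => tcoef z0 (F ^~ i) n).
Proof. by move=> h z0; apply: ent_tcoef. Qed.

Lemma tcoef0 D wt F z0 i : entire D wt F -> D i -> tcoef z0 (F ^~ i) 0 = F z0 i.
Proof.
move=> h Di; have [K K0 /(_ i Di)[_ /(_ 1%N 0)]] := entireP h z0 (lexx 1).
rewrite cmod0 mul0r expr1 mulr0 => /(_ ler01).
rewrite psumS psum0 add0r expr0 mulr1 addr0 => h1; apply/esym/eqP.
by rewrite -subr_eq0 -cmod_eq0 eq_le cmod_ge0 andbT.
Qed.

Lemma entire_ext D wt F G : (forall z i, D i -> F z i = G z i) -> entire D wt F ->
  entire D wt G.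
Proof.
move=> FG h z0; have [a ha] := h z0; exists a => rho r1.
have [K K0 hK] := ha rho r1; exists K => // i Di.
by have [h1 h2] := hK i Di; split => // N t tr; rewrite -FG//; exact: h2.
Qed.

Lemma entire_le D wt wt' F : (forall i, D i -> wt i <= wt' i) -> entire D wt F ->
  entire D wt' F.
Proof.
move=> ww h z0; have [a ha] := h z0; exists a => rho r1.
have r0 : 0 < rho by exact: lt_le_trans r1.
have [K K0 hK] := ha rho r1; exists K => // i Di.
have [h1 h2] := hK i Di; split => [n|N t tr].
  by rewrite (le_trans (h1 n))// ler_wpM2l// ww.
rewrite (le_trans (h2 N t tr))// ler_wpM2r ?ler_wpM2l ?ww//.
by rewrite exprn_ge0// divr_ge0 ?cmod_ge0// ltW.
Qed.

Lemma entire_sub (J : Type) (D' : J -> Prop) (h : J -> I) D wt F :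
  (forall j, D' j -> D (h j)) -> entire D wt F ->
  entire D' (fun j => wt (h j)) (fun z j => F z (h j)).
Proof.
move=> Dh hF z0; have [a ha] := hF z0; exists (fun n j => a n (h j)) => rho r1.
by have [K K0 hK] := ha rho r1; exists K => // j Dj; exact: hK _ (Dh _ Dj).
Qed.

Lemma entire_single D wt F i : entire D wt F -> D i ->
  entire (fun _ : unit => True) (fun _ => 1) (fun z _ => F z i).
Proof.
move=> h Di z0; have [a ha] := h z0; exists (fun n _ => a n i).
exact: ent_single ha Di.
Qed.

Lemma entD D wt z0 F G a b : ent D wt z0 F a -> ent D wt z0 G b ->
  ent D wt z0 (fun z i => F z i + G z i) (fun n i => a n i + b n i).
Proof.
move=> hF hG rho r1; have r0 : 0 <= rho by exact: le_trans r1.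
have [K K0 hK] := hF rho r1; have [L L0 hL] := hG rho r1.
exists (K + L) => [|i Di]; first exact: addr_ge0.
have [h1 h2] := hK i Di; have [h3 h4] := hL i Di; split => [n|N t tr].
  rewrite mulrDl (le_trans _ (lerD (h1 n) (h3 n)))// -mulrDl ler_wpM2r//.
    exact: exprn_ge0.
  exact: cmodD.
rewrite psumD !mulrDl (le_trans _ (lerD (h2 N t tr) (h4 N t tr)))//.
by rewrite (le_trans _ (cmodD _ _))// opprD addrACA.
Qed.

(** The factors are expanded with radius [2 rho]. A coefficient of the product has [n + 1] summands,
    and the spare factor [2 ^- n] pays for them because [n + 1 <= 2 * 2 ^ n]. *)
Lemma entM D wt wt' z0 F G a b : ent D wt z0 F a -> ent D wt' z0 G b ->
  ent D (fun i => wt i * wt' i) z0 (fun z i => F z i * G z i)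
    (fun n i => cauchy_prod (a ^~ i) (b ^~ i) n).
Proof.
move=> hF hG rho r1; have r0 : 0 < rho by exact: lt_le_trans r1.
have r2 : 1 <= 2 * rho by rewrite (le_trans r1)// ler_peMl ?ltW// ltr1n.
have [K K0 hK] := hF _ r2; have [L L0 hL] := hG _ r2.
exists (2 * (K * L)) => [|i Di]; first by rewrite !mulr_ge0.
have [h1 h2] := hK i Di; have [h3 h4] := hL i Di.
have n2 n : n.+1%:R / 2 ^+ n <= 2 :> R.
  by rewrite ler_pdivrMr ?exprn_gt0// -exprS -natrX ler_nat ltnW// ltn_expl.
have Kw : 0 <= K * wt i.
  by have := h1 0%N; rewrite expr0 mulr1; exact: le_trans (cmod_ge0 _).
have Lw : 0 <= L * wt' i.
  by have := h3 0%N; rewrite expr0 mulr1; exact: le_trans (cmod_ge0 _).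
pose W := K * wt i * (L * wt' i).
have W0 : 0 <= W by rewrite mulr_ge0.
have We : 2 * (K * L) * (wt i * wt' i) = 2 * W by rewrite /W; ring.
have h1' n : cmod (a n i) <= K * wt i / (2 * rho) ^+ n.
  by rewrite ler_pdivlMr ?h1// exprn_gt0// mulr_gt0.
have h3' n : cmod (b n i) <= L * wt' i / (2 * rho) ^+ n.
  by rewrite ler_pdivlMr ?h3// exprn_gt0// mulr_gt0.
rewrite We; split => [n|N t tr].
  apply: (@le_trans _ _ (n.+1%:R / 2 ^+ n * W)); last by rewrite ler_wpM2r.
  have e : n.+1%:R / 2 ^+ n * W = (\sum_(k < n.+1) W / (2 * rho) ^+ n) * rho ^+ n.
    rewrite sumr_const card_ord -mulr_natl exprMn; field.
    by rewrite !expf_neq0 ?gt_eqF.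
  rewrite e ler_wpM2r ?exprn_ge0 ?(ltW r0)// (le_trans (cmod_sum _ _ _))//.
  apply: ler_sum => k _; rewrite cmodM.
  apply: le_trans (ler_pM (cmod_ge0 _) (cmod_ge0 _) (h1' k) (h3' _)) _.
  rewrite mulrACA -invfM -exprD subnKC// -ltnS//.
have t0 := cmod_ge0 t.
set s := cmod t / (2 * rho).
have s0 : 0 <= s by rewrite divr_ge0// mulr_ge0// ltW.
have t2r : cmod t <= 2 * rho by rewrite (le_trans tr)// ler_peMl ?ltW// ltr1n.
have hs : (cmod t / rho) ^+ N = 2 ^+ N * s ^+ N.
  by rewrite -exprMn /s; congr (_ ^+ _); field; rewrite gt_eqF.
apply: (@le_trans _ _ (N.+1%:R * (W * s ^+ N))); last first.
  have -> : 2 * W * (cmod t / rho) ^+ N = 2 * 2 ^+ N * (W * s ^+ N) by rewrite hs; ring.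
  have Ws : 0 <= W * s ^+ N by rewrite (mulr_ge0 W0)// exprn_ge0.
  rewrite ler_wpM2r//.
  by rewrite -exprS -natrX ler_nat ltnW// ltn_expl.
(* The remainder of a product: the remainder of [F] times the full [G], plus each term of [F] times
   a remainder of [G] of the complementary order. *)
have hFG : F (z0 + t) i * G (z0 + t) i - psum (fun n => cauchy_prod (a ^~ i) (b ^~ i) n) N t =
    (F (z0 + t) i - psum (a ^~ i) N t) * G (z0 + t) i +
    \sum_(k < N) a k i * t ^+ k * (G (z0 + t) i - psum (b ^~ i) (N - k) t).
  rewrite psum_cauchy; under [in RHS]eq_bigr do rewrite mulrBr.
  by rewrite sumrB -big_distrl /= mulrBl /psum; ring.
have -> : N.+1%:R * (W * s ^+ N) = W * s ^+ N + N%:R * (W * s ^+ N).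
  by rewrite -natr1; ring.
rewrite hFG (le_trans (cmodD _ _))//; apply: lerD; last first.
  rewrite (le_trans (cmod_sum _ _ _))//.
  have -> : N%:R * (W * s ^+ N) = \sum_(k < N) W * s ^+ N.
    by rewrite sumr_const card_ord mulr_natl.
  apply: ler_sum => k _; rewrite !cmodM cmodX.
  have hh : cmod (a k i) * cmod t ^+ k <= K * wt i * s ^+ k.
    rewrite /s expr_div_n mulrA mulrAC ler_wpM2r ?exprn_ge0//.
  apply: le_trans (ler_pM _ (cmod_ge0 _) hh (h4 (N - k)%N t t2r)) _.
    by rewrite mulr_ge0 ?cmod_ge0 ?exprn_ge0.
  by rewrite mulrACA -exprD subnKC// ltnW.
rewrite cmodM.
have := h4 0%N t t2r; rewrite psum0 subr0 expr0 mulr1 => hG0.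
apply: le_trans (ler_pM (cmod_ge0 _) (cmod_ge0 _) (h2 N t t2r) hG0) _.
by rewrite /W mulrAC.
Qed.

Lemma entireD D wt F G : entire D wt F -> entire D wt G ->
  entire D wt (fun z i => F z i + G z i).
Proof.
move=> hF hG z0; have [a ha] := hF z0; have [b hb] := hG z0.
by exists (fun n i => a n i + b n i); exact: entD.
Qed.

Lemma entireM D wt wt' F G : entire D wt F -> entire D wt' G ->
  entire D (fun i => wt i * wt' i) (fun z i => F z i * G z i).
Proof.
move=> hF hG z0; have [a ha] := hF z0; have [b hb] := hG z0.
by eexists; exact: (entM ha hb).
Qed.

Lemma entire_cst D wt (c : I -> C) (K : R) : 0 <= K ->
  (forall i, D i -> cmod (c i) <= K * wt i) -> entire D wt (fun _ => c).
Proof.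
move=> K0 hc z0; exists (fun n i => if n is 0%N then c i else 0) => rho r1.
have r0 : 0 < rho by exact: lt_le_trans r1.
exists K => // i Di; have Kw := le_trans (cmod_ge0 _) (hc i Di); split => [[|n]|N t tr].
- by rewrite expr0 mulr1 hc.
- by rewrite cmod0 mul0r.
have hp n : psum (fun n => if n is 0%N then c i else 0) n.+1 t = c i.
  elim: n => [|n IH]; first by rewrite psumS psum0 add0r expr0 mulr1.
  by rewrite psumS IH mul0r addr0.
case: N => [|N]; first by rewrite psum0 subr0 expr0 mulr1 hc.
by rewrite hp subrr cmod0 mulr_ge0// exprn_ge0// divr_ge0 ?cmod_ge0// ltW.
Qed.

Lemma entire_id D : entire D (fun _ => 1) (fun z _ => z).
Proof.
move=> z0; pose a n (i : I) : C := if n is 0%N then z0 else if n is 1%N then 1 else 0.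
exists a => rho r1.
have r0 : 0 < rho by exact: lt_le_trans r1.
exists (cmod z0 + rho) => [|i Di]; first by rewrite addr_ge0 ?cmod_ge0// ltW.
have Kw : 0 <= cmod z0 + rho by rewrite addr_ge0 ?cmod_ge0// ltW.
rewrite mulr1; split => [[|[|n]]|[|[|N]] t tr].
- by rewrite expr0 mulr1 lerDl ltW.
- by rewrite cmod1 expr1 mul1r lerDr cmod_ge0.
- by rewrite cmod0 mul0r.
- by rewrite psum0 subr0 expr0 mulr1 (le_trans (cmodD _ _))// lerD2l.
- rewrite psumS psum0 add0r expr0 mulr1 addrC addKr expr1.
  by rewrite mulrC -mulrA ler_peMr ?cmod_ge0// mulrC ler_pdivlMr// mul1r lerDr cmod_ge0.
have hp n : psum (a ^~ i) n.+2 t = z0 + t.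
  elim: n => [|n IH]; first by rewrite !psumS psum0 add0r expr0 mulr1 mul1r.
  by rewrite psumS IH mul0r addr0.
by rewrite hp subrr cmod0 mulr_ge0// exprn_ge0// divr_ge0 ?cmod_ge0// ltW.
Qed.

Lemma entireZ D wt (c : C) F : entire D wt F -> entire D wt (fun z i => c * F z i).
Proof.
move=> hF; have hc : entire D (fun _ => 1) (fun _ _ => c).
  by apply: (@entire_cst _ _ _ (cmod c)) => [|i _]; rewrite ?cmod_ge0// mulr1.
move=> z0; have [a ha] := entireM hc hF z0; exists a => rho r1.
by have [K K0 hK] := ha rho r1; exists K => // i Di; have := hK i Di; rewrite mul1r.
Qed.

Lemma entireN D wt F : entire D wt F -> entire D wt (fun z i => - F z i).
Proof.
move=> /(entireZ (-1)); apply: entire_ext => z i _; exact: mulN1r.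
Qed.

Lemma entireB D wt F G : entire D wt F -> entire D wt G ->
  entire D wt (fun z i => F z i - G z i).
Proof. by move=> hF hG; apply: entireD => //; exact: entireN. Qed.

Lemma entire_mulz D wt F : entire D wt F -> entire D wt (fun z i => z * F z i).
Proof.
move=> hF z0; have [a ha] := entireM (entire_id D) hF z0; exists a => rho r1.
by have [K K0 hK] := ha rho r1; exists K => // i Di; have := hK i Di; rewrite mul1r.
Qed.

Lemma tcoefM D wt wt' F G z0 n i : entire D wt F -> entire D wt' G -> D i ->
  tcoef z0 (fun z => F z i * G z i) n =
  cauchy_prod (tcoef z0 (F ^~ i)) (tcoef z0 (G ^~ i)) n.
Proof.
move=> hF hG Di.
exact: (tcoefE (entM (entireP hF z0) (entireP hG z0)) Di n).
Qed.

Lemma entire_taylor2 D wt F z0 : entire D wt F -> exists2 K : R, 0 <= K &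
  forall i, D i -> cmod (tcoef z0 (F ^~ i) 1) <= K * wt i /\
  (forall t, cmod t <= 1 ->
   cmod (F (z0 + t) i - F z0 i - t * tcoef z0 (F ^~ i) 1) <= K * wt i * cmod t ^+ 2).
Proof.
move=> h; have [K K0 hK] := entireP h z0 (lexx 1); exists K => // i Di.
have [h1 h2] := hK i Di; split => [|t t1].
  by have := h1 1%N; rewrite expr1 mulr1.
have := h2 2 t t1; rewrite !psumS psum0 add0r expr0 expr1 mulr1 divr1 (tcoef0 _ h Di).
by rewrite opprD addrA [t * _]mulrC.
Qed.

End FamilyLemmas.

Definition entireS (F : C -> C) : Prop :=
  entire (fun _ : unit => True) (fun _ => 1) (fun z _ => F z).

Lemma entireSM F G : entireS F -> entireS G -> entireS (fun z => F z * G z).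
Proof.
move=> hF hG z0; have [a ha] := entireM hF hG z0; exists a => rho r1.
by have [K K0 hK] := ha rho r1; exists K => // i Di; have := hK i Di; rewrite mul1r.
Qed.

Lemma entireS_cst (c : C) : entireS (fun _ => c).
Proof.
by apply: (@entire_cst _ _ _ (fun _ => c) (cmod c)) => [|i _]; rewrite ?cmod_ge0// mulr1.
Qed.

Lemma entireSX F n : entireS F -> entireS (fun z => F z ^+ n).
Proof.
move=> h; elim: n => [|n IH].
  by apply: entire_ext (entireS_cst 1) => z i _; rewrite expr0.
by apply: entire_ext (entireSM h IH) => z i _; rewrite exprS.
Qed.

(** With vanishing coefficients the function is its own remainder, and the radius [1 + 2 |t|] bounds
    that by [K / 2 ^ N]. *)
Lemma entireS_eq0 F z0 : entireS F -> (forall n, tcoef z0 F n = 0) ->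
  forall z, F z = 0.
Proof.
move=> h a0 z; pose t := z - z0; pose rho := 1 + 2 * cmod t.
have t0 := cmod_ge0 t.
have r1 : 1 <= rho by rewrite lerDl mulr_ge0.
have r0 : 0 < rho by exact: lt_le_trans r1.
have [K K0 /(_ tt I)[_ hK]] := entireP h z0 r1.
apply: (@cmod_small_eq0 _ _ 1) => e e0; rewrite mul1r.
have [N hN] := exists_half_pow K e0.
have tr : cmod t <= rho by rewrite /rho; lra.
have := hK N t tr; rewrite (_ : z0 + t = z); last by rewrite /t addrC subrK.
rewrite [psum _ _ _]big1 => [|n _]; last by rewrite a0 mul0r.
rewrite subr0 mulr1 => /le_trans; apply; apply: le_trans hN.
rewrite ler_wpM2l// -exprVn lerXn2r ?nnegrE ?divr_ge0 ?invr_ge0 ?(ltW r0)//.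
by rewrite ler_pdivrMr// /rho; lra.
Qed.

Lemma entireS_order F z0 : entireS F -> (exists z, F z != 0) ->
  exists m, tcoef z0 F m != 0 /\ forall k, (k < m)%N -> tcoef z0 F k = 0.
Proof.
move=> h [z Fz].
have ex : exists m, tcoef z0 F m != 0.
  apply: contrapT => nex; move/eqP: Fz; apply; apply: (entireS_eq0 (z0 := z0)) => // n.
  by apply/eqP; apply: contrapT => /negP nz; apply: nex; exists n.
exists (ex_minn ex); case: ex_minnP => m am mmin; split => // k km.
by apply/eqP; apply: contraTT km => ak; rewrite -leqNgt mmin.
Qed.

(** Quotient by the m-th power of [z - z0] with the singularity filled in; this is the right value
    when all coefficients below [m] vanish. *)
Definition divz (F : C -> C) z0 m (z : C) : C :=
  if z == z0 then tcoef z0 F m else F z / (z - z0) ^+ m.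

(** Dividing the remainder of order [N + m] by [t ^ m] leaves one of order [N]; the constant does
    not grow because [1 <= rho]. *)
Lemma ent_divz F z0 m : entireS F -> (forall k, (k < m)%N -> tcoef z0 F k = 0) ->
  ent (fun _ : unit => True) (fun _ => 1) z0 (fun z _ => divz F z0 m z)
    (fun n _ => tcoef z0 F (n + m)).
Proof.
move=> h a0 rho r1; have r0 : 0 < rho by exact: lt_le_trans r1.
have [K K0 /(_ tt I)[h1 h2]] := entireP h z0 r1.
have rm : 1 <= rho ^+ m by rewrite exprn_ege1.
exists K => // _ _; split => [n|N t tr].
  apply: le_trans (h1 (n + m)%N); rewrite exprD mulrA ler_peMr//.
  by rewrite mulr_ge0 ?cmod_ge0 ?exprn_ge0// ltW.
rewrite /divz -[X in _ == X]addr0 (inj_eq (addrI z0)).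
have [->|tn0] := eqVneq t 0.
  case: N => [|N].
    rewrite psum0 subr0 expr0 mulr1 -{1}[m]add0n.
    have := h1 m; rewrite add0n; apply: le_trans.
    by rewrite ler_peMr// cmod_ge0.
  rewrite cmod0 mul0r expr0n/= mulr0.
  have -> : psum (fun n => tcoef z0 F (n + m)) N.+1 0 = tcoef z0 F m.
    rewrite /psum big_ord_recl expr0 mulr1 add0n big1 ?addr0// => k _.
    by rewrite expr0n /= mulr0.
  by rewrite subrr cmod0.
have e1 : z0 + t - z0 = t by ring.
rewrite e1.
have e2 : psum (tcoef z0 F) (N + m) t = t ^+ m * psum (fun n => tcoef z0 F (n + m)) N t.
  elim: N => [|N IH].
    by rewrite add0n psum0 mulr0 /psum big1// => k _; rewrite a0 ?mul0r.
  by rewrite addSn !psumS IH mulrDr exprD; ring.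
have tm0 : t ^+ m != 0 by rewrite expf_neq0.
have -> : F (z0 + t) / t ^+ m - psum (fun n => tcoef z0 F (n + m)) N t =
   (F (z0 + t) - psum (tcoef z0 F) (N + m) t) / t ^+ m by rewrite e2; field.
have c0 : 0 < cmod t by rewrite cmod_gt0.
rewrite cmod_div cmodX ler_pdivrMr ?exprn_gt0//.
rewrite (le_trans (h2 (N + m)%N t tr))// exprD mulrA ler_wpM2l//.
  by rewrite !mulr_ge0 ?exprn_ge0// divr_ge0// ltW.
rewrite lerXn2r ?nnegrE ?divr_ge0 ?(ltW r0) ?(ltW c0)//.
by rewrite ler_pdivrMr// ler_peMr// (ltW c0).
Qed.

End EntireFamilies.

(** * Analytic dependence of solutions on the spectral parameter *)

Section AnalyticODE.
Variable R : realType.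
Local Notation C := R[i].
Variables (V : R -> C) (v : R).
Hypotheses (cV : ccont V) (hV : forall x, cmod (V x) <= v).

Let v0 : 0 <= v. Proof. exact: le_trans (cmod_ge0 _) (hV 0). Qed.

(** The first summand meets the requirement of [ode_estimate] for all parameters within [rho] of
    [z0]. The second makes each step of the recursion for the Taylor coefficients gain a factor
    [1 / rho]. The last one keeps the contribution of the source small. *)
Definition kapf (v : R) (z0 : C) (rho : R) : R :=
  2 * (1 + (v + (cmod z0 + rho) ^+ 2)) + 8 * (cmod z0 + rho) * rho + 4.

Lemma ccontVz (z : C) : ccont (fun x => V x - z ^+ 2).
Proof. by apply: ccontB => //; exact: ccont_cst. Qed.

Lemma cmodVz (z : C) (x : R) : cmod (V x - z ^+ 2) <= v + cmod z ^+ 2.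
Proof. by rewrite (le_trans (cmodB _ _))// cmodX lerD2r. Qed.

Lemma cmodVz_le z0 t (rho x : R) : cmod t <= rho ->
  cmod (V x - (z0 + t) ^+ 2) <= v + (cmod z0 + rho) ^+ 2.
Proof.
move=> tr; rewrite (le_trans (cmodVz _ _))// lerD2l lerXn2r ?nnegrE ?cmod_ge0//.
  by rewrite addr_ge0 ?cmod_ge0// (le_trans _ tr)// cmod_ge0.
by rewrite (le_trans (cmodD _ _))// lerD2l.
Qed.

Definition odepick (Q g1 g2 : R -> C) (x0 : R) (a b : C) : (R -> C) * (R -> C) :=
  if pselect (exists up : (R -> C) * (R -> C),
    [/\ odesol Q g1 g2 up.1 up.2, up.1 x0 = a & up.2 x0 = b]) is left h
  then projT1 (cid h) else (fun _ => 0, fun _ => 0).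

Lemma odepickP (Q g1 g2 : R -> C) (x0 q c kap : R) (a b : C) :
  2 * (1 + q) <= kap -> 0 <= q -> 0 <= c -> ccont Q -> ccont g1 -> ccont g2 ->
  (forall x, cmod (Q x) <= q) ->
  (forall x, cmod (g1 x) <= c * wexp kap x0 x) ->
  (forall x, cmod (g2 x) <= c * wexp kap x0 x) ->
  [/\ odesol Q g1 g2 (odepick Q g1 g2 x0 a b).1 (odepick Q g1 g2 x0 a b).2,
    (odepick Q g1 g2 x0 a b).1 x0 = a & (odepick Q g1 g2 x0 a b).2 x0 = b].
Proof.
move=> h1 h2 h3 h4 h5 h6 h7 h8 h9; rewrite /odepick; case: pselect => [h|[]].
  exact: projT2 (cid h).
have [u [p hup]] := @ode_exists _ _ _ _ x0 q c kap a b h1 h2 h3 h4 h5 h6 h7 h8 h9.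
by exists (u, p).
Qed.

Section Family.
Variables (x0 : R) (G : R -> C) (a b b1 : C) (c : R).
Hypotheses (cG : ccont G) (hG : forall x, cmod (G x) <= c).
Variables (u p : C -> R -> C).
Hypothesis hsol : forall z, odesol (fun x => V x - z ^+ 2) G (fun _ => 0) (u z) (p z).
Hypothesis hu : forall z, u z x0 = a.
(** Affine in [z] so as to cover the plane wave, whose slope at 0 is [- i z]. *)
Hypothesis hp : forall z, p z x0 = b + b1 * z.

Let c0 : 0 <= c. Proof. exact: le_trans (cmod_ge0 _) (hG 0). Qed.

Variable z0 : C.

(* [(U_n, P_n, U_{n-1})] where [U_n], [P_n] are the Taylor coefficients at [z0]. *)
Fixpoint ode_coef (n : nat) : ((R -> C) * (R -> C)) * (R -> C) :=
  if n is m.+1 then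
    (odepick (fun x => V x - z0 ^+ 2) (fun _ => 0)
       (fun x => - (2 * z0) * (ode_coef m).1.1 x - (ode_coef m).2 x) x0
       0 (if m == 0%N then b1 else 0), (ode_coef m).1.1)
  else (odepick (fun x => V x - z0 ^+ 2) G (fun _ => 0) x0 a (b + b1 * z0), fun _ => 0).

Let U n := (ode_coef n).1.1.
Let P n := (ode_coef n).1.2.
Let Um n := (ode_coef n).2.

Let s := cmod a + cmod (b + b1 * z0) + cmod b1 + c.

Let s0 : 0 <= s. Proof. by rewrite !addr_ge0 ?cmod_ge0. Qed.

Let kge (rho : R) : 1 <= rho ->
  [/\ 2 * (1 + (v + (cmod z0 + rho) ^+ 2)) <= kapf v z0 rho, 4 <= kapf v z0 rho,
      0 < kapf v z0 rho & 8 * (cmod z0 + rho) * rho <= kapf v z0 rho].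
Proof.
move=> r1; have r0 : 0 < rho by exact: lt_le_trans r1.
have z00 := cmod_ge0 z0.
have h1 : 0 <= 8 * (cmod z0 + rho) * rho by rewrite !mulr_ge0 ?addr_ge0// ltW.
have h2 : 0 <= 2 * (1 + (v + (cmod z0 + rho) ^+ 2)).
  by rewrite mulr_ge0// !addr_ge0// exprn_ge0// addr_ge0// ltW.
by rewrite /kapf; split; lra.
Qed.

Let qle (rho : R) : 1 <= rho ->
  0 <= v + (cmod z0 + rho) ^+ 2 /\
  forall t, cmod t <= rho -> forall x, cmod (V x - (z0 + t) ^+ 2) <= v + (cmod z0 + rho) ^+ 2.
Proof.
move=> r1; have r0 : 0 < rho by exact: lt_le_trans r1.
split; first by rewrite addr_ge0// exprn_ge0// addr_ge0 ?cmod_ge0// ltW.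
by move=> t tr x; exact: cmodVz_le.
Qed.

(** The spare factor [rho] is needed at [n = 1]: there the initial slope [b1] enters without any
    decay in [rho]. *)
Let B (rho : R) n := 4 * s * rho / rho ^+ n.

Let B_ge0 rho n : 1 <= rho -> 0 <= B rho n.
Proof.
move=> r1; have r0 : 0 <= rho by exact: le_trans r1.
by rewrite /B divr_ge0 ?exprn_ge0// !mulr_ge0.
Qed.

Let BS rho n : 1 <= rho -> B rho n = rho * B rho n.+1.
Proof.
move=> r1; have r0 : rho != 0 by rewrite gt_eqF// (lt_le_trans _ r1).
by rewrite /B exprS; field; rewrite expf_neq0.
Qed.

(** Expanding the square of [z0 + t] shows that the coefficient U_n solves the equation at [z0] with
    source [- 2 z0 U_(n-1) - U_(n-2)]. Through [ode_estimate] the choice of [kapf] turns this into a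
    gain of [1 / rho] per step. *)
Lemma ode_coefP (rho : R) : 1 <= rho -> forall n,
  [/\ odesol (fun x => V x - z0 ^+ 2) (if n == 0%N then G else fun _ => 0)
       (if n == 0%N then fun _ => 0 else
         fun x => - (2 * z0) * U n.-1 x - Um n.-1 x) (U n) (P n),
    U n x0 = (if n == 0%N then a else 0) /\
    P n x0 = (if n == 0%N then b + b1 * z0 else if n == 1%N then b1 else 0),
    forall x, cmod (U n x) <= B rho n * wexp (kapf v z0 rho) x0 x /\
       cmod (P n x) <= B rho n * wexp (kapf v z0 rho) x0 x,
    ccont (U n) /\ ccont (Um n)
  & forall x, cmod (Um n x) <= rho * B rho n * wexp (kapf v z0 rho) x0 x].
Proof.
move=> r1; have r0 : 0 < rho by exact: lt_le_trans r1.
have [k1 k2 k3 k4] := kge r1; have [q0 qz] := qle r1.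
have qz0 x : cmod (V x - z0 ^+ 2) <= v + (cmod z0 + rho) ^+ 2.
  by have := qz 0 _ x; rewrite cmod0 addr0; apply; exact: ltW.
set kap := kapf v z0 rho in k1 k2 k3 k4 *.
have z00 := cmod_ge0 z0.
have w1 y : 1 <= wexp kap x0 y by apply: wexp_ge1; exact: ltW.
have w0 y : 0 <= wexp kap x0 y by exact: wexp_ge0.
have sa : cmod a <= s by rewrite /s -!addrA lerDl !addr_ge0 ?cmod_ge0.
have sb : cmod (b + b1 * z0) <= s.
  by rewrite /s; have := cmod_ge0 a; have := cmod_ge0 b1; have := c0; lra.
have sb1 : cmod b1 <= s.
  by rewrite /s; have := cmod_ge0 a; have := cmod_ge0 (b + b1 * z0); have := c0; lra.
have sc : c <= s.
  by rewrite /s !lerDr !addr_ge0 ?cmod_ge0.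
have est0 (g : R -> C) (d e : R) Q g1 g2 y z : 0 <= e -> odesol Q g1 g2 y z ->
    (forall x, cmod (Q x) <= v + (cmod z0 + rho) ^+ 2) ->
    (forall x, cmod (g1 x) <= e * wexp kap x0 x) ->
    (forall x, cmod (g2 x) <= e * wexp kap x0 x) ->
    cmod (y x0) <= d -> cmod (z x0) <= d -> forall x,
    cmod (y x) <= 2 * (d + e / kap) * wexp kap x0 x /\
    cmod (z x) <= 2 * (d + e / kap) * wexp kap x0 x.
  move=> e0 hs hQ h1 h2 hy hz x.
  exact: (@ode_estimate _ Q g1 g2 y z x0 _ e kap d `|x - x0| k1 q0 e0 hs (fun t _ => hQ t)
    (fun t _ => h1 t) (fun t _ => h2 t) hy hz x (lexx _)).
elim => [|n [IH1 [IH2 IH3] IH4 [IH5 IH6] IH7]].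
  have hG1 x : cmod (G x) <= c * wexp kap x0 x by rewrite (le_trans (hG x))// ler_peMr.
  have h01 x : cmod (0 : C) <= c * wexp kap x0 x by rewrite cmod0 mulr_ge0.
  have [h1 h2 h3] := @odepickP (fun x => V x - z0 ^+ 2) G (fun _ => 0) x0 _ c kap a (b + b1 * z0)
    k1 q0 c0 (ccontVz z0) cG (ccont_cst 0) qz0 hG1 h01.
  have B0 : 2 * (s + c / kap) <= B rho 0.
    rewrite /B expr0 divr1.
    have : c / kap <= s by rewrite ler_pdivrMr// (le_trans sc)// ler_peMr//; lra.
    have : s <= s * rho by rewrite ler_peMr.
    by lra.
  have h4 := est0 G s c _ _ _ _ _ c0 h1 qz0 hG1 h01; rewrite h2 h3 in h4.
  split => //=.
  - move=> x; have [h5 h6] := h4 sa sb x.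
    by split; [apply: le_trans h5 _|apply: le_trans h6 _]; rewrite ler_wpM2r.
  - by split; [exact: cder_ccont (fun t => (h1 t).1)|exact: ccont_cst].
  - by move=> x; rewrite cmod0 mulr_ge0// mulr_ge0 ?B_ge0// ltW.
have Bn := B_ge0 n r1; have Bn1 := B_ge0 n.+1 r1.
pose e := (2 * cmod z0 + rho) * B rho n.
have e0 : 0 <= e by rewrite mulr_ge0// addr_ge0 ?mulr_ge0// ltW.
have hg x : cmod (- (2 * z0) * U n x - Um n x) <= e * wexp kap x0 x.
  have -> : e * wexp kap x0 x =
    2 * cmod z0 * (B rho n * wexp kap x0 x) + rho * B rho n * wexp kap x0 x.
    by rewrite /e; ring.
  rewrite (le_trans (cmodB _ _))//; apply: lerD => //.
  rewrite cmodM cmodN cmodM cmod_nat ler_wpM2l ?mulr_ge0//.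
  by have [] := IH4 x.
have h01 x : cmod (0 : C) <= e * wexp kap x0 x by rewrite cmod0 mulr_ge0.
have cg : ccont (fun x => - (2 * z0) * U n x - Um n x).
  by apply: ccontB => //; exact: ccontZ.
have [h1 h2 h3] := @odepickP (fun x => V x - z0 ^+ 2) (fun _ => 0) _ x0 _ e kap 0
  (if n == 0%N then b1 else 0) k1 q0 e0 (ccontVz z0) (ccont_cst 0) cg qz0 h01 hg.
have he : 2 * (e / kap) <= B rho n.+1 / 2.
  rewrite /e (BS n r1) mulrA ler_pdivrMr//.
  have -> : 2 * ((2 * cmod z0 + rho) * (rho * B rho n.+1)) =
    B rho n.+1 / 2 * (4 * (2 * cmod z0 + rho) * rho) by field.
  apply: ler_wpM2l; first by apply: divr_ge0.
  apply: le_trans k4; apply: ler_wpM2r; first exact: ltW.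
  by have := ltW r0; lra.
have hd : 2 * (if n == 0%N then cmod b1 else 0) <= B rho n.+1 / 2.
  case: (n =P 0%N) => [->|_]; last by rewrite mulr0 divr_ge0.
  by rewrite /B expr1 mulfK ?gt_eqF//; lra.
have h4 := est0 G (if n == 0%N then cmod b1 else 0) e _ _ _ _ _ e0 h1 qz0 h01 hg.
rewrite h2 h3 cmod0 in h4.
split => //=.
- move=> x; have [||h5 h6] := h4 _ _ x.
  + by case: ifP => // _; exact: cmod_ge0.
  + by case: ifP => // _; rewrite cmod0.
  by split; [apply: le_trans h5 _|apply: le_trans h6 _]; rewrite ler_wpM2r//; lra.
- by split => //; exact: cder_ccont (fun t => (h1 t).1).
- by move=> x; rewrite -BS//; have [] := IH4 x.
Qed.

Let R1 N t x := u (z0 + t) x - psum (U ^~ x) N t.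
Let R2 N t x := p (z0 + t) x - psum (P ^~ x) N t.

(** Subtracting a partial sum leaves a solution of the equation at [z0 + t] itself: all sources
    cancel except those feeding coefficients not yet subtracted, and these carry the factor
    [t ^ (N + 1)]. *)
Let rem_sol N t : odesol (fun x => V x - (z0 + t) ^+ 2) (fun _ => 0)
    (fun x => - (t ^+ N.+1 * ((2 * z0 + t) * U N x + Um N x)))
    (R1 N.+1 t) (R2 N.+1 t).
Proof.
elim: N => [|N IH] x.
  have [h1 h2] := hsol (z0 + t) x; have [h3 _ _ _ _] := ode_coefP (lexx 1) 0.
  have [h4 h5] := h3 x; split.
    apply: cder_ext (cderB h1 h4) => [y|]; first by rewrite /R1 psumS psum0 expr0; ring.
    by rewrite /R2 psumS psum0 expr0 /=; ring.
  apply: cder_ext (cderB h2 h5) => [y|]; first by rewrite /R2 psumS psum0 expr0; ring.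
  by rewrite /R1 psumS psum0 expr0 /=; ring.
have [h1 h2] := IH x; have [h3 _ _ _ _] := ode_coefP (lexx 1) N.+1.
have [h4 h5] := h3 x; split.
  apply: cder_ext (cderB h1 (cderZ (t ^+ N.+1) h4)) => [y|].
    by rewrite /R1 [psum _ N.+2 _]psumS; ring.
  by rewrite /R2 [psum _ N.+2 _]psumS /=; ring.
apply: cder_ext (cderB h2 (cderZ (t ^+ N.+1) h5)) => [y|].
  by rewrite /R2 [psum _ N.+2 _]psumS; ring.
rewrite /R1 [psum _ N.+2 _]psumS /= [t ^+ N.+2]exprS.
have -> : Um N.+1 = U N by [].
by ring.
Qed.

(** Order 0 is the a priori bound on the solution. In order [N + 1] the source is that of [rem_sol],
    and the only initial datum left is the slope [b1 t] when [N = 0], because the data are affine in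
    the parameter. *)
Lemma ode_remainder (rho : R) : 1 <= rho -> forall N t x, cmod t <= rho ->
  cmod (R1 N t x) <= 8 * rho * s * (cmod t / rho) ^+ N * wexp (kapf v z0 rho) x0 x /\
  cmod (R2 N t x) <= 8 * rho * s * (cmod t / rho) ^+ N * wexp (kapf v z0 rho) x0 x.
Proof.
move=> r1 N t x tr; have r0 : 0 < rho by exact: lt_le_trans r1.
have [k1 k2 k3 k4] := kge r1; have [q0 /(_ t tr) qz] := qle r1.
have hB := ode_coefP r1.
set kap := kapf v z0 rho in k1 k2 k3 k4 hB *.
have z00 := cmod_ge0 z0; have t0 := cmod_ge0 t.
have w1 y : 1 <= wexp kap x0 y by apply: wexp_ge1; exact: ltW.
have w0 y : 0 <= wexp kap x0 y by exact: wexp_ge0.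
have sa : cmod a <= s by rewrite /s -!addrA lerDl !addr_ge0 ?cmod_ge0.
have sb : cmod (b + b1 * z0) <= s.
  by rewrite /s; have := cmod_ge0 a; have := cmod_ge0 b1; have := c0; lra.
have sb1 : cmod b1 <= s.
  by rewrite /s; have := cmod_ge0 a; have := cmod_ge0 (b + b1 * z0); have := c0; lra.
have sc : c <= s.
  by rewrite /s !lerDr !addr_ge0 ?cmod_ge0.
have ssr : s <= s * rho by rewrite ler_peMr.
have est0 (d e : R) g1 g2 y z : 0 <= e -> odesol (fun x => V x - (z0 + t) ^+ 2) g1 g2 y z ->
    (forall x, cmod (g1 x) <= e * wexp kap x0 x) ->
    (forall x, cmod (g2 x) <= e * wexp kap x0 x) ->
    cmod (y x0) <= d -> cmod (z x0) <= d ->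
    2 * (d + e / kap) <= 8 * rho * s * (cmod t / rho) ^+ N ->
    cmod (y x) <= 8 * rho * s * (cmod t / rho) ^+ N * wexp kap x0 x /\
    cmod (z x) <= 8 * rho * s * (cmod t / rho) ^+ N * wexp kap x0 x.
  move=> e0 hs h1 h2 hy hz hd.
  have [h3 h4] := @ode_estimate _ _ g1 g2 y z x0 _ e kap d `|x - x0| k1 q0 e0 hs
    (fun t _ => qz t) (fun t _ => h1 t) (fun t _ => h2 t) hy hz x (lexx _).
  by split; [apply: le_trans h3 _|apply: le_trans h4 _]; rewrite ler_wpM2r.
case: N est0 => [|N] est0.
  have e1 (F : nat -> R -> C) (y : C) : y - psum (F ^~ x) 0 t = y.
    by rewrite psum0 subr0.
  rewrite /R1 /R2 !e1.
  apply: (est0 (s + s * rho) c G (fun _ => 0)) => //.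
  - by move=> y; rewrite (le_trans (hG y))// ler_peMr.
  - by move=> y; rewrite cmod0 mulr_ge0.
  - by rewrite hu (le_trans sa)// lerDl mulr_ge0// ltW.
  - rewrite hp mulrDr addrA (le_trans (cmodD _ _))// cmodM lerD//.
    by rewrite ler_pM ?cmod_ge0.
  rewrite expr0 mulr1.
  have : c / kap <= s by rewrite ler_pdivrMr// (le_trans sc)// ler_peMr//; lra.
  by have := s0; lra.
have BN := B_ge0 N r1; have BN1 := B_ge0 N.+1 r1.
have tN : 0 <= cmod t ^+ N.+1 by rewrite exprn_ge0.
pose e := cmod t ^+ N.+1 * ((2 * cmod z0 + 2 * rho) * B rho N).
have e0 : 0 <= e by rewrite mulr_ge0// mulr_ge0// addr_ge0 ?mulr_ge0// ltW.
have [_ [hU0 hP0] hUP _ hUm] := hB N.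
apply: (est0 (if N == 0%N then cmod b1 * cmod t else 0) e _ _ _ _ e0 (rem_sol N t)).
- by move=> y; rewrite cmod0 mulr_ge0.
- move=> y; rewrite cmodN cmodM cmodX /e -[leRHS]mulrA ler_wpM2l// (le_trans (cmodD _ _))//.
  have [hy _] := hUP y; have hm := hUm y.
  have -> : (2 * cmod z0 + 2 * rho) * B rho N * wexp kap x0 y =
    (2 * cmod z0 + rho) * (B rho N * wexp kap x0 y) + rho * B rho N * wexp kap x0 y by ring.
  apply: lerD => //; rewrite cmodM ler_pM ?cmod_ge0//.
  by rewrite (le_trans (cmodD _ _))// cmodM cmod_nat lerD2l.
- rewrite /R1 hu psumS hU0; case: (N =P 0%N) => [->|Nn0].
    by rewrite psum0 expr0 (_ : _ - _ = 0) ?cmod0 ?mulr_ge0 ?cmod_ge0//; ring.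
  have -> : psum (U ^~ x0) N t = a.
    case: N Nn0 {est0 BN BN1 tN e e0 hU0 hP0 hUP hUm} => // N _.
    rewrite /psum big_ord_recl expr0 mulr1 /=.
    have [_ [-> _] _ _ _] := hB 0%N; rewrite big1 ?addr0// => k _.
    by have [_ [-> _] _ _ _] := hB (bump 0 k); rewrite mul0r.
  by rewrite mul0r addr0 subrr cmod0.
- rewrite /R2 hp psumS hP0; case: (N =P 0%N) => [->|Nn0].
    rewrite psum0 expr0 (_ : _ - _ = b1 * t) ?cmodM//; ring.
  case: (N =P 1%N) => [->|Nn1].
    have [_ [_ e2] _ _ _] := hB 0%N.
    by rewrite psumS psum0 e2 /= expr0 expr1 (_ : _ - _ = 0) ?cmod0//; ring.
  have -> : psum (P ^~ x0) N t = b + b1 * z0 + b1 * t.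
    case: N Nn0 Nn1 {est0 BN BN1 tN e e0 hU0 hP0 hUP hUm} => [|[|N]]// _ _.
    rewrite /psum 2!big_ord_recl /= expr0 expr1 mulr1.
    have [_ [_ ->] _ _ _] := hB 0%N; have [_ [_ ->] _ _ _] := hB (bump 0 0).
    rewrite /= addrA big1 ?addr0// => k _.
    by have [_ [_ ->] _ _ _] := hB (bump 0 (bump 0 k)); rewrite mul0r.
  by rewrite mul0r addr0 (_ : _ - _ = 0) ?cmod0//; ring.
have h1 : 2 * (e / kap) <= 4 * rho * s * (cmod t / rho) ^+ N.+1.
  rewrite /e mulrA ler_pdivrMr// BS// /B.
  set k := kap in k4 *.
  have -> : 2 * (cmod t ^+ N.+1 * ((2 * cmod z0 + 2 * rho) * (rho * (4 * s * rho / rho ^+ N.+1)))) =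
     2 * rho * s * (cmod t ^+ N.+1 / rho ^+ N.+1) * (8 * (cmod z0 + rho) * rho) by ring.
  rewrite expr_div_n.
  have W : 0 <= 2 * rho * s * (cmod t ^+ N.+1 / rho ^+ N.+1).
    by rewrite !mulr_ge0// ?invr_ge0 ?exprn_ge0// ltW.
  apply: le_trans (ler_wpM2l W k4) _; apply: ler_wpM2r; first exact: ltW.
  by move: W; lra.
have h2 : 2 * (if N == 0%N then cmod b1 * cmod t else 0) <= 4 * rho * s * (cmod t / rho) ^+ N.+1.
  have W : 0 <= 4 * rho * s * (cmod t / rho) ^+ N.+1.
    by rewrite mulr_ge0 ?exprn_ge0 ?divr_ge0// ?mulr_ge0// ltW.
  case: (N =P 0%N) W => [->|_ W]; last by rewrite mulr0.
  rewrite expr1 => _; have -> : 4 * rho * s * (cmod t / rho) = 4 * s * cmod t.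
    by field; rewrite gt_eqF.
  by have := ler_wpM2r t0 sb1; have := mulr_ge0 s0 t0; lra.
by lra.
Qed.

End Family.
End AnalyticODE.

(** * Square integrable functions and H^2 regularity *)

Section LocalSpaces.
Variable R : realType.
Local Notation C := R[i].
Local Notation mu := (@lebesgue_measure R).
Implicit Types (f g u : R -> C) (x y M : R).

Definition nrm2 f : R := fine (sqL2 setT f).
Definition nrm f : R := Num.sqrt (nrm2 f).

Lemma sqL2_ge0 D f : (0 <= sqL2 D f)%E.
Proof. by apply: integral_ge0 => x _; rewrite lee_fin sqr_ge0. Qed.

Lemma nrm_ge0 f : 0 <= nrm f. Proof. exact: sqrtr_ge0. Qed.

Lemma nrm_sqr f : nrm f ^+ 2 = nrm2 f.
Proof. by rewrite sqr_sqrtr// fine_ge0// sqL2_ge0. Qed.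

Lemma sqL2_nrm f : L2 f -> sqL2 setT f = (nrm f ^+ 2)%:E.
Proof.
by move=> [_ foo]; rewrite nrm_sqr fineK// ge0_fin_numE// sqL2_ge0.
Qed.

Lemma measurable_cmod2 f : cmeasurable f ->
  measurable_fun setT (fun x => cmod (f x) ^+ 2).
Proof.
move=> [m1 m2]; rewrite (_ : (fun x => _) =
  (fun x => complex.Re (f x) ^+ 2 + complex.Im (f x) ^+ 2)); last first.
  by apply/funext => x; rewrite cmod_sqr.
by apply: measurable_funD; apply: measurable_funX.
Qed.

Lemma ccont_measurable f : ccont f -> cmeasurable f.
Proof. by move=> [c1 c2]; split; exact: continuous_measurable_fun. Qed.

Lemma cmeasurableD f g : cmeasurable f -> cmeasurable g ->
  cmeasurable (fun x => f x + g x).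
Proof.
move=> [f1 f2] [g1 g2]; split.
  rewrite (_ : (fun x => _) = (fun x => complex.Re (f x)) \+ (fun x => complex.Re (g x))).
    exact: measurable_funD.
  by apply/funext => x; rewrite ReD.
rewrite (_ : (fun x => _) = (fun x => complex.Im (f x)) \+ (fun x => complex.Im (g x))).
  exact: measurable_funD.
by apply/funext => x; rewrite ImD.
Qed.

Lemma cmeasurableZ (a : C) f : cmeasurable f -> cmeasurable (fun x => a * f x).
Proof.
move=> [f1 f2]; split.
  rewrite (_ : (fun x => _) = (fun x => complex.Re a * complex.Re (f x)) \-
                              (fun x => complex.Im a * complex.Im (f x))).
    by apply: measurable_funB; apply: measurable_funM.
  by apply/funext => x; rewrite ReM.
rewrite (_ : (fun x => _) = (fun x => complex.Re a * complex.Im (f x)) \+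
                            (fun x => complex.Im a * complex.Re (f x))).
  by apply: measurable_funD; apply: measurable_funM.
by apply/funext => x; rewrite ImM.
Qed.

Lemma boxE M x : box M x = (- M <= x <= M) :> Prop.
Proof. by rewrite /box /= in_itv. Qed.

Lemma box_measure M : 0 <= M -> mu (box M) = (2 * M)%:E.
Proof.
move=> M0; rewrite /box lebesgue_measure_itv/= lte_fin.
case: ltP => h; first by rewrite -EFinB; congr EFin; ring.
by have -> : M = 0; [apply/eqP; rewrite eq_le; apply/andP; split; lra|rewrite mulr0].
Qed.

Lemma cmod_sqrD (z w : C) : cmod (z + w) ^+ 2 <= 2 * cmod z ^+ 2 + 2 * cmod w ^+ 2.
Proof.
have := cmodD z w; have := cmod_ge0 (z + w); have := sqr_ge0 (cmod z - cmod w).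
move: (cmod z) (cmod w) (cmod (z + w)) => a b c; nra.
Qed.

Lemma sqL2D D f g : measurable D -> cmeasurable f -> cmeasurable g ->
  (sqL2 D (fun x => (f x + g x)%R) <= 2%:E * sqL2 D f + 2%:E * sqL2 D g)%E.
Proof.
move=> mD mf mg; rewrite /sqL2.
have e0 h x : D x -> (0 <= (cmod (h x) ^+ 2)%:E :> \bar R)%E.
  by move=> _; rewrite lee_fin sqr_ge0.
have mm h : cmeasurable h -> measurable_fun D (fun x => (cmod (h x) ^+ 2)%:E).
  move=> mh; apply/measurable_EFinP.
  exact: measurable_funS (measurable_cmod2 mh).
rewrite -!ge0_integralZl ?lee_fin//; [|exact: mm|by move=> x Dx; exact: (e0 g)|
  exact: mm|by move=> x Dx; exact: (e0 f)].
rewrite -ge0_integralD//=; last 4 first.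
- by move=> x _; rewrite -EFinM lee_fin mulr_ge0// sqr_ge0.
- by apply: measurable_funeM; exact: mm.
- by move=> x _; rewrite -EFinM lee_fin mulr_ge0// sqr_ge0.
- by apply: measurable_funeM; exact: mm.
apply: ge0_le_integral => //.
- exact: e0.
- by apply: mm; exact: cmeasurableD.
- by apply: emeasurable_funD; apply: measurable_funeM; exact: mm.
- by move=> x _; rewrite -!EFinM -EFinD lee_fin; exact: cmod_sqrD.
Qed.

Lemma sqL2Z D (a : C) f : measurable D -> cmeasurable f ->
  sqL2 D (fun x => (a * f x)%R) = ((cmod a ^+ 2)%:E * sqL2 D f)%E.
Proof.
move=> mD mf; rewrite /sqL2 -ge0_integralZl ?lee_fin ?sqr_ge0//.
- by apply: eq_integral => x _; rewrite -EFinM cmodM exprMn.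
- apply/measurable_EFinP; exact: measurable_funS (measurable_cmod2 mf).
- by move=> x _; rewrite lee_fin sqr_ge0.
Qed.

Lemma sqL2_subset D f : measurable D -> cmeasurable f -> (sqL2 D f <= sqL2 setT f)%E.
Proof.
move=> mD mf; apply: ge0_subset_integral => //.
- by apply/measurable_EFinP; exact: measurable_cmod2.
- by move=> x _; rewrite lee_fin sqr_ge0.
Qed.

Lemma sqL2_box_le M (K : R) f : cmeasurable f -> 0 <= K ->
  (forall x, box M x -> cmod (f x) <= K) ->
  (sqL2 (box M) f <= (2 * `|M| * K ^+ 2)%:E)%E.
Proof.
move=> mf K0 hK.
have [M0|M0] := leP 0 M; last first.
  rewrite (_ : box M = set0); last first.
    by rewrite /box; apply: set_itv_ge; rewrite bnd_simp -ltNge; lra.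
  by rewrite /sqL2 integral_set0 lee_fin !mulr_ge0// sqr_ge0.
have mb : measurable (box M) by exact: measurable_itv.
rewrite ger0_norm//.
have -> : (2 * M * K ^+ 2)%:E = (\int[mu]_(x in box M) cst (K ^+ 2)%:E x)%E.
  rewrite integral_cst; last exact: measurable_itv.
  rewrite mulrC EFinM; congr (_ * _)%E; exact/esym/box_measure.
apply: ge0_le_integral => //.
- by move=> x _; rewrite lee_fin sqr_ge0.
- apply/measurable_EFinP; exact: measurable_funS (measurable_cmod2 mf).
- by move=> x bx; rewrite lee_fin lerXn2r ?nnegrE ?cmod_ge0 ?hK.
Qed.

Lemma L2D f g : L2 f -> L2 g -> L2 (fun x => f x + g x).
Proof.
move=> hf hg; split; first by apply: cmeasurableD; [exact: hf.1|exact: hg.1].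
apply: le_lt_trans (sqL2D _ hf.1 hg.1) _ => //.
by rewrite !sqL2_nrm// -!EFinM -EFinD ltry.
Qed.

Lemma L2Z (a : C) f : L2 f -> L2 (fun x => a * f x).
Proof.
move=> hf; split; first by apply: cmeasurableZ; exact: hf.1.
by rewrite sqL2Z//; [rewrite sqL2_nrm// -EFinM ltry|exact: hf.1].
Qed.

Lemma L2_supp_le M N f : M <= N -> L2_supp M f -> L2_supp N f.
Proof. by move=> MN [h1 h2]; split => // x Nx; apply: h2; exact: le_lt_trans Nx. Qed.

Lemma L2_suppD M f g : L2_supp M f -> L2_supp M g -> L2_supp M (fun x => f x + g x).
Proof.
by move=> [f1 f2] [g1 g2]; split => [|x Mx]; [exact: L2D|rewrite f2// g2// addr0].
Qed.

Lemma L2_suppZ M (a : C) f : L2_supp M f -> L2_supp M (fun x => a * f x).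
Proof. by move=> [f1 f2]; split => [|x Mx]; [exact: L2Z|rewrite f2// mulr0]. Qed.

Lemma L2c_supp f : L2c f -> exists2 M, 0 <= M & L2_supp M f.
Proof.
by move=> [M hM]; exists `|M| => //; exact: L2_supp_le (ler_norm _) hM.
Qed.

Definition cintegrable D f : Prop :=
  mu.-integrable D (EFin \o (fun x => complex.Re (f x))) /\
  mu.-integrable D (EFin \o (fun x => complex.Im (f x))).

Lemma cintegrableS D E f : measurable D -> measurable E -> E `<=` D ->
  cintegrable D f -> cintegrable E f.
Proof. by move=> mD mE ED [h1 h2]; split; [exact: integrableS h1|exact: integrableS h2]. Qed.

Lemma ccont_integrable f x y : ccont f -> cintegrable `[x, y] f.
Proof. by move=> [c1 c2]; split; exact: continuous_integrable_itv. Qed.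

Lemma cintegralD D f g : measurable D -> cintegrable D f -> cintegrable D g ->
  cintegral D (fun x => f x + g x) = cintegral D f + cintegral D g.
Proof.
move=> mD [f1 f2] [g1 g2]; rewrite /cintegral.
under eq_Rintegral do rewrite ReD.
under [in X in _ +i* X]eq_Rintegral do rewrite ImD.
by rewrite !RintegralD.
Qed.

Lemma cintegrableZ D (a : C) f : measurable D -> cintegrable D f ->
  cintegrable D (fun x => a * f x).
Proof.
move=> mD [f1 f2]; split.
  apply: eq_integrable (integrableB mD (integrableZl mD (complex.Re a) f1)
    (integrableZl mD (complex.Im a) f2)) => // x _ /=.
  by rewrite ReM EFinB !EFinM.
apply: eq_integrable (integrableD mD (integrableZl mD (complex.Re a) f2)
    (integrableZl mD (complex.Im a) f1)) => // x _ /=.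
by rewrite ImM EFinD !EFinM.
Qed.

Lemma cintegralZ D (a : C) f : measurable D -> cintegrable D f ->
  cintegral D (fun x => a * f x) = a * cintegral D f.
Proof.
move=> mD [f1 f2]; rewrite /cintegral.
under eq_Rintegral do rewrite ReM.
under [in X in _ +i* X]eq_Rintegral do rewrite ImM.
have g1 (c : R) (g : R -> R) : mu.-integrable D (EFin \o g) ->
    mu.-integrable D (EFin \o (fun x => c * g x)).
  by move=> h; apply: eq_integrable (integrableZl mD c h) => // x _ /=; rewrite EFinM.
rewrite RintegralB ?RintegralD ?RintegralZl//; try exact: g1.
by apply: complex_eq; rewrite ?ReM ?ImM.
Qed.

Lemma cmod_cintegral_le D (K : R) f : measurable D -> cintegrable D f ->
  (\int[mu]_(x in D) `|complex.Re (f x)| <= K)%R ->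
  (\int[mu]_(x in D) `|complex.Im (f x)| <= K)%R ->
  cmod (cintegral D f) <= 2 * K.
Proof.
move=> mD [f1 f2] h1 h2; rewrite (le_trans (cmod_ReIm _))//= mulr_natl mulr2n lerD//.
  by rewrite (le_trans _ h1)// le_normr_Rintegral.
by rewrite (le_trans _ h2)// le_normr_Rintegral.
Qed.

Lemma cder_primitive_of f (df : R -> C) : (forall x, cder f x (df x)) -> ccont df ->
  primitive_of df f.
Proof.
move=> hf [c1 c2] x y; rewrite le_eqVlt => /predU1P[<-|xy].
  by rewrite subrr /cintegral set_itv1 !Rintegral_set1.
have FTC (g dg : R -> R) : (forall t, is_derive t (1 : R) g (dg t)) -> continuous dg ->
    (\int[mu]_(t in `[x, y]) dg t)%R = g y - g x.
  move=> hg cdg; have cg t : {for t, continuous g} := is_derive_continuous (hg t).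
  rewrite /Rintegral (@continuous_FTC2 _ dg g)//.
  - exact: continuous_subspaceT.
  - split; first by move=> t _; exact: ex_derive.
      exact: cvg_at_right_filter (cg x).
    exact: cvg_at_left_filter (cg y).
  - by move=> t _; rewrite derive1E derive_val.
rewrite /cintegral (FTC (fun t => complex.Re (f t)) _ (fun t => (hf t).1) c1).
rewrite (FTC (fun t => complex.Im (f t)) _ (fun t => (hf t).2) c2).
by apply: complex_eq; rewrite ?ReD ?ImD ?ReN ?ImN.
Qed.

Section Primitive.
Variables (M : R) (f : R -> C).
Hypotheses (M0 : 0 <= M) (hf : L2_supp M f).

Let mf : cmeasurable f. Proof. by case: hf => -[]. Qed.

(* AM-GM: [2 |f| <= eta 1_[-M, M] + |f|^2 / eta], integrated with [eta] close to
   the L^2 norm. *)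
Let part_int (g : R -> R) : measurable_fun setT g -> (forall x, `|g x| <= cmod (f x)) ->
  mu.-integrable setT (EFin \o g) /\ (\int[mu]_x `|g x| <= nrm f * (M + 1))%R.
Proof.
move=> mg gf.
have m2 : measurable_fun setT (fun x => (cmod (f x) ^+ 2)%:E).
  by apply/measurable_EFinP; exact: measurable_cmod2.
have p2 x : setT x -> (0 <= (cmod (f x) ^+ 2)%:E :> \bar R)%E.
  by move=> _; rewrite lee_fin sqr_ge0.
have mbox : measurable (box M) by exact: measurable_itv.
have key (eta : R) : 0 < eta ->
    (\int[mu]_x (`|g x|%:E) <= (eta * M + nrm f ^+ 2 / (2 * eta))%:E)%E.
  move=> e0; have ei : 0 <= (2 * eta)^-1 by rewrite invr_ge0 mulr_ge0// ltW.
  apply: (@le_trans _ _ (\int[mu]_x ((eta / 2)%:E * (\1_(box M) x)%:E +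
      (2 * eta)^-1%:E * (cmod (f x) ^+ 2)%:E))%E).
    apply: ge0_le_integral => //.
    - by apply/measurable_EFinP; exact: measurableT_comp.
    - apply: emeasurable_funD; apply: measurable_funeM => //.
      exact/measurable_EFinP.
    - move=> x _; rewrite -!EFinM -EFinD lee_fin (le_trans (gf x))//.
      rewrite indicE; have [xM|xM] := boolP (x \in box M); last first.
        rewrite hf.2 ?cmod0 ?mulr0 ?expr0n ?mulr0 ?addr0//=.
        move: xM; rewrite notin_setE boxE => /negP.
        by rewrite -ler_norml -ltNge.
      rewrite mulr1 -subr_ge0.
      have -> : eta / 2 + (2 * eta)^-1 * cmod (f x) ^+ 2 - cmod (f x) =
        (eta - cmod (f x)) ^+ 2 / (2 * eta) by field; rewrite gt_eqF.
      by rewrite mulr_ge0 ?sqr_ge0.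
  rewrite ge0_integralD//=; last 4 first.
  - by move=> x _; rewrite -EFinM lee_fin mulr_ge0// divr_ge0// ltW.
  - by apply: measurable_funeM; exact/measurable_EFinP.
  - by move=> x _; rewrite -EFinM lee_fin mulr_ge0// sqr_ge0.
  - exact: measurable_funeM.
  rewrite ge0_integralZl//=; last 2 first.
  - exact/measurable_EFinP.
  - by rewrite lee_fin divr_ge0// ltW.
  rewrite ge0_integralZl ?lee_fin//.
  rewrite [X in ((eta / 2)%:E * X)%E](_ : _ = (2 * M)%:E); last first.
    by rewrite integral_indic// setIT; exact: box_measure.
  rewrite [X in ((2 * eta)^-1%:E * X)%E](_ : _ = (nrm f ^+ 2)%:E); last first.
    exact: sqL2_nrm hf.1.
  by rewrite -!EFinM -EFinD lee_fin le_eqVlt; apply/orP; left; apply/eqP; field; rewrite gt_eqF.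
have gi : mu.-integrable setT (EFin \o g).
  apply/integrableP; split; first exact/measurable_EFinP.
  by apply: le_lt_trans (key 1 ltr01) _; rewrite ltry.
split => //.
have key2 (eta : R) : 0 < eta ->
    (\int[mu]_x `|g x| <= eta * M + nrm f ^+ 2 / (2 * eta))%R.
  move=> e0; have := key eta e0; rewrite /Rintegral => h.
  have fi : (\int[mu]_x (`|g x|%:E))%E \is a fin_num.
    by apply: (integrable_fin_num (mu := mu) (D := setT)) => //; exact: integrable_norm gi.
  by rewrite -lee_fin fineK.
apply/ler_addgt0Pl => e e0.
have n0 := nrm_ge0 f.
pose d := e / (M + 1).
have M1 : 0 < M + 1 by rewrite ltr_wpDl.
have d0 : 0 < d by rewrite divr_gt0.
have nd : 0 < nrm f + d by rewrite ltr_wpDl.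
apply: le_trans (key2 _ nd) _.
have -> : e = d * (M + 1) by rewrite divfK ?gt_eqF.
have h : nrm f ^+ 2 / (2 * (nrm f + d)) <= nrm f + d.
  rewrite ler_pdivrMr ?mulr_gt0//.
  by have := mulr_ge0 n0 (ltW d0); have := sqr_ge0 d; have := sqr_ge0 (nrm f); lra.
by lra.
Qed.

Lemma L2_supp_integrable : cintegrable setT f.
Proof.
by split; [have [] := part_int mf.1 (fun x => cmod_Re (f x))|
  have [] := part_int mf.2 (fun x => cmod_Im (f x))].
Qed.

Lemma L2_supp_integrable_itv (i : interval R) : cintegrable [set` i] f.
Proof. exact: cintegrableS L2_supp_integrable. Qed.

Lemma cintegral_nrm_le (i : interval R) : cmod (cintegral [set` i] f) <= 2 * (M + 1) * nrm f.
Proof.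
have [i1 i2] := L2_supp_integrable.
have le (g : R -> R) : measurable_fun setT g -> mu.-integrable setT (EFin \o g) ->
    (\int[mu]_(x in [set` i]) `|g x| <= \int[mu]_x `|g x|)%R.
  move=> mg ig; have ng := integrable_norm ig.
  rewrite /Rintegral; apply: fine_le.
  - by apply: (integrable_fin_num (mu := mu)) => //; exact: integrableS ng.
  - by apply: (integrable_fin_num (mu := mu)).
  apply: ge0_subset_integral => //.
  by apply/measurable_EFinP; exact: measurableT_comp.
rewrite -mulrA; apply: cmod_cintegral_le => //.
- exact: L2_supp_integrable_itv.
- rewrite (le_trans (le _ mf.1 i1))// mulrC.
  by have [] := part_int mf.1 (fun x => cmod_Re (f x)).
- rewrite (le_trans (le _ mf.2 i2))// mulrC.
  by have [] := part_int mf.2 (fun x => cmod_Im (f x)).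
Qed.

End Primitive.

(** Integration from minus infinity makes the primitive depend on [f] alone and not on a bound for
    its support, hence linear in [f]. *)
Definition prim0 f x : C := cintegral `]-oo, x] f.

Section Prim0.
Variables (M : R) (f : R -> C).
Hypotheses (M0 : 0 <= M) (hf : L2_supp M f).

Lemma prim0_le x : cmod (prim0 f x) <= 2 * (M + 1) * nrm f.
Proof. exact: cintegral_nrm_le. Qed.

Lemma prim0B x y : x <= y -> prim0 f y - prim0 f x = cintegral `[x, y] f.
Proof.
move=> xy; have [i1 i2] := L2_supp_integrable_itv M0 hf `]-oo, y].
have [j1 j2] := L2_supp_integrable_itv M0 hf `]x, y].
apply: complex_eq; rewrite ?ReD ?ImD ?ReN ?ImN /prim0 /cintegral /=.
  by rewrite Rintegral_itvB ?bnd_simp// Rintegral_itv_obnd_cbnd.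
by rewrite Rintegral_itvB ?bnd_simp// Rintegral_itv_obnd_cbnd.
Qed.

Lemma prim0_left x : x < - M -> prim0 f x = 0.
Proof.
move=> xM; rewrite /prim0 /cintegral.
have z t : `]-oo, x]%classic t -> f t = 0.
  rewrite /= in_itv/= => tx; apply: hf.2; rewrite ltrNr in xM.
  by rewrite (lt_le_trans xM)// ler_normr lerN2 tx orbT.
have z0 (g : C -> R) : g 0 = 0 -> (\int[mu]_(t in `]-oo, x]) g (f t))%R = 0.
  move=> g0; under eq_Rintegral => t; first by rewrite inE => /z ->; rewrite g0; over.
  by rewrite /Rintegral integral0.
by rewrite !z0.
Qed.

Lemma prim0_right x y : M < x -> x <= y -> prim0 f y = prim0 f x.
Proof.
move=> Mx xy; apply/eqP; rewrite -subr_eq0 prim0B//; apply/eqP.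
rewrite /cintegral.
have z t : `[x, y]%classic t -> f t = 0.
  rewrite /= in_itv/= => /andP[xt _]; apply: hf.2.
  by rewrite (lt_le_trans Mx)// (le_trans xt)// ler_norm.
have z0 (g : C -> R) : g 0 = 0 -> (\int[mu]_(t in `[x, y]) g (f t))%R = 0.
  move=> g0; under eq_Rintegral => t; first by rewrite inE => /z ->; rewrite g0; over.
  by rewrite /Rintegral integral0.
by rewrite !z0.
Qed.

Lemma ccont_prim0 : ccont (prim0 f).
Proof.
have part (g : R -> R) : mu.-integrable setT (EFin \o g) ->
    continuous (fun x => \int[mu]_(t in `]-oo, x]) g t)%R.
  move=> ig x.
  have ii (i : interval R) : mu.-integrable [set` i] (EFin \o g) by exact: integrableS ig.
  have xx : x - 1 < x + 1 by lra.
  have := parameterized_integral_continuous (ltW xx) (ii `[x - 1, x + 1]).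
  move=> /(continuous_within_itvP _ xx)[/(_ x) + _ _].
  rewrite in_itv/= ltrBlDr ltrDl ltr01 andbT => /(_ isT) cx.
  have e y : x - 1 <= y -> (\int[mu]_(t in `]-oo, y]) g t)%R =
      (\int[mu]_(t in `]-oo, (x - 1)%R]) g t)%R + (\int[mu]_(t in `[(x - 1)%R, y]) g t)%R.
    move=> xy; rewrite -Rintegral_itv_obnd_cbnd; last exact: ii.
    by rewrite -(@Rintegral_itvB _ g -oo%O (BRight y) (x - 1)) ?bnd_simp//; ring.
  have : {for x, continuous (fun y => (\int[mu]_(t in `]-oo, (x - 1)%R]) g t)%R +
     (\int[mu]_(t in `[(x - 1)%R, y]) g t)%R)}.
    by apply: cvgD; [exact: cvg_cst|exact: cx].
  move=> h; rewrite /continuous_at (e x); last by lra.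
  apply: cvg_trans h; apply: near_eq_cvg; near=> y; apply/esym/e.
  have : `|x - y| < 1 by near: y; exact: (@cvgr_dist_lt _ _ _ (nbhs x) _ id x).
  by rewrite ltr_norml => /andP[]; lra.
have [i1 i2] := L2_supp_integrable M0 hf.
by split; [exact: (part _ i1)|exact: (part _ i2)].
Unshelve. all: by end_near. Qed.

End Prim0.

Lemma prim0_lin (a : C) f g x : L2c f -> L2c g ->
  prim0 (fun y => a * f y + g y) x = a * prim0 f x + prim0 g x.
Proof.
move=> /L2c_supp[M M0 hM] /L2c_supp[N N0 hN].
have i1 := L2_supp_integrable_itv M0 hM `]-oo, x].
have i2 := L2_supp_integrable_itv N0 hN `]-oo, x].
by rewrite /prim0 cintegralD ?cintegralZ//; exact: cintegrableZ.
Qed.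

(* [u'' = g - Phi'], where [Phi] is merely continuous. *)
Definition reg (Phi u u1 g : R -> C) : Prop :=
  [/\ forall x, cder u x (u1 x), ccont u1,
      forall x, cder (fun y => u1 y + Phi y) x (g x) & ccont g].

Lemma reg_lin (a : C) Phi u u1 g Psi w w1 h : reg Phi u u1 g -> reg Psi w w1 h ->
  reg (fun x => a * Phi x + Psi x) (fun x => a * u x + w x) (fun x => a * u1 x + w1 x)
    (fun x => a * g x + h x).
Proof.
move=> [a1 a2 a3 a4] [b1 b2 b3 b4]; split.
- by move=> x; apply: cderD (cderZ _ (a1 x)) (b1 x).
- by apply: ccontD => //; exact: ccontZ.
- move=> x; apply: cder_ext (cderD (cderZ a (a3 x)) (b3 x)) => // y; ring.
- by apply: ccontD => //; exact: ccontZ.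
Qed.

Lemma reg_ext Phi u u1 g Psi w w1 h : Phi =1 Psi -> u =1 w -> u1 =1 w1 -> g =1 h ->
  reg Phi u u1 g -> reg Psi w w1 h.
Proof. by move=> /funext-> /funext-> /funext-> /funext->. Qed.

Lemma reg0 : reg (fun _ => 0) (fun _ => 0) (fun _ => 0) (fun _ => 0).
Proof.
split; try exact: ccont_cst; move=> x; first exact: cder_cst.
by apply: cder_ext (cder_cst 0 x) => // y; rewrite addr0.
Qed.

Section RegSpaces.
Variables (M : R) (f : R -> C) (chi : C) (u u1 g : R -> C).
Hypotheses (M0 : 0 <= M) (hf : L2_supp M f).
Hypothesis hreg : reg (fun x => chi * prim0 f x) u u1 g.

(** The second derivative as a locally square integrable function. The scalar [chi] is 1 for the
    resolvent applied to [f], and 0 for derivatives in the parameter and Laurent coefficients, in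
    which the source no longer appears. *)
Let u2 x := g x - chi * f x.

Let mf : cmeasurable f. Proof. by case: hf => -[]. Qed.

Lemma reg_meas2 : cmeasurable u2.
Proof.
case: hreg => _ _ _ cg; apply: cmeasurableD; first exact: ccont_measurable.
rewrite (_ : (fun x => _) = (fun x => - chi * f x)); first exact: cmeasurableZ.
by apply/funext => x; rewrite mulNr.
Qed.

Lemma reg_sqL2 D : measurable D ->
  (sqL2 D u2 <= 2%:E * sqL2 D g + (2 * (cmod chi * nrm f) ^+ 2)%:E)%E.
Proof.
move=> mD; case: (hreg) => _ _ _ cg; have mg := ccont_measurable cg.
rewrite (_ : u2 = (fun x => g x + - chi * f x)); last first.
  by apply/funext => x; rewrite mulNr.
apply: le_trans (sqL2D mD mg (cmeasurableZ (- chi) mf)) _.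
apply: leeD => //; rewrite sqL2Z// cmodN.
have -> : (2 * (cmod chi * nrm f) ^+ 2)%:E =
  (2%:E * ((cmod chi ^+ 2)%:E * (nrm f ^+ 2)%:E))%E by rewrite -!EFinM exprMn.
rewrite -sqL2_nrm; last exact: hf.1.
apply: lee_wpmul2l; first by rewrite lee_fin.
by apply: lee_wpmul2l; rewrite ?lee_fin ?sqr_ge0// sqL2_subset.
Qed.

Lemma reg_H2loc : H2loc_derivs u u1 u2.
Proof.
case: (hreg) => h1 h2 h3 h4; split; first exact: cder_primitive_of.
- move=> x y xy; have := cder_primitive_of h3 h4 xy.
  have := prim0B M0 hf xy.
  have -> : cintegral `[x, y] u2 = cintegral `[x, y] g - chi * cintegral `[x, y] f.
    have i := L2_supp_integrable_itv M0 hf `[x, y].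
    rewrite (_ : u2 = (fun x => g x + - chi * f x)); last first.
      by apply/funext => t; rewrite mulNr.
    rewrite cintegralD ?cintegralZ ?mulNr//; first exact: ccont_integrable.
    exact: cintegrableZ.
  by move=> <- <-; ring.
- split; first exact: reg_meas2.
  move=> N; have mN : measurable (box N) by exact: measurable_itv.
  apply: le_lt_trans (reg_sqL2 mN) _.
  have [K K0 hK] := ccont_bounded (- N) N h4.
  have : (sqL2 (box N) g <= (2 * `|N| * K ^+ 2)%:E)%E.
    by apply: (sqL2_box_le (ccont_measurable h4) K0) => x; rewrite boxE; exact: hK.
  move=> h; have h' : (2%:E * sqL2 (box N) g <= 2%:E * (2 * `|N| * K ^+ 2)%:E)%E.
    by apply: lee_wpmul2l; rewrite ?lee_fin.
  apply: le_lt_trans (leeD h' (lexx _)) _.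
  by rewrite -EFinM -EFinD ltry.
Qed.

Lemma reg_sqH2 (N K : R) : 0 <= K ->
  (forall x, box N x -> [/\ cmod (u x) <= K, cmod (u1 x) <= K & cmod (g x) <= K]) ->
  (sqH2 (box N) u u1 u2 <= (8 * `|N| * K ^+ 2 + 2 * (cmod chi * nrm f) ^+ 2)%:E)%E.
Proof.
move=> K0 hK; case: (hreg) => h1 h2 h3 h4.
have mN : measurable (box N) by exact: measurable_itv.
have cu : ccont u := cder_ccont h1.
have hu : (sqL2 (box N) u <= (2 * `|N| * K ^+ 2)%:E)%E.
  by apply: sqL2_box_le => //; [exact: ccont_measurable|move=> x /hK[]].
have hu1 : (sqL2 (box N) u1 <= (2 * `|N| * K ^+ 2)%:E)%E.
  by apply: sqL2_box_le => //; [exact: ccont_measurable|move=> x /hK[]].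
have hg : (sqL2 (box N) g <= (2 * `|N| * K ^+ 2)%:E)%E.
  by apply: sqL2_box_le => //; [exact: ccont_measurable|move=> x /hK[]].
rewrite /sqH2; apply: le_trans (leeD (leeD hu hu1) (reg_sqL2 mN)) _.
have h' : (2%:E * sqL2 (box N) g <= 2%:E * (2 * `|N| * K ^+ 2)%:E)%E.
  by apply: lee_wpmul2l; rewrite ?lee_fin.
apply: le_trans (leeD (lexx _) (leeD h' (lexx _))) _.
by rewrite -!EFinM -!EFinD lee_fin; lra.
Qed.

End RegSpaces.

End LocalSpaces.

(** * Taylor coefficients of families of solutions *)

Section FamiliesOfSolutions.
Variable R : realType.
Local Notation C := R[i].

Lemma entire_scale (I : Type) (D : I -> Prop) (wt : I -> R) (k : R) F : 0 <= k ->
  entire D (fun i => k * wt i) F -> entire D wt F.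
Proof.
move=> k0 h z0; have [a ha] := h z0; exists a => rho r1.
have [K K0 hK] := ha rho r1; exists (K * k) => [|i Di]; first exact: mulr_ge0.
by rewrite -mulrA; exact: hK.
Qed.

Lemma tcoef_cst (c : C) z0 n : tcoef z0 (fun _ => c) n = if n is 0%N then c else 0.
Proof.
have h : ent (fun _ : unit => True) (fun _ => 1) z0 (fun _ _ => c)
    (fun n _ => if n is 0%N then c else 0).
  move=> rho r1; have r0 : 0 < rho by exact: lt_le_trans r1.
  exists (cmod c) => [|_ _]; first exact: cmod_ge0.
  rewrite mulr1; split => [[|k]|N t tr].
  - by rewrite expr0 mulr1.
  - by rewrite cmod0 mul0r cmod_ge0.
  have hp k : psum (fun n => if n is 0%N then c else 0) k.+1 t = c.
    elim: k => [|k IH]; first by rewrite psumS psum0 add0r expr0 mulr1.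
    by rewrite psumS IH mul0r addr0.
  case: N => [|N]; first by rewrite psum0 subr0 expr0 mulr1.
  by rewrite hp subrr cmod0 mulr_ge0 ?cmod_ge0// exprn_ge0// divr_ge0 ?cmod_ge0// ltW.
exact: (tcoefE h (i := tt)).
Qed.

Lemma tcoef_id z0 n : tcoef z0 (fun z : C => z) n =
  if n is 0%N then z0 else if n is 1%N then 1 else 0.
Proof.
have h : ent (fun _ : unit => True) (fun _ => 1) z0 (fun z _ => z)
    (fun n _ => if n is 0%N then z0 else if n is 1%N then 1 else 0).
  move=> rho r1; have r0 : 0 < rho by exact: lt_le_trans r1.
  have Kw : 0 <= cmod z0 + rho by rewrite addr_ge0 ?cmod_ge0// ltW.
  exists (cmod z0 + rho) => // _ _.
  rewrite mulr1; split => [[|[|n']]|[|[|N]] t tr].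
  - by rewrite expr0 mulr1 lerDl ltW.
  - by rewrite cmod1 expr1 mul1r lerDr cmod_ge0.
  - by rewrite cmod0 mul0r.
  - by rewrite psum0 subr0 expr0 mulr1 (le_trans (cmodD _ _))// lerD2l.
  - rewrite psumS psum0 add0r expr0 mulr1 addrC addKr expr1.
    by rewrite mulrC -mulrA ler_peMr ?cmod_ge0// mulrC ler_pdivlMr// mul1r lerDr cmod_ge0.
  have hp k : psum (fun n => if n is 0%N then z0 else if n is 1%N then 1 else 0) k.+2 t = z0 + t.
    elim: k => [|k IH]; first by rewrite !psumS psum0 add0r expr0 mulr1 mul1r.
    by rewrite psumS IH mul0r addr0.
  by rewrite hp subrr cmod0 mulr_ge0// exprn_ge0// divr_ge0 ?cmod_ge0// ltW.
exact: (tcoefE h (i := tt)).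
Qed.

Lemma tcoefD (F G : C -> C) z0 n : entireS F -> entireS G ->
  tcoef z0 (fun z => F z + G z) n = tcoef z0 F n + tcoef z0 G n.
Proof.
by move=> hF hG; exact: (tcoefE (entD (entireP hF z0) (entireP hG z0)) (i := tt)).
Qed.

Lemma tcoefZ (c : C) (F : C -> C) z0 n : entireS F ->
  tcoef z0 (fun z => c * F z) n = c * tcoef z0 F n.
Proof.
move=> hF; rewrite (tcoefM (D := fun _ : unit => True) z0 n (i := tt) (entireS_cst c) hF I).
rewrite /cauchy_prod big_ord_recl /= tcoef_cst subn0 big1 ?addr0// => k _.
by rewrite tcoef_cst mul0r.
Qed.

Lemma tcoefB (F G : C -> C) z0 n : entireS F -> entireS G ->
  tcoef z0 (fun z => F z - G z) n = tcoef z0 F n - tcoef z0 G n.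
Proof.
move=> hF hG; have e : (fun z => F z - G z) = (fun z => F z + -1 * G z).
  by apply/funext => z; rewrite mulN1r.
rewrite e tcoefD ?tcoefZ ?mulN1r//; exact: entireZ.
Qed.

Lemma tcoef_mulz (F : C -> C) z0 n : entireS F ->
  tcoef z0 (fun z => z * F z) n =
  z0 * tcoef z0 F n + (if n is m.+1 then tcoef z0 F m else 0).
Proof.
move=> hF; rewrite (tcoefM (D := fun _ : unit => True) z0 n (i := tt) (entire_id _) hF I).
rewrite /cauchy_prod big_ord_recl /= tcoef_id subn0; congr (_ + _).
case: n => [|n]; first by rewrite big_ord0.
rewrite big_ord_recl /= tcoef_id /bump /= addn0 subSS subn0 mul1r big1 ?addr0// => k _.
by rewrite tcoef_id mul0r.
Qed.

(** The recursion behind [ode_coef], recovered from the product; coefficients of negative index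
    count as 0. *)
Lemma tcoef_potential (F : C -> C) (c z0 : C) n : entireS F ->
  tcoef z0 (fun z => (c - z ^+ 2) * F z) n =
  (c - z0 ^+ 2) * tcoef z0 F n - 2 * z0 * (if n is m.+1 then tcoef z0 F m else 0)
  - (if n is m.+2 then tcoef z0 F m else 0).
Proof.
move=> hF; have zF : entireS (fun z => z * F z) by exact: entire_mulz.
have e : (fun z => (c - z ^+ 2) * F z) = (fun z => c * F z - z * (z * F z)).
  by apply/funext => z; ring.
rewrite e tcoefB; [|exact: entireZ|exact: entire_mulz].
rewrite tcoefZ// tcoef_mulz//.
case: n => [|[|n]]; rewrite !tcoef_mulz//; ring.
Qed.

Section ODEFamily.
Variables (V : R -> C) (v : R).
Hypotheses (cV : ccont V) (hV : forall x, cmod (V x) <= v).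
Variables (J : Type) (D : J -> Prop) (x0 : R).
Variables (G : J -> R -> C) (a b b1 : J -> C) (c : J -> R).
Hypotheses (cG : forall j, D j -> ccont (G j))
  (hG : forall j, D j -> forall x, cmod (G j x) <= c j).
Variables (u p : C -> J -> R -> C).
Hypothesis hsol : forall z j, D j ->
  odesol (fun x => V x - z ^+ 2) (G j) (fun _ => 0) (u z j) (p z j).
Hypothesis hu : forall z j, D j -> u z j x0 = a j.
Hypothesis hp : forall z j, D j -> p z j x0 = b j + b1 j * z.

Let wt (jx : J * R) := cmod (a jx.1) + cmod (b jx.1) + cmod (b1 jx.1) + c jx.1.
Let DX (X : R) (jx : J * R) := D jx.1 /\ `|jx.2 - x0| <= X.
Let oc z0 n (jx : J * R) := ode_coef V x0 (G jx.1) (a jx.1) (b jx.1) (b1 jx.1) z0 n.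

(** On [|x - x0| <= X] the exponential weight is bounded, so that the pointwise bounds on
    coefficients and remainders become uniform in the datum and the point. The factor [1 + |z0|]
    absorbs the part of the initial slope that depends on [z0]. *)
Lemma ode_ent X z0 :
  ent (DX X) wt z0 (fun z jx => u z jx.1 jx.2) (fun n jx => (oc z0 n jx).1.1 jx.2) /\
  ent (DX X) wt z0 (fun z jx => p z jx.1 jx.2) (fun n jx => (oc z0 n jx).1.2 jx.2).
Proof.
have key (rho : R) : 1 <= rho -> exists2 K : R, 0 <= K & forall jx, DX X jx ->
  ((forall n, cmod ((oc z0 n jx).1.1 jx.2) * rho ^+ n <= K * wt jx) /\
   forall N t, cmod t <= rho ->
    cmod (u (z0 + t) jx.1 jx.2 - psum (fun n => (oc z0 n jx).1.1 jx.2) N t) <=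
      K * wt jx * (cmod t / rho) ^+ N) /\
  ((forall n, cmod ((oc z0 n jx).1.2 jx.2) * rho ^+ n <= K * wt jx) /\
   forall N t, cmod t <= rho ->
    cmod (p (z0 + t) jx.1 jx.2 - psum (fun n => (oc z0 n jx).1.2 jx.2) N t) <=
      K * wt jx * (cmod t / rho) ^+ N).
  move=> r1; have r0 : 0 < rho by exact: lt_le_trans r1.
  pose w := expR (kapf v z0 rho * `|X|); have w0 : 0 <= w by exact: expR_ge0.
  have z00 := cmod_ge0 z0.
  exists (8 * rho * (1 + cmod z0) * w) => [|[j x] [/= Dj xX]].
    by rewrite !mulr_ge0// ?addr_ge0// ltW.
  have c0 : 0 <= c j by exact: le_trans (cmod_ge0 _) (hG Dj 0).
  have v0 : 0 <= v by exact: le_trans (cmod_ge0 _) (hV 0).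
  have k0 : 0 <= kapf v z0 rho.
    by rewrite /kapf !addr_ge0 ?mulr_ge0 ?addr_ge0 ?exprn_ge0 ?addr_ge0// ltW.
  have wx : wexp (kapf v z0 rho) x0 x <= w.
    by rewrite ler_expR ler_wpM2l// (le_trans xX)// ler_norm.
  have a0 := cmod_ge0 (a j); have b0 := cmod_ge0 (b j); have b10 := cmod_ge0 (b1 j).
  have s0 : 0 <= cmod (a j) + cmod (b j + b1 j * z0) + cmod (b1 j) + c j.
    by rewrite !addr_ge0 ?cmod_ge0.
  have sw : cmod (a j) + cmod (b j + b1 j * z0) + cmod (b1 j) + c j <= (1 + cmod z0) * wt (j, x).
    have h := cmodD (b j) (b1 j * z0); rewrite cmodM in h.
    have h1 := mulr_ge0 z00 a0; have h2 := mulr_ge0 z00 b0; have h3 := mulr_ge0 z00 c0.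
    by rewrite /wt /=; lra.
  have wt0 : 0 <= wt (j, x) by rewrite /wt /= !addr_ge0.
  set s := _ + c j in s0 sw.
  have fin (y e : R) : 0 <= e -> y <= 8 * rho * s * e * wexp (kapf v z0 rho) x0 x ->
      y <= 8 * rho * (1 + cmod z0) * w * wt (j, x) * e.
    move=> e0 /le_trans; apply.
    have -> : 8 * rho * (1 + cmod z0) * w * wt (j, x) * e =
      8 * rho * ((1 + cmod z0) * wt (j, x)) * e * w by ring.
    have r8 : 0 <= 8 * rho by rewrite mulr_ge0// ltW.
    apply: ler_pM => //; last by rewrite ler_wpM2r// ler_wpM2l.
      by rewrite mulr_ge0// mulr_ge0.
    exact: expR_ge0.
  have hc := @ode_coefP R V v cV hV x0 (G j) (a j) (b j) (b1 j) (c j) (cG Dj) (hG Dj) z0 rho r1.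
  have hr := @ode_remainder R V v cV hV x0 (G j) (a j) (b j) (b1 j) (c j) (cG Dj) (hG Dj)
    (fun z => u z j) (fun z => p z j) (fun z => hsol z Dj) (fun z => hu z Dj)
    (fun z => hp z Dj) z0 rho r1.
  have cf (n : nat) (y : C) : cmod y <= 4 * s * rho / rho ^+ n * wexp (kapf v z0 rho) x0 x ->
      cmod y * rho ^+ n <= 8 * rho * (1 + cmod z0) * w * wt (j, x).
    move=> h; rewrite -[leRHS]mulr1; apply: fin => //; rewrite mulr1.
    have rn : 0 < rho ^+ n by exact: exprn_gt0.
    apply: le_trans (ler_wpM2r (ltW rn) h) _.
    rewrite mulrAC divfK ?gt_eqF// ler_wpM2r ?expR_ge0//.
    by have := mulr_ge0 s0 (ltW r0); lra.
  by split; split => [n|N t tr]; [apply: cf|apply: fin|apply: cf|apply: fin];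
    rewrite ?exprn_ge0 ?divr_ge0 ?cmod_ge0 ?(ltW r0)//;
    [have [_ _ /(_ x)[]] := hc n|have [] := hr N t x tr|
     have [_ _ /(_ x)[]] := hc n|have [] := hr N t x tr].
split => rho r1; have [K K0 hK] := key rho r1; exists K => // jx Djx; have [h1 h2] := hK jx Djx.
  exact: h1.
exact: h2.
Qed.

Lemma ode_entire X : entire (DX X) wt (fun z jx => u z jx.1 jx.2) /\
  entire (DX X) wt (fun z jx => p z jx.1 jx.2).
Proof.
by split => z0; have [h1 h2] := ode_ent X z0; eexists; [exact: h1|exact: h2].
Qed.

Lemma ode_entire_single j x : D j ->
  entireS (fun z => u z j x) /\ entireS (fun z => p z j x).
Proof.
move=> Dj; have [h1 h2] := ode_entire `|x - x0|.
by split; [apply: (entire_single (i := (j, x))) h1 _|apply: (entire_single (i := (j, x))) h2 _].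
Qed.

(** As functions of [x] the Taylor coefficients solve the equation differentiated in the parameter.
    The Laurent coefficients of the resolvent owe their H^2 regularity to this. *)
Lemma ode_tcoef j z0 n x : D j ->
  cder (fun y => tcoef z0 (fun z => u z j y) n) x
    (tcoef z0 (fun z => p z j x) n + if n == 0%N then G j x else 0) /\
  cder (fun y => tcoef z0 (fun z => p z j y) n) x
    (tcoef z0 (fun z => (V x - z ^+ 2) * u z j x) n).
Proof.
move=> Dj.
have eu y m : tcoef z0 (fun z => u z j y) m = (oc z0 m (j, y)).1.1 y.
  have [h _] := ode_ent `|y - x0| z0.
  exact: (tcoefE h (i := (j, y))).
have ep y m : tcoef z0 (fun z => p z j y) m = (oc z0 m (j, y)).1.2 y.
  have [_ h] := ode_ent `|y - x0| z0.
  exact: (tcoefE h (i := (j, y))).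
have [h _ _ _ _] := @ode_coefP R V v cV hV x0 (G j) (a j) (b j) (b1 j) (c j) (cG Dj) (hG Dj)
  z0 1 (lexx _) n.
have [h1 h2] := h x; split.
  apply: cder_ext h1 => [y|]; first by rewrite eu.
  by rewrite ep; case: ifP.
have [eS _] := ode_entire_single x Dj.
rewrite (tcoef_potential _ _ _ eS).
apply: cder_ext h2 => [y|]; first by rewrite ep.
rewrite eu; case: n {h h1} => [|[|n]] /=.
- by ring.
- by rewrite eu /oc /=; ring.
- by rewrite !eu /oc /=; ring.
Qed.

End ODEFamily.

(** The exponential solves the equation with zero potential and initial data affine in [z], so it is
    an instance of the families already treated. *)
Lemma cexp_entire (x : R) : entireS (fun z => cexp ('i * z * x%:C)).
Proof.
have h (z : C) (j : unit) : True -> odesol (fun x : R => (fun _ => 0) x - z ^+ 2) (fun _ => 0) (fun _ => 0)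
    (fun y => cexp ('i * z * y%:C)) (fun y => 'i * z * cexp ('i * z * y%:C)).
  move=> _ y; have d := cder_cexpl ('i * z) y; split; first by apply: cder_eq d _; rewrite addr0.
  apply: cder_eq (cderZ ('i * z) d) _.
  have -> : z ^+ 2 = - ('i * z) ^+ 2 by rewrite exprMn sqr_i mulN1r opprK.
  by ring.
have h1 (y : R) : cmod ((fun _ : R => 0 : C) y) <= 0 by rewrite cmod0.
have h2 z (_ : unit) : True -> cexp ('i * z * (0 : R)%:C) = 1 by rewrite mulr0 cexp0.
have h3 (z : C) (_ : unit) : True -> 'i * z * cexp ('i * z * (0 : R)%:C) = 0 + 'i * z.
  by rewrite mulr0 cexp0 mulr1 add0r.
have [e _] := @ode_entire_single (fun _ => 0) 0 (ccont_cst 0) h1 unit (fun _ => True) 0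
  (fun _ _ => 0) (fun _ => 1) (fun _ => 0) (fun _ => 'i) (fun _ => 0)
  (fun _ _ => ccont_cst 0) (fun _ _ => h1)
  (fun z _ y => cexp ('i * z * y%:C)) (fun z _ y => 'i * z * cexp ('i * z * y%:C))
  h h2 h3 tt x I.
exact: e.
Qed.

End FamiliesOfSolutions.

(** * The resolvent in the upper half plane *)

Section Resolvent.
Variable R : realType.
Local Notation C := R[i].
Local Notation mu := (@lebesgue_measure R).
Variables (V : R -> C) (v : R).
Hypotheses (cV : ccont V) (hV : forall x, cmod (V x) <= v).
Hypothesis V_out : forall x, ~~ (0 < x < 1) -> V x = 0.

Let v0 : 0 <= v. Proof. exact: le_trans (cmod_ge0 _) (hV 0). Qed.

Let sq_i (z : C) : z ^+ 2 = - ('i * z) ^+ 2.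
Proof. by rewrite exprMn sqr_i mulN1r opprK. Qed.

Definition phi0 (z : C) := odepick (fun x => V x - z ^+ 2) (fun _ => 0) (fun _ => 0) 0 1 (- 'i * z).
Definition phi z := (phi0 z).1.
Definition phip z := (phi0 z).2.

Lemma phiP z : [/\ odesol (fun x => V x - z ^+ 2) (fun _ => 0) (fun _ => 0) (phi z) (phip z),
  phi z 0 = 1 & phip z 0 = - 'i * z].
Proof.
apply: (@odepickP R (fun x => V x - z ^+ 2) _ _ 0 (v + cmod z ^+ 2) 0 _ 1 (- 'i * z) (lexx _)).
- by rewrite addr_ge0// exprn_ge0// cmod_ge0.
- by [].
- exact: ccontVz.
- exact: ccont_cst.
- exact: ccont_cst.
- by move=> x; exact: cmodVz.
- by move=> x; rewrite cmod0 mul0r.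
- by move=> x; rewrite cmod0 mul0r.
Qed.

Definition suppM (f : R -> C) : R :=
  if pselect (exists M, 0 <= M /\ L2_supp M f) is left h then projT1 (cid h) else 0.

Lemma suppMP f : L2c f -> 0 <= suppM f /\ L2_supp (suppM f) f.
Proof.
move=> /L2c_supp[M M0 hM]; rewrite /suppM; case: pselect => [h|[]].
  exact: projT2 (cid h).
by exists M.
Qed.

(** The solution of the inhomogeneous equation that vanishes on the left. Its second component is u'
    plus [prim0 f], and the initial point lies one unit to the left of the support. *)
Definition esol0 z f := odepick (fun x => V x - z ^+ 2) (fun x => - prim0 f x) (fun _ => 0)
  (- (suppM f + 1)) 0 0.
Definition esol z f := (esol0 z f).1.
Definition esolp z f := (esol0 z f).2.

(** Uniqueness is available on intervals centred at the initial point. The half line is covered in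
    steps of half the distance from [x0] to [y0], which keeps every such interval inside the region
    without sources. *)
Lemma ode_zero_left (Q g1 g2 u p : R -> C) (x0 y0 : R) : ccont Q -> odesol Q g1 g2 u p ->
  (forall x, x < y0 -> g1 x = 0) -> (forall x, x < y0 -> g2 x = 0) ->
  x0 < y0 -> u x0 = 0 -> p x0 = 0 -> forall x, x <= x0 -> u x = 0 /\ p x = 0.
Proof.
move=> cQ hs h1 h2 xy u0 p0.
pose d := (y0 - x0) / 2; have d0 : 0 < d by rewrite divr_gt0// subr_gt0.
have H n : forall x, x0 - n%:R * d <= x <= x0 -> u x = 0 /\ p x = 0.
  elim: n => [|n IH] x.
    by rewrite mul0r subr0 => /andP[a b]; have -> : x = x0 by apply/eqP; rewrite eq_le a b.
  move=> /andP[a b]; have [ax|ax] := leP (x0 - n%:R * d) x.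
    by apply: IH; rewrite ax b.
  have nd : 0 <= n%:R * d by rewrite mulr_ge0// ltW.
  have [|e1 e2] := IH (x0 - n%:R * d); first by rewrite lexx/=; lra.
  have yd : y0 = x0 + 2 * d by rewrite /d; field.
  have lt t : `|t - (x0 - n%:R * d)| <= d -> t < y0.
    by rewrite ler_norml => /andP[_]; lra.
  apply: (@ode_zero_on R Q g1 g2 u p d (x0 - n%:R * d)) => //.
  - by move=> t /lt; exact: h1.
  - by move=> t /lt; exact: h2.
  - rewrite ler_norml -natr1 in a *; apply/andP; split; lra.
move=> x xx0.
apply: (H (Num.truncn ((x0 - x) / d)).+1); rewrite xx0 andbT.
by rewrite lerBlDl -lerBlDr -ler_pdivrMr// ltW// truncnS_gt.
Qed.

(** The construction starts from the arbitrary bound [suppM f]; uniqueness on the left shows that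
    any other bound [M] gives the same solution. Linearity in [f] relies on this freedom. *)
Lemma esolP M z f : 0 <= M -> L2_supp M f ->
  odesol (fun x => V x - z ^+ 2) (fun x => - prim0 f x) (fun _ => 0) (esol z f) (esolp z f) /\
  forall x, x <= - (M + 1) -> esol z f x = 0 /\ esolp z f x = 0.
Proof.
move=> M0 hf.
have [N0 hN] : 0 <= suppM f /\ L2_supp (suppM f) f by apply: suppMP; exists M.
have hz := cmodVz hV z.
have kk : 4 <= 2 * (1 + (v + cmod z ^+ 2)) + 2 by have := exprn_ge0 2 (cmod_ge0 z); have := v0; lra.
have k0 : 0 <= 2 * (1 + (v + cmod z ^+ 2)) + 2 by apply: le_trans kk.
have [h1 h2 h3] : [/\ odesol (fun x => V x - z ^+ 2) (fun x => - prim0 f x) (fun _ => 0)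
    (esol z f) (esolp z f), esol z f (- (suppM f + 1)) = 0 & esolp z f (- (suppM f + 1)) = 0].
  apply: (@odepickP R (fun x => V x - z ^+ 2) _ _ _ (v + cmod z ^+ 2)
    (2 * (suppM f + 1) * nrm f) (2 * (1 + (v + cmod z ^+ 2)) + 2)).
  - by lra.
  - by rewrite addr_ge0// exprn_ge0// cmod_ge0.
  - by rewrite mulr_ge0 ?nrm_ge0// mulr_ge0// addr_ge0.
  - exact: ccontVz.
  - by apply: ccontN; exact: ccont_prim0 N0 hN.
  - exact: ccont_cst.
  - exact: hz.
  - move=> x; rewrite cmodN (le_trans (prim0_le N0 hN x))// ler_peMr//.
      by rewrite mulr_ge0 ?nrm_ge0// mulr_ge0// addr_ge0.
    exact: wexp_ge1.
  - move=> x; rewrite cmod0 mulr_ge0 ?wexp_ge0//.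
    by rewrite mulr_ge0 ?nrm_ge0// mulr_ge0// addr_ge0.
split => // x xM.
have zl N x0 : 0 <= N -> L2_supp N f -> x0 < - N -> esol z f x0 = 0 -> esolp z f x0 = 0 ->
    forall x, x <= x0 -> esol z f x = 0 /\ esolp z f x = 0.
  move=> N0' hN' xN e1 e2; apply: (ode_zero_left (ccontVz cV z) h1 _ _ xN) => // t tN.
  by rewrite (prim0_left hN')// oppr0.
have sN : - (suppM f + 1) < - suppM f by rewrite ltrN2 ltrDl.
have [ML|LM] := leP (suppM f) M.
  apply: (zl (suppM f) (- (suppM f + 1))) => //.
  by rewrite (le_trans xM)// lerN2 lerD2r.
have [e1 e2] : esol z f (- (M + 1)) = 0 /\ esolp z f (- (M + 1)) = 0.
  apply: (@ode_zero_on R _ _ _ _ _ (suppM f - M) (- (suppM f + 1)) (ccontVz cV z) h1) => //.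
  - move=> t; rewrite ler_norml => /andP[_ h]; rewrite (prim0_left hf) ?oppr0//; lra.
  - by rewrite ler_norml; apply/andP; split; lra.
by apply: (zl M (- (M + 1))) => //; lra.
Qed.

(** With [c] the value of [prim0 f] at [X], [p - c] is u'. To the right of all supports the
    expression is constant in [X] and equals [- 2 i z] times the coefficient of the incoming wave
    [exp (- i z x)]; it vanishes exactly on outgoing solutions when [z] is not 0. *)
Definition outf (z c : C) (X : R) (u p : R -> C) : C :=
  cexp ('i * z * X%:C) * (p X - c - 'i * z * u X).

Lemma outf_cst z c g u p (x y : R) : odesol (fun x => V x - z ^+ 2) g (fun _ => 0) u p ->
  (forall t, x <= t <= y -> V t = 0 /\ g t = - c) -> x <= y ->
  outf z c y u p = outf z c x u p.
Proof.
move=> hs hV0 xy.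
apply: (@cder0_eq R (fun t => outf z c t u p) x y) => //; last 2 first.
- by rewrite xy lexx.
- by rewrite xy lexx.
move=> t txy; have [d1 d2] := hs t; have [e1 e2] := hV0 t txy.
rewrite e1 e2 in d1 d2.
apply: cder_eq (cderM (cder_cexpl ('i * z) t)
  (cderB (cderB d2 (cder_cst c t)) (cderZ ('i * z) d1))) _.
by rewrite (sq_i z); ring.
Qed.

(** The incoming component of [esol z f] on the right, a linear functional of [f]; [ellE] frees it
    from the point of evaluation. *)
Definition ell z f : C := outf z (prim0 f (suppM f + 2)) (suppM f + 2) (esol z f) (esolp z f).

Lemma ellE M X z f : 0 <= M -> L2_supp M f -> M + 2 <= X ->
  ell z f = outf z (prim0 f X) X (esol z f) (esolp z f).
Proof.
move=> M0 hf MX.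
have [N0 hN] : 0 <= suppM f /\ L2_supp (suppM f) f by apply: suppMP; exists M.
have cst N Y Z : 0 <= N -> L2_supp N f -> N + 2 <= Y -> Y <= Z ->
    outf z (prim0 f Z) Z (esol z f) (esolp z f) = outf z (prim0 f Y) Y (esol z f) (esolp z f).
  move=> N0' hN' NY YZ; have NY' : N < Y by lra.
  rewrite (prim0_right N0' hN' NY' YZ).
  have [hs _] := esolP z N0' hN'.
  apply: (outf_cst hs) => // t /andP[Yt tZ]; split.
    by apply: V_out; rewrite negb_and -!leNgt; apply/orP; right; lra.
  by rewrite (prim0_right N0' hN' NY' Yt).
have [XS|SX] := leP X (suppM f + 2).
  by rewrite /ell (cst M X)//.
by rewrite /ell -(cst _ (suppM f + 2) X N0 hN)// ltW.
Qed.

Definition Wr z : C := outf z 0 1 (phi z) (phip z).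

Lemma WrE z x : 1 <= x -> Wr z = outf z 0 x (phi z) (phip z).
Proof.
move=> x1; have [hs _ _] := phiP z.
apply/esym; apply: (outf_cst hs) => // t /andP[t1 _]; split; last by rewrite oppr0.
by apply: V_out; rewrite negb_and -!leNgt t1 orbT.
Qed.

(** The multiple of [phi] that cancels the incoming component of [esol] on the right. It brings in
    the Wronskian as the only denominator of the resolvent. *)
Definition alpha z f : C := - (ell z f / Wr z).
Definition Tres z f x : C := alpha z f * phi z x + esol z f x.
Definition Tres1 z f x : C := alpha z f * phip z x + (esolp z f x - prim0 f x).

Lemma esol_reg z f : L2c f -> reg (fun x => 1 * prim0 f x) (esol z f)
  (fun x => esolp z f x - prim0 f x) (fun x => (V x - z ^+ 2) * esol z f x).
Proof.
move=> /L2c_supp[M M0 hf]; have [hs _] := esolP z M0 hf.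
have cp : ccont (esolp z f) := cder_ccont (fun t => (hs t).2).
have cu : ccont (esol z f) := cder_ccont (fun t => (hs t).1).
split.
- by move=> x; exact: (hs x).1.
- by apply: ccontB => //; exact: ccont_prim0 M0 hf.
- move=> x; apply: cder_ext (hs x).2; last by rewrite addr0.
  by move=> y; rewrite mul1r subrK.
- by apply: ccontM => //; exact: ccontVz.
Qed.

Lemma phi_reg z : reg (fun x => 0) (phi z) (phip z) (fun x => (V x - z ^+ 2) * phi z x).
Proof.
have [hs _ _] := phiP z.
have cp : ccont (phip z) := cder_ccont (fun t => (hs t).2).
have cu : ccont (phi z) := cder_ccont (fun t => (hs t).1).
split => //.
- by move=> x; apply: cder_eq (hs x).1 _; rewrite addr0.
- move=> x; apply: cder_ext (hs x).2; last by rewrite addr0.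
  by move=> y; rewrite addr0.
- by apply: ccontM => //; exact: ccontVz.
Qed.

Lemma Tres_reg z f : L2c f -> reg (fun x => 1 * prim0 f x) (Tres z f) (Tres1 z f)
  (fun x => (V x - z ^+ 2) * Tres z f x).
Proof.
move=> hf; apply: reg_ext (reg_lin (alpha z f) (phi_reg z) (esol_reg z hf)) => x //.
  by rewrite mulr0 add0r.
by rewrite /Tres; ring.
Qed.

Lemma esol_uniq M z f u p : 0 <= M -> L2_supp M f ->
  odesol (fun x => V x - z ^+ 2) (fun x => - prim0 f x) (fun _ => 0) u p ->
  u (- (M + 1)) = 0 -> p (- (M + 1)) = 0 -> forall x, esol z f x = u x /\ esolp z f x = p x.
Proof.
move=> M0 hf hs e1 e2 x; have [h1 /(_ _ (lexx _))[h2 h3]] := esolP z M0 hf.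
by apply: (ode_uniq (x0 := - (M + 1)) (ccontVz cV z) h1 hs); rewrite ?h2 ?h3 ?e1 ?e2.
Qed.

Lemma esol_lin z (a : C) f g : L2c f -> L2c g -> forall x,
  esol z (fun y => a * f y + g y) x = a * esol z f x + esol z g x /\
  esolp z (fun y => a * f y + g y) x = a * esolp z f x + esolp z g x.
Proof.
move=> hf hg; have [M M0 hM] := L2c_supp hf; have [N N0 hN] := L2c_supp hg.
have MN0 : 0 <= M + N by rewrite addr_ge0.
have hM' : L2_supp (M + N) f by apply: L2_supp_le hM; rewrite lerDl.
have hN' : L2_supp (M + N) g by apply: L2_supp_le hN; rewrite lerDr.
have [s1 /(_ _ (lexx _))[e1 e2]] := esolP z MN0 hM'.
have [s2 /(_ _ (lexx _))[e3 e4]] := esolP z MN0 hN'.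
apply: (esol_uniq MN0).
- by apply: L2_suppD => //; exact: L2_suppZ.
- apply: odesol_ext (odesolD (odesolZ a s1) s2) => // x; last by rewrite mulr0 addr0.
  by rewrite prim0_lin//; ring.
- by rewrite e1 e3 mulr0 addr0.
- by rewrite e2 e4 mulr0 addr0.
Qed.

Lemma ell_lin z (a : C) f g : L2c f -> L2c g ->
  ell z (fun y => a * f y + g y) = a * ell z f + ell z g.
Proof.
move=> hf hg; have [M M0 hM] := L2c_supp hf; have [N N0 hN] := L2c_supp hg.
have MN0 : 0 <= M + N by rewrite addr_ge0.
have hM' : L2_supp (M + N) f by apply: L2_supp_le hM; rewrite lerDl.
have hN' : L2_supp (M + N) g by apply: L2_supp_le hN; rewrite lerDr.
have hMN : L2_supp (M + N) (fun y => a * f y + g y).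
  by apply: L2_suppD => //; exact: L2_suppZ.
rewrite !(@ellE (M + N) (M + N + 2))// /outf.
have [-> ->] := esol_lin z a hf hg (M + N + 2).
by rewrite prim0_lin//; ring.
Qed.

Lemma alpha_lin z (a : C) f g : L2c f -> L2c g ->
  alpha z (fun y => a * f y + g y) = a * alpha z f + alpha z g.
Proof. by move=> hf hg; rewrite /alpha ell_lin//; ring. Qed.

Lemma Tres_lin z : linear_oper (Tres z).
Proof.
move=> a f g hf hg x; rewrite /Tres alpha_lin//.
by have [-> _] := esol_lin z a hf hg x; ring.
Qed.

(** Closes a bootstrap: a bound that improves from [L] to [s + L / 2] ends up as close to the fixed
    point [2 s] as desired, whatever finite bound [K] one starts from. *)
Lemma halving (P : R -> Prop) (s K : R) :
  (forall L L', L <= L' -> P L -> P L') -> 0 <= s -> 0 <= K ->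
  (forall L, 0 <= L -> P L -> P (s + L / 2)) -> P K -> forall e, 0 < e -> P (2 * s + e).
Proof.
move=> mon s0 K0 H PK e e0; have [n hn] := exists_half_pow K e0.
apply: (mon (2 * s + K / 2 ^+ n)); first by rewrite lerD2l.
elim: n {hn} => [|n IH].
  by apply: mon PK; rewrite expr0 divr1 lerDr mulr_ge0.
have L0 : 0 <= 2 * s + K / 2 ^+ n by rewrite addr_ge0 ?divr_ge0 ?exprn_ge0 ?mulr_ge0.
have -> : 2 * s + K / 2 ^+ n.+1 = s + (2 * s + K / 2 ^+ n) / 2.
  by rewrite exprS invfM; field; rewrite expf_neq0.
exact: H.
Qed.

(** High in the upper half plane the potential is a perturbation: [m], which is [phi] freed from its
    exponential growth, stays near 1, and [n] stays small, while the Wronskian is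
    [n 1 - 2 i z m 1]. *)
Lemma Wr_neq0 z : 3 * v + 1 < complex.Im z -> Wr z != 0.
Proof.
move=> zc; set y := complex.Im z in zc.
have v0' := v0.
have y0 : 0 < y by lra.
have [hs p0 pp0] := phiP z.
set w := 'i * z.
have Rew : complex.Re w = - y by rewrite /w ReM /= mul0r mul1r sub0r.
pose m x := cexp (w * x%:C) * phi z x.
pose n x := cexp (w * x%:C) * (phip z x + w * phi z x).
have dm x : cder m x (n x).
  have [d1 _] := hs x.
  by apply: cder_eq (cderM (cder_cexpl w x) d1) _; rewrite /n; ring.
have dn x : cder n x (2 * w * n x + V x * m x).
  have [d1 d2] := hs x.
  apply: cder_eq (cderM (cder_cexpl w x) (cderD d2 (cderZ w d1))) _.
  by rewrite (sq_i z) -/w /n /m; ring.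
(* The integrating factor removes the term [2 w n] from the equation for [n]; only [V m] remains, so
   the estimate does not lose the growth. *)
pose k x := cexp (- (2 * w) * x%:C) * n x.
have dk x : cder k x (cexp (- (2 * w) * x%:C) * (V x * m x)).
  apply: cder_eq (cderM (cder_cexpl (- (2 * w)) x) (dn x)) _; ring.
have m0 : m 0 = 1 by rewrite /m mulr0 cexp0 p0 mulr1.
have n0 : n 0 = 0 by rewrite /n mulr0 cexp0 p0 pp0 /w; ring.
have ek x : cmod (cexp (- (2 * w) * x%:C)) = expR (2 * y * (x - 0)).
  rewrite cmod_cexp; congr expR.
  have -> : - (2 * w) * x%:C = (- 2 * x)%:C * w.
    by rewrite rmorphM rmorphN /= (rmorph_nat (real_complex R) 2); ring.
  by rewrite ReM /= Rew; ring.
have nb (L : R) : 0 <= L -> (forall x, 0 <= x <= 1 -> cmod (m x) <= L) ->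
    forall x, 0 <= x <= 1 -> cmod (n x) <= v * L / (2 * y).
  move=> L0 hL x /andP[x0 x1].
  have := @cder_dist_le R k (fun t => cexp (- (2 * w) * t%:C) * (V t * m t))
    (fun t => v * L / (2 * y) * expR (2 * y * (t - 0)))
    (fun t => v * L / (2 * y) * (2 * y * expR (2 * y * (t - 0)))) 0 x x0 (fun t _ => dk t).
  move=> /(_ (fun t _ => is_derive_mull _ (is_derive_expR_lin _ _ _))) h.
  have {h} := h _; rewrite /k n0 mulr0 subr0 cmodM ek subrr mulr0 expR0 mulr1 => h.
  have E0 : 0 < expR (2 * y * (x - 0)) by exact: expR_gt0.
  rewrite -(ler_pM2l E0) mulrC.
  have c0 : 0 <= v * L / (2 * y) by rewrite divr_ge0 ?mulr_ge0// ltW.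
  have hb : forall t, 0 <= t <= x ->
      cmod (cexp (- (2 * w) * t%:C) * (V t * m t)) <=
      v * L / (2 * y) * (2 * y * expR (2 * y * (t - 0))).
    move=> t /andP[t0 tx]; rewrite cmodM ek (cmodM (V t) (m t)).
    have -> : v * L / (2 * y) * (2 * y * expR (2 * y * (t - 0))) =
      expR (2 * y * (t - 0)) * (v * L) by field; rewrite gt_eqF.
    rewrite ler_wpM2l ?expR_ge0// ler_pM ?cmod_ge0//.
    by apply: hL; rewrite t0 (le_trans tx x1).
  by move: (h hb); rewrite mulrC; lra.
have mb (L : R) : 0 <= L -> (forall x, 0 <= x <= 1 -> cmod (m x) <= L) ->
    forall x, 0 <= x <= 1 -> cmod (m x - 1) <= v * L / (2 * y).
  move=> L0 hL x /andP[x0 x1].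
  have c0 : 0 <= v * L / (2 * y) by rewrite divr_ge0 ?mulr_ge0// ltW.
  have := @cder_dist_cst R m n (v * L / (2 * y)) 0 x x0 (fun t _ => dm t).
  rewrite m0 subr0 => h; apply: le_trans (h _) _; last by rewrite ler_piMr.
  by move=> t /andP[t0 tx]; apply: (nb L) => //; rewrite t0 (le_trans tx x1).
have vy (L : R) : 0 <= L -> v * L / (2 * y) <= L / 6.
  move=> L0; rewrite ler_pdivrMr ?mulr_gt0//.
  have : 0 <= (y - 3 * v) * L by rewrite mulr_ge0//; lra.
  by lra.
have cm : ccont m := cder_ccont dm.
have [K K0 hK] := ccont_bounded 0 1 cm.
(* The bound [L / 6] on [m - 1] is weakened to [L / 2] to fit [halving], which then yields 3. *)
have m3 : forall x, 0 <= x <= 1 -> cmod (m x) <= 3.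
  have := @halving (fun L => forall x, 0 <= x <= 1 -> cmod (m x) <= L) 1 K _ ler01 K0 _ hK 1 ltr01.
  have -> : 2 * 1 + 1 = 3 :> R by ring.
  apply.
  - by move=> L L' LL h x xx; exact: le_trans (h x xx) LL.
  - move=> L L0 hL x xx; rewrite -[m x](subrK 1) (le_trans (cmodD _ _))// cmod1 addrC lerD2l.
    by rewrite (le_trans (mb L L0 hL x xx))// (le_trans (vy L L0))//; lra.
have i1 : 0 <= (1 : R) <= 1 by rewrite ler01 lexx.
have h1 := le_trans (nb 3 (ler0n _ 3) m3 1 i1) (vy 3 (ler0n _ 3)).
have h2 := le_trans (mb 3 (ler0n _ 3) m3 1 i1) (vy 3 (ler0n _ 3)).
have We : Wr z = n 1 - 2 * w * m 1 by rewrite /Wr /outf /n /m -/w; ring.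
have wy : y <= cmod w by rewrite -[y]opprK -Rew (le_trans (ler_norm _))// normrN cmod_Re.
rewrite -cmod_gt0 We.
have m1 : 1 / 2 <= cmod (m 1).
  have : cmod 1 <= cmod (m 1) + cmod (m 1 - 1).
    by rewrite {1}(_ : 1 = m 1 - (m 1 - 1)) ?cmodB//; ring.
  by rewrite cmod1; lra.
have : cmod (2 * w * m 1) <= cmod (n 1) + cmod (n 1 - 2 * w * m 1).
  by rewrite {1}(_ : 2 * w * m 1 = n 1 - (n 1 - 2 * w * m 1)) ?cmodB//; ring.
rewrite (cmodM (2 * w)) (cmodM 2) cmod_nat => h3.
have h4 : 2 * y * (1 / 2) <= 2 * cmod w * cmod (m 1).
  by apply: ler_pM => //; [rewrite mulr_ge0// ltW|rewrite ler_wpM2l].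
by lra.
Qed.

Lemma phi_left z x : x <= 0 -> phi z x = cexp (- ('i * z) * x%:C) /\
  phip z x = - ('i * z) * phi z x.
Proof.
move=> x0; have [hs p0 pp0] := phiP z; set w := 'i * z.
have V0 t : t <= 0 -> V t = 0 by move=> t0; apply: V_out; rewrite negb_and -!leNgt t0.
pose n t := cexp (- w * t%:C) * (phip z t + w * phi z t).
have dn t : t <= 0 -> cder n t 0.
  move=> t0; have [d1 d2] := hs t.
  apply: cder_eq (cderM (cder_cexpl (- w) t) (cderD d2 (cderZ w d1))) _.
  by rewrite (V0 t t0) (sq_i z) -/w; ring.
have hn t : t <= 0 -> phip z t = - w * phi z t.
  move=> t0; have nt : n t = n 0.
    apply: (@cder0_eq R n t 0) => [s /andP[_ /dn]//||]; by rewrite t0 lexx.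
  have : n t = 0 by rewrite nt /n p0 pp0 /w; ring.
  rewrite /n => /eqP; rewrite mulf_eq0 (negbTE (cexp_neq0 _))/= addr_eq0 => /eqP ->.
  by rewrite mulNr.
split; last exact: hn.
pose k t := cexp (w * t%:C) * phi z t.
have dk t : t <= 0 -> cder k t 0.
  move=> t0; have [d1 _] := hs t.
  apply: cder_eq (cderM (cder_cexpl w t) d1) _.
  by rewrite (hn t t0); ring.
have kt : k x = k 0.
  by apply: (@cder0_eq R k x 0) => [s /andP[_ /dk]//||]; rewrite x0 lexx.
have : k x = 1 by rewrite kt /k mulr0 cexp0 p0 mulr1.
rewrite /k mulNr cexpN => h.
by rewrite -[RHS]mulr1 -h mulKf// cexp_neq0.
Qed.

Lemma Tres_right M z f X x : 0 <= M -> L2_supp M f -> M + 2 <= X -> Wr z != 0 -> X <= x ->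
  Tres1 z f x = 'i * z * Tres z f x /\
  Tres z f x = cexp ('i * z * (x - X)%:C) * Tres z f X.
Proof.
move=> M0 hf MX W0 Xx.
have h1 t : X <= t -> Tres1 z f t = 'i * z * Tres z f t.
  move=> Xt; have Mt : M + 2 <= t by exact: le_trans Xt.
  have t1 : 1 <= t by lra.
  have := ellE z M0 hf Mt; have := WrE z t1; rewrite /outf /Tres1 /Tres /alpha => hW hl.
  have E := cexp_neq0 ('i * z * t%:C).
  set c := ell z f / Wr z; have cW : c * Wr z = ell z f by rewrite divfK.
  have : cexp ('i * z * t%:C) * (- c * phip z t + (esolp z f t - prim0 f t) -
    'i * z * (- c * phi z t + esol z f t)) = 0.
    clearbody c; transitivity (ell z f - c * Wr z); last by rewrite cW subrr.
    by rewrite hl hW; ring.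
  by move/eqP; rewrite mulf_eq0 (negbTE E)/= subr_eq0 => /eqP.
split; first exact: h1.
have [r1 _ _ _] := Tres_reg z (ex_intro _ M hf : L2c f).
pose k t := cexp (- ('i * z) * t%:C) * Tres z f t.
have dk t : X <= t -> cder k t 0.
  move=> Xt; apply: cder_eq (cderM (cder_cexpl (- ('i * z)) t) (r1 t)) _.
  by rewrite (h1 t Xt); ring.
have kx : k x = k X.
  by apply: (@cder0_eq R k X x) => [s /andP[/dk]//||]; rewrite ?Xx lexx.
have e : 'i * z * (x - X)%:C = 'i * z * x%:C + - ('i * z) * X%:C.
  by rewrite rmorphB /=; ring.
rewrite e cexpD -mulrA -/(k X) -kx /k mulNr cexpN mulrA mulfV ?mul1r//.
exact: cexp_neq0.
Qed.

Lemma Tres_left M z f x : 0 <= M -> L2_supp M f -> x <= - (M + 1) ->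
  Tres z f x = alpha z f * cexp (- ('i * z) * x%:C) /\
  Tres1 z f x = - ('i * z) * Tres z f x.
Proof.
move=> M0 hf xM; have x0 : x <= 0 by lra.
have [e1 e2] := phi_left z x0; have [_ /(_ x xM)[e3 e4]] := esolP z M0 hf.
rewrite /Tres /Tres1 e3 e4 addr0 (prim0_left hf) ?subr0 ?addr0//; last first.
  by lra.
by rewrite e2 -e1; split => //; ring.
Qed.

End Resolvent.

(** * Square integrable solutions and uniqueness of the resolvent *)

Section H2Solutions.
Variable R : realType.
Local Notation C := R[i].
Local Notation mu := (@lebesgue_measure R).

Lemma integral_expR_decay (eta : R) : 0 < eta ->
  (\int[mu]_x (expR (- (eta * `|x|)))%:E < +oo)%E.
Proof.
move=> e0.
have cl : continuous (fun x : R => - (eta * `|x|)).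
  by move=> x; apply: cvgN; apply: cvgM; [exact: cvg_cst|exact: norm_continuous].
have cf : continuous (fun x : R => expR (- (eta * `|x|))).
  by move=> x; apply: (@continuous_comp _ _ _ (fun x : R => - (eta * `|x|)) expR);
    [exact: cl|exact: continuous_expR].
have f0 (x : R) : 0 <= expR (- (eta * `|x|)) by exact: expR_ge0.
have ev : (fun x : R => expR (- (eta * `|x|))) =1 (fun x : R => expR (- (eta * `|x|))) \o -%R.
  by move=> x /=; rewrite normrN.
rewrite (ge0_symfun_integralT f0 cf ev).
rewrite -set_itvcy.
have dF (x : R) : is_derive x (1 : R) (fun x : R => - eta^-1 * expR (- eta * (x - 0)))
    (expR (- eta * (x - 0))).
  apply: is_derive_ext (is_derive_mull (- eta^-1) (is_derive_expR_lin (- eta) 0 x)) => //.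
  by rewrite mulrA mulrNN mulVf ?gt_eqF// mul1r.
rewrite (_ : (\int[mu]_(x in _) _)%E = (0%:E - (- eta^-1 * expR (- eta * (0 - 0)))%:E)%E).
  by rewrite -EFinB -EFinM ltry.
transitivity (\int[mu]_(x in `[0%R, +oo[) (expR (- eta * (x - 0)))%:E)%E.
  apply: eq_integral => x; rewrite inE/= in_itv/= andbT => x0.
  by rewrite ger0_norm// subr0 mulNr.
apply: (@ge0_continuous_FTC2y R _ (fun x : R => - eta^-1 * expR (- eta * (x - 0)))).
- by move=> x _; exact: expR_ge0.
- apply: continuous_subspaceT => x; apply: (is_derive_continuous (d := - eta * expR (- eta * (x - 0)))).
  exact: is_derive_expR_lin.
- suff : (- eta^-1 * expR (- eta * (x - 0)) : R) @[x --> +oo] --> - eta^-1 * 0 by rewrite mulr0.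
  apply: cvgM; first exact: cvg_cst.
  have : (expR (- (eta * x)) : R) @[x --> +oo] --> (0 : R).
    apply: (@cvg_comp _ _ _ (fun x : R => eta * x) (fun x : R => expR (- x)) (pinfty_nbhs R) (pinfty_nbhs R)).
      by apply: gt0_cvgMry => //; exact: cvg_id.
    exact: cvgr_expR.
  apply: cvg_trans; apply: near_eq_cvg; near=> x.
  by rewrite subr0 mulNr.
- by move=> x _; exact: ex_derive.
- by apply: cvg_at_right_filter; exact: (is_derive_continuous (dF 0)).
- by move=> x _; rewrite derive1E derive_val.
Unshelve. all: by end_near. Qed.

Lemma L2_decay (h : R -> C) (eta K : R) : cmeasurable h -> 0 < eta ->
  (forall x, cmod (h x) <= K * expR (- (eta * `|x|))) -> L2 h.
Proof.
move=> mh e0 hK; split => //.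
have K0 : 0 <= K.
  by have := le_trans (cmod_ge0 _) (hK 0); rewrite pmulr_lge0// expR_gt0.
have cf : measurable_fun setT (fun x : R => expR (- (eta * 2 * `|x|))).
  apply: continuous_measurable_fun => x.
  apply: (@continuous_comp _ _ _ (fun x : R => - (eta * 2 * `|x|)) expR);
    [|exact: continuous_expR].
  by apply: cvgN; apply: cvgM; [exact: cvg_cst|exact: norm_continuous].
apply: (@le_lt_trans _ _ (\int[mu]_x ((K ^+ 2)%:E * (expR (- (eta * 2 * `|x|)))%:E))%E).
  apply: ge0_le_integral => //.
  - by move=> x _; rewrite lee_fin sqr_ge0.
  - by apply/measurable_EFinP; exact: measurable_cmod2.
  - by apply: measurable_funeM; exact/measurable_EFinP.
  - move=> x _; rewrite -EFinM lee_fin.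
    have -> : K ^+ 2 * expR (- (eta * 2 * `|x|)) = (K * expR (- (eta * `|x|))) ^+ 2.
      by rewrite exprMn -expRM_natl; congr (_ * expR _); ring.
    by rewrite lerXn2r ?nnegrE ?cmod_ge0// mulr_ge0// expR_ge0.
rewrite ge0_integralZl ?lee_fin ?sqr_ge0//.
- have h2 : 0 < eta * 2 by rewrite mulr_gt0.
  have := integral_expR_decay h2.
  set I := (\int[mu]_x _)%E => Ioo.
  have I0 : (0 <= I)%E by apply: integral_ge0 => x _; rewrite lee_fin expR_ge0.
  have If : I \is a fin_num by rewrite ge0_fin_numE.
  by rewrite -(fineK If) -EFinM ltry.
- exact/measurable_EFinP.
Qed.

Lemma L2_integrable_itv (h : R -> C) (x y : R) : L2 h -> cintegrable `[x, y] h.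
Proof.
move=> [mh hoo]; have mi : measurable (`[x, y] : set R) by exact: measurable_itv.
have i2 : mu.-integrable `[x, y] (fun t => (cmod (h t) ^+ 2)%:E).
  apply/integrableP; split.
    by apply/measurable_EFinP; exact: measurable_funS (measurable_cmod2 mh).
  apply: le_lt_trans hoo; apply: (@le_trans _ _ (sqL2 `[x, y] h)).
    rewrite le_eqVlt; apply/orP; left; apply/eqP; apply: eq_integral => t _.
    by rewrite gee0_abs// lee_fin sqr_ge0.
  exact: sqL2_subset.
have i1 : mu.-integrable `[x, y] (fun t => (1 + cmod (h t) ^+ 2)%:E).
  have c1 : continuous (cst 1 : R -> R) by exact: cst_continuous.
  have i3 := continuous_integrable_itv x y c1.
  have i4 : mu.-integrable `[x, y] ((EFin \o (cst 1 : R -> R)) \+ (fun t => (cmod (h t) ^+ 2)%:E)).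
    exact: integrableD.
  exact: i4.
have part (g : R -> R) : measurable_fun setT g -> (forall t, `|g t| <= cmod (h t)) ->
    mu.-integrable `[x, y] (EFin \o g).
  move=> mg gh; apply: le_integrable i1 => //.
    by apply/measurable_EFinP; exact: measurable_funS mg.
  move=> t _ /=; rewrite lee_fin (le_trans (gh t))// ger0_norm ?addr_ge0 ?sqr_ge0//.
  by have := sqr_ge0 (cmod (h t) - 1); have := cmod_ge0 (h t); nra.
by split; apply: part; [exact: mh.1|move=> t; exact: cmod_Re|exact: mh.2|move=> t; exact: cmod_Im].
Qed.

Lemma primitive_of_ccont (g h : R -> C) : (forall x y, cintegrable `[x, y] g) ->
  primitive_of g h -> ccont h.
Proof.
move=> ig pg.
have part (G H : R -> R) : (forall x y, mu.-integrable `[x, y] (EFin \o G)) ->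
    (forall x y, x <= y -> H y - H x = (\int[mu]_(t in `[x, y]) G t)%R) -> continuous H.
  move=> iG hH x; have xx : x - 1 < x + 1 by lra.
  have := parameterized_integral_continuous (ltW xx) (iG _ _).
  move=> /(continuous_within_itvP _ xx)[/(_ x) + _ _].
  rewrite in_itv/= ltrBlDr ltrDl ltr01 andbT => /(_ isT) cx.
  have e y : x - 1 <= y -> H y = H (x - 1) + (\int[mu]_(t in `[(x - 1)%R, y]) G t)%R.
    by move=> xy; rewrite -hH// addrC subrK.
  have : {for x, continuous (fun y => H (x - 1) + (\int[mu]_(t in `[(x - 1)%R, y]) G t)%R)}.
    by apply: cvgD; [exact: cvg_cst|exact: cx].
  move=> h'; rewrite /continuous_at (e x); last by lra.
  apply: cvg_trans h'; apply: near_eq_cvg; near=> y; apply/esym/e.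
  have : `|x - y| < 1 by near: y; exact: (@cvgr_dist_lt _ _ _ (nbhs x) _ id x).
  by rewrite ltr_norml => /andP[]; lra.
split.
  apply: (part (fun t => complex.Re (g t))) => [x y|x y xy]; first exact: (ig x y).1.
  by rewrite -ReN -ReD (pg x y xy).
apply: (part (fun t => complex.Im (g t))) => [x y|x y xy]; first exact: (ig x y).2.
by rewrite -ImN -ImD (pg x y xy).
Unshelve. all: by end_near. Qed.

Lemma primitive_of_cder (g h : R -> C) : ccont g -> primitive_of g h ->
  forall x, cder h x (g x).
Proof.
move=> cg pg x; have [P [_ dP]] := ccont_primitive 0 cg.
have pP := cder_primitive_of dP cg.
have e t : h t = P t + (h 0 - P 0).
  have [t0|/ltW t0] := leP 0 t.
    by have := pP 0 t t0; rewrite -(pg 0 t t0) => h1; rewrite -[P t](subrK (P 0)) h1; ring.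
  by have := pP t 0 t0; rewrite -(pg t 0 t0) => h1; rewrite -[P 0](subrK (P t)) h1; ring.
apply: cder_ext (cderD (dP x) (cder_cst (h 0 - P 0) x)); last by rewrite addr0.
by move=> t; rewrite (e t).
Qed.

Lemma ae_eq_cintegral (x y : R) (g h : R -> C) : cmeasurable g -> cmeasurable h ->
  {ae mu, forall t, g t = h t} -> cintegral `[x, y] g = cintegral `[x, y] h.
Proof.
move=> mg mh gh.
have F : Filter (almost_everywhere mu) by apply: ae_filter_ringOfSetsType.
have part (G H : R -> R) : measurable_fun setT G -> measurable_fun setT H ->
    {ae mu, forall t, G t = H t} ->
    (\int[mu]_(t in `[x, y]) G t)%R = (\int[mu]_(t in `[x, y]) H t)%R.
  move=> mG mH GH; rewrite /Rintegral; congr fine; apply: ae_eq_integral => //.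
  - by apply/measurable_EFinP; exact: measurable_funS mG.
  - by apply/measurable_EFinP; exact: measurable_funS mH.
  - by apply: (@filterS _ _ F _ _ _ GH) => t /= -> _.
rewrite /cintegral (part _ _ mg.1 mh.1) ?(part _ _ mg.2 mh.2)//.
  by apply: (@filterS _ _ F _ _ _ gh) => t /= ->.
by apply: (@filterS _ _ F _ _ _ gh) => t /= ->.
Qed.

(** A modulus of at least [c] on arbitrarily long intervals contradicts square integrability unless
    [c = 0]. This excludes the exponentially growing component at either end. *)
Lemma L2_lower_bound (h : R -> C) (c : R) : L2 h -> 0 <= c ->
  (forall n : nat, exists a, forall x, a <= x <= a + n%:R -> c <= cmod (h x)) -> c = 0.
Proof.
move=> hL c0 hc; apply/eqP; rewrite eq_le c0 andbT leNgt; apply/negP => cp.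
have [mh _] := hL.
have key (n : nat) : c ^+ 2 * n%:R <= nrm h ^+ 2.
  have [a ha] := hc n; rewrite -lee_fin -sqL2_nrm//.
  apply: le_trans (sqL2_subset (D := `[a, a + n%:R]) _ mh) => //.
  have -> : (c ^+ 2 * n%:R)%:E = (\int[mu]_(x in `[a, (a + n%:R)%R]) cst (c ^+ 2)%:E x)%E.
    rewrite integral_cst// EFinM; congr (_ * _)%E.
    apply/esym; transitivity (mu `[a, (a + n%:R)%R]) => //.
    rewrite lebesgue_measure_itv/= lte_fin ltrDl; case: ltP => [_|].
      by rewrite -EFinB addrAC subrr add0r.
    by rewrite lern0 => /eqP ->.
  apply: ge0_le_integral => //.
  - by move=> x _; rewrite lee_fin sqr_ge0.
  - by apply/measurable_EFinP; exact: measurable_funS (measurable_cmod2 mh).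
  - move=> x; rewrite /= in_itv/= => /ha cx; rewrite lee_fin.
    by rewrite lerXn2r ?nnegrE ?cmod_ge0.
have c2 : 0 < c ^+ 2 by rewrite exprn_gt0.
have := key (Num.truncn (nrm h ^+ 2 / c ^+ 2)).+1.
by rewrite mulrC -ler_pdivlMr// leNgt truncnS_gt.
Qed.

Variables (V : R -> C) (v : R).
Hypotheses (cV : ccont V) (hV : forall x, cmod (V x) <= v).
Hypothesis V_out : forall x, ~~ (0 < x < 1) -> V x = 0.

(** The source, known only almost everywhere, drops out of the difference. Its second derivative
    then agrees almost everywhere with a continuous function, so the homogeneous equation holds
    classically. *)
Lemma H2_solution_diff z f u w : H2_solution V z f u -> H2_solution V z f w ->
  exists d1, [/\ odesol (fun x => V x - z ^+ 2) (fun _ => 0) (fun _ => 0)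
    (fun x => u x - w x) d1, L2 (fun x => u x - w x) & L2 d1].
Proof.
move=> [u1 [u2 [[[pu pu1 _] Lu Lu1 Lu2] eu]]] [w1 [w2 [[[pw pw1 _] Lw Lw1 Lw2] ew]]].
have LB (g h : R -> C) : L2 g -> L2 h -> L2 (fun x => g x - h x).
  move=> hg hh; rewrite (_ : (fun x => _) = (fun x => g x + -1 * h x)).
    by apply: L2D => //; exact: L2Z.
  by apply/funext => x; rewrite mulN1r.
have pB (g h G H : R -> C) : L2 g -> L2 h -> primitive_of g G -> primitive_of h H ->
    primitive_of (fun x => g x - h x) (fun x => G x - H x).
  move=> Lg Lh pg ph x y xy.
  rewrite (_ : (fun x => g x - h x) = (fun x => g x + -1 * h x)); last first.
    by apply/funext => t; rewrite mulN1r.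
  rewrite cintegralD ?cintegralZ//; try exact: L2_integrable_itv.
    by rewrite -(pg x y xy) -(ph x y xy); ring.
  by apply: cintegrableZ => //; exact: L2_integrable_itv.
pose d x := u x - w x; pose d1 x := u1 x - w1 x; pose d2 x := u2 x - w2 x.
have pd : primitive_of d1 d by exact: pB.
have pd1 : primitive_of d2 d1 by exact: pB.
have Ld1 : L2 d1 by exact: LB.
have Ld2 : L2 d2 by exact: LB.
have cd : ccont d by apply: primitive_of_ccont pd => x y; exact: L2_integrable_itv.
have cVd : ccont (fun x => (V x - z ^+ 2) * d x) by apply: ccontM => //; exact: ccontVz.
have cd1 : ccont d1 by apply: primitive_of_ccont pd1 => x y; exact: L2_integrable_itv.
have pd1' : primitive_of (fun x => (V x - z ^+ 2) * d x) d1.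
  move=> x y xy; rewrite (pd1 x y xy); apply: ae_eq_cintegral; first exact: Ld2.1.
    exact: ccont_measurable.
  have F : Filter (almost_everywhere mu) by apply: ae_filter_ringOfSetsType.
  apply: (@filterS2 _ _ F _ _ _ _ eu ew) => t /= e1 e2; rewrite /d2 /d.
  have -> : u2 t = (V t - z ^+ 2) * u t - f t by rewrite -e1; ring.
  have -> : w2 t = (V t - z ^+ 2) * w t - f t by rewrite -e2; ring.
  by ring.
exists d1; split => //; last exact: LB.
move=> x; split; first by apply: cder_eq (primitive_of_cder cd1 pd x) _; rewrite addr0.
by apply: cder_eq (primitive_of_cder cVd pd1' x) _; rewrite addr0.
Qed.

Let Rew z (x : R) : complex.Re ('i * z * x%:C) = - complex.Im z * x.
Proof. by rewrite !ReM !ImM /=; ring. Qed.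

(** Square integrability on the right kills the incoming component, and on the left it forces [d] to
    be a multiple of [phi]. The incoming component of that multiple is [d 0] times the Wronskian, so
    [d 0 = 0]. *)
Lemma H2_homogeneous_eq0 z d d1 : 0 < complex.Im z -> Wr V z != 0 ->
  odesol (fun x => V x - z ^+ 2) (fun _ => 0) (fun _ => 0) d d1 -> L2 d -> L2 d1 ->
  forall x, d x = 0.
Proof.
move=> y0 W0 hs Ld Ld1 x; set w := 'i * z.
have sq : z ^+ 2 = - w ^+ 2 by rewrite /w exprMn sqr_i mulN1r opprK.
have Lc (c : C) : L2 (fun t => d1 t + c * d t) by apply: L2D => //; exact: L2Z.
have hr t : 1 <= t -> outf z 0 t d d1 = outf z 0 1 d d1.
  move=> t1; apply: (outf_cst hs) => // s /andP[s1 _]; split; last by rewrite oppr0.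
  by apply: V_out; rewrite negb_and -!leNgt s1 orbT.
have K0 : cmod (outf z 0 1 d d1) = 0.
  apply: (@L2_lower_bound (fun t => d1 t + - w * d t)); [exact: Lc|exact: cmod_ge0|].
  move=> n; exists 1 => t /andP[t1 _]; rewrite -(hr t t1) /outf cmodM cmod_cexp Rew.
  rewrite (_ : d1 t - 0 - 'i * z * d t = d1 t + - w * d t); last by rewrite /w; ring.
  rewrite ler_piMl ?cmod_ge0// -expR0 ler_expR mulNr oppr_le0 mulr_ge0// ltW//.
  exact: lt_le_trans t1.
have V0 t : t <= 0 -> V t = 0 by move=> t0; apply: V_out; rewrite negb_and -!leNgt t0.
pose n t := cexp (- w * t%:C) * (d1 t + w * d t).
have dn t : t <= 0 -> cder n t 0.
  move=> t0; have [e1 e2] := hs t.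
  apply: cder_eq (cderM (cder_cexpl (- w) t) (cderD e2 (cderZ w e1))) _.
  by rewrite (V0 t t0) sq; ring.
have nn t : t <= 0 -> n t = n 0.
  by move=> t0; apply: (@cder0_eq R n t 0) => [s /andP[_ /dn]//||]; rewrite t0 lexx.
have n0 : cmod (n 0) = 0.
  apply: (@L2_lower_bound (fun t => d1 t + w * d t)); [exact: Lc|exact: cmod_ge0|].
  move=> k; exists (- k%:R) => t /andP[_]; rewrite addrC subrr => t0.
  rewrite -(nn t t0) /n cmodM cmod_cexp mulNr ReN Rew.
  rewrite ler_piMl ?cmod_ge0// -expR0 ler_expR mulNr opprK pmulr_rle0//.
have d10 : d1 0 = - w * d 0.
  move/eqP: n0; rewrite cmod_eq0 /n mulr0 cexp0 mul1r addr_eq0 => /eqP ->.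
  by rewrite mulNr.
have [ps p0 pp0] := phiP cV hV z.
have e t : d t = d 0 * phi V z t /\ d1 t = d 0 * phip V z t.
  apply: (ode_uniq (v := fun t => d 0 * phi V z t) (r := fun t => d 0 * phip V z t)
    (x0 := 0) (ccontVz cV z) hs).
  - by apply: odesol_ext (odesolZ (d 0) ps) => // s; rewrite mulr0.
  - by rewrite p0 mulr1.
  - by rewrite pp0 d10 /w; ring.
have : outf z 0 1 d d1 = d 0 * Wr V z.
  by rewrite /Wr /outf (e 1).1 (e 1).2; ring.
move/eqP: K0; rewrite cmod_eq0 => /eqP -> /esym/eqP.
by rewrite mulf_eq0 (negbTE W0) orbF => /eqP d00; rewrite (e x).1 d00 mul0r.
Qed.

(** On both sides the solution is a pure exponential. The factor [E] in the constant pays for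
    measuring the decay from 0 instead of the ends of the middle interval, and it also covers the
    middle by compactness. *)
Lemma Tres_decay z f : 0 < complex.Im z -> Wr V z != 0 -> L2c f ->
  exists K : R, forall x, cmod (Tres V z f x) <= K * expR (- (complex.Im z * `|x|)) /\
    cmod (Tres1 V z f x) <= K * expR (- (complex.Im z * `|x|)).
Proof.
move=> y0 W0 hfc; have [M M0 hf] := L2c_supp hfc; set y := complex.Im z.
have [r1 r2 _ _] := Tres_reg cV hV z hfc.
have cT : ccont (Tres V z f) := cder_ccont r1.
have [K1 K10 hK1] := ccont_bounded (- (M + 1)) (M + 2) cT.
have [K2 K20 hK2] := ccont_bounded (- (M + 1)) (M + 2) r2.
have yM : 0 <= y * (M + 2) by rewrite mulr_ge0 ?addr_ge0// ltW.
pose E := expR (y * (M + 2)); have E0 : 0 < E by exact: expR_gt0.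
have E1 : 1 <= E by rewrite -expR0 ler_expR.
have z0 := cmod_ge0 z.
pose A := cmod (alpha V z f); have A0 : 0 <= A by exact: cmod_ge0.
pose K := (K1 + K2 + A) * (1 + cmod z) * E.
have cw : cmod ('i * z) = cmod z by rewrite cmodM cmod_i mul1r.
have KK (a x : R) : 0 <= a -> a <= K1 + K2 + A ->
   a * (expR (- (y * `|x|)) * E) <= K * expR (- (y * `|x|)) /\
   cmod z * (a * (expR (- (y * `|x|)) * E)) <= K * expR (- (y * `|x|)).
  move=> a0 aK; have e0 := expR_ge0 (- (y * `|x|)).
  have eE : 0 <= expR (- (y * `|x|)) * E by rewrite mulr_ge0// ltW.
  have S0 : 0 <= K1 + K2 + A by rewrite !addr_ge0.
  have -> : K * expR (- (y * `|x|)) =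
    (K1 + K2 + A) * (expR (- (y * `|x|)) * E) + cmod z * ((K1 + K2 + A) * (expR (- (y * `|x|)) * E)).
    by rewrite /K; ring.
  have h1 : a * (expR (- (y * `|x|)) * E) <= (K1 + K2 + A) * (expR (- (y * `|x|)) * E).
    by rewrite ler_wpM2r.
  have h2 := ler_wpM2l z0 h1.
  have h3 : 0 <= (K1 + K2 + A) * (expR (- (y * `|x|)) * E) by rewrite mulr_ge0.
  have h4 := mulr_ge0 z0 h3.
  by split; lra.
exists K => x.
have [xl|xl] := leP x (- (M + 1)).
  have [e1 e2] := Tres_left cV hV V_out z M0 hf xl.
  have xn : `|x| = - x by rewrite ler0_norm//; lra.
  have b1 : cmod (Tres V z f x) <= A * (expR (- (y * `|x|)) * E).
    rewrite e1 cmodM cmod_cexp mulNr ReN Rew -/y xn.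
    have -> : - (- y * x) = - (y * - x) by ring.
    by rewrite ler_wpM2l// ler_peMr ?expR_ge0.
  have [k1 k2] := KK A x A0 (ler_wpDl (addr_ge0 K10 K20) (lexx _)).
  split; first exact: le_trans b1 k1.
  rewrite e2 mulNr cmodN cmodM cw; apply: le_trans k2.
  by rewrite ler_wpM2l.
have [xr|xr] := leP (M + 2) x.
  have [e1 e2] := Tres_right cV hV V_out M0 hf (lexx _) W0 xr.
  have xn : `|x| = x by rewrite ger0_norm//; lra.
  have b1 : cmod (Tres V z f x) <= K1 * (expR (- (y * `|x|)) * E).
    rewrite e2 cmodM cmod_cexp Rew -/y mulrC.
    have -> : expR (- y * (x - (M + 2))) = expR (- (y * `|x|)) * E.
      by rewrite /E xn -expRD; congr expR; ring.
    apply: ler_pM; rewrite ?cmod_ge0 ?mulr_ge0 ?expR_ge0//.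
    by apply: hK1; apply/andP; split; lra.
  have [|k1 k2] := KK K1 x K10; first by lra.
  split; first exact: le_trans b1 k1.
  rewrite e1 cmodM cw; apply: le_trans k2.
  by rewrite ler_wpM2l.
have xb : - (M + 1) <= x <= M + 2 by rewrite (ltW xl) (ltW xr).
have ge1 : 1 <= expR (- (y * `|x|)) * E.
  rewrite /E -expRD -[leLHS]expR0 ler_expR addrC subr_ge0 ler_wpM2l ?(ltW y0)//.
  by rewrite ler_norml; apply/andP; split; lra.
split.
  have [|k1 _] := KK K1 x K10; first by lra.
  by apply: le_trans k1; rewrite (le_trans (hK1 x xb))// ler_peMr.
have [|k1 _] := KK K2 x K20; first by lra.
by apply: le_trans k1; rewrite (le_trans (hK2 x xb))// ler_peMr.
Qed.

Lemma Tres_is_resolvent z : 3 * v + 1 < complex.Im z -> is_resolvent V z (Tres V z).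
Proof.
move=> zc f hfc; have W0 := Wr_neq0 cV hV zc.
have v0 : 0 <= v by exact: le_trans (cmod_ge0 _) (hV 0).
have y0 : 0 < complex.Im z by lra.
have [M M0 hf] := L2c_supp hfc.
have hreg := Tres_reg cV hV z hfc.
have [K hK] := Tres_decay y0 W0 hfc.
have cT : ccont (Tres V z f) by case: hreg => r1 _ _ _; exact: cder_ccont r1.
have cT1 : ccont (Tres1 V z f) by case: hreg.
have LT : L2 (Tres V z f).
  by apply: (L2_decay (ccont_measurable cT) y0) => x; exact: (hK x).1.
have hsolT : H2_solution V z f (Tres V z f).
  exists (Tres1 V z f), (fun x => (V x - z ^+ 2) * Tres V z f x - 1 * f x); split.
    split.
    - exact: reg_H2loc M0 hf hreg.
    - exact: LT.
    - by apply: (L2_decay (ccont_measurable cT1) y0) => x; exact: (hK x).2.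
    - rewrite (_ : (fun x => _) = (fun x => (V x - z ^+ 2) * Tres V z f x + -1 * f x)); last first.
        by apply/funext => x; rewrite mulN1r mul1r.
      apply: L2D; last by apply: L2Z; exact: hf.1.
      have cg : ccont (fun x => (V x - z ^+ 2) * Tres V z f x).
        by apply: ccontM => //; exact: ccontVz.
      apply: (@L2_decay _ (complex.Im z) ((v + cmod z ^+ 2) * K) (ccont_measurable cg) y0) => x.
      by rewrite cmodM -mulrA ler_pM ?cmod_ge0 ?cmodVz ?(hK x).1.
  by apply: aeW => x; ring.
split => // u hu x; apply/eqP; rewrite -subr_eq0; apply/eqP.
have [d1 [hs Ld Ld1]] := H2_solution_diff hu hsolT.
exact: (H2_homogeneous_eq0 y0 W0 hs Ld Ld1).
Qed.

End H2Solutions.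

(** * Meromorphic continuation *)

Section SecondOrderExpansions.
Variable R : realType.
Local Notation C := R[i].

(** Expansion about a single centre, which is all that [ent_divz] provides for a quotient by a power
    of [z - z0]. *)
Definition entx z0 (F : C -> C) : Prop :=
  exists a, ent (fun _ : unit => True) (fun _ => 1) z0 (fun z _ => F z) a.

Lemma entx_single (I : Type) (D : I -> Prop) wt z0 F a i : ent D wt z0 F a -> D i ->
  entx z0 (F ^~ i).
Proof. by move=> h Di; eexists; exact: ent_single h Di. Qed.

Lemma entx_ext F G z0 : F =1 G -> entx z0 F -> entx z0 G.
Proof. by move=> /funext ->. Qed.

Lemma entxD F G z0 : entx z0 F -> entx z0 G -> entx z0 (fun z => F z + G z).
Proof. by move=> [a ha] [b hb]; eexists; exact: (entD ha hb). Qed.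

Lemma entxM F G z0 : entx z0 F -> entx z0 G -> entx z0 (fun z => F z * G z).
Proof.
move=> [a ha] [b hb]; exists (fun n i => cauchy_prod (a ^~ i) (b ^~ i) n).
by have := entM ha hb; rewrite (_ : (fun _ => _) = fun _ => 1)//; apply/funext => ?; rewrite mulr1.
Qed.

Lemma entx_cst (c : C) z0 : entx z0 (fun _ => c).
Proof. exact: entireS_cst. Qed.

Lemma entxZ (c : C) F z0 : entx z0 F -> entx z0 (fun z => c * F z).
Proof. by apply: entxM; exact: entx_cst. Qed.

Lemma entxX F z0 n : entx z0 F -> entx z0 (fun z => F z ^+ n).
Proof.
move=> h; elim: n => [|n IH]; first exact: entx_cst.
by apply: entx_ext (entxM h IH) => z; rewrite exprS.
Qed.

Lemma entx_sum n (F : nat -> C -> C) z0 : (forall k, entx z0 (F k)) ->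
  entx z0 (fun z => \sum_(k < n) F k z).
Proof.
move=> h; elim: n => [|n IH].
  by apply: entx_ext (entx_cst 0 z0) => z; rewrite big_ord0.
by apply: entx_ext (entxD IH (h n)) => z; rewrite big_ord_recr.
Qed.

Lemma tcoef_linx (c : C) F G z0 n : entx z0 F -> entx z0 G ->
  tcoef z0 (fun z => c * F z + G z) n = c * tcoef z0 F n + tcoef z0 G n.
Proof.
move=> hF hG.
have e1 := tcoefE (i := tt) (entD (ent_tcoef (entxZ c hF)) (ent_tcoef hG)) I n.
rewrite /= in e1; rewrite e1; congr (_ + _).
have [a ha] := hF; have [k hk] := entx_cst c z0.
have hc := entM hk ha.
rewrite (tcoefE (i := tt) hc I) (tcoefE (i := tt) ha I n) /cauchy_prod big_ord_recl /= subn0.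
have kE m : k m tt = if m is 0%N then c else 0.
  by rewrite -(tcoefE (i := tt) hk I) tcoef_cst.
rewrite kE big1 ?addr0// => j _; by rewrite kE mul0r.
Qed.

Section Families.
Variable I : Type.
Implicit Types (D : I -> Prop) (wt : I -> R) (F G : C -> I -> C) (a b : I -> C).

(** Expansion to second order on a small disc, uniform over the index. Unlike [ent] it survives
    inversion, as [1 / Wr] requires, and it is enough for a derivative in operator norm. *)
Definition tay2 D wt (z : C) F a : Prop :=
  exists2 K : R, 0 <= K & exists2 d : R, 0 < d <= 1 & forall i, D i ->
  [/\ cmod (F z i) <= K * wt i, cmod (a i) <= K * wt i
    & forall t, cmod t <= d ->
      cmod (F (z + t) i - F z i - t * a i) <= K * wt i * cmod t ^+ 2].

Lemma tay2_ent D wt z F (a : nat -> I -> C) : ent D wt z F a -> (forall i, D i -> F z i = a 0%N i) ->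
  tay2 D wt z F (a 1%N).
Proof.
move=> h F0; have [K K0 hK] := h 1 (lexx _).
exists K => //; exists 1; rewrite ?ltr01 ?lexx// => i Di.
have [h1 h2] := hK i Di; rewrite F0//; split.
- by have := h1 0%N; rewrite expr0 mulr1.
- by have := h1 1%N; rewrite expr1 mulr1.
- move=> t t1; have := h2 2%N t t1; rewrite !psumS psum0 expr0 expr1 mulr1 add0r divr1.
  by rewrite opprD addrA (mulrC t).
Qed.

Lemma tay2_entire D wt z F : entire D wt F ->
  tay2 D wt z F (fun i => tcoef z (F ^~ i) 1).
Proof. by move=> h; apply: tay2_ent (entireP h z) _ => i Di; rewrite (tcoef0 z h Di). Qed.

Lemma tay2_near D wt z F G a (d : R) : 0 < d ->
  (forall t i, cmod t <= d -> D i -> F (z + t) i = G (z + t) i) ->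
  tay2 D wt z F a -> tay2 D wt z G a.
Proof.
move=> d0 FG [K K0 [e /andP[e0 e1] h]]; exists K => //; exists (Num.min d e).
  by rewrite lt_min d0 e0 ge_min e1 orbT.
move=> i Di; have [h1 h2 h3] := h i Di.
have GF : G z i = F z i by rewrite -[z]addr0 FG// cmod0 ltW.
split=> // [|t]; first by rewrite GF.
by rewrite le_min => /andP[td te]; rewrite GF -FG//; exact: h3.
Qed.

Lemma tay2_cst D wt z (c : I -> C) (K : R) : 0 <= K ->
  (forall i, D i -> cmod (c i) <= K * wt i) -> tay2 D wt z (fun _ => c) (fun _ => 0).
Proof.
move=> K0 h; exists K => //; exists 1; rewrite ?ltr01 ?lexx// => i Di.
have Kw : 0 <= K * wt i by exact: le_trans (cmod_ge0 _) (h _ Di).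
split=> [||t _]; rewrite ?h ?cmod0// subrr mulr0 subr0 cmod0.
by rewrite mulr_ge0 ?exprn_ge0 ?cmod_ge0.
Qed.

Lemma tay2D D wt z F G a b : tay2 D wt z F a -> tay2 D wt z G b ->
  tay2 D wt z (fun w i => F w i + G w i) (fun i => a i + b i).
Proof.
move=> [K K0 [d /andP[d0 d1] hF]] [L L0 [e /andP[e0 e1] hG]].
exists (K + L); first exact: addr_ge0.
exists (Num.min d e); first by rewrite lt_min d0 e0 ge_min d1.
move=> i Di; have [f1 f2 f3] := hF i Di; have [g1 g2 g3] := hG i Di; split.
- by rewrite mulrDl (le_trans (cmodD _ _))// lerD.
- by rewrite mulrDl (le_trans (cmodD _ _))// lerD.
move=> t; rewrite le_min => /andP[td te].
rewrite (_ : _ - _ = (F (z + t) i - F z i - t * a i) + (G (z + t) i - G z i - t * b i)).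
  by rewrite !mulrDl (le_trans (cmodD _ _))// lerD ?f3 ?g3.
by ring.
Qed.

Lemma tay2M D wt wt' z F G a b : tay2 D wt z F a -> tay2 D wt' z G b ->
  tay2 D (fun i => wt i * wt' i) z (fun w i => F w i * G w i)
    (fun i => a i * G z i + F z i * b i).
Proof.
move=> [K K0 [d /andP[d0 d1] hF]] [L L0 [e /andP[e0 e1] hG]].
(* 6 = 1 + 3 + 2, from the product of the two linear terms, the remainder of [F] and the remainder
   of [G]. *)
exists (6 * (K * L)); first by rewrite !mulr_ge0.
exists (Num.min d e); first by rewrite lt_min d0 e0 ge_min d1.
move=> i Di; have [f1 f2 f3] := hF i Di; have [g1 g2 g3] := hG i Di.
have Kw : 0 <= K * wt i by exact: le_trans (cmod_ge0 _) f1.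
have Lw : 0 <= L * wt' i by exact: le_trans (cmod_ge0 _) g1.
have KL0 : 0 <= K * wt i * (L * wt' i) by rewrite mulr_ge0.
have E : 6 * (K * L) * (wt i * wt' i) = 6 * (K * wt i * (L * wt' i)) by ring.
rewrite E; split.
- by rewrite cmodM (le_trans (ler_pM (cmod_ge0 _) (cmod_ge0 _) f1 g1))//; lra.
- rewrite (le_trans (cmodD _ _))// !cmodM.
  have := ler_pM (cmod_ge0 _) (cmod_ge0 _) f2 g1.
  by have := ler_pM (cmod_ge0 _) (cmod_ge0 _) f1 g2; lra.
move=> t; rewrite le_min => /andP[td te].
have t1 : cmod t <= 1 by exact: le_trans d1.
have t2 : cmod t ^+ 2 <= 1 by rewrite exprn_ile1 ?cmod_ge0.
have c0 := cmod_ge0 t.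
set r := F (z + t) i - F z i - t * a i; set s := G (z + t) i - G z i - t * b i.
rewrite (_ : _ - _ = t ^+ 2 * (a i * b i) + (r * (G z i + t * b i + s) + (F z i + t * a i) * s)); last first.
  by rewrite /r /s; ring.
have r2 := f3 t td; have s2 := g3 t te; rewrite -/r in r2; rewrite -/s in s2.
have tb (x : C) M : 0 <= M -> cmod x <= M -> cmod (t * x) <= M.
  by move=> M0 xM; rewrite cmodM (le_trans (ler_piMl _ t1))// cmod_ge0.
have s1 : cmod s <= L * wt' i by rewrite (le_trans s2)// ler_piMr.
have h1 : cmod (G z i + t * b i + s) <= 3 * (L * wt' i).
  rewrite (le_trans (cmodD _ _))// (le_trans (lerD (cmodD _ _) (lexx _)))//.
  by have := tb _ _ Lw g2; lra.
have h2 : cmod (F z i + t * a i) <= 2 * (K * wt i).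
  by rewrite (le_trans (cmodD _ _))//; have := tb _ _ Kw f2; lra.
rewrite (le_trans (cmodD _ _))// (le_trans (lerD (lexx _) (cmodD _ _)))//.
rewrite [cmod (t ^+ 2 * _)]cmodM cmodX [cmod (a i * _)]cmodM [cmod (r * _)]cmodM [cmod (_ * s)]cmodM.
have q1 := ler_pM (cmod_ge0 _) (cmod_ge0 _) f2 g2.
have q2 := ler_pM (cmod_ge0 _) (cmod_ge0 _) r2 h1.
have q3 := ler_pM (cmod_ge0 _) (cmod_ge0 _) h2 s2.
have q1' := ler_wpM2l (exprn_ge0 2 c0) q1.
apply: le_trans (lerD q1' (lerD q2 q3)) _.
by rewrite le_eqVlt; apply/orP; left; apply/eqP; ring.
Qed.

Lemma tay2_le D wt wt' z F a : (forall i, D i -> wt i = wt' i) ->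
  tay2 D wt z F a -> tay2 D wt' z F a.
Proof.
by move=> e [K K0 [d d0 h]]; exists K => //; exists d => // i Di; rewrite -e//; exact: h.
Qed.

End Families.

Lemma tay2_sub (I J : Type) (D : I -> Prop) (D' : J -> Prop) (h : J -> I) wt z F a :
  (forall j, D' j -> D (h j)) -> tay2 D wt z F a ->
  tay2 D' (fun j => wt (h j)) z (fun w j => F w (h j)) (fun j => a (h j)).
Proof.
by move=> Dh [K K0 [d d0 hF]]; exists K => //; exists d => // j Dj; exact: hF _ (Dh _ Dj).
Qed.

Definition hols (z : C) (F : C -> C) (a : C) : Prop :=
  tay2 (fun _ : unit => True) (fun _ => 1) z (fun w _ => F w) (fun _ => a).

Lemma hols_entire F z : entireS F -> hols z F (tcoef z F 1).
Proof. by move=> h; apply: tay2_entire h. Qed.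

Lemma holsM F G a b z : hols z F a -> hols z G b ->
  hols z (fun w => F w * G w) (a * G z + F z * b).
Proof. by move=> hF hG; apply: tay2_le (tay2M hF hG) => ? _; rewrite mulr1. Qed.

(** The radius [e] keeps at least half of the modulus of [F z]. The remainder of the inverse is then
    one explicit fraction with numerator of second order and denominator bounded below. *)
Lemma holsV F a z : hols z F a -> F z != 0 -> hols z (fun w => (F w)^-1) (- (a / F z ^+ 2)).
Proof.
move=> [K K0 [d /andP[d0 d1] /(_ tt I)[_ h2 h3]]] Fz; rewrite !mulr1 in h2 h3.
pose s0 := F z; have s00 : 0 < cmod s0 by rewrite cmod_gt0.
pose e := Num.min d (cmod s0 / (4 * (K + 1))).
have e0 : 0 < e by rewrite lt_min d0 divr_gt0// mulr_gt0// ltr_wpDl.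
have key t : cmod t <= e -> cmod (F (z + t) - s0) <= 2 * K * cmod t /\
    cmod s0 / 2 <= cmod (F (z + t)).
  rewrite le_min => /andP[td te].
  have t1 : cmod t <= 1 by exact: le_trans d1.
  have i1 : cmod (F (z + t) - s0) <= 2 * K * cmod t.
    rewrite (_ : _ - _ = (F (z + t) - F z - t * a) + t * a); last by rewrite /s0; ring.
    rewrite (le_trans (cmodD _ _))// cmodM (le_trans (lerD (h3 t td) (lexx _)))//.
    have q : K * cmod t ^+ 2 <= K * cmod t.
      by rewrite ler_wpM2l// expr2 ler_piMr ?cmod_ge0.
    have := ler_wpM2l (cmod_ge0 t) h2; lra.
  split=> //.
  have : 2 * K * cmod t <= cmod s0 / 2.
    have K1 : 0 < 4 * (K + 1) by rewrite mulr_gt0// ltr_wpDl.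
    move: te; rewrite ler_pdivlMr// => te.
    have := mulr_ge0 K0 (cmod_ge0 t); have := cmod_ge0 t; lra.
  have := cmod_dist s0 (F (z + t)); rewrite cmod_distC ler_norml => /andP[_ h]; lra.
pose L := (cmod s0 * K + 2 * K * K) / (cmod s0 / 2 * cmod s0 ^+ 2).
have den0 : 0 < cmod s0 / 2 * cmod s0 ^+ 2 by rewrite mulr_gt0 ?divr_gt0 ?exprn_gt0.
have L0 : 0 <= L by rewrite divr_ge0 ?(ltW den0)// addr_ge0// !mulr_ge0// ltW.
exists ((cmod s0)^-1 + K / cmod s0 ^+ 2 + L).
  by rewrite !addr_ge0// ?invr_ge0 ?divr_ge0// ?exprn_ge0// ltW.
have a0 : 0 <= (cmod s0)^-1 by rewrite invr_ge0 ltW.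
have b0 : 0 <= K / cmod s0 ^+ 2 by rewrite divr_ge0// exprn_ge0// ltW.
exists e; first by rewrite e0 ge_min d1.
move=> _ _; rewrite mulr1; split.
- rewrite cmodV -/s0; lra.
- rewrite cmodN cmod_div cmodX -/s0.
  have : cmod a / cmod s0 ^+ 2 <= K / cmod s0 ^+ 2.
    by rewrite ler_wpM2r// invr_ge0 exprn_ge0// ltW.
  lra.
move=> t te; have [i1 i2] := key t te.
have td : cmod t <= d by move: te; rewrite le_min => /andP[].
have st0 : F (z + t) != 0.
  by rewrite -cmod_gt0 (lt_le_trans _ i2)// divr_gt0.
rewrite (_ : _ - _ = (- s0 * (F (z + t) - F z - t * a) + t * a * (F (z + t) - s0)) /
   (F (z + t) * s0 ^+ 2)); last first.
  by rewrite /s0; field; rewrite st0 Fz.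
rewrite cmod_div cmodM cmodX.
have n1 : cmod (- s0 * (F (z + t) - F z - t * a) + t * a * (F (z + t) - s0)) <=
    (cmod s0 * K + 2 * K * K) * cmod t ^+ 2.
  rewrite (le_trans (cmodD _ _))// !cmodM cmodN mulrDl lerD//.
    by rewrite -mulrA ler_wpM2l ?cmod_ge0// h3.
  rewrite -mulrA (le_trans (ler_pM _ _ (lexx _) (ler_pM _ _ h2 i1)))// ?mulr_ge0 ?cmod_ge0//.
  by rewrite le_eqVlt; apply/orP; left; apply/eqP; ring.
have d2 : cmod s0 / 2 * cmod s0 ^+ 2 <= cmod (F (z + t)) * cmod s0 ^+ 2.
  by rewrite ler_wpM2r// exprn_ge0// ltW.
have dd0 : 0 < cmod (F (z + t)) * cmod s0 ^+ 2 by exact: lt_le_trans d2.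
rewrite ler_pdivrMr//.
have t20 : 0 <= cmod t ^+ 2 by rewrite exprn_ge0 ?cmod_ge0.
apply: (le_trans n1).
have e1 : (cmod s0 * K + 2 * K * K) * cmod t ^+ 2 = L * cmod t ^+ 2 * (cmod s0 / 2 * cmod s0 ^+ 2).
  rewrite [in RHS]mulrAC /L divfK//; exact: lt0r_neq0.
rewrite e1; apply: ler_pM => //; first by rewrite mulr_ge0.
  exact: ltW.
by rewrite ler_wpM2r//; lra.
Qed.

End SecondOrderExpansions.

(** * Families of operators, holomorphic in the H^2 norm *)

Section OperatorFamilies.
Variable R : realType.
Local Notation C := R[i].
Implicit Types (f g : R -> C) (z w : C).

(* A jet [j] lists [u], [u'] and the continuous part [u'' + Phi'] of [u'']. *)
Definition regj (chi : C) f (j : nat -> R -> C) : Prop :=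
  reg (fun x => chi * prim0 f x) (j 0%N) (j 1%N) (j 2%N).

Lemma regj_lin (a chi chi' : C) f j j' : regj chi f j -> regj chi' f j' ->
  regj (a * chi + chi') f (fun c x => a * j c x + j' c x).
Proof.
move=> h h'; apply: reg_ext (reg_lin a h h') => // x.
by rewrite mulrDl mulrA.
Qed.

Lemma regj_ext chi f j j' : (forall c x, j c x = j' c x) -> regj chi f j -> regj chi f j'.
Proof. by move=> e; apply: reg_ext => // x. Qed.

Lemma regj0 f : regj 0 f (fun _ _ => 0).
Proof. by apply: reg_ext (@reg0 R) => // x; rewrite mul0r. Qed.

Lemma regjZ (a : C) f j : regj 0 f j -> regj 0 f (fun c x => a * j c x).
Proof.
move=> h; have := regj_lin a h (regj0 f); rewrite mulr0 addr0.
by apply: regj_ext => c x; rewrite addr0.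
Qed.

Lemma regj_sum n f (j : nat -> nat -> R -> C) : (forall k, (k < n)%N -> regj 0 f (j k)) ->
  regj 0 f (fun c x => \sum_(k < n) j k c x).
Proof.
elim: n => [|n IH] h; first by apply: regj_ext (regj0 f) => c x; rewrite big_ord0.
have := regj_lin 1 (IH (fun k kn => h k (leqW kn))) (h n (ltnSn n)); rewrite mul1r addr0.
by apply: regj_ext => c x; rewrite mul1r big_ord_recr.
Qed.

(** From pointwise to Sobolev bounds on an interval of length [2 |M|]: u and u' contribute
    [2 |M| K ^ 2] each. The second derivative splits into its continuous part and a multiple of [f],
    and the square of a sum costs a factor 2. *)
Lemma opnorm_regj (T : oper R) (chi : C) (j : (R -> C) -> nat -> R -> C) (M K c : R) :
  0 <= K -> 8 * `|M| * K ^+ 2 + 2 * cmod chi ^+ 2 <= c ^+ 2 ->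
  (forall f, L2_supp M f -> T f =1 j f 0%N /\ regj chi f (j f) /\
     forall x k, `|x| <= `|M| -> cmod (j f k x) <= K * nrm f) ->
  opnorm_le T M c.
Proof.
move=> K0 Kc h f hf; have [Tj [hr hb]] := h f hf.
have hf' : L2_supp `|M| f by apply: L2_supp_le hf; exact: ler_norm.
exists (j f 1%N), (fun x => j f 2%N x - chi * f x).
have -> : T f = j f 0%N by apply/funext.
split; first exact: reg_H2loc (normr_ge0 _) hf' hr.
have Kn0 : 0 <= K * nrm f by rewrite mulr_ge0// nrm_ge0.
have hB x : box M x -> [/\ cmod (j f 0%N x) <= K * nrm f,
    cmod (j f 1%N x) <= K * nrm f & cmod (j f 2%N x) <= K * nrm f].
  rewrite boxE => /andP[x1 x2].
  have xM : `|x| <= `|M|.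
    by rewrite ler_norml (le_trans _ x1) ?(le_trans x2)// ?ler_norm// lerN2 ler_norm.
  by split; exact: hb.
have B := @reg_sqH2 R `|M| f chi _ _ _ hf' hr M (K * nrm f) Kn0 hB.
apply: (le_trans B).
rewrite (sqL2_nrm (proj1 hf)) -EFinM lee_fin.
have -> : 8 * `|M| * (K * nrm f) ^+ 2 + 2 * (cmod chi * nrm f) ^+ 2 =
   (8 * `|M| * K ^+ 2 + 2 * cmod chi ^+ 2) * nrm f ^+ 2 by ring.
by rewrite ler_wpM2r// exprn_ge0 ?nrm_ge0.
Qed.

(** An index consists of a source, a component of the jet and a point; expansions uniform over this
    set, weighted by [wJ], are expansions in operator norm. *)
Definition DJ (M N : R) (i : (R -> C) * nat * R) : Prop :=
  L2_supp M i.1.1 /\ `|i.2| <= N.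
Definition wJ (i : (R -> C) * nat * R) : R := nrm i.1.1.

Definition jets := (R -> C) -> nat -> R -> C.
Definition joper (j : jets) : oper R := fun f => j f 0%N.

Definition jflat (j : C -> jets) z (i : (R -> C) * nat * R) : C := j z i.1.1 i.1.2 i.2.

Lemma joper_bounded (j : jets) (chi : C) : linear_oper (joper j) ->
  (forall f, L2c f -> regj chi f (j f)) ->
  (forall M N, 0 <= M -> exists2 K : R, 0 <= K & forall i, DJ M N i ->
     cmod (j i.1.1 i.1.2 i.2) <= K * wJ i) -> bounded_oper (joper j).
Proof.
move=> jl jr jb; split=> // M; have [K K0 hK] := jb `|M| `|M| (normr_ge0 _).
pose s := 8 * `|M| * K ^+ 2 + 2 * cmod chi ^+ 2.
have s0 : 0 <= s by rewrite addr_ge0// !mulr_ge0 ?exprn_ge0 ?cmod_ge0.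
exists (1 + s); apply: (opnorm_regj (chi := chi) (j := j) K0) => [|f hf].
  rewrite -/s; nra.
have hf' : L2_supp `|M| f by apply: L2_supp_le hf; exact: ler_norm.
split=> //; split=> [|x k xM]; first by apply: jr; exists M.
exact: (hK (f, k, x)).
Qed.

(* [j] is a family of jets, holomorphic at [z] with derivative [j']. *)
Definition hol_jets (chi : C) z (j : C -> jets) (j' : jets) : Prop :=
  [/\ forall w f, L2c f -> regj chi f (j w f),
      forall f, L2c f -> regj 0 f (j' f),
      forall w, linear_oper (joper (j w))
    & forall M N, 0 <= M -> tay2 (DJ M N) wJ z (jflat j)
        (fun i => j' i.1.1 i.1.2 i.2)].

(** The expansions for the combination, for [f] and for [g] are compared at a small real increment:
    the defect of linearity of the derivative is at most a multiple of that increment. *)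
Lemma hol_jets_linear chi z j j' : hol_jets chi z j j' -> linear_oper (joper j').
Proof.
move=> [_ _ jl jt] a f g hf hg x.
have [M1 M10 s1] := L2c_supp hf; have [M2 M20 s2] := L2c_supp hg.
pose M := M1 + M2.
have m1 : L2_supp M f by apply: L2_supp_le s1; rewrite lerDl.
have m2 : L2_supp M g by apply: L2_supp_le s2; rewrite lerDr.
have m3 : L2_supp M (fun y => a * f y + g y) by apply: L2_suppD => //; exact: L2_suppZ.
have [K K0 [d /andP[d0 d1] hK]] := jt M `|x| (addr_ge0 M10 M20).
have [_ _ t1] := hK (f, 0%N, x) (conj m1 (lexx _)).
have [_ _ t2] := hK (g, 0%N, x) (conj m2 (lexx _)).
have [_ _ t3] := hK (fun y => a * f y + g y, 0%N, x) (conj m3 (lexx _)).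
rewrite /jflat/= in t1 t2 t3; rewrite /joper.
set nf := wJ (f, _, _) in t1; set ng := wJ (g, _, _) in t2; set nh := wJ _ in t3.
apply/eqP; rewrite -subr_eq0; apply/eqP.
apply: (@cmod_small_eq0 _ _ (K * nh + (cmod a * (K * nf) + K * ng))) => e e0.
pose s := Num.min d e.
have s0 : 0 < s by rewrite lt_min d0.
pose t : C := s%:C.
have ct : cmod t = s by rewrite cmodC gtr0_norm.
have sd : s <= d by rewrite ge_min lexx.
have se : s <= e by rewrite ge_min lexx orbT.
have := t1 t; have := t2 t; have := t3 t; rewrite ct => /(_ sd) h3 /(_ sd) h2 /(_ sd) h1.
have l1 := jl (z + t) a f g hf hg x; have l0 := jl z a f g hf hg x.
rewrite /joper in l1 l0.
set S := K * nh + _.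
have key : cmod (j' (fun y => a * f y + g y) 0%N x - (a * j' f 0%N x + j' g 0%N x)) * s <= S * s ^+ 2.
  rewrite -ct -cmodM ct.
  set q3 := (X in cmod X <= K * nh * _) in h3.
  set q2 := (X in cmod X <= K * ng * _) in h2.
  set q1 := (X in cmod X <= K * nf * _) in h1.
  rewrite (_ : _ * t = - q3 + (a * q1 + q2)); last by rewrite /q3 /q2 /q1 l1 l0; ring.
  rewrite (le_trans (cmodD _ _))// cmodN /S mulrDl lerD// (le_trans (cmodD _ _))//.
  by rewrite mulrDl lerD// cmodM -mulrA ler_wpM2l ?cmod_ge0.
have S0 : 0 <= S.
  have := le_trans (mulr_ge0 (cmod_ge0 _) (ltW s0)) key.
  by rewrite pmulr_lge0// exprn_gt0.
move: key; rewrite expr2 mulrA ler_pM2r// => /le_trans; apply.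
by rewrite ler_wpM2l.
Qed.

Lemma hol_jets_oper chi z j j' : hol_jets chi z j j' ->
  bounded_oper (joper (j z)) /\
  exists A' : oper R, bounded_oper A' /\
    forall M eps : R, 0 < eps -> exists delta : R, 0 < delta /\
      forall w, 0 < cmod (w - z) < delta ->
      opnorm_le (fun f x => (joper (j w) f x - joper (j z) f x) / (w - z) - A' f x) M eps.
Proof.
move=> H; have [jr jr' jl jt] := H; split.
  apply: joper_bounded (jl z) (jr z) _ => M N M0.
  by have [K K0 [d d0 hK]] := jt M N M0; exists K => // i Di; have [] := hK i Di.
exists (joper j'); split.
  apply: joper_bounded (hol_jets_linear H) jr' _ => M N M0.
  by have [K K0 [d d0 hK]] := jt M N M0; exists K => // i Di; have [] := hK i Di.
move=> M eps eps0; have [K K0 [d /andP[d0 d1] hK]] := jt `|M| `|M| (normr_ge0 _).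
(* Chosen so that [8 |M| <= m ^ 2], which turns the bound required by [opnorm_regj] into a
   comparison of two squares. *)
pose m := 8 * `|M| + 1.
have m0 : 0 < m by rewrite ltr_wpDl// mulr_ge0.
have Km0 : 0 < m * (K + 1) by rewrite mulr_gt0// ltr_wpDl.
exists (Num.min d (eps / (m * (K + 1)))); split.
  by rewrite lt_min d0 divr_gt0.
move=> w /andP[w0]; rewrite lt_min => /andP[wd we].
have wz : w - z != 0 by rewrite -cmod_gt0.
pose s := cmod (w - z).
pose J f c x := (w - z)^-1 * (j w f c x - j z f c x) - j' f c x.
apply: (@opnorm_regj _ 0 J M (K * s)) => [||f hf].
- by rewrite mulr_ge0// cmod_ge0.
- rewrite cmod0 expr0n mulr0 addr0.
  move: we; rewrite -/s ltr_pdivlMr// => we.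
  have s0 : 0 <= s by exact: cmod_ge0.
  have h1 : m * (K * s) <= eps by have := mulr_ge0 (ltW m0) s0; nra.
  have h0 : 0 <= K * s by exact: mulr_ge0.
  have h2 : 8 * `|M| <= m ^+ 2.
    by rewrite /m; have := normr_ge0 M; nra.
  have h3 : 8 * `|M| * (K * s) ^+ 2 <= m ^+ 2 * (K * s) ^+ 2 by rewrite ler_wpM2r// exprn_ge0.
  apply: le_trans h3 _; rewrite -exprMn; apply: lerXn2r => //; rewrite nnegrE.
    by rewrite mulr_ge0// ltW.
  exact: ltW.
have hf' : L2_supp `|M| f by apply: L2_supp_le hf; exact: ler_norm.
have fc : L2c f by exists M.
split; first by move=> x; rewrite /J /joper mulrC.
split.
  have h1 : regj 0 f (fun c x => j w f c x - j z f c x).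
    have := regj_lin (-1) (jr z f fc) (jr w f fc); rewrite mulN1r addNr.
    by apply: regj_ext => c x; ring.
  have := regj_lin (-1) (jr' f fc) (regjZ (w - z)^-1 h1); rewrite mulr0 addr0.
  by apply: regj_ext => c x; rewrite /J; ring.
move=> x k xM; have [_ _ h] := hK (f, k, x) (conj hf' xM).
have := h (w - z) (ltW wd); rewrite /jflat /wJ/= [z + _]addrC subrK -/s => h1.
rewrite /J (_ : _ - _ = (w - z)^-1 * (j w f k x - j z f k x - (w - z) * j' f k x)).
  rewrite cmodM cmodV -/s ler_pdivrMl//.
  by apply: le_trans h1 _; rewrite le_eqVlt; apply/orP; left; apply/eqP; ring.
by rewrite [RHS]mulrBr mulrA mulVf// mul1r.
Qed.

Lemma hol_jets_ext chi z j j' (J : C -> jets) : (forall w f c x, J w f c x = j w f c x) ->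
  hol_jets chi z j j' -> hol_jets chi z J j'.
Proof.
move=> e; have -> : J = j by apply/funext => w; apply/funext => f; apply/funext => c; apply/funext => x.
by [].
Qed.

Lemma hol_jetsD chi chi' z j j' k k' : hol_jets chi z j j' -> hol_jets chi' z k k' ->
  hol_jets (chi + chi') z (fun w f c x => j w f c x + k w f c x)
    (fun f c x => j' f c x + k' f c x).
Proof.
move=> [a1 a2 a3 a4] [b1 b2 b3 b4]; split.
- move=> w f hf; have := regj_lin 1 (a1 w f hf) (b1 w f hf); rewrite mul1r.
  by apply: regj_ext => c x; rewrite mul1r.
- move=> f hf; have := regj_lin 1 (a2 f hf) (b2 f hf); rewrite mul1r addr0.
  by apply: regj_ext => c x; rewrite mul1r.
- move=> w a f g hf hg x; have := a3 w a f g hf hg x; have := b3 w a f g hf hg x.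
  by rewrite /joper => -> ->; ring.
- by move=> M N M0; apply: tay2D; [exact: a4|exact: b4].
Qed.

Lemma hol_jetsM (h : C -> C) h' z j j' : hols z h h' -> hol_jets 0 z j j' ->
  hol_jets 0 z (fun w f c x => h w * j w f c x) (fun f c x => h' * j z f c x + h z * j' f c x).
Proof.
move=> hh [a1 a2 a3 a4]; split.
- by move=> w f hf; apply: regjZ; exact: a1.
- move=> f hf; have := regj_lin h' (a1 z f hf) (regjZ (h z) (a2 f hf)).
  by rewrite mulr0 addr0.
- move=> w a f g hf hg x; have := a3 w a f g hf hg x.
  by rewrite /joper => ->; ring.
- move=> M N M0.
  apply: tay2_le (tay2M (tay2_sub (D' := DJ M N) (h := fun=> tt) _ hh) (a4 M N M0)) => //.
  by move=> i _; rewrite mul1r.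
Qed.

Lemma hol_jets_cst z (j : jets) : (forall f, L2c f -> regj 0 f (j f)) ->
  linear_oper (joper j) ->
  (forall M N, 0 <= M -> exists2 K : R, 0 <= K & forall i, DJ M N i ->
     cmod (j i.1.1 i.1.2 i.2) <= K * wJ i) ->
  hol_jets 0 z (fun _ => j) (fun _ _ _ => 0).
Proof.
move=> jr jl jb; split=> //; first by move=> f _; exact: regj0.
by move=> M N M0; have [K K0 hK] := jb M N M0; exact: tay2_cst K0 hK.
Qed.

Lemma hol_jets0 z : hol_jets 0 z (fun _ _ _ _ => 0) (fun _ _ _ => 0).
Proof.
apply: hol_jets_cst => [f _||M N M0]; first exact: regj0.
  by move=> a f g _ _ x; rewrite /joper mulr0 addr0.
by exists 0 => // i _; rewrite cmod0 mul0r.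
Qed.

Lemma hol_jets_sum n z (j : nat -> C -> jets) (j' : nat -> jets) :
  (forall k, (k < n)%N -> hol_jets 0 z (j k) (j' k)) ->
  exists k', hol_jets 0 z (fun w f c x => \sum_(k < n) j k w f c x) k'.
Proof.
elim: n => [|n IH] h.
  by eexists; apply: hol_jets_ext (hol_jets0 z) => w f c x; rewrite big_ord0.
have [k' hk] := IH (fun k kn => h k (leqW kn)).
eexists; have := hol_jetsD hk (h n (ltnSn n)); rewrite addr0; apply: hol_jets_ext => w f c x.
by rewrite big_ord_recr.
Qed.

(** Holomorphy at [z] involves only nearby parameters, so a family given by different formulas at
    and off the pole can be replaced by a convenient one. *)
Lemma hol_jets_near chi z j j' (J : C -> jets) (d : R) : 0 < d ->
  (forall w, cmod (w - z) <= d -> forall f c x, J w f c x = j w f c x) ->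
  (forall w f, L2c f -> regj chi f (J w f)) -> (forall w, linear_oper (joper (J w))) ->
  hol_jets chi z j j' -> hol_jets chi z J j'.
Proof.
move=> d0 Jj Jr Jl [a1 a2 a3 a4]; split => // M N M0.
apply: tay2_near d0 _ (a4 M N M0) => t i td _; rewrite /jflat Jj//.
by rewrite [z + t]addrC addrK.
Qed.

End OperatorFamilies.

(** * Finite rank *)

Section FiniteRank.
Variable R : realType.
Local Notation C := R[i].

(** The spanning functions [e k] need not lie in the range, whereas [oper_rank] asks for a basis of
    the range. Take the largest number of sources with independent images: it is at most [n],
    because a matrix with more rows than columns has a nonzero left kernel, and maximality makes the
    images span. *)
Lemma finite_rank_span (T : oper R) n (e : nat -> R -> C) (a : nat -> (R -> C) -> C) :
  linear_oper T ->
  (forall f, L2c f -> forall x, T f x = \sum_(k < n) a k f * e k x) -> finite_rank T.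
Proof.
move=> Tl Tn.
have L20 : L2c (fun _ : R => 0 : C).
  exists 0; split=> //; split; first by split; exact: measurable_cst.
  rewrite /sqL2 (eq_integral (cst 0%E)) ?integral0//.
  by move=> x _; rewrite cmod0 expr0n.
pose ind d := exists F : 'I_d -> R -> C, (forall i, L2c (F i)) /\
  forall c : 'I_d -> C, (forall x, \sum_(i < d) c i * T (F i) x = 0) -> forall i, c i = 0.
have ind0 : ind 0%N by exists (fun _ _ => 0); split => // c _ [].
have ind_le d : ind d -> (d <= n)%N.
  move=> [F [hF Fi]]; rewrite leqNgt; apply/negP => nd.
  pose A : 'M[C]_(d, n) := \matrix_(i, k) a k (F i).
  have : kermx A != 0.
    rewrite -mxrank_eq0 mxrank_ker -lt0n subn_gt0 (leq_ltn_trans (rank_leq_col _))//.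
  case/rowV0Pn => r /sub_kermxP rA /rV0Pn [i ri].
  suff /(_ i) h : forall i, r ord0 i = 0 by rewrite h eqxx in ri.
  apply: Fi => x.
  rewrite (eq_bigr (fun j => \sum_(k < n) r ord0 j * A j k * e k x)); last first.
    move=> j _; rewrite Tn// mulr_sumr; apply: eq_bigr => k _; by rewrite mxE mulrA.
  rewrite exchange_big/= big1// => k _; rewrite -mulr_suml.
  have := congr1 (fun B : 'rV_n => B ord0 k) rA; rewrite !mxE => ->; exact: mul0r.
have [d id dmax] : exists2 d, ind d & forall d', ind d' -> (d' <= d)%N.
  have ex : exists d, `[< ind d >] by exists 0%N; exact/asboolP.
  have ub d : `[< ind d >] -> (d <= n)%N by move=> /asboolP; exact: ind_le.
  case: (ex_maxnP ex ub) => d /asboolP hd hm; exists d => // d' hd'.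
  by apply: hm; exact/asboolP.
have [F [hF Fi]] := id; exists d, (fun i => T (F i)); split=> [i||f hf].
- by exists (F i).
- exact: Fi.
apply: contrapT => nex.
suff : ind d.+1 by move/dmax; rewrite ltnn.
exists (fun i => if unlift ord_max i is Some j then F j else f); split.
  by move=> i; case: unlift.
move=> c hc.
have hc' x : \sum_(i < d) c (lift ord_max i) * T (F i) x + c ord_max * T f x = 0.
  have := hc x; rewrite big_ord_recr /= unlift_none => h.
  rewrite -[RHS]h; congr (_ + _); apply: eq_bigr => i _.
  have e' : widen_ord (leqnSn d) i = lift ord_max i.
    by apply: val_inj; rewrite /= /bump leqNgt ltn_ord.
  by rewrite e' liftK.
have cm : c ord_max = 0.
  apply/eqP; apply: contrapT => /negP c0; apply: nex.
  exists (fun i => - (c (lift ord_max i) / c ord_max)) => x.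
  rewrite (eq_bigr (fun i => - (c ord_max)^-1 * (c (lift ord_max i) * T (F i) x))); last first.
    by move=> i _; ring.
  have := hc' x; move/eqP; rewrite addr_eq0 -mulr_sumr => /eqP ->.
  by rewrite mulrNN mulrA mulVf// mul1r.
move=> i; case: (unliftP ord_max i) => [j ->|->] //.
apply: (Fi (fun j => c (lift ord_max j))) => x.
by have := hc' x; rewrite cm mul0r addr0.
Qed.

End FiniteRank.

(** * Laurent expansion of the resolvent *)

Section ResolventLaurent.
Variable R : realType.
Local Notation C := R[i].
Implicit Types (f g : R -> C) (z w : C).

Lemma entire_if (I : Type) (D : I -> Prop) (wt : I -> R) (b : I -> bool) (F G : C -> I -> C) :
  entire D wt F -> entire D wt G -> entire D wt (fun z i => if b i then F z i else G z i).
Proof.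
move=> hF hG z0; have [a1 h1] := hF z0; have [a2 h2] := hG z0.
exists (fun n i => if b i then a1 n i else a2 n i) => rho r1.
have [K K0 hK] := h1 rho r1; have [L L0 hL] := h2 rho r1.
exists (K + L) => [|i Di]; first exact: addr_ge0.
have [k1 k2] := hK i Di; have [l1 l2] := hL i Di.
have r0 : 0 < rho by exact: lt_le_trans r1.
have Kw : 0 <= K * wt i by apply: le_trans (k1 0%N); rewrite mulr_ge0 ?cmod_ge0 ?exprn_ge0// ltW.
have Lw : 0 <= L * wt i by apply: le_trans (l1 0%N); rewrite mulr_ge0 ?cmod_ge0 ?exprn_ge0// ltW.
have p t N : 0 <= (cmod t / rho) ^+ N by rewrite exprn_ge0// divr_ge0 ?cmod_ge0// ltW.
rewrite mulrDl; case: (b i); split=> [n|N t tr].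
- by rewrite (le_trans (k1 n))// lerDl.
- by rewrite (le_trans (k2 N t tr))// ler_wpM2r// lerDl.
- by rewrite (le_trans (l1 n))// lerDr.
- by rewrite (le_trans (l2 N t tr))// ler_wpM2r// lerDr.
Qed.

Variables (V : R -> C) (v : R).
Hypotheses (cV : ccont V) (hV : forall x, cmod (V x) <= v).
Hypothesis V_out : forall x, ~~ (0 < x < 1) -> V x = 0.

Let v0 : 0 <= v. Proof. exact: le_trans (cmod_ge0 _) (hV 0). Qed.

Definition jE z : jets R := fun f c x =>
  if c == 0%N then esol V z f x else if c == 1%N then esolp V z f x - prim0 f x
  else (V x - z ^+ 2) * esol V z f x.

Definition jphi z (c : nat) x : C :=
  if c == 0%N then phi V z x else if c == 1%N then phip V z x
  else (V x - z ^+ 2) * phi V z x.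

Lemma entire_potential (I : Type) (D : I -> Prop) (wt : I -> R) (h : I -> R) F :
  entire D wt F -> entire D wt (fun z i => (V (h i) - z ^+ 2) * F z i).
Proof.
move=> hF; apply: (@entire_ext _ _ _ _ (fun z i => V (h i) * F z i - z * (z * F z i))).
  by move=> z i _; ring.
apply: entireB; last by do 2!apply: entire_mulz.
apply: (@entire_le _ _ _ (fun i => 1 * wt i)) => [i _|]; first by rewrite mul1r.
apply: entireM hF; apply: (@entire_cst _ _ _ _ _ v) => // i _; rewrite mulr1; exact: hV.
Qed.

(** A coefficient into which the source does not enter solves a homogeneous recursion with
    continuous data and needs no correction by [prim0 f]. *)
Lemma coef_reg (u p : C -> R -> C) z0 f (g : nat -> R -> C) n :
  (forall x, entireS (u ^~ x)) ->
  (forall m x, cder (fun y => tcoef z0 (u ^~ y) m) x (tcoef z0 (p ^~ x) m + g m x) /\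
    cder (fun y => tcoef z0 (p ^~ y) m) x (tcoef z0 (fun z => (V x - z ^+ 2) * u z x) m)) ->
  (forall x, g n x = 0) ->
  reg (fun x => 0 * prim0 f x) (fun x => tcoef z0 (u ^~ x) n) (fun x => tcoef z0 (p ^~ x) n)
    (fun x => tcoef z0 (fun z => (V x - z ^+ 2) * u z x) n).
Proof.
move=> eu h g0.
have cU m : ccont (fun x => tcoef z0 (u ^~ x) m) by exact: (cder_ccont (fun x => proj1 (h m x))).
split.
- by move=> x; have [h1 _] := h n x; rewrite g0 addr0 in h1.
- exact: (cder_ccont (fun x => proj2 (h n x))).
- move=> x; have [_ h2] := h n x; apply: cder_ext h2 => // y.
  by rewrite mul0r addr0.
- apply: ccont_ext; first by move=> x; rewrite tcoef_potential//.
  apply: ccontB; [apply: ccontB|].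
  + by apply: ccontM => //; exact: ccontVz.
  + by case: n {g0} => [|m]; [rewrite mulr0; exact: ccont_cst|exact: ccontZ].
  + by case: n {g0} => [|[|m]]; [exact: ccont_cst|exact: ccont_cst|exact: cU].
Qed.

Section Esol.
Variables (M : R).
Hypothesis M0 : 0 <= M.

Let cG f : L2_supp M f -> ccont (fun x => - prim0 f x).
Proof. by move=> hf; apply: ccontN; exact: ccont_prim0 M0 hf. Qed.

Let hG f : L2_supp M f -> forall x, cmod (- prim0 f x) <= 2 * (M + 1) * nrm f.
Proof. by move=> hf x; rewrite cmodN; exact: prim0_le. Qed.

Let hsol z f : L2_supp M f ->
  odesol (fun x => V x - z ^+ 2) (fun x => - prim0 f x) (fun _ => 0) (esol V z f) (esolp V z f).
Proof. by move=> hf; have [] := esolP cV hV z M0 hf. Qed.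

Let hu z f : L2_supp M f -> esol V z f (- (M + 1)) = 0.
Proof. by move=> hf; have [_ /(_ _ (lexx _))[]] := esolP cV hV z M0 hf. Qed.

Let hp z f : L2_supp M f -> esolp V z f (- (M + 1)) = 0 + 0 * z.
Proof. by move=> hf; have [_ /(_ _ (lexx _))[]] := esolP cV hV z M0 hf; rewrite mul0r addr0. Qed.

Lemma esol_entire N : entire (DJ M N) (@wJ R) (fun z i => esol V z i.1.1 i.2) /\
  entire (DJ M N) (@wJ R) (fun z i => esolp V z i.1.1 i.2).
Proof.
have [h1 h2] := ode_entire cV hV cG hG hsol hu hp (N + M + 1).
pose h (i : (R -> C) * nat * R) := (i.1.1, i.2).
have Dh : forall i, DJ M N i -> L2_supp M (h i).1 /\ `|(h i).2 - - (M + 1)| <= N + M + 1.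
  move=> [[f c] x] [/= hf xN]; split=> //; rewrite opprK (le_trans (ler_normD _ _))//.
  by rewrite [`|M + 1|]ger0_norm ?addr_ge0//; lra.
have k0 : 0 <= 2 * (M + 1) by rewrite mulr_ge0// addr_ge0.
have fin F : entire (DJ M N) (fun i => cmod (0 : C) + cmod (0 : C) + cmod (0 : C) + 2 * (M + 1) * nrm i.1.1) F ->
    entire (DJ M N) (@wJ R) F.
  move=> hF; apply: entire_scale k0 _; apply: entire_le hF => i _.
  by rewrite cmod0 !add0r.
split; apply: fin.
  exact: (entire_sub Dh h1).
exact: (entire_sub Dh h2).
Qed.

Lemma jE_entire N : entire (DJ M N) (@wJ R) (jflat jE).
Proof.
have [h1 h2] := esol_entire N.
apply: (entire_if (fun i => i.1.2 == 0%N)) => //.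
apply: (entire_if (fun i => i.1.2 == 1%N)).
  apply: entireB => //; apply: (@entire_cst _ _ _ _ _ (2 * (M + 1))).
    by rewrite mulr_ge0// addr_ge0.
  by move=> i [hf _]; exact: prim0_le.
exact: (@entire_potential _ _ _ (fun i => i.2)).
Qed.

Lemma jE_tcoef1_reg z0 f : L2_supp M f ->
  regj 0 f (fun c x => tcoef z0 (fun z => jE z f c x) 1).
Proof.
move=> hf.
have e x := ode_entire_single cV hV cG hG hsol hu hp x hf.
have := @coef_reg (fun z x => esol V z f x) (fun z x => esolp V z f x) z0 f
  (fun m x => if m == 0%N then - prim0 f x else 0) 1 (fun x => (e x).1)
  (fun m x => ode_tcoef cV hV cG hG hsol hu hp z0 m x hf) (fun=> erefl).
apply: reg_ext => // x; rewrite /jE/=.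
by rewrite tcoefB ?tcoef_cst ?subr0//; [have [] := e x|exact: entireS_cst].
Qed.

End Esol.

Let phi_sol z (j : unit) : True -> odesol (fun x => V x - z ^+ 2) (fun _ => 0) (fun _ => 0)
  (phi V z) (phip V z).
Proof. by move=> _; have [] := phiP cV hV z. Qed.

Let phi_u z (j : unit) : True -> phi V z 0 = 1.
Proof. by move=> _; have [] := phiP cV hV z. Qed.

Let phi_p z (j : unit) : True -> phip V z 0 = 0 + - 'i * z.
Proof. by move=> _; have [] := phiP cV hV z; rewrite add0r. Qed.

Let c0 (j : unit) : True -> ccont (fun _ : R => 0 : C).
Proof. by move=> _; exact: ccont_cst. Qed.

Let h0 (j : unit) : True -> forall x : R, cmod (0 : C) <= 0.
Proof. by move=> _ x; rewrite cmod0. Qed.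

Lemma phi_entire x : entireS (phi V ^~ x) /\ entireS (phip V ^~ x).
Proof. exact: (ode_entire_single cV hV c0 h0 phi_sol phi_u phi_p x (j := tt) I). Qed.

Lemma jphi_entire N : entire (fun i : (R -> C) * nat * R => `|i.2| <= N) (fun _ => 1)
  (fun z i => jphi z i.1.2 i.2).
Proof.
have [h1 h2] := ode_entire cV hV c0 h0 phi_sol phi_u phi_p N.
pose h (i : (R -> C) * nat * R) := (tt, i.2).
have Dh : forall i : (R -> C) * nat * R, `|i.2| <= N -> True /\ `|(h i).2 - 0| <= N.
  by move=> i; rewrite subr0.
have fin F : entire (fun i : (R -> C) * nat * R => `|i.2| <= N)
    (fun i => cmod (1 : C) + cmod (0 : C) + cmod (- 'i : C) + 0) F ->
    entire (fun i : (R -> C) * nat * R => `|i.2| <= N) (fun _ => 1) F.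
  move=> hF; apply: (@entire_scale _ _ _ _ 2) => //; apply: entire_le hF => i _.
  by rewrite cmod0 cmod1 cmodN cmod_i; lra.
have f1 := fin _ (entire_sub Dh h1); have f2 := fin _ (entire_sub Dh h2).
apply: (entire_if (fun i => i.1.2 == 0%N)) => //.
apply: (entire_if (fun i => i.1.2 == 1%N)) => //.
exact: (@entire_potential _ _ _ (fun i => i.2)).
Qed.

Lemma jphi_tcoef_reg z0 n f : regj 0 f (fun c x => tcoef z0 (fun z => jphi z c x) n).
Proof.
have := @coef_reg (phi V) (phip V) z0 f (fun m x => if m == 0%N then 0 else 0) n
  (fun x => (phi_entire x).1)
  (fun m x => ode_tcoef cV hV c0 h0 phi_sol phi_u phi_p z0 m x (j := tt) I).
by apply=> x; case: ifP.
Qed.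

Lemma outf_entire (J : Type) (D : J -> Prop) (wt : J -> R) (c : J -> C) (K X : R)
    (u p : C -> J -> C) : 0 <= K -> (forall i, D i -> cmod (c i) <= K * wt i) ->
  entire D wt u -> entire D wt p ->
  entire D wt (fun z i => outf z (c i) X (fun _ => u z i) (fun _ => p z i)).
Proof.
move=> K0 hc hu hp.
apply: (@entire_le _ _ _ (fun i => 1 * wt i)) => [i _|]; first by rewrite mul1r.
apply: entireM.
  exact: (entire_sub (D' := D) (h := fun=> tt) (fun _ _ => I) (cexp_entire X)).
apply: entireB; first by apply: entireB => //; exact: entire_cst K0 hc.
apply: (@entire_ext _ _ _ _ (fun z i => 'i * (z * u z i))) => [z i _|]; first by rewrite mulrA.
by apply: entireZ; exact: entire_mulz.
Qed.

Lemma ell_entire M : 0 <= M -> entire (fun f => L2_supp M f) (@nrm R) (ell V).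
Proof.
move=> M0; have [h1 h2] := esol_entire M0 (M + 2).
pose h f : (R -> C) * nat * R := (f, 0%N, M + 2).
have Dh : forall f, L2_supp M f -> DJ M (M + 2) (h f).
  by move=> f hf; split=> //=; rewrite ger0_norm// addr_ge0.
apply: (@entire_ext _ _ _ _ (fun z f => outf z (prim0 f (M + 2)) (M + 2)
    (fun _ => esol V z f (M + 2)) (fun _ => esolp V z f (M + 2)))).
  by move=> z f hf; rewrite (ellE cV hV V_out z M0 hf (lexx _)).
apply: (@outf_entire _ _ _ _ (2 * (M + 1))).
- by rewrite mulr_ge0// addr_ge0.
- by move=> f hf; exact: prim0_le.
- exact: (entire_sub Dh h1).
- exact: (entire_sub Dh h2).
Qed.

Lemma Wr_entire : entireS (Wr V).
Proof.
have [h1 h2] := phi_entire 1.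
apply: (@outf_entire unit (fun=> True) (fun=> 1) (fun=> 0) 0 1 (fun z _ => phi V z 1)
  (fun z _ => phip V z 1)) => // i _; by rewrite cmod0 mul0r.
Qed.

Lemma tcoef_mulx (F G : C -> C) z0 n : entx z0 F -> entx z0 G ->
  tcoef z0 (fun z => F z * G z) n = \sum_(k < n.+1) tcoef z0 F k * tcoef z0 G (n - k)%N.
Proof.
move=> hF hG.
by rewrite (tcoefE (i := tt) (entM (ent_tcoef hF) (ent_tcoef hG)) I n).
Qed.

Section WeightedProduct.
Variables (G : C -> C) (z0 : C).
Hypothesis hG : entx z0 G.

(** The rank one part of the resolvent with a scalar weight [G] in place of the inverse Wronskian.
    The weight will be the constant 1 or a truncated inverse with an expansion at [z0]. *)
Definition jP z : jets R := fun f c x => ell V z f * G z * jphi z c x.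

Definition cP n : jets R := fun f c x => tcoef z0 (fun z => jP z f c x) n.

Lemma jP_ent M N : 0 <= M ->
  ent (DJ M N) (@wJ R) z0 (jflat jP) (fun n i => cP n i.1.1 i.1.2 i.2).
Proof.
move=> M0; apply: (@ent_tcoef _ _ _ _ _ (jflat jP)).
have [a ha] := @entire_sub _ _ _ (DJ M N) (fun i => i.1.1) _ _ _ (fun i h => proj1 h)
  (ell_entire M0) z0.
have [b hb] := @entire_sub _ _ _ (DJ M N) id _ _ _ (fun i h => proj2 h) (jphi_entire N) z0.
have [c hc] := hG.
have hc' : ent (DJ M N) (fun _ => 1) z0 (fun z _ => G z) (fun n _ => c n tt).
  move=> rho r1; have [K K0 /(_ tt I) hK] := hc rho r1; exists K => // i _; exact: hK.
eexists; have := entM (entM ha hc') hb.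
rewrite (_ : (fun i => _ * _ * 1) = @wJ R); first exact.
by apply/funext => i; rewrite !mulr1.
Qed.

Lemma ell_entx f : L2c f -> entx z0 (ell V ^~ f).
Proof.
move=> /L2c_supp [M M0 hf].
exact: (@entx_single _ _ _ _ _ _ _ f (entireP (ell_entire M0) z0) hf).
Qed.

Lemma jphi_entx c x : entx z0 (fun z => jphi z c x).
Proof.
exact: (@entx_single _ _ _ _ _ _ _ (fun=> 0, c, x) (entireP (jphi_entire `|x|) z0) (lexx _)).
Qed.

Lemma jP_entx f c x : L2c f -> entx z0 (fun z => jP z f c x).
Proof. by move=> hf; apply: entxM (jphi_entx c x); exact: entxM (ell_entx hf) hG. Qed.

(** The functions of [x] on the right do not involve [f], and there are [n + 1] of them: this is the
    finite rank of the principal part. *)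
Lemma cP_sum n f c x : L2c f -> cP n f c x = \sum_(k < n.+1)
  tcoef z0 (fun z => ell V z f * G z) k * tcoef z0 (fun z => jphi z c x) (n - k)%N.
Proof.
move=> hf; rewrite /cP /jP tcoef_mulx//; last exact: jphi_entx.
exact: entxM (ell_entx hf) hG.
Qed.

Lemma cP_reg n f : L2c f -> regj 0 f (cP n f).
Proof.
move=> hf; apply: regj_ext; first by move=> c x; rewrite cP_sum.
apply: (@regj_sum _ _ f (fun k c x => tcoef z0 (fun z => ell V z f * G z) k *
  tcoef z0 (fun z => jphi z c x) (n - k)%N)) => k _.
by apply: regjZ; exact: jphi_tcoef_reg.
Qed.

Lemma jP_reg z f : L2c f -> regj 0 f (jP z f).
Proof.
move=> hf; apply: regjZ; apply: reg_ext (phi_reg cV hV z) => // x.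
by rewrite mul0r.
Qed.

Lemma jP_linear z a f g c x : L2c f -> L2c g ->
  jP z (fun y => a * f y + g y) c x = a * jP z f c x + jP z g c x.
Proof. by move=> hf hg; rewrite /jP (ell_lin cV hV V_out)//; ring. Qed.

Lemma cP_linear n a f g c x : L2c f -> L2c g ->
  cP n (fun y => a * f y + g y) c x = a * cP n f c x + cP n g c x.
Proof.
move=> hf hg; rewrite /cP -tcoef_linx; [|exact: jP_entx..].
by congr (tcoef z0 _ n); apply/funext => z; rewrite jP_linear.
Qed.

Lemma cP_bound n M N : 0 <= M -> exists2 K : R, 0 <= K & forall i, DJ M N i ->
  cmod (cP n i.1.1 i.1.2 i.2) <= K * wJ i.
Proof.
move=> M0; have [K K0 h] := jP_ent N M0 (lexx 1).
exists K => // i Di; have [/(_ n) + _] := h i Di.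
by rewrite expr1n mulr1.
Qed.

Lemma cP_oper n (a : C) : bounded_oper (fun f x => a * cP n f 0%N x) /\
  finite_rank (fun f x => a * cP n f 0%N x).
Proof.
have l : linear_oper (fun f x => a * cP n f 0%N x).
  by move=> b f g hf hg x; rewrite cP_linear//; ring.
split.
  apply: (@joper_bounded _ (fun f c x => a * cP n f c x) 0) => // [f hf|M N M0].
    by apply: regjZ; exact: cP_reg.
  have [K K0 h] := cP_bound n N M0; exists (cmod a * K) => [|i Di].
    by rewrite mulr_ge0// cmod_ge0.
  by rewrite cmodM -mulrA ler_wpM2l ?cmod_ge0// h.
apply: (@finite_rank_span _ _ n.+1 (fun k x => tcoef z0 (fun z => jphi z 0%N x) (n - k))
  (fun k f => a * tcoef z0 (fun z => ell V z f * G z) k)) => // f hf x.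
by rewrite cP_sum// mulr_sumr; apply: eq_bigr => k _; rewrite mulrA.
Qed.

End WeightedProduct.

Let one : C -> C := fun _ => 1.
Let one_entx z : entx z one. Proof. exact: entx_cst. Qed.

Lemma jE_hol z : hol_jets 1 z jE (fun f c x => tcoef z (fun w => jE w f c x) 1).
Proof.
split.
- move=> w f hf; exact: esol_reg hf.
- by move=> f /L2c_supp[M M0 hf]; exact: (jE_tcoef1_reg M0).
- by move=> w a f g hf hg x; have [h _] := esol_lin cV hV w a hf hg x; exact: h.
- by move=> M N M0; exact: (tay2_entire z (jE_entire M0 N)).
Qed.

Lemma jP1_hol z : hol_jets 0 z (jP one) (cP one z 1).
Proof.
split.
- by move=> w f hf; exact: jP_reg.
- by move=> f hf; apply: cP_reg.
- by move=> w a f g hf hg x; exact: jP_linear.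
- move=> M N M0; have h := jP_ent (one_entx z) N M0; apply: (tay2_ent h) => i Di.
  have [K K0 /(_ i Di)[_ /(_ 1%N 0)]] := h 1 (lexx _).
  rewrite cmod0 mul0r expr1 mulr0 => /(_ ler01).
  rewrite psumS psum0 add0r expr0 mulr1 addr0 => h1; apply/eqP.
  by rewrite -subr_eq0 -cmod_eq0 eq_le cmod_ge0 andbT.
Qed.

Definition jT z : jets R := fun f c x => jE z f c x + - (Wr V z)^-1 * jP one z f c x.

Lemma jT_Tres z f x : joper (jT z) f x = Tres V z f x.
Proof. by rewrite /joper /jT /jE /jP /jphi /Tres /alpha /one/=; ring. Qed.

Lemma jT_hol z : Wr V z != 0 -> exists j', hol_jets 1 z jT j'.
Proof.
move=> W0; have h := holsV (hols_entire z Wr_entire) W0.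
have h1 := holsM (hols_entire z (entireS_cst (-1))) h.
eexists; have := hol_jetsD (jE_hol z) (hol_jetsM h1 (jP1_hol z)); rewrite addr0.
by apply: hol_jets_ext => w f c x; rewrite /jT; ring.
Qed.

Lemma jT_reg w f : L2c f -> regj 1 f (jT w f).
Proof.
move=> hf; have [r _ _ _] := jE_hol w.
by have := regj_lin 1 (r w f hf) (regjZ (- (Wr V w)^-1) (jP_reg one w hf)); rewrite mulr1 addr0;
  apply: regj_ext => c x; rewrite mul1r.
Qed.

(** On a small disc the quotient stays within half of its central value. That its relative deviation
    is of order [t] serves the Laurent expansion; that it is at most 1/2 serves the geometric series
    on a whole circle. *)
Lemma divz_near (F : C -> C) z0 m : entireS F -> tcoef z0 F m != 0 ->
  (forall k, (k < m)%N -> tcoef z0 F k = 0) ->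
  exists2 K : R, 0 <= K & exists2 r : R, 0 < r <= 1 & forall t, cmod t <= r ->
  [/\ cmod (tcoef z0 F m) / 2 <= cmod (divz F z0 m (z0 + t)),
      cmod (1 - divz F z0 m (z0 + t) / tcoef z0 F m) <= K * cmod t,
      cmod (1 - divz F z0 m (z0 + t) / tcoef z0 F m) <= 1 / 2
    & t != 0 -> F (z0 + t) = t ^+ m * divz F z0 m (z0 + t)].
Proof.
move=> hF g0 low; set g := divz F z0 m; set c := tcoef z0 F m in g0 *.
have [K K0 /(_ tt I)[_ hK]] := ent_divz hF low (lexx 1).
have c0' : 0 < cmod c by rewrite cmod_gt0.
exists (K / cmod c); first by rewrite divr_ge0// ltW.
have K1 : 0 < 2 * (K + 1) by rewrite mulr_gt0// ltr_wpDl.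
exists (Num.min 1 (cmod c / (2 * (K + 1)))).
  by rewrite lt_min ltr01 divr_gt0//= ge_min lexx.
move=> t; rewrite le_min => /andP[t1]; rewrite ler_pdivlMr// => te.
have h : cmod (g (z0 + t) - c) <= K * cmod t.
  have := hK 1%N t t1; rewrite psumS psum0 add0r expr0 !mulr1 add0n divr1 expr1; exact.
have hc : K * cmod t <= cmod c / 2.
  have := mulr_ge0 K0 (cmod_ge0 t); have := cmod_ge0 t; lra.
have e : cmod (1 - g (z0 + t) / c) = cmod (g (z0 + t) - c) / cmod c.
  by rewrite -cmod_div cmod_distC mulrBl divff.
split.
- have := cmod_dist c (g (z0 + t)); rewrite cmod_distC ler_norml => /andP[_ h2]; lra.
- by rewrite e mulrAC ler_wpM2r// invr_ge0 ltW.
- rewrite e ler_pdivrMr//; lra.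
- move=> t0; rewrite /g /divz; case: eqP => [/eqP|_].
    by rewrite -subr_eq0 addrC addKr (negbTE t0).
  by rewrite [z0 + t]addrC addrK mulrC divfK// expf_neq0.
Qed.

Lemma geom_inv (x : C) N : x * \sum_(k < N) (1 - x) ^+ k = 1 - (1 - x) ^+ N.
Proof.
elim: N => [|N IH]; first by rewrite big_ord0 mulr0 expr0 subrr.
by rewrite big_ord_recr /= mulrDr IH exprS; ring.
Qed.

Section LaurentAt.
Variables (z0 : C) (m : nat).
Hypotheses (W0 : tcoef z0 (Wr V) m != 0) (Wlow : forall k, (k < m)%N -> tcoef z0 (Wr V) k = 0).

Let g := divz (Wr V) z0 m.
Let g0 := tcoef z0 (Wr V) m.

Let g_entx : entx z0 g.
Proof. by eexists; exact: ent_divz Wr_entire Wlow. Qed.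

(* A partial sum of the expansion of [1 / g] in powers of [1 - g / g0]. *)
Definition ginv N z : C := g0^-1 * \sum_(k < N) (1 - g z / g0) ^+ k.

Lemma ginv_entx N : entx z0 (ginv N).
Proof.
apply: entxZ; apply: (@entx_sum _ N (fun k z => (1 - g z / g0) ^+ k)) => k; apply: entxX.
apply: (@entx_ext _ (fun z => 1 + - g0^-1 * g z)) => [z|].
  by rewrite mulNr mulrC.
by apply: entxD; [exact: entx_cst|exact: entxZ].
Qed.

Lemma ginvP N z : g z != 0 -> (g z)^-1 = ginv N z + (1 - g z / g0) ^+ N / g z.
Proof.
move=> gz; have h := geom_inv (g z / g0) N.
apply: (mulfI gz); rewrite divff// /ginv mulrDr [g z * (_ / _)]mulrC divfK//.
by rewrite mulrA h subrK.
Qed.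

Lemma ginv_at N : ginv N.+1 z0 = g0^-1.
Proof.
have gz : g z0 = g0 by rewrite /g /divz eqxx.
rewrite /ginv gz divff// subrr big_ord_recl expr0 big1 ?addr0 ?mulr1// => i _.
by rewrite /= expr0n.
Qed.

(** With [m + 2] terms of the geometric series the error in [1 / g] is of order [t ^ (m + 2)]. After
    division by [t ^ m] it is still of second order, so it contributes neither a value nor a
    derivative at [z0]. *)
Let G := ginv m.+2.
Let cG n := cP G z0 n.
Let G_entx : entx z0 G := ginv_entx _.

Let cG_lin n a f h c x : L2c f -> L2c h ->
  cG n (fun y => a * f y + h y) c x = a * cG n f c x + cG n h c x.
Proof. exact: cP_linear. Qed.

(** The product with weight [G], minus its Taylor polynomial of degree below [m], divided by the
    m-th power; the value at [z0] is the m-th coefficient. *)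
Definition jprin w : jets R := fun f c x => if w == z0 then cG m f c x
  else (w - z0) ^- m * (jP G w f c x - \sum_(n < m) cG n f c x * (w - z0) ^+ n).

(** The contribution of the tail of the geometric series for [1 / g]. *)
Definition jrem w : jets R := fun f c x => if w == z0 then 0
  else (w - z0) ^- m * ((1 - g w / g0) ^+ m.+2 / g w) * jP one w f c x.

Lemma jprin_hol : hol_jets 0 z0 jprin (cG m.+1).
Proof.
split.
- move=> w f hf; rewrite /jprin; case: eqP => _; first exact: cP_reg.
  apply: regjZ; have hs : regj 0 f (fun c x => \sum_(n < m) (w - z0) ^+ n * cG n f c x).
    by apply: (@regj_sum _ _ f (fun n c x => (w - z0) ^+ n * cG n f c x)) => n _;
      apply: regjZ; exact: cP_reg.
  have := regj_lin (-1) hs (jP_reg G w hf); rewrite mulr0 addr0; apply: regj_ext => c x.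
  rewrite mulN1r addrC; congr (_ - _); by apply: eq_bigr => n _; rewrite mulrC.
- by move=> f hf; exact: cP_reg.
- move=> w a f h hf hh x; rewrite /joper /jprin; case: eqP => _; first exact: cP_linear.
  rewrite jP_linear// (eq_bigr (fun n : 'I_m => a * (cG n f 0%N x * (w - z0) ^+ n) + cG n h 0%N x * (w - z0) ^+ n)).
    by rewrite big_split/= -mulr_sumr; ring.
  by move=> n _; rewrite cG_lin//; ring.
move=> M N M0; have [K K0 hK] := jP_ent G_entx N M0 (lexx 1).
exists K => //; exists 1; rewrite ?ltr01 ?lexx// => i Di; have [h1 h2] := hK i Di.
rewrite /jflat /jprin eqxx; split.
- by have := h1 m; rewrite expr1n mulr1.
- by have := h1 m.+1; rewrite expr1n mulr1.
move=> t t1; have [->|t0] := eqVneq t 0.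
  rewrite addr0 eqxx mul0r !subrr cmod0 expr0n/= mulr0//.
rewrite -subr_eq0 [z0 + t]addrC addrK (negbTE t0).
have := h2 m.+2 t t1; rewrite !psumS divr1 [z0 + t]addrC /jflat => h.
rewrite (_ : _ - _ = t ^- m * (jP G (t + z0) i.1.1 i.1.2 i.2 -
   (psum (fun n => cG n i.1.1 i.1.2 i.2) m t + cG m i.1.1 i.1.2 i.2 * t ^+ m
     + cG m.+1 i.1.1 i.1.2 i.2 * t ^+ m.+1))); last first.
  rewrite /psum exprSr; field; exact: expf_neq0.
rewrite cmodM cmodV cmodX ler_pdivrMl ?exprn_gt0 ?cmod_gt0//.
apply: le_trans h _; rewrite -[m.+2]addn2 exprD le_eqVlt; apply/orP; left; apply/eqP; ring.
Qed.

Lemma jrem_hol : hol_jets 0 z0 jrem (fun _ _ _ => 0).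
Proof.
have [K K0 [r /andP[r0 r1] hr]] := divz_near Wr_entire W0 Wlow.
split.
- move=> w f hf; rewrite /jrem; case: eqP => _; first exact: regj0.
  by apply: regjZ; exact: jP_reg.
- by move=> f hf; exact: regj0.
- move=> w a f h hf hh x; rewrite /joper /jrem; case: eqP => _; first by rewrite mulr0 addr0.
  by rewrite jP_linear//; ring.
move=> M N M0; have [L L0 hL] := jP_ent (one_entx z0) N M0 (lexx 1).
have c0' : 0 < cmod g0 by rewrite cmod_gt0.
pose S := K ^+ m.+2 * (2 / cmod g0) * L.
have S0' : 0 <= K ^+ m.+2 * (2 / cmod g0) by rewrite mulr_ge0// ?exprn_ge0// divr_ge0// ltW.
have S0 : 0 <= S by rewrite mulr_ge0.
exists S => //; exists r; rewrite ?r0// => i Di; have [_ h2] := hL i Di.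
have Lw : 0 <= L * wJ i.
  by have := h2 0%N 0; rewrite expr0 mulr1 cmod0; move=> /(_ ler01); exact: le_trans (cmod_ge0 _).
have Sw : S * wJ i = K ^+ m.+2 * (2 / cmod g0) * (L * wJ i) by rewrite /S; ring.
have Sw0 : 0 <= S * wJ i.
  by rewrite Sw mulr_ge0.
rewrite /jflat /jrem eqxx cmod0; split=> // t tr.
rewrite mulr0 !subr0; case: eqP => [_|/eqP t0']; first by rewrite cmod0 mulr_ge0// exprn_ge0// cmod_ge0.
have t0 : t != 0 by apply: contraNneq t0' => ->; rewrite addr0.
have [b1 b2 _ _] := hr t tr; rewrite -/g -/g0 in b1 b2.
have b3 : cmod (jP one (z0 + t) i.1.1 i.1.2 i.2) <= L * wJ i.
  have := h2 0%N t (le_trans tr r1); rewrite psum0 subr0 expr0 mulr1; exact.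
rewrite [z0 + t - z0](_ : _ = t); last by ring.
have gp : 0 < cmod (g (z0 + t)) by rewrite (lt_le_trans _ b1)// divr_gt0.
have tp : 0 < cmod t ^+ m by rewrite exprn_gt0// cmod_gt0.
rewrite [cmod (_ * jP _ _ _ _ _)]cmodM [cmod (t ^- m * _)]cmodM cmodV cmodX cmod_div cmodX Sw.
rewrite -[leLHS]mulrA ler_pdivrMl// mulrA.
have e1 : cmod (1 - g (z0 + t) / g0) ^+ m.+2 <= K ^+ m.+2 * cmod t ^+ m.+2.
  by rewrite -exprMn lerXn2r// nnegrE ?mulr_ge0 ?cmod_ge0.
have e2 : (cmod (g (z0 + t)))^-1 <= 2 / cmod g0.
  by rewrite -[2 / _]invf_div lef_pV2// posrE divr_gt0.
have e3 : 0 <= (cmod (g (z0 + t)))^-1 by rewrite invr_ge0 ltW.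
apply: le_trans (ler_pM _ _ (ler_pM _ _ e1 e2) b3) _ => //.
- by rewrite mulr_ge0// exprn_ge0// cmod_ge0.
- exact: cmod_ge0.
- by rewrite exprn_ge0// cmod_ge0.
by rewrite -[m.+2]addn2 !exprD; rewrite le_eqVlt; apply/orP; left; apply/eqP; ring.
Qed.

(** The resolvent minus its principal part, filled in at [z0]. The signs of the sum reflect the
    minus sign of [1 / Wr] in [jT]. *)
Definition jA0 w : jets R := fun f c x => if w == z0 then jE w f c x - cG m f c x
  else jT w f c x + \sum_(j < m) cG (m - j.+1)%N f c x / (w - z0) ^+ j.+1.

Lemma jA0_near (w : C) f c x : w != z0 -> Wr V w = (w - z0) ^+ m * g w -> g w != 0 ->
  jA0 w f c x = jE w f c x - (jprin w f c x + jrem w f c x).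
Proof.
move=> wz Ww gw; rewrite /jA0 /jprin /jrem (negbTE wz) /jT Ww.
have wz0 : w - z0 != 0 by rewrite subr_eq0.
have -> : \sum_(j < m) cG (m - j.+1)%N f c x / (w - z0) ^+ j.+1 =
    (w - z0) ^- m * \sum_(n < m) cG n f c x * (w - z0) ^+ n.
  rewrite (reindex_inj rev_ord_inj) mulr_sumr; apply: eq_bigr => j _ /=.
  rewrite subnSK// subKn 1?ltnW//.
  have -> : (w - z0) ^+ m = (w - z0) ^+ (m - j) * (w - z0) ^+ j.
    by rewrite -exprD subnK// ltnW.
  by field; rewrite !expf_neq0.
have -> : jP G w f c x = G w * jP one w f c x by rewrite /jP /one; ring.
rewrite invfM [in LHS](ginvP m.+2 gw) -/G.
set X := (w - z0) ^- m; set Y := _ ^+ m.+2 / _; set S := \sum_(_ < _) _.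
by move: (G w) (jP one w f c x) (jE w f c x) X Y S => *; ring.
Qed.

Lemma jA0_reg w f : L2c f -> regj 1 f (jA0 w f).
Proof.
move=> hf; rewrite /jA0; case: eqP => _.
  have [r _ _ _] := jE_hol z0.
  have := regj_lin (-1) (cP_reg G_entx m hf) (r w f hf); rewrite mulr0 add0r.
  by apply: regj_ext => c x; rewrite mulN1r addrC.
have hs : regj 0 f (fun c x => \sum_(j < m) (w - z0) ^- j.+1 * cG (m - j.+1)%N f c x).
  apply: (@regj_sum _ _ f (fun j c x => (w - z0) ^- j.+1 * cG (m - j.+1)%N f c x)) => j _.
  by apply: regjZ; exact: cP_reg.
have := regj_lin 1 hs (jT_reg w hf); rewrite mul1r add0r.
apply: regj_ext => c x; rewrite mul1r addrC; congr (_ + _).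
by apply: eq_bigr => j _; rewrite mulrC.
Qed.

Lemma jA0_linear w : linear_oper (joper (jA0 w)).
Proof.
move=> a f h hf hh x; rewrite /joper /jA0; have [_ _ l _] := jE_hol w.
case: eqP => _.
  have := l w a f h hf hh x; rewrite /joper => ->.
  by rewrite cG_lin//; ring.
have e : jT w (fun y => a * f y + h y) 0%N x = a * jT w f 0%N x + jT w h 0%N x.
  by have := Tres_lin cV hV V_out w a hf hh x; rewrite -!jT_Tres.
rewrite e; move: (jT w f 0%N x) (jT w h 0%N x) => p q; rewrite mulrDr addrACA; congr (_ + _).
rewrite mulr_sumr -big_split/=; apply: eq_bigr => j _.
by rewrite cG_lin//; ring.
Qed.

Lemma jA0_hol_at : exists j', hol_jets 1 z0 jA0 j'.
Proof.
have [K K0 [r /andP[r0 r1] hr]] := divz_near Wr_entire W0 Wlow.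
have h0' := hol_jetsD jprin_hol jrem_hol; rewrite addr0 in h0'.
have h1 := hol_jetsM (hols_entire z0 (entireS_cst (-1))) h0'.
have h2 := hol_jetsD (jE_hol z0) h1; rewrite addr0 in h2.
eexists; apply: (hol_jets_near r0 _ jA0_reg jA0_linear h2) => w wr f c x.
have [->|wz] := eqVneq w z0.
  by rewrite /jA0 /jprin /jrem !eqxx; ring.
have [b1 _ _ b4] := hr (w - z0) wr; rewrite [z0 + _]addrC subrK in b1 b4.
rewrite jA0_near//; first by ring.
  by apply: b4; rewrite subr_eq0.
by rewrite -cmod_gt0 (lt_le_trans _ b1)// divr_gt0// cmod_gt0.
Qed.

Lemma jA0_hol_off w : w != z0 -> Wr V w != 0 -> exists j', hol_jets 1 w jA0 j'.
Proof.
move=> wz Ww; have [j1 h1] := jT_hol Ww.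
have wz0 : w - z0 != 0 by rewrite subr_eq0.
have hp j : hols w (fun y => (y - z0) ^+ j) (tcoef w (fun y => (y - z0) ^+ j) 1).
  apply: hols_entire; apply: (entireSX (F := fun y => y - z0)).
  by apply: entireB; [exact: entire_id|exact: entireS_cst].
have [j2 h2] : exists j2, hol_jets 0 w (fun y f c x =>
    \sum_(j < m) ((y - z0) ^- j.+1 * cG (m - j.+1)%N f c x)) j2.
  apply: (@hol_jets_sum _ m w (fun j y f c x => (y - z0) ^- j.+1 * cG (m - j.+1)%N f c x)
    (fun j f c x => - (tcoef w (fun y => (y - z0) ^+ j.+1) 1 / ((w - z0) ^+ j.+1) ^+ 2) *
       cG (m - j.+1)%N f c x + (w - z0) ^- j.+1 * 0)) => j _.
  apply: (hol_jetsM (holsV (hp j.+1) _)); first exact: expf_neq0.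
  apply: hol_jets_cst; first by move=> f hf; exact: cP_reg.
    by move=> a f h hf hh x; exact: cG_lin.
  by move=> M N M0; exact: cP_bound.
have h3 := hol_jetsD h1 h2; rewrite addr0 in h3.
have d0 : 0 < cmod (w - z0) / 2 by rewrite divr_gt0// cmod_gt0.
eexists; apply: (hol_jets_near d0 _ jA0_reg jA0_linear h3) => y yw f c x.
have yz : y != z0.
  apply: contraTneq yw => ->; rewrite -ltNge cmod_distC ltr_pdivrMr// ltr_pMr ?ltr1n//.
  by rewrite cmod_distC cmod_gt0.
rewrite /jA0 (negbTE yz); congr (_ + _); apply: eq_bigr => j _; exact: mulrC.
Qed.

(** The coefficient of order [- j] is minus the Taylor coefficient of index [m - j] of the weighted
    product. The leading one is made explicit, since the presence of a genuine pole is read off from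
    it. *)
Lemma Tres_laurent : exists r A A0, laurent (Tres V) z0 r m A A0 /\
  forall f x, L2c f -> A m f x = - (ell V z0 f / g0) * phi V z0 x.
Proof.
have [K K0 [r /andP[r0 r1] hr]] := divz_near Wr_entire W0 Wlow.
exists r, (fun j f x => -1 * cG (m - j)%N f 0%N x), (fun z => joper (jA0 z)).
split; last first.
  move=> f x hf; rewrite subnn /cG /cP.
  have [a ha] := jP_entx G_entx 0%N x hf.
  have e : jP G z0 f 0 x = tcoef z0 (fun z => jP G z f 0%N x) 0.
    rewrite (tcoefE (i := tt) ha I); have [L L0 /(_ tt I)[_ /(_ 1%N 0)]] := ha 1 (lexx _).
    rewrite cmod0 mul0r expr1 mulr0 => /(_ ler01).
    rewrite psumS psum0 add0r expr0 mulr1 addr0 => h1; apply/eqP.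
    by rewrite -subr_eq0 -cmod_eq0 eq_le cmod_ge0 andbT.
  by rewrite -e /jP /G ginv_at /jphi eqxx; ring.
split=> //.
- move=> w wr; have [->|wz] := eqVneq w z0.
    by have [j' h] := jA0_hol_at; exact: hol_jets_oper h.
  have [b1 _ _ b4] := hr (w - z0) (ltW wr); rewrite [z0 + _]addrC subrK in b1 b4.
  have Ww : Wr V w != 0.
    rewrite b4 ?subr_eq0// mulf_neq0 ?expf_neq0 ?subr_eq0//.
    by rewrite -cmod_gt0 (lt_le_trans _ b1)// divr_gt0// cmod_gt0.
  by have [j' h] := jA0_hol_off wz Ww; exact: hol_jets_oper h.
- by move=> j _; exact: cP_oper.
- move=> z /andP[z0' _] f hf x.
  have zz : z != z0 by rewrite -subr_eq0 -cmod_gt0.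
  rewrite /joper /jA0 (negbTE zz) -jT_Tres /joper addrCA -[LHS]addr0; congr (_ + _).
  rewrite big_add1/= big_mkord -big_split/= big1// => j _; ring.
Qed.

End LaurentAt.

End ResolventLaurent.

(** * Poles of the continued resolvent *)

Section CircleIntegrals.
Variable R : realType.
Local Notation C := R[i].

Lemma ccont_cintegral_le (f : R -> C) (K a b : R) : a <= b -> ccont f ->
  (forall x, a <= x <= b -> cmod (f x) <= K) -> cmod (cintegral `[a, b] f) <= K * (b - a).
Proof.
move=> ab cf hK; have [F [_ hF]] := ccont_primitive 0 cf.
rewrite -(cder_primitive_of hF cf ab).
by apply: cder_dist_cst ab _ hK => x _; exact: hF.
Qed.

Lemma cintegral_unif (h : R -> C) (H : nat -> R -> C) (D : R) (l : C) (a b : R) k0 : a <= b ->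
  (forall k, ccont (H k)) -> (forall k s, cmod (h s - H k s) <= D / 2 ^+ k) ->
  (forall k, (k0 <= k)%N -> cintegral `[a, b] (H k) = l) ->
  ccont h /\ cintegral `[a, b] h = l.
Proof.
move=> ab cH hH hl; have D0 : 0 <= D.
  by have := le_trans (cmod_ge0 _) (hH 0%N 0); rewrite expr0 divr1.
have ch : ccont h.
  apply: ccont_unif => X e e0; have [k hk] := exists_half_pow D e0.
  by exists (H k) => // x _; exact: le_trans (hH k x) hk.
split=> //; apply/eqP; rewrite -subr_eq0; apply/eqP.
apply: (@cmod_small_eq0 _ _ (b - a)) => e e0; have [k hk] := exists_half_pow D e0.
rewrite -(hl (k0 + k)%N (leq_addr _ _)).
have e1 : cintegral `[a, b] h - cintegral `[a, b] (H (k0 + k)%N) =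
    cintegral `[a, b] (fun x => h x - H (k0 + k)%N x).
  have -> : (fun x => h x - H (k0 + k)%N x) = (fun x => h x + -1 * H (k0 + k)%N x).
    by apply/funext => x; rewrite mulN1r.
  rewrite cintegralD ?cintegralZ ?mulN1r//; do ?exact: ccont_integrable.
  by apply: cintegrableZ => //; exact: ccont_integrable.
rewrite e1 mulrC; apply: ccont_cintegral_le => //; first exact: ccontB.
move=> x _; apply: le_trans (hH _ x) _; apply: le_trans hk.
by rewrite ler_wpM2l// lef_pV2 ?posrE ?exprn_gt0// ler_weXn2l ?ler1n// leq_addl.
Qed.

Definition circ (s : R) : C := cexp ('i * s%:C).

Lemma circE s : circ s = cos s +i* sin s.
Proof. by rewrite /circ /cexp/= !(mul0r, mul1r, subr0, addr0, mulr0, add0r) oppr0 expR0 !mul1r. Qed.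

Lemma cmod_circ s : cmod (circ s) = 1.
Proof.
by rewrite cmod_cexp/= !(mul0r, mul1r, subr0, addr0, mulr0, add0r) oppr0 expR0.
Qed.

Lemma ccont_circ : ccont circ.
Proof. exact: (cder_ccont (fun x => cder_cexpl 'i x)). Qed.

Lemma circV s : (circ s)^-1 = cexp (- 'i * s%:C).
Proof. by rewrite mulNr cexpN. Qed.

Lemma cintegral_circ n k : cintegral `[0, 2 * pi] (fun s => circ s ^+ n / circ s ^+ k) =
  if n == k then (2 * pi)%:C else 0.
Proof.
have pi0 : 0 <= 2 * pi :> R by rewrite mulr_ge0// pi_ge0.
pose c : C := 'i * (n%:R - k%:R).
have e s : circ s ^+ n / circ s ^+ k = cexp (c * s%:C).
  by rewrite -!cexpMn -cexpB; congr cexp; rewrite /c; ring.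
rewrite (_ : (fun s => _) = fun s => cexp (c * s%:C)); last exact/funext.
case: eqP => [nk|/eqP nk].
  have -> : (fun s : R => cexp (c * s%:C)) = fun _ => 1.
    by apply/funext => s; rewrite /c nk subrr mulr0 mul0r cexp0.
  rewrite -(cder_primitive_of (@cder_id R) (ccont_cst 1) pi0).
  by rewrite subr0.
have c0 : c != 0.
  rewrite mulf_neq0// ?subr_eq0 ?eqr_nat//.
  by rewrite -cmod_gt0 cmod_i.
have hd x : cder (fun s => c^-1 * cexp (c * s%:C)) x (cexp (c * x%:C)).
  by apply: cder_eq (cderZ c^-1 (cder_cexpl c x)) _; rewrite mulrA mulVf// mul1r.
rewrite -(cder_primitive_of hd _ pi0); last exact: (cder_ccont (fun x => cder_cexpl c x)).
rewrite -mulrBr mulr0 cexp0.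
have <- : circ (2 * pi) ^+ n / circ (2 * pi) ^+ k = cexp (c * (2 * pi)%:C) by [].
have -> : circ (2 * pi) = 1.
  rewrite circE mulr_natl cos2pi sin2pi; exact: complex_eq.
by rewrite !expr1n divr1 subrr mulr0.
Qed.

Lemma cintegral_sum n (F : nat -> R -> C) (a b : R) : (forall k, ccont (F k)) ->
  cintegral `[a, b] (fun s => \sum_(k < n) F k s) = \sum_(k < n) cintegral `[a, b] (F k).
Proof.
move=> cF; elim: n => [|n IH].
  rewrite big_ord0 (_ : (fun s => _) = fun s => 0 * (fun _ => 0) s); last first.
    by apply/funext => s; rewrite big_ord0 mul0r.
  by rewrite cintegralZ ?mul0r//; apply: ccont_integrable; exact: ccont_cst.
rewrite big_ord_recr -IH /= -cintegralD//; first last.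
- exact: ccont_integrable.
- by apply: ccont_integrable; exact: ccont_sum.
by congr cintegral; apply/funext => s; rewrite big_ord_recr.
Qed.

(** The Cauchy formula for coefficients. With radius [1 + 2 r] the partial sums converge
    geometrically on the circle, and by orthogonality all those with more than [k] terms have the
    same integral. *)
Lemma ent_circle z0 (F : C -> C) a k (r : R) : 0 <= r ->
  ent (fun _ : unit => True) (fun _ => 1) z0 (fun z _ => F z) (fun n _ => a n) ->
  ccont (fun s => F (z0 + r%:C * circ s) / circ s ^+ k) /\
  cintegral `[0, 2 * pi] (fun s => F (z0 + r%:C * circ s) / circ s ^+ k) =
    (2 * pi)%:C * (a k * r%:C ^+ k).
Proof.
move=> r0 hF; pose rho := 1 + 2 * r.
have rho1 : 1 <= rho by rewrite lerDl mulr_ge0.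
have [K K0 /(_ tt I)[_ hK]] := hF rho rho1; rewrite mulr1 in hK.
have ci : 1 = 1 :> R by [].
have pi0 : 0 <= 2 * pi :> R by rewrite mulr_ge0// pi_ge0.
have cV : ccont (fun s => (circ s ^+ k)^-1).
  apply: ccont_ext (cder_ccont (fun x => cder_cexpl (- 'i * k%:R) x)) => s.
  by rewrite -exprVn circV -cexpMn; congr cexp; ring.
have cX n : ccont (fun s => circ s ^+ n).
  elim: n => [|n IH]; first exact: ccont_cst.
  by apply: ccont_ext (ccontM ccont_circ IH) => s; rewrite exprS.
pose H N s := \sum_(n < N) (a n * r%:C ^+ n) * (circ s ^+ n / circ s ^+ k).
have cH1 n : ccont (fun s => (a n * r%:C ^+ n) * (circ s ^+ n / circ s ^+ k)).
  by apply: ccontZ; exact: ccontM.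
have HE N s : H N s = psum a N (r%:C * circ s) / circ s ^+ k.
  by rewrite /H /psum mulr_suml; apply: eq_bigr => n _; rewrite exprMn !mulrA.
apply: (@cintegral_unif _ H K _ _ _ k.+1) => //.
- move=> N; exact: (@ccont_sum _ N (fun n s => (a n * r%:C ^+ n) * (circ s ^+ n / circ s ^+ k))).
- move=> N s; rewrite HE -mulrBl cmod_div cmodX cmod_circ expr1n divr1.
  have cr : cmod (r%:C * circ s) = r by rewrite cmodM cmodC cmod_circ mulr1 ger0_norm.
  have := hK N (r%:C * circ s); rewrite cr => /(_ _)/le_trans; apply.
    by rewrite /rho; lra.
  rewrite ler_wpM2l// -exprVn lerXn2r// ?nnegrE ?divr_ge0 ?invr_ge0//; first by lra.
  by rewrite ler_pdivrMr /rho; lra.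
move=> N kN; rewrite (@cintegral_sum N (fun n s => (a n * r%:C ^+ n) * (circ s ^+ n / circ s ^+ k)))//.
rewrite (bigD1 (Ordinal kN))//= big1 ?addr0.
  by rewrite cintegralZ ?cintegral_circ ?eqxx 1?mulrC//; apply: ccont_integrable; exact: ccontM.
move=> n nk; rewrite cintegralZ ?cintegral_circ//; last by apply: ccont_integrable; exact: ccontM.
by have := nk; rewrite -val_eqE /= => /negbTE ->; rewrite mulr0.
Qed.

End CircleIntegrals.

(** * Simple zeros of the Wronskian are poles of multiplicity one *)

Section Poles.
Variable R : realType.
Local Notation C := R[i].
Implicit Types (f g : R -> C) (z w : C).
Variables (V : R -> C) (v : R).
Hypotheses (cV : ccont V) (hV : forall x, cmod (V x) <= v).
Hypothesis V_out : forall x, ~~ (0 < x < 1) -> V x = 0.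

Lemma Wr_order z0 : exists m, tcoef z0 (Wr V) m != 0 /\
  forall k, (k < m)%N -> tcoef z0 (Wr V) k = 0.
Proof.
apply: entireS_order; first exact: Wr_entire cV hV.
exists (0 +i* (3 * v + 2)); by apply: (Wr_neq0 cV hV) => /=; lra.
Qed.

Lemma Tres_continuation : resolvent_continuation V (Tres V).
Proof.
split; last by exists (3 * v + 1) => z hz; exact: (Tres_is_resolvent cV hV V_out).
move=> z0; have [m [W0 Wlow]] := Wr_order z0.
have [r [A [A0 [h _]]]] := Tres_laurent cV hV V_out W0 Wlow.
by exists r, m, A, A0.
Qed.

(** Twice the positive part of [(x - 1) (2 - x)]: continuous, and supported to the right of the
    potential. *)
Let bump (x : R) : R := (x - 1) * (2 - x) + `|(x - 1) * (2 - x)|.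

Lemma bump_out x : ~~ (1 <= x <= 2) -> bump x = 0.
Proof.
move=> h; suff y0 : (x - 1) * (2 - x) <= 0 by rewrite /bump ler0_norm ?subrr.
have [x1|x1] := ltP x 1; first by nra.
have [x2|x2] := ltP 2 x; first by nra.
by move: h; rewrite x1 x2.
Qed.

Lemma bump_cont : continuous bump.
Proof.
have c (x : R) : (fun t : R => (t - 1) * (2 - t)) @ x --> (x - 1) * (2 - x).
  apply: cvgM; first by apply: cvgB; [exact: cvg_id|exact: cvg_cst].
  by apply: cvgB; [exact: cvg_cst|exact: cvg_id].
by move=> x; apply: cvgD; [exact: c|apply: cvg_norm; exact: c].
Qed.

(** For a source to the right of the potential the incoming component has derivative
    [- exp (i z x) f]. With [f] a bump times [exp (- i z x)] this is minus the bump, whose integral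
    is positive. *)
Lemma ell_neq0 z : exists2 f, L2c f & ell V z f != 0.
Proof.
pose f x : C := (bump x)%:C * cexp (- ('i * z) * x%:C).
have cf : ccont f.
  apply: ccontM; first exact: ccont_real bump_cont.
  exact: (cder_ccont (fun x => cder_cexpl (- ('i * z)) x)).
have fout x : ~~ (1 <= x <= 2) -> f x = 0 by move=> h; rewrite /f bump_out// mul0r.
have hf : L2_supp 2 f.
  split; last first.
    move=> x; rewrite ltr_normr => h; apply: fout; apply/negP => /andP[h1 h2].
    by case/orP: h => h; lra.
  have [K K0 hK] := ccont_bounded 1 2 cf.
  apply: (@L2_decay _ f 1 (K * expR 2)) => //; first exact: ccont_measurable.
  move=> x; rewrite -mulrA -expRD; have [/andP[x1 x2]|h] := boolP (1 <= x <= 2).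
    apply: le_trans (hK x _) _; first by rewrite x1.
    by rewrite ler_peMr// -[leLHS]expR0 ler_expR mul1r ger0_norm; lra.
  by rewrite fout// cmod0 mulr_ge0// expR_ge0.
have M0 : 0 <= 2 :> R by [].
exists f; first by exists 2.
have dF x : cder (prim0 f) x (f x).
  apply: primitive_of_cder => // a b ab; exact: (prim0B M0 hf).
have F0 x : x <= 1 -> prim0 f x = 0.
  move=> x1; have [x3|x3] := ltP x (- 2); first exact: prim0_left hf _ x3.
  rewrite -(prim0_left hf (x := - 3)); last by lra.
  apply: (@cder0_eq _ _ (- 3) 1); [|by apply/andP; split; lra..].
  by move=> y /andP[_ y1]; apply: cder_eq (dF y) _; rewrite /f /bump ler0_norm ?subrr ?mul0r//; nra.
have [hs h0] := esolP cV hV z M0 hf.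
have e0 : esol V z f 1 = 0 /\ esolp V z f 1 = 0.
  have [u0 p0] := h0 (- (2 + 1)) (lexx _).
  have := @ode_zero_on _ _ _ _ _ _ 4 _ (ccontVz cV z) hs _ _ u0 p0 1.
  apply=> [x|x|] //; first by rewrite ler_norml => /andP[_ ?]; rewrite F0 ?oppr0//; lra.
  by rewrite ger0_norm; lra.
rewrite (ellE cV hV V_out z M0 hf (X := 4)); last by lra.
pose H x := outf z (prim0 f x) x (esol V z f) (esolp V z f).
rewrite -/(H 4).
have H1 : H 1 = 0 by rewrite /H /outf F0// (proj1 e0) (proj2 e0) mulr0 !subr0 mulr0.
have dH x : 1 <= x -> cder H x (- bump x)%:C.
  move=> x1; have [du dp] := hs x.
  have := cderM (cder_cexpl ('i * z) x) (cderB (cderB dp (dF x)) (cderZ ('i * z) du)).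
  move=> h; apply: cder_eq h _.
  have i2 : 'i * 'i = - 1 :> C by rewrite -expr2 sqr_i.
  have Vx : V x = 0 by apply: V_out; rewrite negb_and orbC -leNgt x1.
  have ef : cexp ('i * z * x%:C) * f x = (bump x)%:C.
    by rewrite /f mulrCA mulNr cexpN mulfV ?mulr1// cexp_neq0.
  have -> : (- bump x)%:C = - (cexp ('i * z * x%:C) * f x).
    by rewrite ef; apply: complex_eq; rewrite /= ?oppr0.
  rewrite Vx add0r.
  set E := cexp _; set u := esol V z f x; set p := esolp V z f x; set F := prim0 f x; set fx := f x.
  have -> : 'i * z * E * (p - F - 'i * z * u) + E * (- z ^+ 2 * u + 0 - fx - 'i * z * (p + - F)) =
    E * ((- ('i * 'i) - 1) * z ^+ 2 * u - fx) by ring.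
  by rewrite i2 opprK subrr !mul0r sub0r mulrN.
have bump0 x : 0 <= bump x by rewrite /bump; have := ler_norm (- ((x - 1) * (2 - x))); rewrite normrN; lra.
have hr (x : R) : 1 <= x -> is_derive x (1 : R) (fun t => complex.Re (H t)) (- bump x).
  by move=> x1; have [] := dH x x1.
(* A crude lower bound replaces the integral: the bump is nonnegative, and at least 1/8 on the
   interval from 5/4 to 3/2. *)
have s1 := @derive_le_dist _ (fun t => complex.Re (H t)) (fun _ => 0) (fun x => - bump x) (fun _ => 0) 1 (5/4).
have s2 := @derive_le_dist _ (fun t => complex.Re (H t)) (fun x => - (1/8) * x) (fun x => - bump x) (fun _ => - (1/8)) (5/4) (3/2).
have s3 := @derive_le_dist _ (fun t => complex.Re (H t)) (fun _ => 0) (fun x => - bump x) (fun _ => 0) (3/2) 4.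
have t1 : complex.Re (H (5/4)) - complex.Re (H 1) <= 0 - 0.
  apply: s1; [lra|by move=> x /andP[? _]; exact: hr|].
  by move=> x _; rewrite oppr_le0.
have t2 : complex.Re (H (3/2)) - complex.Re (H (5/4)) <= - (1/8) * (3/2) - - (1/8) * (5/4).
  apply: s2; [lra|by move=> x /andP[? _]; apply: hr; lra| |].
    move=> x _; apply: is_derive_ext (is_derive_mull (- (1/8)) (is_derive_id x 1)) => //; exact: mulr1.
  by move=> x /andP[x1 x2]; rewrite lerN2 /bump; have := normr_ge0 ((x - 1) * (2 - x)); nra.
have t3 : complex.Re (H 4) - complex.Re (H (3/2)) <= 0 - 0.
  apply: s3; [lra|by move=> x /andP[? _]; apply: hr; lra|].
  by move=> x _; rewrite oppr_le0.
apply/eqP => H4; rewrite H4 H1 /= in t1 t3; lra.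
Qed.

Section SimpleZero.
Variable z0 : C.
Hypotheses (Wz0 : Wr V z0 = 0) (Wz1 : tcoef z0 (Wr V) 1 != 0).

Let Wlow k : (k < 1)%N -> tcoef z0 (Wr V) k = 0.
Proof.
case: k => // _.
by rewrite (@tcoef0 _ _ _ _ (fun z _ => Wr V z) z0 tt (Wr_entire cV hV) I).
Qed.

Lemma simple_zero_pole : is_pole (Tres V) z0.
Proof.
have [r [A [A0 [h hA]]]] := Tres_laurent cV hV V_out Wz1 Wlow.
exists r, 1%N, A, A0; split=> //; have [f hf l0] := ell_neq0 z0.
exists f; split=> //; exists 0; rewrite hA//.
have [_ -> _] := phiP cV hV z0.
by rewrite mulr1 oppr_eq0 mulf_neq0// invr_eq0.
Qed.

(** On the circle [z - z0] times the resolvent is approximated by the functions [F k], with error of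
    order [2 ^- k] since [|1 - g / g0| <= 1 / 2] there. These have expansions at [z0], so their
    means over the circle are their values at [z0], the same for all [k >= 1]. The radius depends
    neither on [f] nor on [x]. *)
Lemma contour_simple_zero : exists2 r0 : R, 0 < r0 & forall r : R, 0 < r < r0 ->
  forall f x, L2c f -> contour_oper (Tres V) z0 r f x =
    (0 +i* (2 * pi)) * (- (ell V z0 f / tcoef z0 (Wr V) 1)) * phi V z0 x.
Proof.
have [K K0 [r0 /andP[r00 r01] hr]] := divz_near (Wr_entire cV hV) Wz1 Wlow.
exists r0 => // r /andP[rp rr] f x hf.
pose one : C -> C := fun _ => 1.
have one_entx : entx z0 one by exact: entx_cst.
pose P z := jP V one z f 0%N x.
have Pe : entx z0 P by exact: jP_entx.
have [M M0 hfM] := L2c_supp hf.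
have Ee : entx z0 (fun z => esol V z f x).
  exact: (@entx_single _ _ _ _ _ _ _ (f, 0%N, x)
    (entireP (esol_entire cV hV M0 `|x|).1 z0) (conj hfM (lexx _))).
pose F k z := (z - z0) * esol V z f x + -1 * (ginv V z0 1 k z * P z).
have Fe k : entx z0 (F k).
  apply: entxD; last exact: entxZ (entxM (ginv_entx cV hV Wlow k) Pe).
  apply: entxM => //; apply: (@entx_ext _ (fun z => z + - z0)) => //.
  by apply: entxD; [exact: entire_id|exact: entx_cst].
have [L L0 /(_ tt I)[_ hL]] := ent_tcoef Pe (lexx 1).
have Wz1' := Wz1; set g0 := tcoef z0 (Wr V) 1 in hr Wz1' *.
have g00 : 0 < cmod g0 by rewrite cmod_gt0.
pose h s := Tres V (z0 + r%:C * circ s) f x * ((0 +i* r) * circ s).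
pose H k s := 'i * (F k (z0 + r%:C * circ s) / circ s ^+ 0).
have cH k : ccont (H k).
  have [a ha] := Fe k; apply: ccontZ.
  exact: (ent_circle 0 (ltW rp) (ent_tcoef (Fe k))).1.
have irE : (0 +i* r) = 'i * r%:C :> C by apply: complex_eq; rewrite /=; ring.
have hH k s : cmod (h s - H k s) <= (2 / cmod g0 * L) / 2 ^+ k.
  pose t := r%:C * circ s.
  have ct : cmod t = r by rewrite cmodM cmodC cmod_circ mulr1 gtr0_norm.
  have t0 : t != 0 by rewrite -cmod_gt0 ct.
  have tr : cmod t <= r0 by rewrite ct ltW.
  have [b1 _ b3 b4] := hr t tr.
  have gt : divz (Wr V) z0 1 (z0 + t) != 0.
    by rewrite -cmod_gt0 (lt_le_trans _ b1)// divr_gt0.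
  have Pt : cmod (P (z0 + t)) <= L.
    have := hL 0%N t (le_trans tr r01); rewrite psum0 subr0 expr0 !mulr1; exact.
  have -> : h s - H k s = - 'i * ((1 - divz (Wr V) z0 1 (z0 + t) / g0) ^+ k /
      divz (Wr V) z0 1 (z0 + t) * P (z0 + t)).
    rewrite /h /H expr0 divr1 -/t irE -jT_Tres /joper /jT -/(P _) b4// expr1.
    rewrite invfM [in LHS](ginvP k gt) /F /jE eqxx /= -/g0.
    have -> : z0 + t - z0 = t by ring.
    have -> : 'i * r%:C * circ s = 'i * t by rewrite /t mulrA.
    set e := esol _ _ _ _; set G := ginv _ _ _ _ _; set q := _ / _; set p := P _.
    rewrite mulrDl; have -> : - (t^-1 * (G + q)) * p * ('i * t) = - 'i * (G + q) * p * (t^-1 * t) by ring.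
    by rewrite mulVf//; ring.
  rewrite cmodM cmodN cmod_i mul1r cmodM cmod_div cmodX.
  have e2 : (cmod (divz (Wr V) z0 1 (z0 + t)))^-1 <= 2 / cmod g0.
    by rewrite -[2 / _]invf_div lef_pV2// posrE ?divr_gt0// cmod_gt0.
  have e1 : cmod (1 - divz (Wr V) z0 1 (z0 + t) / g0) ^+ k <= 1 / 2 ^+ k.
    have := lerXn2r k (cmod_ge0 _) (divr_ge0 (@ler01 R) (@ler0n R 2)) b3.
    by rewrite expr_div_n expr1n.
  have := ler_pM (mulr_ge0 (exprn_ge0 k (cmod_ge0 _)) _) (cmod_ge0 _)
    (ler_pM (exprn_ge0 k (cmod_ge0 _)) _ e1 e2) Pt.
  move=> /(_ (ltac:(by rewrite invr_ge0 cmod_ge0)) (ltac:(by rewrite invr_ge0 cmod_ge0))).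
  move/le_trans; apply; rewrite le_eqVlt; apply/orP; left; apply/eqP; ring.
pose l : C := 'i * ((2 * pi)%:C * (- (ell V z0 f / g0) * phi V z0 x)).
have hl k : (1 <= k)%N -> cintegral `[0, 2 * pi] (H k) = l.
  case: k => // k _; rewrite /H cintegralZ//; last first.
    by apply: ccont_integrable; exact: (ent_circle 0 (ltW rp) (ent_tcoef (Fe k.+1))).1.
  rewrite (ent_circle 0 (ltW rp) (ent_tcoef (Fe k.+1))).2 expr0 mulr1 /l; congr (_ * (_ * _)).
  have [K1 K10 /(_ tt I)[_ /(_ 1%N 0)]] := ent_tcoef (Fe k.+1) (lexx 1).
  rewrite cmod0 mul0r expr1 mulr0 => /(_ ler01).
  rewrite psumS psum0 add0r expr0 mulr1 addr0 => h1.
  have <- : F k.+1 z0 = tcoef z0 (fun z => F k.+1 z) 0.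
    by apply/eqP; rewrite -subr_eq0 -cmod_eq0 eq_le cmod_ge0 andbT.
  by rewrite /F subrr mul0r add0r ginv_at// /P /jP /jphi eqxx -/g0; ring.
have pi0 : 0 <= 2 * pi :> R by rewrite mulr_ge0// pi_ge0.
have [_ hI] := cintegral_unif pi0 cH hH hl.
have -> : contour_oper (Tres V) z0 r f x = cintegral `[0, 2 * pi] h.
  by congr cintegral; apply/funext => s; rewrite /h circE.
rewrite hI /l; have -> : (0 +i* (2 * pi)) = 'i * (2 * pi)%:C :> C.
  by apply: complex_eq; rewrite /=; ring.
ring.
Qed.

(** The residue is a functional of the source times [phi]. The functional is not zero by [ell_neq0],
    and [phi] is 1 at 0, so the range is a line. *)
Lemma simple_zero_multiplicity : pole_multiplicity (Tres V) z0 1.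
Proof.
have [r0 r00 hr] := contour_simple_zero; exists r0; split=> // r rr.
have [f hf l0] := ell_neq0 z0.
have [_ phi0 _] := phiP cV hV z0.
have pi0 : (0 +i* (2 * pi)) != 0 :> C.
  by rewrite eq_complex /= negb_and mulf_neq0 ?orbT// gt_eqF// pi_gt0.
pose c h : C := (0 +i* (2 * pi)) * - (ell V z0 h / tcoef z0 (Wr V) 1).
have cf : c f != 0 by rewrite mulf_neq0// oppr_eq0 mulf_neq0// invr_eq0.
exists (fun _ => contour_oper (Tres V) z0 r f); split.
- by move=> _; exists f.
- move=> a /(_ 0); rewrite big_ord1 hr// -/(c f) phi0 mulr1 => /eqP.
  by rewrite mulf_eq0 (negbTE cf) orbF => /eqP a0 i; rewrite ord1.
- move=> h hh; exists (fun _ => c h / c f) => x.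
  by rewrite big_ord1 !hr// -/(c f) -/(c h) mulrA divfK.
Qed.

End SimpleZero.

End Poles.

(** * Approximate solutions of the Riccati equation *)

Section PolynomialNorm.
Variable R : realType.
Local Notation C := R[i].
Implicit Types p q P : {poly C}.

(** The sum of the moduli of the coefficients is submultiplicative, controls derivatives up to the
    degree, and dominates the values on the unit disc, where all nodes lie. *)
Definition pnorm p : R := \sum_(i < size p) cmod p`_i.

Lemma pnorm_ge0 p : 0 <= pnorm p.
Proof. by apply: sumr_ge0 => i _; exact: cmod_ge0. Qed.

Lemma pnormE p n : (size p <= n)%N -> pnorm p = \sum_(i < n) cmod p`_i.
Proof.
move=> h; rewrite /pnorm -[LHS](big_mkord xpredT (fun i => cmod p`_i)).
rewrite -(big_mkord xpredT (fun i => cmod p`_i)) (big_cat_nat (leq0n _) h)//=.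
rewrite [X in _ = _ + X]big_nat_cond [X in _ = _ + X]big1 ?addr0// => i /andP[/andP[hi _] _].
by rewrite nth_default ?cmod0.
Qed.

Lemma pnorm0 : pnorm 0 = 0.
Proof. by rewrite /pnorm size_poly0 big_ord0. Qed.

Lemma pnormD p q : pnorm (p + q) <= pnorm p + pnorm q.
Proof.
pose n := maxn (size p) (size q).
rewrite (pnormE (size_polyD _ _)) (@pnormE p n) ?leq_maxl// (@pnormE q n) ?leq_maxr//.
by rewrite -big_split; apply: ler_sum => i _; rewrite coefD; exact: cmodD.
Qed.

Lemma pnormZ (c : C) p : pnorm (c *: p) = cmod c * pnorm p.
Proof.
rewrite (pnormE (size_scale_leq c p)) /pnorm mulr_sumr; apply: eq_bigr => i _.
by rewrite coefZ cmodM.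
Qed.

Lemma pnormN p : pnorm (- p) = pnorm p.
Proof. by rewrite -scaleN1r pnormZ cmodN cmod1 mul1r. Qed.

Lemma pnormB p q : pnorm (p - q) <= pnorm p + pnorm q.
Proof. by rewrite -(pnormN q); exact: pnormD. Qed.

Lemma pnormX p n : pnorm (p * 'X^n) = pnorm p.
Proof.
rewrite (@pnormE _ (n + size p)); last first.
  have [->|p0] := eqVneq p 0; first by rewrite mul0r size_poly0.
  by rewrite size_mulXn.
rewrite -(big_mkord xpredT (fun i => cmod (p * 'X^n)`_i)) (big_cat_nat (leq0n _) (leq_addr _ n))//=.
rewrite big_nat_cond big1 ?add0r; last first.
  by move=> i /andP[/andP[_ hi] _]; rewrite coefMXn hi cmod0.
rewrite -{1}[n]add0n big_addn addKn big_mkord; apply: eq_bigr => i _.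
by rewrite coefMXn ltnNge leq_addl /= addnK.
Qed.

Lemma pnorm_sum n (F : nat -> {poly C}) : pnorm (\sum_(i < n) F i) <= \sum_(i < n) pnorm (F i).
Proof.
elim: n => [|n IH]; first by rewrite !big_ord0 pnorm0.
by rewrite !big_ord_recr /= (le_trans (pnormD _ _))// lerD2r.
Qed.

Lemma pnormM p q : pnorm (p * q) <= pnorm p * pnorm q.
Proof.
rewrite -[p in p * q]coefK poly_def mulr_suml.
apply: le_trans (pnorm_sum _ (fun i => p`_i *: 'X^i * q)) _.
rewrite [pnorm p]/pnorm mulr_suml; apply: ler_sum => i _.
by rewrite -scalerAl pnormZ ['X^i * q]mulrC pnormX.
Qed.

Lemma pnorm_deriv p : pnorm p^`() <= (size p)%:R * pnorm p.
Proof.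
have [->|p0] := eqVneq p 0; first by rewrite derivC pnorm0 mulr0.
rewrite (@pnormE _ (size p).-1); last by rewrite -ltnS prednK ?size_poly_gt0// lt_size_deriv.
rewrite (pnormE (leqSpred (size p))) big_ord_recl /= mulrDr.
rewrite -[leLHS]add0r lerD ?mulr_ge0 ?cmod_ge0//.
rewrite mulr_sumr; apply: ler_sum => i _.
rewrite coef_deriv -[p`_i.+1 *+ _]mulr_natl cmodM cmod_nat ler_wpM2r ?cmod_ge0// ler_nat.
by rewrite (leq_trans (ltn_ord i)) ?leq_pred.
Qed.

Lemma size_deriv_le p : (size p^`() <= size p)%N.
Proof.
by have [->|p0] := eqVneq p 0; [rewrite derivC size_poly0|exact/ltnW/lt_size_deriv].
Qed.

Lemma horner_pnorm p (x : C) : cmod x <= 1 -> cmod p.[x] <= pnorm p.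
Proof.
move=> x1; rewrite horner_coef (le_trans (cmod_sum _ _ _))//.
by apply: ler_sum => i _; rewrite cmodM cmodX ler_piMr ?cmod_ge0// exprn_ile1 ?cmod_ge0.
Qed.

(* Picard iterates for the Riccati equation [s' + s^2 + kap s = P]. *)
Fixpoint sig (kap : C) P (n : nat) : {poly C} :=
  if n is m.+1 then kap^-1 *: (P - (sig kap P m)^`() - sig kap P m ^+ 2) else 0.

Lemma size_sig kap P n : (size (sig kap P n) <= 2 ^ n * size P)%N.
Proof.
elim: n => [|n IH]; first by rewrite size_poly0.
rewrite /= (leq_trans (size_scale_leq _ _))//.
have P1 : (size P <= 2 ^ n.+1 * size P)%N by rewrite leq_pmull// expn_gt0.
have s1 : (size (sig kap P n) <= 2 ^ n.+1 * size P)%N.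
  by rewrite (leq_trans IH)// leq_mul2r leq_exp2l// leqnSn orbT.
rewrite (leq_trans (size_polyD _ _))// size_polyN geq_max; apply/andP; split.
  rewrite (leq_trans (size_polyD _ _))// size_polyN geq_max P1 /=.
  by rewrite (leq_trans _ s1)// size_deriv_le.
rewrite expr2 (leq_trans (size_polyMleq _ _))// expnS -mulnA mul2n -addnn.
by rewrite (leq_trans (leq_pred _))// leq_add.
Qed.

Section Bounds.
Variables (Q : {poly C}).

Let d n : R := (2 ^ n * size Q)%:R.

(** Majorants depending on the shape [Q] of a piece and not on its amplitude [B]. The bounds built
    from them stay linear in [|B|], so the amplitude can be fixed afterwards to make them small. *)
Fixpoint sig_cst (n : nat) : R :=
  if n is m.+1 then pnorm Q + d m * sig_cst m + sig_cst m ^+ 2 else 0.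

Fixpoint dsig_cst (n : nat) : R :=
  if n is m.+1 then (d m.+1 + sig_cst m.+1 + sig_cst m) * dsig_cst m else pnorm Q.

Lemma sig_cst_ge0 n : 0 <= sig_cst n.
Proof.
elim: n => // n IH /=; rewrite addr_ge0 ?exprn_ge0// addr_ge0 ?pnorm_ge0//.
by rewrite mulr_ge0// /d.
Qed.

Lemma dsig_cst_ge0 n : 0 <= dsig_cst n.
Proof.
elim: n => [|n IH]; first exact: pnorm_ge0.
by rewrite /= mulr_ge0// addr_ge0 ?sig_cst_ge0// addr_ge0 ?(sig_cst_ge0 n.+1)// /d.
Qed.

Variables (B kap : C).
Hypotheses (B1 : cmod B <= 1) (k1 : 1 <= cmod kap).
Let s := sig kap (B *: Q).

Let k0 : 0 < cmod kap. Proof. exact: lt_le_trans k1. Qed.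

Lemma size_sig_le n : (size (s n))%:R <= d n.
Proof.
rewrite ler_nat (leq_trans (size_sig _ _ _))// leq_mul2l; apply/orP; right.
exact: size_scale_leq.
Qed.

Lemma sig_deriv_le n : pnorm (s n)^`() <= d n * pnorm (s n).
Proof.
by rewrite (le_trans (pnorm_deriv _))// ler_wpM2r ?pnorm_ge0// size_sig_le.
Qed.

Lemma pnorm_sig n : pnorm (s n) <= cmod B * sig_cst n / cmod kap.
Proof.
elim: n => [|n IH]; first by rewrite /= pnorm0 mulr0 mul0r.
rewrite /s /= pnormZ cmodV mulrC -/s ler_wpM2r ?invr_ge0 ?(ltW k0)//.
have h : pnorm (s n) <= cmod B * sig_cst n.
  apply: (le_trans IH); rewrite ler_piMr ?mulr_ge0 ?cmod_ge0 ?sig_cst_ge0//.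
  by rewrite invf_le1.
rewrite (le_trans (pnormB _ _))// mulrDr lerD//.
  rewrite (le_trans (pnormB _ _))// mulrDr lerD//; first by rewrite pnormZ.
  by rewrite (le_trans (sig_deriv_le n))// mulrCA ler_wpM2l// /d.
rewrite expr2 (le_trans (pnormM _ _))//.
apply: le_trans (ler_pM (pnorm_ge0 _) (pnorm_ge0 _) h h) _.
rewrite mulrACA -!expr2 ler_wpM2r ?exprn_ge0 ?sig_cst_ge0//.
by rewrite expr2 ler_piMr// cmod_ge0.
Qed.

Let nsig n : pnorm (s n) <= sig_cst n.
Proof.
apply: (le_trans (pnorm_sig n)); rewrite ler_pdivrMr// [leRHS]mulrC.
by rewrite ler_wpM2r ?sig_cst_ge0// (le_trans B1).
Qed.

(** The difference of consecutive iterates obeys a linear recursion with prefactor [- 1 / kap],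
    obtained by factoring the difference of squares; each iteration gains one power. *)
Lemma pnorm_dsig n : pnorm (s n.+1 - s n) <= cmod B * dsig_cst n / cmod kap ^+ n.+1.
Proof.
elim: n => [|n IH].
  by rewrite /s /= subr0 derivC expr0n /= !subr0 pnormZ cmodV pnormZ expr1 mulrC.
have E : s n.+2 - s n.+1 = - kap^-1 *: ((s n.+1 - s n)^`() + (s n.+1 - s n) * (s n.+1 + s n)).
  have e m : s m.+1 = kap^-1 *: (B *: Q - (s m)^`() - s m ^+ 2) by [].
  rewrite (e n.+1) (e n) -scalerBr scaleNr -scalerN -(e n); congr (_ *: _).
  by rewrite derivB; ring.
rewrite E pnormZ cmodN cmodV.
have sz : (size (s n.+1 - s n))%:R <= d n.+1.
  rewrite ler_nat (leq_trans (size_polyD _ _))// size_polyN geq_max.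
  have h m : (size (s m) <= 2 ^ m * size Q)%N by have := size_sig_le m; rewrite ler_nat.
  by rewrite (h n.+1) (leq_trans (h n))// leq_mul2r leq_exp2l// leqnSn orbT.
have h1 : pnorm ((s n.+1 - s n)^`() + (s n.+1 - s n) * (s n.+1 + s n)) <=
    (d n.+1 + sig_cst n.+1 + sig_cst n) * pnorm (s n.+1 - s n).
  rewrite -[d n.+1 + _ + _]addrA [leRHS]mulrDl (le_trans (pnormD _ _))// lerD//.
    by rewrite (le_trans (pnorm_deriv _))// ler_wpM2r ?pnorm_ge0.
  rewrite [leRHS]mulrC (le_trans (pnormM _ _))// ler_wpM2l ?pnorm_ge0//.
  by rewrite (le_trans (pnormD _ _))// lerD.
apply: le_trans (ler_wpM2l _ h1) _; first by rewrite invr_ge0 ltW.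
have c0 : 0 <= d n.+1 + sig_cst n.+1 + sig_cst n.
  by rewrite addr_ge0 ?sig_cst_ge0// addr_ge0 ?sig_cst_ge0// /d.
apply: le_trans (ler_wpM2l _ (ler_wpM2l c0 IH)) _; first by rewrite invr_ge0 ltW.
rewrite -[dsig_cst n.+1]/((d n.+1 + sig_cst n.+1 + sig_cst n) * dsig_cst n) [cmod kap ^+ n.+2]exprS invfM.
move: (d n.+1) (sig_cst n.+1) (sig_cst n) => x y w.
by rewrite le_eqVlt; apply/orP; left; apply/eqP; ring.
Qed.

End Bounds.

(** Each iteration differentiates once, so it lowers the order of vanishing at a node by one and
    multiplies the leading coefficient by minus the current order; the quadratic term vanishes to
    higher order. Hence the value at the node is 0 until iteration [beta + 1], where it becomes a
    nonzero multiple of [kap ^ - (beta + 1)]. *)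
Lemma sig_vanish (P q : {poly C}) (b : C) beta : P = ('X - b%:P) ^+ beta * q -> q.[b] != 0 ->
  exists c : nat -> C, (forall n, (0 < n <= beta.+1)%N -> c n != 0) /\
  forall kap n, kap != 0 -> (0 < n <= beta.+1)%N -> exists r : {poly C},
    sig kap P n = ('X - b%:P) ^+ (beta.+1 - n) * r /\ r.[b] = c n * kap ^- n.
Proof.
move=> PE q0.
pose c := fix c n : C := match n with
  | 0%N => 0 | 1%N => q.[b] | m.+1 => - (beta.+1 - m)%:R * c m end.
have cS n : c n.+2 = - (beta.+1 - n.+1)%:R * c n.+1 by [].
exists c; split.
  case=> // n; elim: n => [//|n IH] /andP[_ h].
  rewrite cS mulf_neq0// ?IH ?(ltnW h)// oppr_eq0 -cmod_gt0 cmod_nat ltr0n subn_gt0.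
  exact: h.
move=> kap [//|n] k0; elim: n => [_|n IH /andP[_ h]].
  exists (kap^-1 *: q); rewrite /= derivC expr0n /= !subr0 subn1 /= hornerZ expr1 mulrC.
  by split; [rewrite PE -scalerAl; congr (_ *: _)|]; exact: mulrC.
have [|r [rE rb]] := IH; first by rewrite (ltnW h).
have hn : (n.+1 <= beta)%N by [].
pose e := (beta - n.+1)%N.
have e1 : (beta.+1 - n.+1)%N = e.+1 by rewrite subSn.
have e2 : (beta.+1 - n.+2)%N = e by rewrite subSS.
have e3 : beta = (e + n.+1)%N by rewrite /e subnK.
set X := 'X - b%:P in PE rE *; rewrite e1 in rE.
exists (kap^-1 *: (X ^+ n.+1 * q - (e.+1%:R *: r + X * r^`()) - X ^+ e.+2 * r ^+ 2)).
split.
  rewrite e2 -scalerAr [LHS]/=; congr (_ *: _).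
  have -> : kap^-1 *: (P - (sig kap P n)^`() - sig kap P n ^+ 2) = X ^+ e.+1 * r by rewrite -rE.
  rewrite {1}PE e3 exprD derivM deriv_exp derivXsubC mul1r /= scaler_nat.
  rewrite -[X ^+ e *+ _]mulr_natr -[r *+ _]mulr_natr !exprS.
  by move: (e.+1%:R) => u; ring.
have : X.[b] = 0 by rewrite hornerXsubC subrr.
move: X {PE rE} => Y Yb.
rewrite hornerZ !(hornerD, hornerN, hornerM, horner_exp, hornerZ) Yb !exprS !mul0r add0r addr0 subr0.
rewrite rb cS e1 exprS !invfM; move: (c n.+1) (e.+1%:R) => x y; ring.
Qed.

End PolynomialNorm.

(** * Propagation of the two amplitudes across one piece *)

Section RiccatiPiece.
Variable R : realType.
Local Notation C := R[i].

(** Two coupled quantities of very different size are controlled together, each relative to its own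
    weight, by a bootstrap over a stretch short enough for the rate [r]. *)
Lemma pair_growth (a c da dc : R -> C) (x0 x1 r A G : R) : x0 <= x1 -> 0 <= r ->
  r * (x1 - x0) <= 1 / 4 -> 0 < A -> 0 < G -> ccont a -> ccont c ->
  (forall x, x0 <= x <= x1 -> cder a x (da x)) -> (forall x, x0 <= x <= x1 -> cder c x (dc x)) ->
  (forall x L, x0 <= x <= x1 -> 0 <= L -> cmod (a x) <= A * L -> cmod (c x) <= G * L ->
     cmod (da x) <= r * (A * L) /\ cmod (dc x) <= r * (G * L)) ->
  cmod (a x0) <= A -> cmod (c x0) <= G ->
  forall x, x0 <= x <= x1 -> cmod (a x - a x0) <= 2 * r * (x - x0) * A /\
    cmod (c x - c x0) <= 2 * r * (x - x0) * G.
Proof.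
move=> x01 r0 rx A0 G0 ca cc ha hc hL a0 c0.
pose P L := forall x, x0 <= x <= x1 -> cmod (a x) <= A * L /\ cmod (c x) <= G * L.
have Pmon L L' : L <= L' -> P L -> P L'.
  move=> LL h x hx; have [h1 h2] := h x hx.
  by rewrite (le_trans h1) ?(le_trans h2) ?ler_wpM2l// ltW.
have Pdist L : 0 <= L -> P L -> forall x, x0 <= x <= x1 ->
    cmod (a x - a x0) <= r * (A * L) * (x - x0) /\ cmod (c x - c x0) <= r * (G * L) * (x - x0).
  move=> L0 h x /andP[xx0 xx1].
  have sub y : x0 <= y <= x -> x0 <= y <= x1 by move=> /andP[-> /le_trans ->].
  have b y : x0 <= y <= x -> cmod (da y) <= r * (A * L) /\ cmod (dc y) <= r * (G * L).
    by move=> hy; have [h1 h2] := h y (sub y hy); exact: hL (sub y hy) L0 h1 h2.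
  split.
    by apply: (@cder_dist_cst _ _ da) => // y hy; [exact/ha/sub|have [] := b y hy].
  by apply: (@cder_dist_cst _ _ dc) => // y hy; [exact/hc/sub|have [] := b y hy].
have Pstep L : 0 <= L -> P L -> P (1 + L / 4).
  move=> L0 h x hx; have [h1 h2] := Pdist L L0 h x hx; have /andP[xx0 xx1] := hx.
  have rr : r * (x - x0) <= 1 / 4.
    by apply: le_trans rx; rewrite ler_wpM2l// lerD2r.
  have q B : 0 < B -> r * (B * L) * (x - x0) <= B * (L / 4).
    move=> B0; have := ler_wpM2r (mulr_ge0 (ltW B0) L0) rr; nra.
  split.
    have := cmodD (a x - a x0) (a x0); rewrite subrK mulrDr mulr1 => /le_trans; apply.
    by rewrite addrC lerD// (le_trans h1)// q.
  have := cmodD (c x - c x0) (c x0); rewrite subrK mulrDr mulr1 => /le_trans; apply.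
  by rewrite addrC lerD// (le_trans h2)// q.
have [K K0 hK] := ccont_bounded x0 x1 ca; have [K' K0' hK'] := ccont_bounded x0 x1 cc.
have PK : P (K / A + K' / G).
  move=> x hx; split.
    rewrite (le_trans (hK x hx))// mulrDr mulrCA divff ?mulr1 ?gt_eqF// lerDl.
    by rewrite mulr_ge0 ?divr_ge0// ltW.
  rewrite (le_trans (hK' x hx))// mulrDr [G * (K' / G)]mulrCA divff ?mulr1 ?gt_eqF// lerDr.
  by rewrite mulr_ge0 ?divr_ge0// ltW.
(* [halving] only gives 3; one more step, [1 + 3 / 4], brings the factor down to 2. *)
have P3 : P 3.
  have := @halving _ P 1 (K / A + K' / G) Pmon ler01 _ _ PK 1 ltr01.
  rewrite (_ : 2 * 1 + 1 = 3); last by ring.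
  apply; first by rewrite addr_ge0// divr_ge0// ltW.
  move=> L L0 PL; apply: Pmon (Pstep L L0 PL); lra.
have P2 : P 2 by apply: Pmon (Pstep 3 _ P3) => //; lra.
move=> x hx; have [h1 h2] := Pdist 2 (ler0n _ _) P2 x hx.
by split; [apply: (le_trans h1)|apply: (le_trans h2)];
  rewrite le_eqVlt; apply/orP; left; apply/eqP; ring.
Qed.

Variables (V : R -> C) (w : C) (f p : R -> C).
Hypotheses (df : forall x, cder f x (p x)) (dp : forall x, cder p x ((V x + w ^+ 2) * f x)).

(** Up to a factor the Wronskian of [f] with a function of logarithmic derivative [w + s]: zero on
    that function, it measures the share of the other solution in [f]. *)
Definition riccati (w : C) (s : R -> C) x : C := cexp (w * x%:C) * ((w + s x) * f x - p x).

(** For an exact solution [s] of the Riccati equation the last term would vanish; the defect of an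
    approximate one is what couples the two amplitudes. *)
Lemma cder_riccati (u : C) (s : R -> C) x d : u ^+ 2 = w ^+ 2 -> cder s x d ->
  cder (riccati u s) x (- s x * riccati u s x +
    (d + s x ^+ 2 + 2 * u * s x - V x) * (f x * cexp (u * x%:C))).
Proof.
move=> uw hs.
have h := cderM (cder_cexpl u x) (cderB (cderM (cderD (cder_cst u x) hs) (df x)) (dp x)).
apply: cder_eq h _; rewrite -uw /riccati; ring.
Qed.

Lemma riccati_diff (s s' : R -> C) x :
  (2 * w + s x - s' x) * (f x * cexp (w * x%:C)) =
  riccati w s x - cexp (2 * w * x%:C) * riccati (- w) s' x.
Proof.
have e : cexp (2 * w * x%:C) * cexp (- w * x%:C) = cexp (w * x%:C).
  by rewrite -cexpD; congr cexp; ring.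
by rewrite /riccati [in RHS]mulrA e; ring.
Qed.

Lemma ccont_riccati (u : C) (s : R -> C) : ccont s -> ccont (riccati u s).
Proof.
move=> cs; apply: ccontM; first exact: (cder_ccont (fun x => cder_cexpl u x)).
apply: ccontB; last exact: cder_ccont dp.
by apply: ccontM; [apply: ccontD => //; exact: ccont_cst|exact: cder_ccont df].
Qed.

Let kap : C := 2 * w.
Let k := cmod kap.

(** The amplitudes of [f] along the solutions close to [exp (- w x)] and [exp (w x)] respectively.
    The division by [kap] makes the first one start near 1. *)
Definition apl P n x : C := riccati w (fun y => (sig kap P n).[y%:C]) x / kap.
Definition cmi P n x : C := riccati (- w) (fun y => (sig (- kap) P n).[y%:C]) x.

Lemma ccont_poly (P : {poly C}) : ccont (fun y => P.[y%:C]).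
Proof. exact: (cder_ccont (fun x => cder_poly P x)). Qed.

Section Piece.
Variables (P : {poly C}) (N : nat) (x0 x1 s g E : R).
Hypotheses (x01 : x0 <= x1) (x00 : 0 <= x0) (x11 : x1 <= 1).
Hypothesis VP : forall x, x0 <= x <= x1 -> V x = P.[x%:C].
Hypotheses (w0 : 0 <= complex.Re w) (hE : expR (2 * complex.Re w) <= E).
Hypotheses (k1 : 1 <= k) (s0 : 0 <= s) (g0 : 0 <= g) (sk : 4 * s <= k).
Hypothesis hs : forall u : C, cmod u = k -> pnorm (sig u P N) <= s / k.
Hypothesis hg : forall u : C, cmod u = k ->
  pnorm (sig u P N.+1 - sig u P N) <= g / k ^+ N.+1.

Let k0 : 0 < k. Proof. exact: lt_le_trans k1. Qed.

Let kap0 : kap != 0. Proof. by rewrite -cmod_gt0. Qed.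

Let x_le x : x0 <= x <= x1 -> cmod x%:C <= 1.
Proof.
move=> /andP[h1 h2]; rewrite cmodC ger0_norm; first exact: le_trans x11.
exact: le_trans h1.
Qed.

Let sig_le u x : cmod u = k -> x0 <= x <= x1 -> cmod (sig u P N).[x%:C] <= s / k.
Proof. by move=> uk hx; apply: le_trans (horner_pnorm _ (x_le hx)) (hs uk). Qed.

(** By construction of the iterates the defect of the N-th one is [- u] times the difference to the
    next, hence of order [k ^ - N]. *)
Let rho_le u x : cmod u = k -> x0 <= x <= x1 ->
  cmod ((sig u P N)^`().[x%:C] + (sig u P N).[x%:C] ^+ 2 + u * (sig u P N).[x%:C] - V x) <= g / k ^+ N.
Proof.
move=> uk hx; have u0 : u != 0 by rewrite -cmod_gt0 uk.
have e : u *: sig u P N.+1 = P - (sig u P N)^`() - sig u P N ^+ 2.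
  by rewrite /= scalerA mulfV// scale1r.
have -> : (sig u P N)^`().[x%:C] + (sig u P N).[x%:C] ^+ 2 + u * (sig u P N).[x%:C] - V x =
    - (u * (sig u P N.+1 - sig u P N).[x%:C]).
  have e' : u * (sig u P N.+1).[x%:C] = P.[x%:C] - (sig u P N)^`().[x%:C] - (sig u P N).[x%:C] ^+ 2.
    by rewrite -hornerZ e !(hornerD, hornerN) horner_exp.
  by rewrite hornerD hornerN mulrBr e' VP//; ring.
rewrite cmodN cmodM uk.
have h := le_trans (horner_pnorm _ (x_le hx)) (hg uk).
apply: le_trans (ler_wpM2l (ltW k0) h) _.
rewrite exprS invfM mulrCA [k * _]mulrA divff ?gt_eqF// mul1r//.
Qed.

Let D x : C := kap + (sig kap P N).[x%:C] - (sig (- kap) P N).[x%:C].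

Let D_le x : x0 <= x <= x1 -> k / 2 <= cmod (D x).
Proof.
move=> hx; have h1 := sig_le (erefl k) hx; have h2 := @sig_le (- kap) x (cmodN _) hx.
have sk4 : s / k <= k / 4.
  rewrite ler_pdivrMr//; have := ler_wpM2l (ltW k0) k1; have := sk; nra.
have := cmod_dist kap (- ((sig kap P N).[x%:C] - (sig (- kap) P N).[x%:C])).
rewrite opprK addrA -/(D x) cmodN ler_norml => /andP[_].
by have := cmodB (sig kap P N).[x%:C] (sig (- kap) P N).[x%:C]; rewrite -/k; lra.
Qed.

Let fexpE x : x0 <= x <= x1 -> f x * cexp (w * x%:C) =
  (kap * apl P N x - cexp (kap * x%:C) * cmi P N x) / D x.
Proof.
move=> hx; have D0 : D x != 0 by rewrite -cmod_gt0 (lt_le_trans _ (D_le hx))// divr_gt0.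
have -> : kap * apl P N x = riccati w (fun y => (sig kap P N).[y%:C]) x.
  by rewrite /apl mulrCA divff// mulr1.
apply: (mulIf D0); rewrite divfK// mulrC.
rewrite /D /kap.
by rewrite -(riccati_diff (fun y => (sig kap P N).[y%:C]) (fun y => (sig (- kap) P N).[y%:C])).
Qed.

Let E1 : 1 <= E.
Proof. by apply: le_trans hE; rewrite -[leLHS]expR0 ler_expR mulr_ge0. Qed.

Let Re_kap x : complex.Re (kap * x%:C) = 2 * complex.Re w * x.
Proof. by rewrite !ReM !ImM /=; ring. Qed.

Let exp_le x : x0 <= x <= x1 -> cmod (cexp (kap * x%:C)) <= E.
Proof.
move=> /andP[h1 h2]; rewrite cmod_cexp Re_kap; apply: le_trans hE.
rewrite ler_expR ler_piMr ?mulr_ge0//; exact: le_trans x11.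
Qed.

Let expN_le x : x0 <= x <= x1 -> cmod (cexp (- kap * x%:C)) <= 1.
Proof.
move=> /andP[h1 h2]; rewrite cmod_cexp mulNr ReN Re_kap -[leRHS]expR0 ler_expR oppr_le0.
by rewrite !mulr_ge0// (le_trans x00).
Qed.

Lemma fexp_le x : x0 <= x <= x1 ->
  cmod (f x * cexp (w * x%:C)) <= 2 * cmod (apl P N x) + 2 * E * cmod (cmi P N x) / k /\
  cmod (f x * cexp (- w * x%:C)) <=
    2 * cmod (cexp (- kap * x%:C) * apl P N x) + 2 * cmod (cmi P N x) / k.
Proof.
move=> hx; have h1 := D_le hx; have D0 : 0 < cmod (D x) by rewrite (lt_le_trans _ h1)// divr_gt0.
have d2 : (cmod (D x))^-1 <= 2 / k by rewrite -[2 / _]invf_div lef_pV2// posrE divr_gt0.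
have key y : cmod (y / D x) <= cmod y * (2 / k).
  by rewrite cmod_div ler_wpM2l// cmod_ge0.
have kk : k / k = 1 by rewrite divff// gt_eqF.
split.
  rewrite fexpE//; apply: le_trans (key _) _.
  apply: le_trans (ler_wpM2r _ (cmodB _ _)) _; first by rewrite divr_ge0// ltW.
  rewrite mulrDl [cmod (kap * _)]cmodM [cmod (cexp _ * _)]cmodM -/k lerD//.
    have -> : k * cmod (apl P N x) * (2 / k) = 2 * cmod (apl P N x) * (k / k) by ring.
    by rewrite kk mulr1.
  have -> : cmod (cexp (kap * x%:C)) * cmod (cmi P N x) * (2 / k) =
    cmod (cexp (kap * x%:C)) * (2 * cmod (cmi P N x) / k) by ring.
  have -> : 2 * E * cmod (cmi P N x) / k = E * (2 * cmod (cmi P N x) / k) by ring.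
  by rewrite ler_wpM2r ?exp_le// divr_ge0 ?(ltW k0)// mulr_ge0// cmod_ge0.
have -> : f x * cexp (- w * x%:C) =
    (kap * (cexp (- kap * x%:C) * apl P N x) - cmi P N x) / D x.
  have e1 : cexp (- w * x%:C) = cexp (- kap * x%:C) * cexp (w * x%:C).
    by rewrite -cexpD; congr cexp; rewrite /kap; ring.
  have e2 : cexp (- kap * x%:C) * cexp (kap * x%:C) = 1.
    by rewrite -cexpD mulNr addNr cexp0.
  rewrite e1 mulrCA fexpE// [LHS]mulrA; congr (_ / _).
  by rewrite mulrBr [_ * (cexp _ * cmi _ _ _)]mulrA e2 mul1r mulrCA.
apply: le_trans (key _) _.
apply: le_trans (ler_wpM2r _ (cmodB _ _)) _; first by rewrite divr_ge0// ltW.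
rewrite mulrDl [cmod (kap * _)]cmodM -/k lerD//.
  set y := cmod _; have -> : k * y * (2 / k) = 2 * y * (k / k) by ring.
  by rewrite kk mulr1.
by rewrite mulrA [_ * 2]mulrC.
Qed.

Variables (A G : R).
Hypotheses (A0 : 0 < A) (G0 : 0 < G).
Hypotheses (hAG : 2 * g * E * G <= k ^+ N.+1 * A) (hGA : 2 * g * A * k <= k ^+ N * G).
Let r := (s + 2 * g + 1) / k.
Hypothesis hr : r <= 1 / 4.

(** The amplitudes act on each other through the defect only. The assumptions [hAG] and [hGA] state
    that this coupling, of order [k ^ - N], is weak compared with the ratio of the weights in spite
    of the exponential growth [E]. *)
Lemma piece_growth : cmod (apl P N x0) <= A -> cmod (cmi P N x0) <= G ->
  forall x, x0 <= x <= x1 -> cmod (apl P N x - apl P N x0) <= 2 * r * (x - x0) * A /\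
    cmod (cmi P N x - cmi P N x0) <= 2 * r * (x - x0) * G.
Proof.
have r0 : 0 <= r by rewrite divr_ge0 ?(ltW k0)// !addr_ge0// mulr_ge0.
have kN : 0 < k ^+ N by rewrite exprn_gt0.
have kN1 : 1 <= k ^+ N by rewrite exprn_ege1.
pose rho u x := (sig u P N)^`().[x%:C] + (sig u P N).[x%:C] ^+ 2 + u * (sig u P N).[x%:C] - V x.
pose da x := - (sig kap P N).[x%:C] * apl P N x + rho kap x * (f x * cexp (w * x%:C)) / kap.
pose dc x := - (sig (- kap) P N).[x%:C] * cmi P N x + rho (- kap) x * (f x * cexp (- w * x%:C)).
apply: (@pair_growth (apl P N) (cmi P N) da dc) => //.
- rewrite -[leRHS]mulr1; apply: ler_pM => //; first by rewrite subr_ge0.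
  have := x11; have := x00; lra.
- apply: ccont_ext (ccontZ kap^-1 (ccont_riccati w (ccont_poly (sig kap P N)))) => x.
  exact: mulrC.
- exact: ccont_riccati (ccont_poly _).
- move=> x _; have := cderZ kap^-1 (cder_riccati (erefl (w ^+ 2)) (cder_poly (sig kap P N) x)).
  apply: cder_ext => [y|]; first exact: mulrC.
  by rewrite /da /apl /rho /kap; ring.
- move=> x _; have := cder_riccati (sqrrN w) (cder_poly (sig (- kap) P N) x).
  by apply: cder_ext => //; rewrite /dc /cmi /rho /kap; ring.
move=> x L hx L0 aL cL.
have [f1 f2] := fexp_le hx.
have q1 := sig_le (erefl k) hx; have q2 := @sig_le (- kap) x (cmodN _) hx.
have r1 := rho_le (erefl k) hx; have r2 := @rho_le (- kap) x (cmodN _) hx.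
rewrite -/(rho _ _) in r1; rewrite -/(rho _ _) in r2.
have AL0 : 0 <= A * L by rewrite mulr_ge0// ltW.
have GL0 : 0 <= G * L by rewrite mulr_ge0// ltW.
have gk0 : 0 <= g / k ^+ N by rewrite divr_ge0// ltW.
have gk : g / k ^+ N <= g by rewrite ler_pdivrMr// ler_peMr.
have sk0 : 0 <= s / k by rewrite divr_ge0// ltW.
split.
  rewrite (le_trans (cmodD _ _))// cmodM cmodN [cmod (rho _ _ * _ / kap)]cmod_div [cmod (rho _ _ * _)]cmodM -/k.
  have t1 : cmod (sig kap P N).[x%:C] * cmod (apl P N x) <= s / k * (A * L).
    by apply: ler_pM => //; exact: cmod_ge0.
  have t2 : cmod (f x * cexp (w * x%:C)) <= 2 * (A * L) + 2 * E * (G * L) / k.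
    apply: (le_trans f1); rewrite lerD ?ler_wpM2l//.
    by rewrite ler_wpM2r ?invr_ge0 ?(ltW k0)// ler_wpM2l// mulr_ge0// (le_trans _ E1).
  have t3 := ler_pM (cmod_ge0 _) (cmod_ge0 _) r1 t2.
  have t4 : cmod (rho kap x) * cmod (f x * cexp (w * x%:C)) / k <= (2 * g + 1) / k * (A * L).
    rewrite [leRHS]mulrAC ler_wpM2r ?invr_ge0 ?(ltW k0)//; apply: (le_trans t3).
    rewrite mulrDr [leRHS]mulrDl mul1r lerD//.
      have -> : 2 * g * (A * L) = g * (2 * (A * L)) by ring.
      by rewrite ler_wpM2r// mulr_ge0.
    have -> : g / k ^+ N * (2 * E * (G * L) / k) = 2 * g * E * G / (k * k ^+ N) * L.
      by rewrite invfM; ring.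
    rewrite ler_wpM2r// ler_pdivrMr; first by rewrite [A * _]mulrC -exprS.
    by rewrite mulr_gt0.
  by apply: le_trans (lerD t1 t4) _; rewrite /r; rewrite -mulrDl -mulrDl addrA.
rewrite (le_trans (cmodD _ _))// cmodM cmodN [cmod (rho _ _ * _)]cmodM.
have t1 : cmod (sig (- kap) P N).[x%:C] * cmod (cmi P N x) <= s / k * (G * L).
  by apply: ler_pM => //; exact: cmod_ge0.
have t2 : cmod (f x * cexp (- w * x%:C)) <= 2 * (A * L) + 2 * (G * L) / k.
  apply: (le_trans f2); rewrite lerD//; last first.
    by rewrite ler_wpM2r ?invr_ge0 ?(ltW k0)// ler_wpM2l.
  rewrite ler_wpM2l// cmodM; apply: le_trans aL.
  by rewrite ler_piMl ?cmod_ge0// expN_le.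
have t3 := ler_pM (cmod_ge0 _) (cmod_ge0 _) r2 t2.
have t4 : g / k ^+ N * (2 * (A * L) + 2 * (G * L) / k) <= (2 * g + 1) / k * (G * L).
  rewrite mulrDr [in leRHS]mulrDl mulrDl addrC lerD//.
    have -> : 2 * g / k * (G * L) = g * (2 * (G * L) / k) by ring.
    by rewrite ler_wpM2r// divr_ge0 ?(ltW k0)// mulr_ge0.
  have -> : g / k ^+ N * (2 * (A * L)) = 2 * g * A / k ^+ N * L by ring.
  have -> : 1 / k * (G * L) = G / k * L by ring.
  by rewrite ler_wpM2r// ler_pdivrMr// [leRHS]mulrAC ler_pdivlMr// [G * _]mulrC.
apply: le_trans (lerD t1 (le_trans t3 t4)) _.
by rewrite /r -mulrDl -mulrDl addrA.
Qed.

End Piece.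

End RiccatiPiece.

(** * Asymptotics of the Wronskian *)

Section BigO.
Variable R : realType.
Local Notation C := R[i].
Variables (Dom : C -> Prop) (kk : C -> R).
Implicit Types (F : C -> C) (H : C -> R) (P Q : C -> Prop).

Definition evl P : Prop := exists2 L : R, 1 <= L & forall l, Dom l -> L <= kk l -> P l.

Lemma evl_true P : (forall l, Dom l -> P l) -> evl P.
Proof. by move=> h; exists 1 => // l Dl _; exact: h. Qed.

Lemma evl_ge (B : R) : evl (fun l => B <= kk l).
Proof.
exists (Num.max 1 B); first by rewrite le_max lexx.
by move=> l _; rewrite ge_max => /andP[].
Qed.

Lemma evl_and P Q : evl P -> evl Q -> evl (fun l => P l /\ Q l).
Proof.
move=> [L L1 h] [M M1 h']; exists (Num.max L M); first by rewrite le_max L1.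
by move=> l Dl; rewrite ge_max => /andP[h1 h2]; split; [exact: h|exact: h'].
Qed.

Lemma evl_imp P Q : evl P -> (forall l, Dom l -> 1 <= kk l -> P l -> Q l) -> evl Q.
Proof.
by move=> [L L1 h] PQ; exists L => // l Dl hl; apply: PQ => //; [exact: le_trans hl|exact: h].
Qed.

Definition bO F H : Prop := exists2 K : R, 0 <= K & evl (fun l => cmod (F l) <= K * H l).

Lemma bO_D F1 F2 H : bO F1 H -> bO F2 H -> bO (fun l => F1 l + F2 l) H.
Proof.
move=> [K K0 h] [M M0 h']; exists (K + M); first exact: addr_ge0.
apply: evl_imp (evl_and h h') _ => l _ _ [a1 a2].
by rewrite mulrDl (le_trans (cmodD _ _))// lerD.
Qed.

Lemma bO_N F H : bO F H -> bO (fun l => - F l) H.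
Proof. by move=> [K K0 h]; exists K => //; apply: evl_imp h _ => l _ _; rewrite cmodN. Qed.

Lemma bO_B F1 F2 H : bO F1 H -> bO F2 H -> bO (fun l => F1 l - F2 l) H.
Proof. by move=> h1 /bO_N; exact: bO_D. Qed.

Lemma bO_M F1 F2 H1 H2 : bO F1 H1 -> bO F2 H2 -> bO (fun l => F1 l * F2 l) (fun l => H1 l * H2 l).
Proof.
move=> [K K0 h] [M M0 h']; exists (K * M); first exact: mulr_ge0.
apply: evl_imp (evl_and h h') _ => l _ _ [a1 a2].
by rewrite cmodM mulrACA ler_pM ?cmod_ge0.
Qed.

Lemma bO_le F H H' (B : R) : bO F H -> 0 <= B -> evl (fun l => H l <= B * H' l) -> bO F H'.
Proof.
move=> [K K0 h] B0 h'; exists (K * B); first exact: mulr_ge0.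
apply: evl_imp (evl_and h h') _ => l _ _ [a1 a2].
by rewrite (le_trans a1)// -mulrA ler_wpM2l.
Qed.

Lemma bO_ext F G H : evl (fun l => F l = G l) -> bO F H -> bO G H.
Proof.
by move=> e [K K0 h]; exists K => //; apply: evl_imp (evl_and e h) _ => l _ _ [<-].
Qed.

End BigO.

(** * Values of the approximations at the nodes *)

Section JumpValues.
Variable R : realType.
Local Notation C := R[i].
Variables (P : {poly C}) (g : nat -> R) (b : C).
Hypotheses (g0 : forall n, 0 <= g n) (b1 : cmod b <= 1).
Hypothesis hg : forall n (u : C), 1 <= cmod u ->
  pnorm (sig u P n.+1 - sig u P n) <= g n / cmod u ^+ n.+1.

Lemma sig_telescope m n u : 1 <= cmod u -> (m <= n)%N ->
  cmod ((sig u P n).[b] - (sig u P m).[b]) <= (\sum_(i < n) g i) / cmod u ^+ m.+1.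
Proof.
move=> u1 mn; have u0 : 0 < cmod u by exact: lt_le_trans u1.
elim: n mn => [|n IH].
  by rewrite leqn0 => /eqP ->; rewrite subrr cmod0 divr_ge0// ?sumr_ge0// exprn_ge0// ltW.
rewrite leq_eqVlt => /predU1P[<-|].
  by rewrite subrr cmod0 divr_ge0// ?sumr_ge0// exprn_ge0// ltW.
rewrite ltnS => mn.
have -> : \sum_(i < n.+1) g i = \sum_(i < n) g i + g n by rewrite big_ord_recr.
rewrite mulrDl [leRHS]addrC.
have -> : (sig u P n.+1).[b] - (sig u P m).[b] =
    (sig u P n.+1 - sig u P n).[b] + ((sig u P n).[b] - (sig u P m).[b]).
  by rewrite hornerD hornerN; ring.
rewrite (le_trans (cmodD _ _))// lerD ?IH//.
rewrite (le_trans (horner_pnorm _ b1))// (le_trans (hg n u1))// ler_wpM2l//.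
by rewrite lef_pV2 ?posrE ?exprn_gt0// ler_weXn2l.
Qed.

Variables (q : {poly C}) (beta : nat).
Hypotheses (Pq : P = ('X - b%:P) ^+ beta * q) (q0 : q.[b] != 0).

Lemma sig_zero u n : u != 0 -> (n <= beta)%N -> (sig u P n).[b] = 0.
Proof.
move=> u0; case: n => [|n] nb; first by rewrite horner0.
have [c [_ h]] := sig_vanish Pq q0.
have [|r [-> _]] := h u n.+1 u0; first by rewrite (leqW nb).
rewrite subSS -(@subnSK n beta nb) exprS hornerM hornerM hornerXsubC subrr !mul0r//.
Qed.

Lemma sig_lead : exists2 c : C, c != 0 & forall n u, 1 <= cmod u -> (beta < n)%N ->
  cmod ((sig u P n).[b] - c * u ^- beta.+1) <= (\sum_(i < n) g i) / cmod u ^+ beta.+2.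
Proof.
have [c [c0 h]] := sig_vanish Pq q0; exists (c beta.+1); first by rewrite c0 ?leqnn.
move=> n u u1 bn; have u0 : u != 0 by rewrite -cmod_gt0 (lt_le_trans _ u1).
have [|r [e rb]] := h u beta.+1 u0; first by rewrite leqnn.
by rewrite -rb (_ : r.[b] = (sig u P beta.+1).[b]) ?sig_telescope// e subnn expr0 mul1r.
Qed.

End JumpValues.

(** * Propagation through all pieces up to the accumulation point *)

Section Asymptotics.
Variable R : realType.
Local Notation C := R[i].
Variables (b : nat -> R) (beta : nat -> nat).
Hypotheses (b0 : b 0%N = 0) (b_incr : forall k, b k < b k.+1) (b_lim : b @ \oo --> (1 : R)).
Hypothesis beta_incr : forall k, (1 <= k)%N -> (beta k < beta k.+1)%N.
Hypothesis beta1_gt0 : (0 < beta 1)%N.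
Variables (V : R -> C) (v : R).
Hypotheses (cV : ccont V) (hV : forall x, cmod (V x) <= v).
Hypothesis V_out : forall x, ~~ (0 < x < 1) -> V x = 0.
Variables (P qL qR : nat -> {poly C}) (s g : nat -> nat -> R).
Hypothesis VP : forall k x, b k <= x <= b k.+1 -> V x = (P k).[x%:C].
Hypothesis PL : forall k, P k = ('X - (b k)%:C%:P) ^+ beta k.+1 * qL k.
Hypothesis PR : forall k, P k = ('X - (b k.+1)%:C%:P) ^+ beta k.+1 * qR k.
Hypothesis qL0 : forall k, (qL k).[(b k)%:C] != 0.
Hypothesis qR0 : forall k, (qR k).[(b k.+1)%:C] != 0.
Hypotheses (s0 : forall k n, 0 <= s k n) (g0 : forall k n, 0 <= g k n).
Hypothesis hs : forall k n (u : C), 1 <= cmod u -> pnorm (sig u (P k) n) <= s k n / cmod u.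
Hypothesis hg : forall k n (u : C), 1 <= cmod u ->
  pnorm (sig u (P k) n.+1 - sig u (P k) n) <= g k n / cmod u ^+ n.+1.
Hypotheses (s1 : forall k n, (n <= k)%N -> s k n <= 1) (g1 : forall k n, (n <= k)%N -> g k n <= 1).

Lemma b_mono i j : (i <= j)%N -> b i <= b j.
Proof.
elim: j => [|j IH]; first by rewrite leqn0 => /eqP ->.
rewrite leq_eqVlt => /predU1P[->//|]; rewrite ltnS => /IH h.
by rewrite (le_trans h)// ltW.
Qed.

Lemma b_ge0 k : 0 <= b k. Proof. by rewrite -b0; exact: b_mono. Qed.

Lemma b_near (e : R) N : 0 < e -> exists2 m, (N <= m)%N & `|1 - b m| <= e.
Proof.
move=> e0; have /cvgrPdist_le/(_ e e0) := b_lim; case=> M _ hM.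
exists (maxn N M); first exact: leq_maxl.
exact: (hM (maxn N M) (leq_maxr N M)).
Qed.

Lemma b_lt1 k : b k < 1.
Proof.
have k1 : 0 < (b k.+1 - b k) / 2 by rewrite divr_gt0// subr_gt0.
have [m km hm] := b_near k.+1 k1.
have := b_mono km; have := b_incr k; move: hm; rewrite ler_norml => /andP[]; lra.
Qed.

Lemma beta_mono i j : (1 <= i)%N -> (i <= j)%N -> (beta i <= beta j)%N.
Proof.
move=> i1; elim: j => [|j IH]; first by case: i i1.
rewrite leq_eqVlt => /predU1P[->//|]; rewrite ltnS => ij.
by rewrite (leq_trans (IH ij))// ltnW// beta_incr// (leq_trans i1).
Qed.

Lemma beta_ge k : (k <= beta k)%N.
Proof.
case: k => // k; elim: k => // k IH.
by rewrite (leq_ltn_trans IH)// beta_incr.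
Qed.

Let cb k : cmod (b k)%:C <= 1.
Proof. by rewrite cmodC ger0_norm ?b_ge0// ltW// b_lt1. Qed.

Let w (l : C) : C := 'i * l.
Let kap (l : C) : C := 2 * w l.
Definition kk (l : C) : R := cmod (2 * ('i * l)).

Let re (l : C) : R := complex.Re (w l).

Variables (N T : nat) (G : R).
Hypotheses (G1 : 1 <= G) (NT : (T + beta 1 + 3 <= N)%N).

(** A region of the lower half plane around logarithmic curves. The polynomial upper bound on the
    growth lets approximations of finite order [N] suffice; the lower bound at the first node makes
    the growing wave dominate there. *)
Definition Dom (l : C) : Prop := [/\ 0 <= re l, expR (2 * re l) <= G * kk l ^+ T
  & kk l ^+ 4 <= G * expR (2 * re l * b 1)].

Local Notation evl := (evl Dom kk).
Local Notation bO := (bO Dom kk).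

(** Size of the double reflection between 0 and [b j]; [YY] adds up these sizes and that of the
    direct wave. *)
Definition TT j (l : C) : R := expR (2 * re l * b j) / kk l ^+ (4 + beta 1 + beta j).

Definition YY n (l : C) : R := 1 + \sum_(i < n) TT i.+1 l.

Let f l := phi V l.
Let p l := phip V l.

Let df l x : cder (f l) x (p l x).
Proof.
by have [h _ _] := phiP cV hV l; have [h1 _] := h x; rewrite addr0 in h1.
Qed.

Let dp l x : cder (p l) x ((V x + w l ^+ 2) * f l x).
Proof.
have [h _ _] := phiP cV hV l; have [_ h1] := h x; rewrite addr0 in h1.
by apply: cder_eq h1 _; rewrite /w exprMn sqr_i mulN1r.
Qed.

Let aa k l x : C := apl (w l) (f l) (p l) (P k) N x.
Let cc k l x : C := cmi (w l) (f l) (p l) (P k) N x.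

Let kkE l : cmod (kap l) = kk l. Proof. by []. Qed.

(* Jumps of the approximate solutions of the Riccati equation. *)
Let J (u : C) j : C := (sig u (P j.+1) N).[(b j.+1)%:C] - (sig u (P j) N).[(b j.+1)%:C].

Let cc0 l : C := (sig (- kap l) (P 0%N) N).[0].

(** A double reflection: the incident decaying wave produces the growing amplitude [cc0] at 0, which
    is amplified by the exponential up to the node and turned back by the jump there. *)
Definition tau j (l : C) : C := - (J (kap l) j * cexp (kap l * (b j.+1)%:C) * cc0 l / kap l ^+ 2).

Definition SS n l : C := 1 + \sum_(i < n) tau i l.

Let kk0 l : 1 <= kk l -> 0 < kk l. Proof. exact: lt_le_trans. Qed.

Lemma TT_ge0 j l : 0 <= TT j l.
Proof. by rewrite divr_ge0 ?expR_ge0// exprn_ge0// cmod_ge0. Qed.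

Lemma YY_ge1 n l : 1 <= YY n l.
Proof. by rewrite lerDl sumr_ge0// => i _; exact: TT_ge0. Qed.

Lemma YY_S n l : YY n.+1 l = YY n l + TT n.+1 l.
Proof. by rewrite /YY big_ord_recr addrA. Qed.

Lemma YY_le n l : Dom l -> 1 <= kk l -> YY n l <= (1 + n%:R) * (G * kk l ^+ T).
Proof.
move=> [r0 hE _] k1; have k0 := kk0 k1.
have E1 : 1 <= expR (2 * re l) by rewrite -[leLHS]expR0 ler_expR mulr_ge0.
rewrite mulrDl mul1r /YY lerD ?(le_trans E1)//.
rewrite -[X in X%:R]card_ord -sumr_const mulr_suml; apply: ler_sum => i _; rewrite mul1r.
apply: le_trans hE; apply: (@le_trans _ _ (expR (2 * re l * b i.+1))).
  by rewrite ler_piMr ?expR_ge0// invf_le1 ?exprn_gt0// exprn_ege1.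
by rewrite ler_expR ler_piMr ?mulr_ge0// ltW// b_lt1.
Qed.

(** The lower bound in [Dom] enters here: the accumulated decaying amplitude is smaller than the
    growth factor at the next node by four powers of [kk l]. *)
Lemma YY_div n l : Dom l -> 1 <= kk l ->
  YY n l / expR (2 * re l * b n.+1) <= (G + n%:R) / kk l ^+ 4.
Proof.
move=> [r0 _ h1] k1; have k0 := kk0 k1; have e0 := expR_gt0 (2 * re l * b n.+1).
have k40 : 0 < kk l ^+ 4 by rewrite exprn_gt0.
have hb i : (i <= n)%N -> expR (2 * re l * b i.+1) <= expR (2 * re l * b n.+1).
  by move=> i_n; rewrite ler_expR ler_wpM2l ?mulr_ge0// b_mono.
rewrite /YY mulrDl [leRHS]mulrDl lerD//.
  rewrite ler_pdivrMr// [leRHS]mulrAC ler_pdivlMr// mul1r (le_trans h1)//.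
  by rewrite ler_wpM2l ?(le_trans ler01)// hb.
have -> : n%:R / kk l ^+ 4 = \sum_(i < n) (kk l ^+ 4)^-1.
  by rewrite sumr_const card_ord mulr_natl.
rewrite mulr_suml; apply: ler_sum => i _.
rewrite /TT mulrAC ler_pdivrMr ?exprn_gt0// -addnA exprD mulrA mulVf ?gt_eqF//.
rewrite mul1r ler_pdivrMr// (le_trans (hb i _))//; first by rewrite ltnW.
by rewrite ler_peMl// ?expR_ge0// exprn_ege1.
Qed.

Let evl_le (D : R) (P' : C -> Prop) : (forall l, Dom l -> 1 <= kk l -> D <= kk l -> P' l) -> evl P'.
Proof. by move=> h; apply: evl_imp (evl_ge Dom kk D) _ => l Dl k1; exact: h. Qed.

Let bO_k F m n : (n <= m)%N -> bO F (fun l => (kk l ^+ m)^-1) -> bO F (fun l => (kk l ^+ n)^-1).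
Proof.
move=> nm h; apply: (bO_le (B := 1)) h _ _ => //.
apply: (@evl_le 1) => l _ k1 _; rewrite mul1r lef_pV2 ?posrE ?exprn_gt0 ?kk0//.
exact: ler_weXn2l.
Qed.

(** At [b (j + 1)] the left piece vanishes to order [beta (j + 1)] and the right one to the higher
    order [beta (j + 2)], so the left one decides. If [N <= beta (j + 1)] both values are exactly
    0. *)
Let J_small j : bO (fun l => J (kap l) j) (fun l => (kk l ^+ (beta j.+1).+1)^-1) /\
  bO (fun l => J (- kap l) j) (fun l => (kk l ^+ (beta j.+1).+1)^-1).
Proof.
have [N1|N1] := leqP N (beta j.+1).
  have N2 : (N <= beta j.+2)%N by rewrite (leq_trans N1)// ltnW// beta_incr.
  have J0 u : u != 0 -> J u j = 0.
    by move=> u0; rewrite /J (sig_zero (PL j.+1) (qL0 _) u0 N2) (sig_zero (PR j) (qR0 _) u0 N1) subr0.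
  split; exists 0 => //; apply: (@evl_le 1) => l _ k1 _; rewrite J0 ?cmod0 ?mul0r//.
    by rewrite -cmod_gt0 kkE kk0.
  by rewrite oppr_eq0 -cmod_gt0 kkE kk0.
have [c c0 hc] := sig_lead (g0 j) (cb j.+1) (hg j) (PR j) (qR0 j).
pose K := \sum_(i < N) g j i + \sum_(i < N) g j.+1 i + cmod c.
have K1 : 0 <= \sum_(i < N) g j i by exact: sumr_ge0.
have K2 : 0 <= \sum_(i < N) g j.+1 i by exact: sumr_ge0.
have K0 : 0 <= K by rewrite addr_ge0 ?cmod_ge0// addr_ge0.
have key u : 1 <= cmod u -> cmod (J u j) <= K * (cmod u ^+ (beta j.+1).+1)^-1.
  move=> u1; have u0 : 0 < cmod u by exact: lt_le_trans u1.
  have h1 := hc N u u1 N1.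
  have h2 := sig_telescope (g0 j.+1) (cb j.+1) (hg j.+1) u1 N1.
  rewrite (sig_zero (PL j.+1) (qL0 _) (n := (beta j.+1).+1)) in h2.
  - rewrite subr0 in h2.
    have i1 : (cmod u ^+ (beta j.+1).+2)^-1 <= (cmod u ^+ (beta j.+1).+1)^-1.
      by rewrite lef_pV2 ?posrE ?exprn_gt0// ler_weXn2l.
    rewrite /J (_ : _ - _ = (sig u (P j.+1) N).[(b j.+1)%:C] -
      ((sig u (P j) N).[(b j.+1)%:C] - c * u ^- (beta j.+1).+1) - c * u ^- (beta j.+1).+1); last by ring.
    rewrite (le_trans (cmodB _ _))// (le_trans (lerD (cmodB _ _) (lexx _)))//.
    rewrite /K !mulrDl [X in _ <= X + _]addrC lerD//; last by rewrite cmodM cmodV cmodX.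
    by rewrite lerD ?(le_trans h2) ?(le_trans h1) ?ler_wpM2l.
  - by rewrite -cmod_gt0.
  - exact: beta_incr.
split; exists K => //; apply: (@evl_le 1) => l _ k1 _.
  by apply: key; rewrite kkE.
by have := @key (- kap l); rewrite cmodN kkE; exact.
Qed.

Let N_beta1 : (beta 1 < N)%N.
Proof. by apply: leq_trans NT; rewrite -addnA addnC -addnA -[ltnLHS]addn0 ltn_add2l. Qed.

Let cc0_lead : exists2 c : C, c != 0 &
  bO (fun l => cc0 l - c * kap l ^- (beta 1).+1) (fun l => (kk l ^+ (beta 1).+2)^-1).
Proof.
have [c c0 hc] := sig_lead (g0 0%N) (cb 0%N) (hg 0%N) (PL 0%N) (qL0 0%N).
exists (c * (-1) ^+ (beta 1).+1); first by rewrite mulf_neq0// signr_eq0.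
exists (\sum_(i < N) g 0%N i); first exact: sumr_ge0.
apply: (@evl_le 1) => l _ k1 _.
have := hc N (- kap l); rewrite cmodN kkE b0 => /(_ k1 N_beta1).
have -> : c / (- kap l) ^+ (beta 1).+1 = c * (-1) ^+ (beta 1).+1 / kap l ^+ (beta 1).+1.
  by rewrite [(- kap l) ^+ _]exprNn invfM -[X in _ * (X * _)]exprVn invrN invr1 mulrA.
exact.
Qed.

Let cc0_small : bO cc0 (fun l => (kk l ^+ (beta 1).+1)^-1).
Proof.
have [c c0 hc] := cc0_lead.
have h1 := bO_k (leqnSn _) hc.
have h2 : bO (fun l => c * kap l ^- (beta 1).+1) (fun l => (kk l ^+ (beta 1).+1)^-1).
  exists (cmod c); first exact: cmod_ge0.
  by apply: (@evl_le 1) => l _ k1 _; rewrite cmodM cmodV cmodX.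
apply: bO_ext (bO_D h1 h2); apply: evl_true => l _; exact: subrK.
Qed.

Let E (j : nat) l := expR (2 * re l * b j).

Let cexp_E l j : cmod (cexp (kap l * (b j)%:C)) = E j l.
Proof. by rewrite cmod_cexp /E /re; congr expR; rewrite ReM [complex.Re (kap l)]ReM /=; ring. Qed.

Let TT_E j l : TT j.+1 l = (kk l ^+ (beta j.+1).+1)^-1 * E j.+1 l * (kk l ^+ (beta 1).+1)^-1 * (kk l ^+ 2)^-1.
Proof.
have -> : TT j.+1 l = E j.+1 l / kk l ^+ ((beta j.+1).+1 + (beta 1).+1 + 2).
  by rewrite addn2 addnS addSn [(beta j.+1 + _)%N]addnC.
by rewrite !exprD !invfM; ring.
Qed.

Let bO_kap : bO (fun l => (kap l)^-1) (fun l => (kk l ^+ 1)^-1).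
Proof. by exists 1 => //; apply: evl_true => l _; rewrite cmodV mul1r expr1. Qed.

Let bO_kap2 : bO (fun l => kap l ^- 2) (fun l => (kk l ^+ 2)^-1).
Proof. by exists 1 => //; apply: evl_true => l _; rewrite cmodV cmodX mul1r. Qed.

Let bO_E j : bO (fun l => cexp (kap l * (b j)%:C)) (E j).
Proof. by exists 1 => //; apply: evl_true => l _; rewrite cexp_E mul1r. Qed.

Lemma tau_small i : bO (tau i) (TT i.+1).
Proof.
have h := bO_M (bO_M (bO_M (J_small i).1 (bO_E i.+1)) cc0_small) bO_kap2.
by apply: bO_ext (bO_N (bO_le (B := 1) h _ _)) => //; apply: evl_true => l _;
  rewrite ?mul1r ?TT_E.
Qed.

Let YY_mono n l : YY n l <= YY n.+1 l.
Proof. by rewrite YY_S lerDl TT_ge0. Qed.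

Let SS_small n : bO (SS n) (YY n).
Proof.
elim: n => [|n IH].
  exists 1 => //; apply: evl_true => l _; rewrite /SS /YY !big_ord0 !addr0 cmod1 mulr1//.
have h1 : bO (SS n) (YY n.+1).
  by apply: (bO_le (B := 1)) IH _ _ => //; apply: evl_true => l _; rewrite mul1r.
have h2 : bO (tau n) (YY n.+1).
  apply: (bO_le (B := 1)) (tau_small n) _ _ => //; apply: evl_true => l _.
  by rewrite mul1r YY_S lerDr (le_trans ler01)// YY_ge1.
by apply: bO_ext (bO_D h1 h2); apply: evl_true => l _; rewrite /SS big_ord_recr addrA.
Qed.

Let rr j l : R := (s j N + 2 * g j N + 1) / kk l.

(** [piece_growth] with the weight [YY] for the decaying amplitude and the size of [cc0] for the
    growing one. The condition [T + beta 1 + 3 <= N] makes the coupling weak enough for this pair of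
    weights. *)
Lemma piece_grow j n K l : Dom l -> 1 <= kk l -> 4 * (s j N + 2 * g j N + 1) <= kk l ->
  2 * g j N * ((1 + n%:R) * G) <= kk l -> 0 < K ->
  cmod (aa j l (b j)) <= K * YY n l -> cmod (cc j l (b j)) <= K / kk l ^+ (beta 1).+1 ->
  cmod (aa j l (b j.+1) - aa j l (b j)) <= 2 * rr j l * (b j.+1 - b j) * (K * YY n l) /\
  cmod (cc j l (b j.+1) - cc j l (b j)) <= 2 * rr j l * (b j.+1 - b j) * (K / kk l ^+ (beta 1).+1).
Proof.
move=> Dl k1 kA kB K0 ha hc; have k0 := kk0 k1; have [r0 hE hE1] := Dl.
have sj := s0 j N; have gj := g0 j N.
have Y0 : 0 < YY n l by exact: lt_le_trans (YY_ge1 n l).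
have kb0 : 0 < kk l ^+ (beta 1).+1 by rewrite exprn_gt0.
have kT0 : 0 <= kk l ^+ T by rewrite exprn_ge0// ltW.
have G0 : 0 <= G by exact: le_trans G1.
have bj := b_incr j.
have nn : 1 <= 1 + n%:R :> R by rewrite lerDl.
have := @piece_growth R V (w l) (f l) (p l) (df l) (dp l) (P j) N (b j) (b j.+1)
  (s j N) (g j N) (G * kk l ^+ T) (ltW bj) (b_ge0 j) (ltW (b_lt1 _)) (VP (k := j)) r0 hE k1 sj gj.
have gN : 2 * g j N * G <= kk l.
  apply: le_trans kB; rewrite ler_wpM2l ?mulr_ge0// ler_peMl//.
move=> /(_ _ _ _ (K * YY n l) (K / kk l ^+ (beta 1).+1)) h; apply: h => //.
- have : 4 * s j N <= kk l by lra.
  exact.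
- by move=> u uk; rewrite -[cmod (2 * w l)]uk; apply: hs; rewrite uk.
- by move=> u uk; rewrite -[cmod (2 * w l)]uk; apply: hg; rewrite uk.
- by rewrite mulr_gt0.
- by rewrite divr_gt0.
- rewrite -/(kk l).
  have e : kk l ^+ T * kk l <= kk l ^+ N.+1.
    by rewrite -exprSr ler_weXn2l// ltnS (leq_trans _ NT)// -addnA leq_addr.
  apply: (@le_trans _ _ (kk l ^+ T * kk l * K)).
    have -> : 2 * g j N * (G * kk l ^+ T) * (K / kk l ^+ (beta 1).+1) =
      (kk l ^+ T * (2 * g j N * G) * K) / kk l ^+ (beta 1).+1 by ring.
    rewrite ler_pdivrMr// (@le_trans _ _ (kk l ^+ T * kk l * K))//.
      by rewrite ler_wpM2r ?(ltW K0)// ler_wpM2l.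
    by rewrite ler_peMr ?exprn_ege1// !mulr_ge0// ltW.
  apply: ler_pM => //; [by rewrite mulr_ge0// ltW|exact: ltW|].
  by rewrite ler_peMr ?YY_ge1// ltW.
- rewrite -/(kk l).
  rewrite [leRHS]mulrA ler_pdivlMr//.
  have h1 := YY_le n Dl k1.
  have h2 : 2 * g j N * YY n l <= kk l ^+ T * kk l.
    apply: le_trans (ler_wpM2l _ h1) _; first by rewrite mulr_ge0.
    have -> : 2 * g j N * ((1 + n%:R) * (G * kk l ^+ T)) = kk l ^+ T * (2 * g j N * ((1 + n%:R) * G)) by ring.
    by rewrite ler_wpM2l.
  have -> : 2 * g j N * (K * YY n l) * kk l * kk l ^+ (beta 1).+1 =
    2 * g j N * YY n l * (kk l * kk l ^+ (beta 1).+1) * K by ring.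
  rewrite ler_wpM2r ?(ltW K0)//.
  apply: le_trans (ler_wpM2r _ h2) _; first by rewrite mulr_ge0 ?ltW.
  rewrite -exprSr -exprS -exprD ler_weXn2l//.
  by apply: leq_trans NT; rewrite addn3 addSn !addnS.
- rewrite -/(kk l) ler_pdivrMr//; lra.
- by rewrite lexx ltW.
Qed.

Let kap_neq0 l : 1 <= kk l -> kap l != 0.
Proof. by move=> k1; rewrite -cmod_gt0 kkE kk0. Qed.

Lemma at_zero l : 1 <= kk l -> cc 0%N l (b 0%N) = cc0 l /\
  aa 0%N l (b 0%N) = 1 + (sig (kap l) (P 0%N) N).[0] / kap l.
Proof.
move=> k1; have kn := kap_neq0 k1; have [_ f0 p0] := phiP cV hV l.
rewrite /aa /apl /cc /cmi /riccati b0 mulr0 mulr0 cexp0 !mul1r -/(f l) -/(p l) in f0 p0 *.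
rewrite f0 p0; split; first by rewrite /cc0 /kap /w; ring.
rewrite -[X in _ = X + _](@divff _ (kap l))// -mulrDl.
rewrite -[(sig (2 * w l) (P 0%N) N).[_]]/((sig (kap l) (P 0%N) N).[0]).
by move: (_.[0]) => S; rewrite /kap /w; congr (_ / _); ring.
Qed.

Let FF n l : C := f l (b n.+1) * cexp (w l * (b n.+1)%:C).
Let DD n l : C := (sig (kap l) (P n) N).[(b n.+1)%:C] - (sig (- kap l) (P n) N).[(b n.+1)%:C].

(** Keeping [DD FF] on the right avoids dividing by [kap + DD]; that term is small enough to be
    absorbed in [FF_le] and to count as an error in [claim_step]. *)
Let FF_eq n l : 1 <= kk l -> kap l * FF n l = kap l * aa n l (b n.+1) -
  cexp (kap l * (b n.+1)%:C) * cc n l (b n.+1) - DD n l * FF n l.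
Proof.
move=> k1; have kn := kap_neq0 k1.
have := @riccati_diff R (w l) (f l) (p l) (fun y => (sig (kap l) (P n) N).[y%:C])
  (fun y => (sig (- kap l) (P n) N).[y%:C]) (b n.+1).
rewrite -/(FF n l) -/(kap l) -/(cc n l (b n.+1)).
have -> : riccati (f l) (p l) (w l) (fun y => (sig (kap l) (P n) N).[y%:C]) (b n.+1) =
    kap l * aa n l (b n.+1) by rewrite /aa /apl mulrCA divff// mulr1.
by move=> <-; rewrite /DD; ring.
Qed.

Let sig_le n (u : C) x : 1 <= cmod u -> cmod x <= 1 -> cmod (sig u (P n) N).[x] <= s n N / cmod u.
Proof. by move=> u1 x1; apply: le_trans (horner_pnorm _ x1) (hs _ _ u1). Qed.

Let DD_le n l : 1 <= kk l -> cmod (DD n l) <= 2 * s n N / kk l.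
Proof.
move=> k1; have h1 := sig_le n (u := kap l) k1 (cb n.+1).
have h2 : cmod (sig (- kap l) (P n) N).[(b n.+1)%:C] <= s n N / kk l.
  by have := @sig_le n (- kap l) (b n.+1)%:C; rewrite cmodN; apply.
by rewrite (le_trans (cmodB _ _))//; rewrite kkE in h1; lra.
Qed.

Let FF_le n l : Dom l -> 1 <= kk l -> 4 * s n N <= kk l ->
  cmod (FF n l) <= 2 * cmod (aa n l (b n.+1)) + 2 * E n.+1 l * cmod (cc n l (b n.+1)) / kk l.
Proof.
move=> Dl k1 ks; have k0 := kk0 k1; have sn := s0 n N.
have h := congr1 (@cmod R) (FF_eq n k1); rewrite [LHS]cmodM kkE in h.
have h1 : kk l * cmod (FF n l) <= kk l * cmod (aa n l (b n.+1)) + E n.+1 l * cmod (cc n l (b n.+1))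
    + 2 * s n N / kk l * cmod (FF n l).
  rewrite h (le_trans (cmodB _ _))// (le_trans (lerD (cmodB _ _) (lexx _)))//.
  rewrite [cmod (kap l * _)]cmodM [cmod (cexp _ * _)]cmodM [cmod (DD _ _ * _)]cmodM kkE cexp_E.
  by rewrite lerD2l ler_wpM2r ?cmod_ge0// DD_le.
have h2 : 2 * s n N / kk l <= kk l / 2.
  by rewrite ler_pdivrMr//; have := ler_wpM2l (ltW k0) k1; nra.
have h3 := ler_wpM2r (cmod_ge0 (FF n l)) h2.
have e : kk l * (2 * E n.+1 l * cmod (cc n l (b n.+1)) / kk l) = 2 * E n.+1 l * cmod (cc n l (b n.+1)).
  by rewrite mulrCA divff ?mulr1// gt_eqF.
rewrite -(ler_pM2l k0) mulrDr e; lra.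
Qed.

(** The solution and its derivative are continuous, so crossing a node alters the amplitudes only
    through the change of the approximate Riccati solution. *)
Let jump n l : 1 <= kk l -> aa n.+1 l (b n.+1) = aa n l (b n.+1) + J (kap l) n * FF n l / kap l /\
  cc n.+1 l (b n.+1) = cc n l (b n.+1) + J (- kap l) n * (cexp (- kap l * (b n.+1)%:C) * FF n l).
Proof.
move=> k1; split.
  by rewrite /aa /apl /riccati /FF /J -mulrDl; congr (_ / _); ring.
have -> : cexp (- kap l * (b n.+1)%:C) * FF n l = f l (b n.+1) * cexp (- w l * (b n.+1)%:C).
  by rewrite /FF mulrCA -cexpD; congr (_ * cexp _); rewrite /kap; ring.
by rewrite /cc /cmi /riccati /J; ring.
Qed.

(** The state at a node: the growing amplitude is still the one created at 0, and the decaying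
    amplitude is the direct wave plus the double reflections met so far, up to a relative error of
    order [1 / kk]. *)
Let claim n := bO (fun l => cc n l (b n) - cc0 l) (fun l => (kk l ^+ (beta 1).+2)^-1) /\
  bO (fun l => aa n l (b n) - SS n l) (fun l => YY n l / kk l).

Let k_inv_le1 l : 1 <= kk l -> (kk l)^-1 <= 1.
Proof. by move=> k1; rewrite invf_le1// kk0. Qed.

Lemma claim_start : claim 0.
Proof.
split; first by exists 0 => //; apply: (@evl_le 1) => l _ k1 _; rewrite (at_zero k1).1 subrr cmod0 mul0r.
exists (s 0%N N) => //; apply: (@evl_le 1) => l _ k1 _.
rewrite (at_zero k1).2 /SS /YY !big_ord0 !addr0 addrAC subrr add0r mul1r cmod_div kkE.
rewrite ler_wpM2r ?invr_ge0 ?cmod_ge0//.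
have h := sig_le 0%N (u := kap l) k1 (x := 0); rewrite cmod0 kkE in h.
by apply: le_trans (h ler01) _; rewrite ler_piMr// k_inv_le1.
Qed.

Lemma claim_bounds n : claim n ->
  bO (fun l => cc n l (b n)) (fun l => (kk l ^+ (beta 1).+1)^-1) /\
  bO (fun l => aa n l (b n)) (YY n).
Proof.
move=> [h1 h2]; split.
  by apply: bO_ext (bO_D (bO_k (leqnSn _) h1) cc0_small); apply: evl_true => l _; exact: subrK.
have h3 : bO (fun l => aa n l (b n) - SS n l) (YY n).
  apply: (bO_le (B := 1)) h2 _ _ => //; apply: (@evl_le 1) => l _ k1 _.
  by rewrite mul1r ler_piMr ?k_inv_le1// (le_trans ler01)// YY_ge1.
by apply: bO_ext (bO_D h3 (SS_small n)); apply: evl_true => l _; exact: subrK.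
Qed.

Lemma claim_step n : claim n -> claim n.+1.
Proof.
move=> cn; have [[K K0 hc] [M M0 ha]] := claim_bounds cn; have [c1 c2] := cn.
pose A := K + M + 1; have A0 : 0 < A by rewrite ltr_wpDl// addr_ge0.
have sn := s0 n N; have gn := g0 n N.
pose r := s n N + 2 * g n N + 1; have r0 : 0 <= r by rewrite /r; lra.
have G0 : 0 <= G by exact: le_trans G1.
have grow : evl (fun l =>
    cmod (aa n l (b n.+1) - aa n l (b n)) <= 2 * r * A * (YY n l / kk l) /\
    cmod (cc n l (b n.+1) - cc n l (b n)) <= 2 * r * A * (kk l ^+ (beta 1).+2)^-1).
  apply: evl_imp (evl_and (evl_and hc ha) (evl_and (evl_ge Dom kk (4 * r))
    (evl_ge Dom kk (2 * g n N * ((1 + n%:R) * G))))) _ => l Dl k1 [[q1 q2] [q3 q4]].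
  have k0 := kk0 k1; have Y1 := YY_ge1 n l; have Y0 : 0 <= YY n l by exact: le_trans Y1.
  have kb0 : 0 < kk l ^+ (beta 1).+1 by rewrite exprn_gt0.
  have q2' : cmod (aa n l (b n)) <= A * YY n l.
    by rewrite (le_trans q2)// ler_wpM2r// /A; lra.
  have q1' : cmod (cc n l (b n)) <= A / kk l ^+ (beta 1).+1.
    by rewrite (le_trans q1)// ler_wpM2r ?invr_ge0 ?(ltW kb0)// /A; lra.
  have [g1' g2'] := piece_grow Dl k1 q3 q4 A0 q2' q1'.
  have bb : 0 <= b n.+1 - b n <= 1.
    by have := b_ge0 n; have := b_lt1 n.+1; have := b_incr n; lra.
  have /andP[bb0 bb1] := bb.
  have rr0 : 0 <= rr n l by rewrite divr_ge0// ltW.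
  have W D : 0 <= D -> 2 * rr n l * (b n.+1 - b n) * D <= 2 * rr n l * D.
    by move=> D0; rewrite ler_wpM2r// ler_piMr// mulr_ge0.
  split.
    apply: le_trans g1' _; apply: le_trans (W _ _) _; first by rewrite mulr_ge0// ltW.
    by rewrite /rr -/r le_eqVlt; apply/orP; left; apply/eqP; ring.
  apply: le_trans g2' _; apply: le_trans (W _ _) _; first by rewrite divr_ge0// ltW.
  by rewrite /rr -/r [kk l ^+ (beta 1).+2]exprS invfM le_eqVlt; apply/orP; left; apply/eqP; ring.
have cA0 : 0 <= 2 * r * A by rewrite !mulr_ge0// ltW.
have d1 : bO (fun l => cc n l (b n.+1) - cc0 l) (fun l => (kk l ^+ (beta 1).+2)^-1).
  have h : bO (fun l => cc n l (b n.+1) - cc n l (b n)) (fun l => (kk l ^+ (beta 1).+2)^-1).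
    by exists (2 * r * A) => //; apply: evl_imp grow _ => l _ _ [].
  apply: bO_ext (bO_D h c1); apply: evl_true => l _; ring.
have d2 : bO (fun l => aa n l (b n.+1) - SS n l) (fun l => YY n l / kk l).
  have h : bO (fun l => aa n l (b n.+1) - aa n l (b n)) (fun l => YY n l / kk l).
    by exists (2 * r * A) => //; apply: evl_imp grow _ => l _ _ [].
  apply: bO_ext (bO_D h c2); apply: evl_true => l _; ring.
have e1 : bO (fun l => cc n l (b n.+1)) (fun l => (kk l ^+ (beta 1).+1)^-1).
  by apply: bO_ext (bO_D (bO_k (leqnSn _) d1) cc0_small); apply: evl_true => l _; exact: subrK.
have e2 : bO (fun l => aa n l (b n.+1)) (YY n).
  have h3 : bO (fun l => aa n l (b n.+1) - SS n l) (YY n).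
    apply: (bO_le (B := 1)) d2 _ _ => //; apply: (@evl_le 1) => l _ k1 _.
    by rewrite mul1r ler_piMr ?k_inv_le1// (le_trans ler01)// YY_ge1.
  by apply: bO_ext (bO_D h3 (SS_small n)); apply: evl_true => l _; exact: subrK.
(* At the node the solution consists of the decaying wave, of size [YY], and the growing one, of
   size [E] times [cc0 / kap]. *)
have F1 : bO (FF n) (fun l => YY n l + E n.+1 l / kk l ^+ (beta 1).+2).
  have [Ka Ka0 h1] := e2; have [Kc Kc0 h2] := e1.
  exists (2 * Ka + 2 * Kc); first by rewrite addr_ge0 ?mulr_ge0.
  apply: evl_imp (evl_and (evl_and h1 h2) (evl_ge Dom kk (4 * s n N))) _ => l Dl k1 [[q1 q2] q3].
  have k0 := kk0 k1; have E0 : 0 <= E n.+1 l by exact: expR_ge0.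
  have Y0 : 0 <= YY n l by apply: le_trans (YY_ge1 n l).
  have Ek : 0 <= E n.+1 l / kk l ^+ (beta 1).+2 by rewrite divr_ge0// exprn_ge0// ltW.
  apply: le_trans (FF_le Dl k1 q3) _.
  have t1 : 2 * cmod (aa n l (b n.+1)) <= 2 * Ka * YY n l by rewrite -mulrA ler_wpM2l.
  have t2 : 2 * E n.+1 l * cmod (cc n l (b n.+1)) / kk l <= 2 * Kc * (E n.+1 l / kk l ^+ (beta 1).+2).
    have -> : 2 * Kc * (E n.+1 l / kk l ^+ (beta 1).+2) = 2 * E n.+1 l * (Kc / kk l ^+ (beta 1).+1) / kk l.
      by rewrite [kk l ^+ (beta 1).+2]exprS invfM; ring.
    by rewrite ler_wpM2r ?invr_ge0 ?(ltW k0)// ler_wpM2l// mulr_ge0.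
  have p1 : 0 <= 2 * Ka * (E n.+1 l / kk l ^+ (beta 1).+2) by apply: mulr_ge0 => //; rewrite mulr_ge0.
  have p2 : 0 <= 2 * Kc * YY n l by apply: mulr_ge0 => //; rewrite mulr_ge0.
  apply: le_trans (lerD t1 t2) _; move: p1 p2; set y := E n.+1 l / _; move: (YY n l) y => x y; lra.
(* Measured against the growing exponential the solution is of order [1 / kk], by [YY_div]. Hence a
   jump changes the growing amplitude at relative order [1 / kk] only. *)
have Fm : bO (fun l => cexp (- kap l * (b n.+1)%:C) * FF n l) (fun l => (kk l ^+ 1)^-1).
  have [K1 K10 h1] := F1.
  exists (K1 * (G + n%:R + 1)); first by rewrite mulr_ge0// addr_ge0// addr_ge0.
  apply: evl_imp h1 _ => l Dl k1 q1.
  have k0 := kk0 k1; have E0 : 0 < E n.+1 l by exact: expR_gt0.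
  have -> : cexp (- kap l * (b n.+1)%:C) = (cexp (kap l * (b n.+1)%:C))^-1 by rewrite mulNr cexpN.
  rewrite cmodM cmodV cexp_E; apply: le_trans (ler_wpM2l _ q1) _; first by rewrite invr_ge0 ltW.
  rewrite mulrCA -mulrA ler_wpM2l// [leLHS]mulrC [leLHS]mulrDl [leRHS]mulrDl lerD//.
    apply: le_trans (YY_div n Dl k1) _; rewrite ler_wpM2l ?addr_ge0//.
    by rewrite lef_pV2 ?posrE ?exprn_gt0// ler_weXn2l.
  by rewrite mulrAC divff ?gt_eqF// !mul1r lef_pV2 ?posrE ?exprn_gt0// ler_weXn2l.
have bn : (beta 1 <= beta n.+1)%N by exact: beta_mono.
split.
  have h1 := bO_M (J_small n).2 Fm.
  have h2 : bO (fun l => J (- kap l) n * (cexp (- kap l * (b n.+1)%:C) * FF n l)) (fun l => (kk l ^+ (beta 1).+2)^-1).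
    apply: (bO_le (B := 1)) h1 _ _ => //; apply: (@evl_le 1) => l _ k1 _.
    rewrite mul1r -invfM -exprD addn1 lef_pV2 ?posrE ?exprn_gt0 ?kk0//.
    by rewrite ler_weXn2l// !ltnS.
  apply: bO_ext (bO_D d1 h2); apply: (@evl_le 1) => l _ k1 _.
  by rewrite (jump n k1).2; ring.
have Yk l : 1 <= kk l -> YY n l / kk l <= YY n.+1 l / kk l.
  by move=> k1; rewrite ler_wpM2r ?invr_ge0 ?(ltW (kk0 k1))// YY_mono.
have Tk l : 1 <= kk l -> TT n.+1 l / kk l <= YY n.+1 l / kk l.
  move=> k1; rewrite ler_wpM2r ?invr_ge0 ?(ltW (kk0 k1))// YY_S lerDr.
  exact: le_trans (YY_ge1 n l).
have D1 : bO (DD n) (fun l => (kk l ^+ 1)^-1).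
  exists (2 * s n N); first by rewrite mulr_ge0.
  by apply: (@evl_le 1) => l _ k1 _; rewrite expr1; exact: DD_le.
(* Inserting [FF_eq] into the jump of the decaying amplitude splits it into [tau n] and three
   errors, estimated in turn. *)
have i1 : bO (fun l => J (kap l) n * aa n l (b n.+1) / kap l) (fun l => YY n.+1 l / kk l).
  apply: (bO_le (B := 1)) (bO_M (bO_M (J_small n).1 e2) bO_kap) _ _ => //.
  apply: (@evl_le 1) => l _ k1 _; rewrite mul1r expr1; apply: le_trans (Yk l k1).
  rewrite ler_wpM2r ?invr_ge0 ?(ltW (kk0 k1))// ler_piMl ?(le_trans ler01 (YY_ge1 _ _))//.
  by rewrite invf_le1 ?exprn_gt0 ?kk0// exprn_ege1.
have i2 : bO (fun l => J (kap l) n * cexp (kap l * (b n.+1)%:C) * (cc n l (b n.+1) - cc0 l) / kap l ^+ 2)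
    (fun l => YY n.+1 l / kk l).
  apply: (bO_le (B := 1)) (bO_M (bO_M (bO_M (J_small n).1 (bO_E n.+1)) d1) bO_kap2) _ _ => //.
  apply: (@evl_le 1) => l _ k1 _; rewrite mul1r; apply: le_trans (Tk l k1).
  by rewrite TT_E [kk l ^+ (beta 1).+2]exprS invfM le_eqVlt; apply/orP; left; apply/eqP; ring.
have i3 : bO (fun l => J (kap l) n * DD n l * FF n l / kap l ^+ 2) (fun l => YY n.+1 l / kk l).
  apply: (bO_le (B := 1)) (bO_M (bO_M (bO_M (J_small n).1 D1) F1) bO_kap2) _ _ => //.
  apply: (@evl_le 1) => l _ k1 _; rewrite mul1r YY_S.
  have k0 := kk0 k1; have E0 : 0 <= E n.+1 l by exact: expR_ge0.
  have inv1 m : (kk l ^+ m)^-1 <= 1 by rewrite invf_le1 ?exprn_gt0// exprn_ege1.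
  have inv0 m : 0 <= (kk l ^+ m)^-1 by rewrite invr_ge0 exprn_ge0// ltW.
  have Y0 : 0 <= YY n l by exact: le_trans (YY_ge1 n l).
  rewrite mulrDr [leLHS]mulrDl [leRHS]mulrDl lerD//.
    have -> : (kk l ^+ (beta n.+1).+1)^-1 / kk l ^+ 1 * YY n l / kk l ^+ 2 =
       (YY n l / kk l) * ((kk l ^+ (beta n.+1).+1)^-1 / kk l ^+ 2) by rewrite expr1; ring.
    by rewrite ler_piMr ?divr_ge0 ?(ltW k0)// mulr_ile1.
  have -> : (kk l ^+ (beta n.+1).+1)^-1 / kk l ^+ 1 * (E n.+1 l / kk l ^+ (beta 1).+2) / kk l ^+ 2 =
      TT n.+1 l / kk l * (kk l)^-1.
    by rewrite TT_E [kk l ^+ (beta 1).+2]exprS expr1 invfM; ring.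
  by apply: ler_piMr; [apply: divr_ge0; [exact: TT_ge0|exact: ltW]|exact: k_inv_le1].
have d2' : bO (fun l => aa n l (b n.+1) - SS n l) (fun l => YY n.+1 l / kk l).
  by apply: (bO_le (B := 1)) d2 _ _ => //; apply: (@evl_le 1) => l _ k1 _; rewrite mul1r; exact: Yk.
apply: bO_ext (bO_D d2' (bO_B (bO_B i1 i2) i3)); apply: (@evl_le 1) => l _ k1 _.
have kn := kap_neq0 k1.
have FE : FF n l = (kap l * aa n l (b n.+1) - cexp (kap l * (b n.+1)%:C) * cc n l (b n.+1) - DD n l * FF n l) / kap l.
  by rewrite -FF_eq// mulrC mulKf.
have -> : SS n.+1 l = SS n l + tau n l by rewrite /SS big_ord_recr addrA.
rewrite (jump n k1).1 {2}FE /tau; move: (SS n l) => S.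
by field.
Qed.

Lemma claimP n : claim n.
Proof. by elim: n => [|n IH]; [exact: claim_start|exact: claim_step]. Qed.

Let NN0 : (0 < N)%N. Proof. exact: leq_ltn_trans N_beta1. Qed.

Let h l x : C := riccati (f l) (p l) (w l) (fun _ => 0) x / kap l.

(** Because [N <= beta], the N-th iterate vanishes at all later nodes. There the amplitude equals
    [h], in which no piece occurs any more and which makes sense at the accumulation point 1. *)
Let aa_h m l : (N <= m)%N -> 1 <= kk l -> aa m l (b m) = h l (b m).
Proof.
case: m => [|m] Nm k1; first by move: NN0 Nm; case: (N).
have kn := kap_neq0 k1.
rewrite /aa /apl /h /riccati (sig_zero (PL m.+1) (qL0 _) kn)//.
by rewrite (leq_trans Nm)// (leq_trans (leqnSn _))// beta_ge.
Qed.

Let aa_glue m l : (N <= m.+1)%N -> 1 <= kk l -> aa m l (b m.+1) = aa m.+1 l (b m.+1) /\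
  cc m l (b m.+1) = cc m.+1 l (b m.+1).
Proof.
move=> Nm k1; have kn := kap_neq0 k1.
have z1 u : u != 0 -> (sig u (P m) N).[(b m.+1)%:C] = 0.
  by move=> u0; apply: (sig_zero (PR m) (qR0 _) u0); rewrite (leq_trans Nm)// beta_ge.
have z2 u : u != 0 -> (sig u (P m.+1) N).[(b m.+1)%:C] = 0.
  move=> u0; apply: (sig_zero (PL m.+1) (qL0 _) u0); rewrite (leq_trans Nm)//.
  by rewrite (leq_trans (leqnSn _))// beta_ge.
rewrite /aa /apl /cc /cmi /riccati !(z1 _ kn) !(z2 _ kn).
by rewrite (z1 (- kap l)) ?(z2 (- kap l)) ?oppr_eq0.
Qed.

(** The derivative of [h] is bounded on the unit interval for fixed [l], which suffices to let the
    nodes tend to 1 without loss in the bound [B]. *)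
Lemma h_lim m l (S : C) (B : R) : (forall n, (m <= n)%N -> cmod (h l (b n) - S) <= B) ->
  cmod (h l 1 - S) <= B.
Proof.
move=> hB.
pose d x := (kap l)^-1 * (- V x * (f l x * cexp (w l * x%:C))).
have hd x : cder (h l) x (d x).
  have := cderZ (kap l)^-1 (cder_riccati (df l) (dp l) (erefl (w l ^+ 2)) (cder_cst 0 x)).
  by apply: cder_ext => [y|]; [exact: mulrC|rewrite /d; ring].
have cd : ccont d.
  apply: ccontZ; apply: ccontM; first exact: ccontN.
  apply: ccontM; first exact: cder_ccont (df l).
  exact: (cder_ccont (fun x => cder_cexpl (w l) x)).
have [K K0 hK] := ccont_bounded 0 1 cd.
apply/ler_addgt0Pr => e e0.
have K1 : 0 < K + 1 by rewrite ltr_wpDl.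
have [n mn hn] := b_near m (divr_gt0 e0 K1).
have n1 := b_lt1 n; have n0 := b_ge0 n.
have q2 : cmod (h l 1 - h l (b n)) <= e.
  apply: le_trans (cder_dist_cst (df := d) (K := K) (ltW n1) _ _) _ => [x _|x /andP[x1 x2]|].
  - exact: hd.
  - by apply: hK; rewrite x2 (le_trans n0).
  move: hn; rewrite ger0_norm ?subr_ge0 ?(ltW n1)// ler_pdivlMr// => hn; nra.
have q1 := hB n mn; move: (h l 1) (h l (b n)) q1 q2 => x y q1 q2.
by rewrite (_ : x - S = (y - S) + (x - y)); [exact: le_trans (cmodD _ _) (lerD q1 q2)|ring].
Qed.

Let h1 l : 1 <= kk l -> h l 1 = - (Wr V l / kap l).
Proof.
move=> k1; rewrite /h /riccati /Wr /outf subr0 addr0 -/(f l) -/(p l) -mulNr -mulrN.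
by congr (_ * _ / _); rewrite /w; ring.
Qed.

(** Up to node [N] there are finitely many steps of [claim_step]. Beyond it there are no jumps and
    the constants [s] and [g] are at most 1, so infinitely many pieces can be crossed with an error
    proportional to their total length. At 1 the amplitude [h] is the normalised Wronskian. *)
Lemma Wr_approx : bO (fun l => - (Wr V l / kap l) - SS N l) (fun l => YY N l / kk l).
Proof.
have cn := claimP N; have [[K K0 hc] [M M0 ha]] := claim_bounds cn.
have [_ d2] := cn.
have small (u1 u2 k : R) : u1 <= 1 -> u2 <= 1 -> 32 <= k -> 4 * (u1 + 2 * u2 + 1) <= k by lra.
pose A := 2 * (K + M + 1); have A0 : 0 < A by rewrite mulr_gt0// ltr_wpDl// addr_ge0.
have AK : A / 2 + K <= A by rewrite /A; lra.
have AM : A / 2 + M <= A by rewrite /A; lra.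
suff H : bO (fun l => - (Wr V l / kap l) - aa N l (b N)) (fun l => YY N l / kk l).
  by apply: bO_ext (bO_D H d2); apply: evl_true => l _; rewrite addrA subrK.
have G0 : 0 <= G by exact: le_trans G1.
exists (8 * A); first by rewrite mulr_ge0// ltW.
apply: evl_imp (evl_and (evl_and hc ha) (evl_and (evl_ge Dom kk 32)
  (evl_ge Dom kk (2 * ((1 + N%:R) * G))))) _ => l Dl k1 [[q1 q2] [q3 q4]].
have k0 := kk0 k1; have Y1 := YY_ge1 N l; have Y0 : 0 < YY N l by exact: lt_le_trans Y1.
have kb0 : 0 < kk l ^+ (beta 1).+1 by rewrite exprn_gt0.
have Z0 : 0 < (kk l ^+ (beta 1).+1)^-1 by rewrite invr_gt0.
(* 4 bounds [s + 2 g + 1] for all pieces beyond [N]; the threshold 32 on [kk l] then gives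
   [r <= 1 / 8]. *)
pose r := 4 / kk l; have r0 : 0 < r by rewrite divr_gt0.
have r8 : r <= 1 / 8 by rewrite ler_pdivrMr//; lra.
have rj j : (N <= j)%N -> rr j l <= r.
  move=> Nj; rewrite ler_wpM2r ?invr_ge0 ?(ltW k0)//.
  by have := s1 Nj; have := g1 Nj; lra.
(* The increments add up to at most half of the weight built with [A]. The bound needed to enter the
   next piece is therefore never exhausted. *)
have key j : (N <= j)%N ->
    cmod (aa j l (b j) - aa N l (b N)) <= 2 * r * (b j - b N) * (A * YY N l) /\
    cmod (cc j l (b j) - cc N l (b N)) <= 2 * r * (b j - b N) * (A / kk l ^+ (beta 1).+1).
  elim: j => [|j IH]; first by move: NN0; case: (N).
  rewrite leq_eqVlt => /predU1P[<-|]; first by rewrite !subrr cmod0 mulr0 !mul0r.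
  rewrite ltnS => Nj; have [i1 i2] := IH Nj.
  have bj : 0 <= b j - b N by rewrite subr_ge0 b_mono.
  have bj1 : b j - b N <= 1 by have := b_lt1 j; have := b_ge0 N; lra.
  have rb : 2 * r * (b j - b N) <= 1 / 2.
    have : r * (b j - b N) <= r by rewrite ler_piMr// ltW.
    lra.
  have half D : 0 <= D -> 2 * r * (b j - b N) * (A * D) <= A / 2 * D.
    move=> D0; have -> : A / 2 * D = 1 / 2 * (A * D) by ring.
    by rewrite ler_wpM2r// mulr_ge0// ltW.
  have a1 : cmod (aa j l (b j)) <= A * YY N l.
    have := cmodD (aa j l (b j) - aa N l (b N)) (aa N l (b N)); rewrite subrK => /le_trans; apply.
    apply: le_trans (lerD (le_trans i1 (half _ (ltW Y0))) q2) _.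
    by rewrite -mulrDl ler_wpM2r ?(ltW Y0).
  have a2 : cmod (cc j l (b j)) <= A / kk l ^+ (beta 1).+1.
    have := cmodD (cc j l (b j) - cc N l (b N)) (cc N l (b N)); rewrite subrK => /le_trans; apply.
    apply: le_trans (lerD (le_trans i2 (half _ (ltW Z0))) q1) _.
    by rewrite -mulrDl ler_wpM2r ?(ltW Z0).
  have sj := s0 j N; have gj := g0 j N; have sj1 := s1 Nj; have gj1 := g1 Nj.
  have c1 : 4 * (s j N + 2 * g j N + 1) <= kk l by exact: small.
  have c2 : 2 * g j N * ((1 + N%:R) * G) <= kk l.
    apply: le_trans q4; apply: ler_wpM2r; first by rewrite mulr_ge0// addr_ge0.
    by rewrite -[leRHS]mulr1 ler_wpM2l.
  have [w1 w2] := piece_grow Dl k1 c1 c2 A0 a1 a2.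
  have [e1 e2] := @aa_glue j l (leqW Nj) k1; rewrite e1 in w1; rewrite e2 in w2.
  have bb : 0 <= b j.+1 - b j by rewrite subr_ge0 ltW// b_incr.
  have step D : 0 <= D -> 2 * rr j l * (b j.+1 - b j) * D <= 2 * r * (b j.+1 - b j) * D.
    by move=> D0; rewrite ler_wpM2r// ler_wpM2r// ler_wpM2l// rj.
  have fin (x y z : C) D : 0 <= D -> cmod (x - y) <= 2 * rr j l * (b j.+1 - b j) * D ->
      cmod (y - z) <= 2 * r * (b j - b N) * D -> cmod (x - z) <= 2 * r * (b j.+1 - b N) * D.
    move=> D0 xy yz; rewrite (_ : x - z = (x - y) + (y - z)); last by ring.
    rewrite (le_trans (cmodD _ _))// (le_trans (lerD (le_trans xy (step _ D0)) yz))//.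
    by rewrite le_eqVlt; apply/orP; left; apply/eqP; ring.
  split; first by apply: fin w1 i1; rewrite mulr_ge0// ltW.
  by apply: fin w2 i2; rewrite divr_ge0// ltW.
rewrite -h1//; apply: (h_lim (m := N)) => j Nj; rewrite -aa_h//.
apply: le_trans (key j Nj).1 _.
have bj : b j - b N <= 1 by have := b_lt1 j; have := b_ge0 N; lra.
have -> : 8 * A * (YY N l / kk l) = 2 * r * 1 * (A * YY N l) by rewrite /r; ring.
apply: ler_wpM2r; first by rewrite mulr_ge0// ltW.
by apply: ler_wpM2l => //; rewrite mulr_ge0// ltW.
Qed.

(** The jump and the initial amplitude are replaced by their leading terms one after the other. The
    sign comes from evaluating [cc0] at [- kap]; the two minus signs in the jump and in [tau]
    cancel. *)
Lemma tau_lead j (c1 c2 : C) (K1 K2 : R) : 0 <= K1 -> 0 <= K2 ->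
  (forall u, 1 <= cmod u -> cmod ((sig u (P j) N).[(b j.+1)%:C] - c1 * u ^- (beta j.+1).+1)
    <= K1 / cmod u ^+ (beta j.+1).+2) ->
  (forall u, 1 <= cmod u -> cmod ((sig u (P 0%N) N).[(b 0%N)%:C] - c2 * u ^- (beta 1).+1)
    <= K2 / cmod u ^+ (beta 1).+2) ->
  bO (fun l => tau j l - c1 * c2 * (-1) ^+ (beta 1).+1 *
      (cexp (2 * ('i * l) * (b j.+1)%:C) / (2 * ('i * l)) ^+ (4 + beta 1 + beta j.+1)))
    (fun l => TT j.+1 l / kk l).
Proof.
move=> K10 K20 hc1 hc2.
pose c2' := c2 * (-1) ^+ (beta 1).+1.
have h2 : bO (fun l => cc0 l - c2' * kap l ^- (beta 1).+1) (fun l => (kk l ^+ (beta 1).+2)^-1).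
  exists K2 => //; apply: (@evl_le 1) => l _ k1 _.
  have := hc2 (- kap l); rewrite cmodN kkE b0 => /(_ k1).
  have -> : c2 / (- kap l) ^+ (beta 1).+1 = c2' / kap l ^+ (beta 1).+1.
    by rewrite [(- kap l) ^+ _]exprNn invfM -[X in _ * (X * _)]exprVn invrN invr1 mulrA.
  exact.
have h3 : bO (fun l => J (kap l) j + c1 * kap l ^- (beta j.+1).+1)
    (fun l => (kk l ^+ (beta j.+1).+2)^-1).
  exists (K1 + \sum_(i < N) g j.+1 i); first by rewrite addr_ge0// sumr_ge0.
  apply: (@evl_le 1) => l _ k1 _; have kn := kap_neq0 k1; have k0 := kk0 k1.
  have q1 := hc1 (kap l) k1.
  have q2 : cmod (sig (kap l) (P j.+1) N).[(b j.+1)%:C] <=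
      (\sum_(i < N) g j.+1 i) / kk l ^+ (beta j.+1).+2.
    have [bN|bN] := leqP (beta j.+1).+1 N.
      have := sig_telescope (g0 j.+1) (cb j.+1) (hg j.+1) k1 bN.
      rewrite (sig_zero (PL j.+1) (qL0 _) kn (n := (beta j.+1).+1)) ?subr0//.
      exact: beta_incr.
    rewrite (sig_zero (PL j.+1) (qL0 _) kn) ?cmod0.
      by rewrite divr_ge0 ?sumr_ge0// exprn_ge0// ltW.
    by rewrite (leq_trans (ltnW bN))// beta_incr.
  have -> : J (kap l) j + c1 / kap l ^+ (beta j.+1).+1 = (sig (kap l) (P j.+1) N).[(b j.+1)%:C] -
    ((sig (kap l) (P j) N).[(b j.+1)%:C] - c1 / kap l ^+ (beta j.+1).+1) by rewrite /J; ring.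
  by rewrite (le_trans (cmodB _ _))// mulrDl addrC lerD.
have c2b : bO (fun l => c2' * kap l ^- (beta 1).+1) (fun l => (kk l ^+ (beta 1).+1)^-1).
  exists (cmod c2'); first exact: cmod_ge0.
  by apply: evl_true => l _; rewrite cmodM cmodV cmodX.
have i1 := bO_M (bO_M (bO_M (J_small j).1 (bO_E j.+1)) h2) bO_kap2.
have i2 := bO_M (bO_M (bO_M h3 (bO_E j.+1)) c2b) bO_kap2.
have i1' : bO (fun l => J (kap l) j * cexp (kap l * (b j.+1)%:C) *
    (cc0 l - c2' * kap l ^- (beta 1).+1) * kap l ^- 2) (fun l => TT j.+1 l / kk l).
  apply: (bO_le (B := 1)) i1 _ _ => //; apply: (@evl_le 1) => l _ k1 _; rewrite mul1r.
  by rewrite TT_E [kk l ^+ (beta 1).+2]exprS invfM le_eqVlt; apply/orP; left; apply/eqP; ring.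
have i2' : bO (fun l => (J (kap l) j + c1 * kap l ^- (beta j.+1).+1) * cexp (kap l * (b j.+1)%:C) *
    (c2' * kap l ^- (beta 1).+1) * kap l ^- 2) (fun l => TT j.+1 l / kk l).
  apply: (bO_le (B := 1)) i2 _ _ => //; apply: (@evl_le 1) => l _ k1 _; rewrite mul1r.
  by rewrite TT_E [kk l ^+ (beta j.+1).+2]exprS invfM le_eqVlt; apply/orP; left; apply/eqP; ring.
apply: bO_ext (bO_N (bO_D i1' i2')); apply: (@evl_le 1) => l _ k1 _.
have kn := kap_neq0 k1.
rewrite /tau -/(w l) -/(kap l) -[c1 * c2 * _]mulrA -/c2'.
have -> : kap l ^+ (4 + beta 1 + beta j.+1) = kap l ^+ (beta j.+1).+1 * kap l ^+ (beta 1).+1 * kap l ^+ 2.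
  rewrite -!exprD; congr (_ ^+ _).
  by rewrite [RHS]addn2 [in RHS]addnS [in RHS]addSn [(beta j.+1 + _)%N]addnC.
rewrite !invfM; move: (kap l ^+ (beta j.+1).+1)^-1 (kap l ^+ (beta 1).+1)^-1 (kap l ^+ 2)^-1.
by move=> u1 u2 u3; ring.
Qed.

End Asymptotics.

(** * The Wronskian on logarithmic curves *)

Section SequenceCalculus.
Variable R : realType.
Local Notation C := R[i].
Implicit Types (F H : nat -> C -> C) (P Q : nat -> C -> Prop).

(* Asymptotics in the index [m], uniformly over [|z| <= 1]. *)
Definition evm P : Prop := exists M, forall m z, (M <= m)%N -> cmod z <= 1 -> P m z.

Lemma evm_and P Q : evm P -> evm Q -> evm (fun m z => P m z /\ Q m z).
Proof.
move=> [M h] [M' h']; exists (maxn M M') => m z; rewrite geq_max => /andP[m1 m2] z1.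
by split; [exact: h|exact: h'].
Qed.

Lemma evm_imp P Q : evm P -> (forall m z, cmod z <= 1 -> P m z -> Q m z) -> evm Q.
Proof. by move=> [M h] PQ; exists M => m z mM z1; apply: PQ => //; exact: h. Qed.

Definition o1 F : Prop := forall e : R, 0 < e -> evm (fun m z => cmod (F m z) <= e).
Definition ub F : Prop := exists2 K : R, 0 <= K & evm (fun m z => cmod (F m z) <= K).

Lemma o1_le F H (K : R) : 0 <= K -> evm (fun m z => cmod (F m z) <= K * cmod (H m z)) ->
  o1 H -> o1 F.
Proof.
move=> K0 h hH e e0; have K1 : 0 < K + 1 by rewrite ltr_wpDl.
apply: evm_imp (evm_and h (hH _ (divr_gt0 e0 K1))) _ => m z z1 [h1 h2].
apply: (le_trans h1); apply: le_trans (ler_wpM2l K0 h2) _.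
by rewrite mulrA ler_pdivrMr// mulrC ler_wpM2l ?(ltW e0)//; lra.
Qed.

Lemma o1_ext F H : evm (fun m z => F m z = H m z) -> o1 F -> o1 H.
Proof.
by move=> e; apply: (o1_le ler01); apply: evm_imp e _ => m z _ <-; rewrite mul1r.
Qed.

Lemma o1D F H : o1 F -> o1 H -> o1 (fun m z => F m z + H m z).
Proof.
move=> hF hH e e0; have e2 : 0 < e / 2 by rewrite divr_gt0.
apply: evm_imp (evm_and (hF _ e2) (hH _ e2)) _ => m z _ [h1 h2].
by rewrite (le_trans (cmodD _ _))//; lra.
Qed.

Lemma o1_sum n (F : nat -> nat -> C -> C) : (forall i, (i < n)%N -> o1 (F i)) ->
  o1 (fun m z => \sum_(i < n) F i m z).
Proof.
elim: n => [|n IH] h.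
  by move=> e e0; exists 0%N => m z _ _; rewrite big_ord0 cmod0 ltW.
apply: o1_ext (o1D (IH (fun i hi => h i (leqW hi))) (h n (ltnSn n))).
by exists 0%N => m z _ _; rewrite big_ord_recr.
Qed.

Lemma ub_o1 F H : ub F -> o1 H -> o1 (fun m z => F m z * H m z).
Proof.
move=> [K K0 hK]; apply: (o1_le K0); apply: evm_imp hK _ => m z _ h.
by rewrite cmodM ler_wpM2r// cmod_ge0.
Qed.

Lemma ubM F H : ub F -> ub H -> ub (fun m z => F m z * H m z).
Proof.
move=> [K K0 hK] [L L0 hL]; exists (K * L); first exact: mulr_ge0.
by apply: evm_imp (evm_and hK hL) _ => m z _ [h1 h2]; rewrite cmodM ler_pM ?cmod_ge0.
Qed.

Lemma ub_bound F (K : R) : 0 <= K -> (forall m z, cmod z <= 1 -> cmod (F m z) <= K) -> ub F.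
Proof. by move=> K0 h; exists K => //; exists 0%N => m z _; exact: h. Qed.

Lemma o1_ub F : o1 (fun m z => F m z - 1) -> ub F.
Proof.
move=> /(_ 1 ltr01) h; exists 2 => //; apply: evm_imp h _ => m z _ h.
have := cmodD (F m z - 1) 1; rewrite subrK cmod1 => /le_trans; apply; lra.
Qed.

Lemma o1_1M F H : o1 (fun m z => F m z - 1) -> o1 (fun m z => H m z - 1) ->
  o1 (fun m z => F m z * H m z - 1).
Proof.
move=> hF hH; apply: o1_ext (o1D (ub_o1 (o1_ub hF) hH) hF).
by exists 0%N => m z _ _; ring.
Qed.

Lemma o1_1V F : o1 (fun m z => F m z - 1) -> o1 (fun m z => (F m z)^-1 - 1).
Proof.
move=> h; apply: (o1_le (K := 2)) (h) => //.
apply: evm_imp (h (1 / 2) ltac:(by rewrite divr_gt0)) _ => m z _ h1.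
have h2 : 1 / 2 <= cmod (F m z).
  have := cmod_dist 1 (F m z); rewrite cmod1 cmod_distC ler_norml => /andP[_]; lra.
have F0 : F m z != 0 by rewrite -cmod_gt0 (lt_le_trans _ h2)// divr_gt0.
have -> : (F m z)^-1 - 1 = (1 - F m z) / F m z by rewrite mulrBl mul1r divff.
rewrite cmod_div cmod_distC mulrC ler_wpM2r ?cmod_ge0//.
have : (1 / 2)^-1 = 2 :> R by rewrite div1r invrK.
move=> <-; rewrite lef_pV2// posrE ?divr_gt0//.
by rewrite cmod_gt0.
Qed.

Lemma o1_1X F n : o1 (fun m z => F m z - 1) -> o1 (fun m z => F m z ^+ n - 1).
Proof.
move=> h; elim: n => [|n IH].
  by move=> e e0; exists 0%N => m z _ _; rewrite expr0 subrr cmod0 ltW.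
by apply: o1_ext (o1_1M h IH); exists 0%N => m z _ _; rewrite exprS.
Qed.

Section Curve.
Variables (x : nat -> R) (t : R) (q : C).
Hypothesis hx : forall B : R, exists M, forall m, (M <= m)%N -> B <= x m.
Hypothesis t0 : 0 < t.

(** A point of the logarithmic curve above [x m], displaced by a fixed shift [q], which will adjust
    phase and modulus, and by the local variable [z] in which the zeros are sought. *)
Definition lcurve m (z : C) : C := (x m)%:C - 'i * (t * ln (x m))%:C + q + z.
Definition pw (al : R) m : R := expR (al * ln (x m)).

Lemma pwE al m : pw al m = expR (al * ln (x m)).
Proof. by []. Qed.

Lemma x_large (B : R) : evm (fun m _ => B <= x m).
Proof. by have [M h] := hx B; exists M => m z Mm _; exact: h. Qed.

Lemma ln_large (B : R) : evm (fun m _ => B <= ln (x m)).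
Proof.
apply: evm_imp (x_large (expR B)) _ => m z _ h.
by rewrite -[leLHS]expRK ler_ln ?posrE ?expR_gt0// (lt_le_trans (expR_gt0 B)).
Qed.

Lemma pwD al be m : pw al m * pw be m = pw (al + be) m.
Proof. by rewrite /pw -expRD -mulrDl. Qed.

Lemma pw_nat n m : 0 < x m -> pw n%:R m = x m ^+ n.
Proof. by move=> x0; rewrite /pw expRM_natl lnK. Qed.

Lemma pw_ge0 al m : 0 <= pw al m. Proof. exact: expR_ge0. Qed.

Lemma pw_le al be m : 1 <= x m -> al <= be -> pw al m <= pw be m.
Proof. by move=> x1 h; rewrite ler_expR ler_wpM2r// ln_ge0. Qed.

Lemma pw_o1 al : al < 0 -> o1 (fun m _ => (pw al m)%:C).
Proof.
move=> al0 e e0; have al1 : 0 < - al by rewrite oppr_gt0.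
apply: evm_imp (ln_large (e^-1 / - al)) _ => m z _; rewrite ler_pdivrMr// => h.
rewrite cmodC ger0_norm ?pw_ge0// /pw -[al]opprK mulNr expRN -[leRHS]invrK.
rewrite lef_pV2 ?posrE ?expR_gt0 ?invr_gt0//.
apply: (@le_trans _ _ (1 + - al * ln (x m))); last exact: expR_ge1Dx.
by rewrite mulrC; lra.
Qed.

Lemma ln_div_o1 : o1 (fun m _ => (ln (x m) / x m)%:C).
Proof.
move=> e e0; apply: evm_imp (evm_and (ln_large 1) (evm_and (ln_large (4 / e)) (x_large 1))) _.
move=> m z _ [h0 [h1 h2]]; have x0 : 0 < x m by exact: lt_le_trans h2.
rewrite cmodC ger0_norm ?divr_ge0 ?(ltW x0) ?(le_trans ler01 h0)//.
rewrite ler_pdivrMr//; move: h1; rewrite ler_pdivrMr// => h1.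
set y := ln (x m) in h0 h1 *.
have xy : x m = expR (y / 2) * expR (y / 2).
  by rewrite -expRD -splitr /y lnK.
have hy := expR_ge1Dx (y / 2).
have y2 : (y / 2) * (y / 2) <= x m.
  by rewrite xy ler_pM//; lra.
nra.
Qed.

Lemma inv_o1 : o1 (fun m _ => ((x m)^-1)%:C).
Proof.
apply: (o1_le ler01) ln_div_o1; apply: evm_imp (evm_and (ln_large 1) (x_large 1)) _.
move=> m z _ [h1 h2]; have x0 : 0 < x m by exact: lt_le_trans h2.
rewrite mul1r !cmodC !ger0_norm ?divr_ge0 ?invr_ge0 ?(ltW x0) ?(le_trans ler01 h1)//.
by rewrite -[leLHS]mul1r ler_wpM2r// invr_ge0 ltW.
Qed.

Lemma lcurve_ratio : o1 (fun m z => lcurve m z / (x m)%:C - 1).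
Proof.
have h1 : ub (fun _ z => q + z).
  apply: (@ub_bound _ (cmod q + 1)); first by rewrite addr_ge0// cmod_ge0.
  by move=> m z z1; rewrite (le_trans (cmodD _ _))// lerD2l.
have h2 : ub (fun _ _ => - 'i * t%:C).
  by apply: (@ub_bound _ (cmod (- 'i * t%:C))); rewrite ?cmod_ge0.
apply: o1_ext (o1D (ub_o1 h2 ln_div_o1) (ub_o1 h1 inv_o1)).
apply: evm_imp (x_large 1) _ => m z _ x1; have x0 : 0 < x m by exact: lt_le_trans x1.
have xC : (x m)%:C != 0 by rewrite -cmod_gt0 cmodC gtr0_norm.
rewrite /lcurve !rmorphM fmorphV /=; field; exact: xC.
Qed.

End Curve.

End SequenceCalculus.

(** * Reduction to the two dominant terms *)

Section CurveAsymptotics.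
Variable R : realType.
Local Notation C := R[i].
Variables (b : nat -> R) (beta : nat -> nat).
Hypotheses (b_ge0 : forall k, 0 <= b k) (b_lt1 : forall k, b k < 1) (b0 : b 0%N = 0).
Variables (W : C -> C) (tau : nat -> C -> C) (lc : nat -> C) (N T K : nat) (G : R).
Variables (x : nat -> R) (t : R) (q : C).
Hypothesis hx : forall B : R, exists M, forall m, (M <= m)%N -> B <= x m.
Hypotheses (t0 : 0 < t) (lc0 : lc 0%N = 1) (lc_neq0 : forall j, lc j != 0).
Hypotheses (KN : (K < N)%N) (tT : 2 * t <= T%:R) (tb1 : 4 <= 2 * t * b 1).
Hypothesis hG : 256 * expR (2 * (cmod q + 1)) <= G.

(** Index 0 stands for the constant term 1 of the expansion, so that it can be compared with the
    reflections on the same footing. *)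
Definition nexp j : nat := if j is 0%N then 0%N else (4 + beta 1 + beta j)%N.
(** The exponent of [x m] in the size of term [j] on the curve of slope [t]. *)
Definition phj j : R := 2 * t * b j - (nexp j)%:R.

Let Phi := phj K.
Hypotheses (PhiS : phj K.+1 = Phi)
  (Phi_max : forall j, j != K -> j != K.+1 -> phj j < Phi).

Local Notation bO := (bO (Dom b T G) (@kk R)).
Hypothesis HW : bO (fun l => - (W l / (2 * ('i * l))) - (1 + \sum_(i < N) tau i l))
  (fun l => YY b beta N l / kk l).
Hypothesis Hs : forall i, bO (tau i) (TT b beta i.+1).
Hypothesis Hl : forall j, j.+1 = K \/ j.+1 = K.+1 ->
  bO (fun l => tau j l - lc j.+1 * (cexp (2 * ('i * l) * (b j.+1)%:C) /
    (2 * ('i * l)) ^+ nexp j.+1)) (fun l => TT b beta j.+1 l / kk l).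

Let l m z := lcurve x t q m z.
Let pw al m := pw x al m.

Let re_l m z : complex.Re ('i * l m z) = t * ln (x m) - complex.Im q - complex.Im z.
Proof.
rewrite /l /lcurve ReM /= mul0r mul1r sub0r !ImD ImN ImM /=; ring.
Qed.

Let Cq := expR (2 * (cmod q + 1)).

Let im_le z y : cmod z <= 1 -> 0 <= y <= 1 ->
  `|2 * (- complex.Im q - complex.Im z) * y| <= 2 * (cmod q + 1).
Proof.
move=> z1 /andP[y0 y1]; rewrite normrM (ger0_norm y0).
have h : `|2 * (- complex.Im q - complex.Im z)| <= 2 * (cmod q + 1).
  rewrite normrM ger0_norm// ler_wpM2l// (le_trans (ler_normB _ _))// normrN.
  by rewrite lerD ?cmod_Im// (le_trans (cmod_Im z)).
by rewrite (le_trans _ h)// ler_piMr.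
Qed.

Let exp_bounds m z y : cmod z <= 1 -> 0 <= y <= 1 ->
  expR (2 * complex.Re ('i * l m z) * y) <= Cq * pw (2 * t * y) m /\
  pw (2 * t * y) m <= Cq * expR (2 * complex.Re ('i * l m z) * y).
Proof.
move=> z1 y1; have := im_le z1 y1; rewrite ler_norml => /andP[h1 h2].
have e : 2 * complex.Re ('i * l m z) * y =
    2 * (- complex.Im q - complex.Im z) * y + 2 * t * y * ln (x m) by rewrite re_l; ring.
by rewrite /Cq /pw !pwE -!expRD !ler_expR e; split; lra.
Qed.

Let x_evt : evm (fun m z => [/\ 1 <= x m, x m <= kk (l m z) & kk (l m z) <= 4 * x m]).
Proof.
have h := lcurve_ratio t q hx.
apply: evm_imp (evm_and (x_large hx 1) (h _ (divr_gt0 (@ltr01 R) (ltr0Sn _ 1)))) _ => m z z1 [x1 hr].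
have x0 : 0 < x m by exact: lt_le_trans x1.
have xC : cmod (x m)%:C = x m by rewrite cmodC gtr0_norm.
have xn : (x m)%:C != 0 by rewrite -cmod_gt0 xC.
have e : l m z = (x m)%:C * (l m z / (x m)%:C) by rewrite mulrC divfK.
have k2 : kk (l m z) = 2 * (x m * cmod (l m z / (x m)%:C)).
  by rewrite /kk [cmod (2 * _)]cmodM [cmod ('i * _)]cmodM cmod_i mul1r cmod_nat [in LHS]e [in LHS]cmodM xC.
have r1 := cmod_dist 1 (l m z / (x m)%:C).
have r2 := cmod_dist (l m z / (x m)%:C) 1.
move: r1 r2; rewrite cmod1 cmod_distC !ler_norml => /andP[_ r1] /andP[_ r2].
rewrite k2; split=> //; nra.
Qed.

(** The curve enters [Dom]: [2 t <= T] gives the polynomial upper bound on the growth, and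
    [4 <= 2 t b_1] the lower bound at the first node. *)
Let Dom_evt (L : R) : evm (fun m z => Dom b T G (l m z) /\ L <= kk (l m z)).
Proof.
have Cq0 : 0 < Cq by exact: expR_gt0.
apply: evm_imp (evm_and x_evt (evm_and (x_large hx L) (ln_large hx ((cmod q + 1) / t)))) _.
move=> m z z1 [[x1 xk kx] [xL hl]]; split; last exact: le_trans xk.
have x0 : 0 < x m by exact: lt_le_trans x1.
have k1 : 1 <= kk (l m z) by exact: le_trans xk.
have [b1 b2] := exp_bounds m z1 (y := 1) ltac:(by rewrite ler01 lexx).
have [b3 b4] := exp_bounds m z1 (y := b 1) ltac:(by rewrite b_ge0 ltW).
rewrite !mulr1 in b1 b2; split.
- rewrite re_l; move: hl; rewrite ler_pdivrMr// mulrC => hl.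
  have := im_le z1 (y := 1) ltac:(by rewrite ler01 lexx).
  by rewrite mulr1 ler_norml => /andP[h1 _]; lra.
- apply: (le_trans b1); apply: ler_pM; [exact: ltW|exact: pw_ge0| |].
    by apply: le_trans hG; rewrite -/Cq; apply: ler_peMl; [exact: ltW|rewrite ler1n].
  apply: le_trans (pw_le x1 tT) _; rewrite pw_nat//; apply: lerXn2r => //; rewrite nnegrE ltW//.
  exact: lt_le_trans xk.
apply: (@le_trans _ _ (256 * pw (2 * t * b 1) m)).
  apply: (@le_trans _ _ ((4 * x m) ^+ 4)).
    by apply: lerXn2r; rewrite ?nnegrE ?cmod_ge0// mulr_ge0// ltW.
  (* The constant 256 in [hG] is the fourth power of the 4 in [kk <= 4 x]. *)
  rewrite exprMn (_ : 4 ^+ 4 = 256 :> R); last by ring.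
  by apply: ler_wpM2l; [exact: ler0n|rewrite -pw_nat//; exact: pw_le].
apply: le_trans (ler_wpM2l (ler0n _ 256) b4) _.
by rewrite mulrA ler_wpM2r ?expR_ge0.
Qed.

Let evl_evm (P : C -> Prop) : evl (Dom b T G) (@kk R) P -> evm (fun m z => P (l m z)).
Proof. by move=> [L _ h]; apply: evm_imp (Dom_evt L) _ => m z _ [h1 h2]; exact: h. Qed.

Let TT_evt j : evm (fun m z => TT b beta j.+1 (l m z) <= Cq * pw (phj j.+1) m).
Proof.
apply: evm_imp x_evt _ => m z z1 [x1 xk _]; have x0 : 0 < x m by exact: lt_le_trans x1.
have [b1 _] := exp_bounds m z1 (y := b j.+1) ltac:(by rewrite b_ge0 ltW).
have k0 : 0 < kk (l m z) by exact: lt_le_trans xk.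
rewrite /TT ler_pdivrMr ?exprn_gt0//; apply: (le_trans b1).
rewrite -[leRHS]mulrA ler_wpM2l ?expR_ge0//.
apply: (@le_trans _ _ (pw (phj j.+1) m * x m ^+ nexp j.+1)).
  by rewrite -pw_nat// pwD /phj subrK.
by rewrite ler_wpM2l ?pw_ge0// lerXn2r// nnegrE ltW.
Qed.

Let Phi_ge j : phj j <= Phi.
Proof.
have [->//|jK] := eqVneq j K; have [->|jK1] := eqVneq j K.+1; first by rewrite PhiS.
exact/ltW/Phi_max.
Qed.

Let pw_Phi j m : 1 <= x m -> pw (phj j) m * pw (- Phi) m <= 1.
Proof.
move=> x1; rewrite /pw pwD pwE -expR0 ler_expR.
by apply: mulr_le0_ge0; rewrite ?ln_ge0// subr_le0 Phi_ge.
Qed.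

Let pwC al m : cmod (pw al m)%:C = pw al m.
Proof. by rewrite cmodC ger0_norm// pw_ge0. Qed.

Let Cq0 : 0 <= Cq. Proof. exact: expR_ge0. Qed.

Let TT_Phi j : evm (fun m z => TT b beta j.+1 (l m z) * pw (- Phi) m <= Cq).
Proof.
apply: evm_imp (evm_and (TT_evt j) x_evt) _ => m z z1 [h [x1 _ _]].
apply: le_trans (ler_wpM2r (pw_ge0 _ _ _) h) _.
by rewrite -mulrA ler_piMr// pw_Phi.
Qed.

Let YY_Phi n : evm (fun m z => YY b beta n (l m z) * pw (- Phi) m <= 1 + n%:R * Cq).
Proof.
elim: n => [|n IH].
  apply: evm_imp x_evt _ => m z z1 [x1 _ _].
  rewrite /YY big_ord0 mul0r addr0 mul1r.
  have h0 : 0 <= Phi by have := Phi_ge 0%N; rewrite /phj /= b0 mulr0 subrr.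
  rewrite -[leRHS](@expR0 R) ler_expR; apply: mulr_le0_ge0; rewrite ?ln_ge0// oppr_le0//.
apply: evm_imp (evm_and IH (TT_Phi n)) _ => m z z1 [h1 h2].
have -> : 1 + n.+1%:R * Cq = (1 + n%:R * Cq) + Cq by rewrite -natr1; ring.
by rewrite YY_S mulrDl; exact: lerD.
Qed.

(* A remainder smaller than the dominant terms by one power of [x]. *)
Let small_k (F : C -> C) H (B : R) : 0 <= B -> bO F (fun l => H l / kk l) ->
  evm (fun m z => 0 <= H (l m z) /\ H (l m z) * pw (- Phi) m <= B) ->
  o1 (fun m z => F (l m z) * (pw (- Phi) m)%:C).
Proof.
move=> B0 [M M0 h] hB; apply: (o1_le (K := M * B)) (inv_o1 hx); first exact: mulr_ge0.
apply: evm_imp (evm_and (evl_evm h) (evm_and hB x_evt)) _ => m z z1 [h1 [[H0 h2] [x1 xk _]]].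
have x0 : 0 < x m by exact: lt_le_trans x1.
have k0 : 0 < kk (l m z) by exact: lt_le_trans xk.
rewrite cmodM pwC cmodC ger0_norm ?invr_ge0 ?(ltW x0)//.
apply: le_trans (ler_wpM2r (pw_ge0 _ _ _) h1) _.
have -> : M * (H (l m z) / kk (l m z)) * pw (- Phi) m =
  M * ((H (l m z) * pw (- Phi) m) / kk (l m z)) by ring.
rewrite -[leRHS]mulrA ler_wpM2l//; apply: ler_pM => //.
- by rewrite mulr_ge0// pw_ge0.
- by rewrite invr_ge0 ltW.
- by rewrite lef_pV2 ?posrE.
Qed.

Let err_o1 : o1 (fun m z => (- (W (l m z) / (2 * ('i * l m z))) - (1 + \sum_(i < N) tau i (l m z)))
  * (pw (- Phi) m)%:C).
Proof.
apply: (small_k (B := 1 + N%:R * Cq)) HW _; first by rewrite addr_ge0// mulr_ge0.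
apply: evm_imp (YY_Phi N) _ => m z _ h; split=> //.
by rewrite addr_ge0// sumr_ge0// => i _; exact: TT_ge0.
Qed.

Definition tterm j (u : C) : C := lc j * (cexp (2 * ('i * u) * (b j)%:C) / (2 * ('i * u)) ^+ nexp j).

Let tm j u : C := if j is i.+1 then tau i u else 1.

Let tm_o1 j : (j <= N)%N -> o1 (fun m z =>
  (tm j (l m z) - (if (j == K) || (j == K.+1) then tterm j (l m z) else 0)) * (pw (- Phi) m)%:C).
Proof.
move=> jN; case: (boolP ((j == K) || (j == K.+1))) => [jK|].
  case: j jK {jN} => [|j] jK.
    move=> e e0; exists 0%N => m z _ _.
    by rewrite /tm /tterm lc0 b0 mulr0 cexp0 expr0 divr1 mulr1 subrr mul0r cmod0 ltW.
  apply: (small_k Cq0 (Hl _)); first by case/orP: jK => /eqP; [left|right].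
  by apply: evm_imp (TT_Phi j) _ => m z _ h; split=> //; exact: TT_ge0.
rewrite negb_or => /andP[jK jK1]; have ph := Phi_max jK jK1.
case: j jK jK1 ph {jN} => [|j] jK jK1 ph.
  have P0 : - Phi < 0 by rewrite oppr_lt0; move: ph; rewrite /phj/= b0 mulr0 subrr.
  apply: o1_ext (pw_o1 hx P0); exists 0%N => m z _ _.
  by rewrite /tm subr0 mul1r.
have P0 : phj j.+1 - Phi < 0 by rewrite subr_lt0.
have [M M0 h] := Hs j.
apply: (o1_le (K := M * Cq)) (pw_o1 hx P0); first exact: mulr_ge0.
apply: evm_imp (evm_and (evl_evm h) (TT_evt j)) _ => m z z1 [h1 h2].
rewrite subr0 cmodM !pwC; apply: le_trans (ler_wpM2r (pw_ge0 _ _ _) h1) _.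
rewrite -[leLHS]mulrA -[leRHS]mulrA ler_wpM2l//.
apply: le_trans (ler_wpM2r (pw_ge0 _ _ _) h2) _.
have e : pw (phj j.+1) m * pw (- Phi) m = pw (phj j.+1 - Phi) m := pwD x _ _ m.
by rewrite -mulrA e.
Qed.

(** Multiplication by [x ^ - Phi] makes the extremal terms bounded. By [Phi_max] every other term
    then decays like a negative power of [x], and the remainders decay like [1 / x]. *)
Lemma two_terms : o1 (fun m z => (- (W (l m z) / (2 * ('i * l m z))) -
  (tterm K (l m z) + tterm K.+1 (l m z))) * (pw (- Phi) m)%:C).
Proof.
have h := @o1_sum R N.+1 (fun j m z => (tm j (l m z) -
  (if (j == K) || (j == K.+1) then tterm j (l m z) else 0)) * (pw (- Phi) m)%:C) (fun j hj => tm_o1 hj).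
apply: o1_ext (o1D err_o1 h); exists 0%N => m z _ _.
rewrite -mulr_suml -mulrDl; congr (_ * _); rewrite sumrB.
have -> : \sum_(j < N.+1) tm j (l m z) = 1 + \sum_(i < N) tau i (l m z) by rewrite big_ord_recl.
have -> : \sum_(j < N.+1) (if (j == K :> nat) || (j == K.+1 :> nat) then tterm j (l m z) else 0) =
    tterm K (l m z) + tterm K.+1 (l m z).
  have K1 : (K < N.+1)%N by rewrite ltnW.
  have K2 : (K.+1 < N.+1)%N by [].
  rewrite (bigD1 (Ordinal K1))//= eqxx (bigD1 (Ordinal K2))/=; last first.
    by rewrite -val_eqE /= gtn_eqF.
  rewrite eqxx orbT big1 ?addr0// => j /andP[j1 j2].
  by move: j1 j2; rewrite -!val_eqE /= => /negbTE -> /negbTE ->.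
by ring.
Qed.

(** The two phase conditions. On the lattice of the [x m] the terms [K] and [K + 1] keep a constant
    relative phase, and the shift [q] makes their limiting quotient at [z = 0] equal to -1. *)
Hypothesis hxK : forall m, cexp (2 * 'i * (x m)%:C * (b K.+1 - b K)%:C) = 1.
Hypothesis hq : lc K.+1 / lc K * cexp (2 * 'i * q * (b K.+1 - b K)%:C) *
  ((2 * 'i) ^+ nexp K / (2 * 'i) ^+ nexp K.+1) = -1.

Definition hnorm m : C := - ((2 * 'i * (x m)%:C)^-1 * (pw (- Phi) m)%:C /
  (lc K * cexp (2 * 'i * ((x m)%:C + q) * (b K)%:C) / (2 * 'i) ^+ nexp K)).

(** The factor [hnorm] sends term [K] to [exp (2 i b_K z)] in the limit, and the last exponential
    removes this oscillation; only the difference of the two nodes survives in the limit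
    function. *)
Definition hfun m z : C := hnorm m * W (l m z) * cexp (- (2 * 'i * (b K)%:C) * z).

Let two_i : 2 * 'i != 0 :> C.
Proof. by rewrite mulf_neq0 ?pnatr_eq0// -cmod_gt0 cmod_i. Qed.

Let ratio m z : C := l m z / (x m)%:C.

Let tterm_eq j m z : 1 <= x m -> ratio m z != 0 -> phj j = Phi ->
  tterm j (l m z) * (pw (- Phi) m)%:C = lc j * cexp (2 * 'i * ((x m)%:C + q) * (b j)%:C) *
    cexp (2 * 'i * (b j)%:C * z) / (2 * 'i) ^+ nexp j * (ratio m z ^+ nexp j)^-1.
Proof.
move=> x1 r0 pj; have x0 : 0 < x m by exact: lt_le_trans x1.
have xn : (x m)%:C != 0 by rewrite -cmod_gt0 cmodC gtr0_norm.
have i2 : 'i * 'i = -1 :> C by rewrite -expr2 sqr_i.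
have e1 : cexp (2 * ('i * l m z) * (b j)%:C) = cexp (2 * 'i * ((x m)%:C + q) * (b j)%:C) *
    cexp (2 * 'i * (b j)%:C * z) * (pw (2 * t * b j) m)%:C.
  have -> : (pw (2 * t * b j) m)%:C = cexp (2 * t * b j * ln (x m))%:C.
    by apply: complex_eq; rewrite /cexp /= ?sin0 ?mulr0// cos0 mulr1.
  rewrite -!cexpD; congr cexp; rewrite /l /lcurve !rmorphM /=.
  have -> : (2 : R)%:C = 2 :> C by rewrite rmorph_nat.
  have -> : 2 * ('i * ((x m)%:C - 'i * (t%:C * (ln (x m))%:C) + q + z)) * (b j)%:C =
    2 * 'i * ((x m)%:C + q) * (b j)%:C + 2 * 'i * (b j)%:C * z
      - ('i * 'i) * (2 * t%:C * (b j)%:C * (ln (x m))%:C) by ring.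
  by rewrite i2 mulN1r opprK.
have e2 : (2 * ('i * l m z)) ^+ nexp j = (2 * 'i) ^+ nexp j * ratio m z ^+ nexp j * (pw (nexp j)%:R m)%:C.
  rewrite /pw pw_nat// rmorphXn -!exprMn; congr (_ ^+ _); rewrite /ratio.
  by rewrite -mulrA [_ / _ * _]divfK//; rewrite mulrA.
have e3 : (pw (2 * t * b j) m)%:C * (pw (- Phi) m)%:C = (pw (nexp j)%:R m)%:C.
  have -> : (nexp j)%:R = 2 * t * b j + - Phi by rewrite -pj /phj; ring.
  by rewrite -rmorphM /= /pw pwD.
have pn : (pw (nexp j)%:R m)%:C != 0 by rewrite -cmod_gt0 pwC /pw expR_gt0.
rewrite /tterm e1 e2.
set A := cexp _; set B := cexp _; set D := (2 * 'i) ^+ _; set E := ratio _ _ ^+ _.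
rewrite -e3; rewrite -e3 mulf_eq0 negb_or in pn; have /andP[p1 p2] := pn.
have D0 : D != 0 by rewrite expf_neq0.
have E0 : E != 0 by rewrite expf_neq0.
by clearbody A B D E; move: p1 p2; move: (pw _ m)%:C (pw _ m)%:C => u1 u2 p1 p2; field; rewrite p1 p2 D0 E0.
Qed.

Lemma hfun_lim : o1 (fun m z => hfun m z - (1 - cexp (2 * 'i * (b K.+1 - b K)%:C * z))).
Proof.
have hr : o1 (fun m z => ratio m z - 1) := lcurve_ratio t q hx.
pose zz z : C := cexp (- (2 * 'i * (b K)%:C) * z).
pose nu m : C := (lc K * cexp (2 * 'i * ((x m)%:C + q) * (b K)%:C) / (2 * 'i) ^+ nexp K)^-1.
have expb (c : C) z : cmod z <= 1 -> cmod (cexp (c * z)) <= expR (cmod c).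
  move=> z1; rewrite cmod_cexp ler_expR (le_trans (ler_norm _))// (le_trans (cmod_Re _))//.
  by rewrite cmodM ler_piMr// cmod_ge0.
have nu_ub : ub (fun m z => ratio m z * nu m * zz z).
  apply: ubM; last first.
    by apply: (@ub_bound _ _ (expR (cmod (- (2 * 'i * (b K)%:C))))) => [|m z]; [exact: expR_ge0|exact: expb].
  apply: ubM; first exact: o1_ub hr.
  pose D := (cmod (lc K / (2 * 'i) ^+ nexp K))^-1 * expR (cmod (2 * 'i * q * (b K)%:C)).
  apply: (@ub_bound _ _ D); first by rewrite mulr_ge0 ?invr_ge0 ?cmod_ge0 ?expR_ge0.
  move=> m z _; rewrite /nu mulrAC cmodV cmodM invfM /D ler_wpM2l ?invr_ge0 ?cmod_ge0//.
  rewrite -cmodV -cexpN cmod_cexp ler_expR.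
  have -> : - (2 * 'i * ((x m)%:C + q) * (b K)%:C) =
    'i * (- 2 * (x m) * b K)%:C + - (2 * 'i * q * (b K)%:C).
    by rewrite !rmorphM rmorphN rmorph_nat /=; ring.
  rewrite ReD {1}ReM /= mulr0 mul0r subrr add0r.
  by rewrite (le_trans (ler_norm _))// (le_trans (cmod_Re _))// cmodN.
have h1 := ub_o1 nu_ub two_terms.
have r1 : o1 (fun m z => ratio m z * (ratio m z ^+ nexp K)^-1 - 1).
  by apply: (o1_1M (hr)); apply: (o1_1V (F := fun m z => ratio m z ^+ _)); exact: (o1_1X _ hr).
have r2 : o1 (fun m z => ratio m z * (ratio m z ^+ nexp K.+1)^-1 - 1).
  by apply: (o1_1M (hr)); apply: (o1_1V (F := fun m z => ratio m z ^+ _)); exact: (o1_1X _ hr).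
have e_ub : ub (fun m z => - cexp (2 * 'i * (b K.+1 - b K)%:C * z)).
  by apply: (@ub_bound _ _ (expR (cmod (2 * 'i * (b K.+1 - b K)%:C)))) => [|m z z1];
    [exact: expR_ge0|rewrite cmodN expb].
apply: o1_ext (o1D h1 (o1D r1 (ub_o1 e_ub r2))).
have r0 := hr _ (divr_gt0 (@ltr01 R) (ltr0Sn _ 1)).
apply: evm_imp (evm_and r0 x_evt) _ => m z z1 [rz [x1 xk _]].
have x0 : 0 < x m by exact: lt_le_trans x1.
have xn : (x m)%:C != 0 by rewrite -cmod_gt0 cmodC gtr0_norm.
have rn : ratio m z != 0.
  apply: contraTneq rz => ->; rewrite sub0r cmodN cmod1 -ltNge; lra.
have T1 := tterm_eq x1 rn (erefl Phi); have T2 := tterm_eq x1 rn PhiS.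
have lK := lc_neq0 K.
set p := (pw (- Phi) m)%:C in T1 T2 *.
rewrite mulrBl [(tterm _ _ + _) * p]mulrDl T1 T2 /hfun /hnorm -/(nu m) -/p -/(zz z).
have cK : cexp (2 * 'i * ((x m)%:C + q) * (b K)%:C) != 0 by exact: cexp_neq0.
have zzE : zz z * cexp (2 * 'i * (b K)%:C * z) = 1 by rewrite /zz -cexpD mulNr addNr cexp0.
have zzE1 : zz z * cexp (2 * 'i * (b K.+1)%:C * z) = cexp (2 * 'i * (b K.+1 - b K)%:C * z).
  by rewrite /zz -cexpD; congr cexp; rewrite rmorphB /=; ring.
have D1 : (2 * 'i) ^+ nexp K != 0 :> C by rewrite expf_neq0.
have D2 : (2 * 'i) ^+ nexp K.+1 != 0 :> C by rewrite expf_neq0.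
have nuE : nu m * (lc K * cexp (2 * 'i * ((x m)%:C + q) * (b K)%:C) / (2 * 'i) ^+ nexp K) = 1.
  by rewrite /nu mulVf// !mulf_neq0// invr_eq0.
have nuE1 : nu m * (lc K.+1 * cexp (2 * 'i * ((x m)%:C + q) * (b K.+1)%:C) / (2 * 'i) ^+ nexp K.+1) = -1.
  have eb : cexp (2 * 'i * ((x m)%:C + q) * (b K.+1)%:C) =
      cexp (2 * 'i * ((x m)%:C + q) * (b K)%:C) * cexp (2 * 'i * q * (b K.+1 - b K)%:C).
    rewrite -[RHS]mulr1 -[X in _ = _ * X](hxK m) -!cexpD; congr cexp; rewrite rmorphB /=; ring.
  rewrite eb /nu -hq; set A := cexp _; set B := cexp _; field.
  by rewrite lK D1 D2 cexp_neq0.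
have lE : W (l m z) / (2 * ('i * l m z)) * ratio m z = W (l m z) / (2 * 'i * (x m)%:C).
  have ln : l m z != 0 by move: rn; rewrite /ratio mulf_eq0 negb_or => /andP[].
  have i0 : 'i != 0 :> C by rewrite -cmod_gt0 cmod_i.
  by rewrite /ratio; field; rewrite xn ln i0.
set eK := cexp (2 * 'i * (b K)%:C * z) in zzE *; set eK1 := cexp (2 * 'i * (b K.+1)%:C * z) in zzE1 *.
set ez := cexp (2 * 'i * (b K.+1 - b K)%:C * z) in zzE1 *.
set c1 := lc K * _ in nuE *; set c2 := lc K.+1 * _ in nuE1 *.
have hA : ratio m z * nu m * zz z * (c1 * eK / (2 * 'i) ^+ nexp K / ratio m z ^+ nexp K) =
    ratio m z / ratio m z ^+ nexp K.
  have -> : ratio m z * nu m * zz z * (c1 * eK / (2 * 'i) ^+ nexp K / ratio m z ^+ nexp K) =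
    ratio m z / ratio m z ^+ nexp K * (nu m * (c1 / (2 * 'i) ^+ nexp K)) * (zz z * eK).
    by move: (ratio m z ^+ nexp K)^-1 ((2 * 'i) ^+ nexp K)^-1 => u1 u2; ring.
  by rewrite nuE zzE !mulr1.
have hB : ratio m z * nu m * zz z * (c2 * eK1 / (2 * 'i) ^+ nexp K.+1 / ratio m z ^+ nexp K.+1) =
    - ez * (ratio m z / ratio m z ^+ nexp K.+1).
  have -> : ratio m z * nu m * zz z * (c2 * eK1 / (2 * 'i) ^+ nexp K.+1 / ratio m z ^+ nexp K.+1) =
    ratio m z / ratio m z ^+ nexp K.+1 * (nu m * (c2 / (2 * 'i) ^+ nexp K.+1)) * (zz z * eK1) by ring.
  by rewrite nuE1 zzE1; ring.
have hC : ratio m z * nu m * zz z * (- (W (l m z) / (2 * ('i * l m z))) * p) =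
    - ((2 * 'i * (x m)%:C)^-1 * p * nu m) * W (l m z) * zz z.
  have -> : ratio m z * nu m * zz z * (- (W (l m z) / (2 * ('i * l m z))) * p) =
    - (W (l m z) / (2 * ('i * l m z)) * ratio m z) * p * nu m * zz z by ring.
  by rewrite lE; ring.
set u0 := ratio m z * nu m * zz z in hA hB hC *.
rewrite (mulrBr u0) (mulrDr u0) hA hB hC.
by move: (ratio m z / _) (ratio m z / _) => u1 u2; ring.
Qed.

End CurveAsymptotics.

(** * Zeros and their number *)

Section ZeroFinding.
Variable R : realType.
Local Notation C := R[i].

Lemma entireS_shift (F : C -> C) (a : C) : entireS F -> entireS (fun z => F (a + z)).
Proof.
move=> h z0; have [c hc] := h (a + z0); exists c => rho r1.
have [K K0 hK] := hc rho r1; exists K => // i Di; have [h1 h2] := hK i Di.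
by split=> // N u ur; rewrite addrA; exact: h2.
Qed.

Lemma cexp_sub1 (v : C) : cmod v <= 1 / 2 -> cmod (cexp v - 1) <= 2 * cmod v.
Proof.
move=> v1.
have h := @cder_dist_cst R (fun s => cexp (v * s%:C)) (fun s => v * cexp (v * s%:C)) (2 * cmod v) 0 1 ler01.
rewrite mulr1 mulr0 cexp0 subr0 mulr1 in h; apply: h => s /andP[s0 s1]; first exact: cder_cexpl.
rewrite cmodM cmod_cexp mulrC ler_wpM2r ?cmod_ge0//.
have e2 : expR (1 / 2) <= 2 :> R.
  have := expR_ge1Dx (- (1 / 2) : R); rewrite expRN => h2.
  have e0 : 0 < expR (1 / 2) :> R by exact: expR_gt0.
  rewrite -[leRHS]invrK -[leLHS]invrK lef_pV2 ?posrE ?invr_gt0//.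
  by apply: le_trans h2; lra.
apply: le_trans e2; rewrite ler_expR; apply: le_trans (ler_norm _) _.
by rewrite (le_trans (cmod_Re _))// cmodM cmodC ger0_norm// (le_trans _ v1)// ler_piMr// cmod_ge0.
Qed.

(** The Cauchy estimate on the unit circle. *)
Lemma tcoef_bound (F : C -> C) (eta : R) n : entireS F ->
  (forall z, cmod z <= 1 -> cmod (F z) <= eta) -> cmod (tcoef 0 F n) <= eta.
Proof.
move=> hF hb; have pi0 : 0 < 2 * pi :> R by rewrite mulr_gt0// pi_gt0.
have [c e] := ent_circle n (@ler01 R) (entireP hF 0).
have : cmod (cintegral `[0, 2 * pi] (fun s => F (0 + (1 : R)%:C * circ s) / circ s ^+ n)) <= eta * (2 * pi - 0).
  apply: ccont_cintegral_le => //; first exact: ltW.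
  move=> s _; rewrite cmod_div cmodX cmod_circ expr1n divr1; apply: hb.
  by rewrite add0r mul1r cmod_circ.
rewrite e expr1n mulr1 cmodM cmodC gtr0_norm// subr0 mulrC ler_pM2r//.
Qed.

(** On the disc of radius 1/4 the differences of n-th powers are at most [4 / 2 ^ n] times the
    distance. Summing these against the bounds of [tcoef_bound] gives 8 times [eta]. *)
Lemma entire_lipschitz (F : C -> C) (eta : R) : entireS F ->
  (forall z, cmod z <= 1 -> cmod (F z) <= eta) ->
  forall z1 z2, cmod z1 <= 1 / 4 -> cmod z2 <= 1 / 4 -> cmod (F z1 - F z2) <= 8 * eta * cmod (z1 - z2).
Proof.
move=> hF hb z1 z2 h1 h2; set d := cmod (z1 - z2).
have d0 : 0 <= d by exact: cmod_ge0.
have eta0 : 0 <= eta by rewrite (le_trans (cmod_ge0 _) (hb 0 _))// cmod0.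
have zn n : cmod z2 ^+ n <= (1 / 2) ^+ n * (1 / 2) ^+ n.
  rewrite -exprMn lerXn2r ?nnegrE ?cmod_ge0//.
  by rewrite (le_trans h2)//; lra.
have p n : cmod (z1 ^+ n - z2 ^+ n) <= 4 * (1 / 2) ^+ n * d.
  elim: n => [|n IH]; first by rewrite !expr0 subrr cmod0 mulr1 mulr_ge0.
  have hn : 0 <= (1 / 2 : R) ^+ n by rewrite exprn_ge0.
  have hn1 : (1 / 2 : R) ^+ n <= 1 by rewrite exprn_ile1//; lra.
  rewrite (_ : z1 ^+ n.+1 - z2 ^+ n.+1 = z1 * (z1 ^+ n - z2 ^+ n) + (z1 - z2) * z2 ^+ n); last by rewrite !exprS; ring.
  rewrite (le_trans (cmodD _ _))// !cmodM cmodX -/d exprS.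
  have q1 : cmod z1 * cmod (z1 ^+ n - z2 ^+ n) <= 1 / 4 * (4 * (1 / 2) ^+ n * d).
    by apply: ler_pM => //; exact: cmod_ge0.
  have q2 : d * cmod z2 ^+ n <= (1 / 2) ^+ n * d.
    by rewrite mulrC ler_wpM2r// (le_trans (zn n))// ler_piMr.
  lra.
have geo N : \sum_(n < N) (1 / 2 : R) ^+ n <= 2.
  suff -> : \sum_(n < N) (1 / 2 : R) ^+ n = 2 - 2 * (1 / 2) ^+ N.
    have : 0 <= (1 / 2 : R) ^+ N by rewrite exprn_ge0.
    lra.
  elim: N => [|N IH]; first by rewrite big_ord0 expr0; ring.
  by rewrite big_ord_recr /= IH exprS; lra.
have ps N : cmod (psum (tcoef 0 F) N z1 - psum (tcoef 0 F) N z2) <= 8 * eta * d.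
  rewrite /psum -sumrB (le_trans (cmod_sum _ _ _))//.
  apply: (@le_trans _ _ (\sum_(n < N) eta * (4 * (1 / 2) ^+ n * d))).
    apply: ler_sum => n _; rewrite -mulrBr cmodM ler_pM ?cmod_ge0//.
    exact: tcoef_bound.
  rewrite -mulr_sumr -mulr_suml -mulr_sumr.
  have := ler_wpM2l (mulr_ge0 (mulr_ge0 (ler0n _ 4) eta0) d0) (geo N).
  by move=> h; apply: le_trans (le_trans _ h) _; rewrite le_eqVlt; apply/orP; left; apply/eqP; ring.
have [K K0 /(_ tt I)[_ hK]] := entireP hF 0 (lexx 1).
apply/ler_addgt0Pr => e e0; have [N hN] := exists_half_pow (2 * K) e0.
have r (z : C) : cmod z <= 1 / 4 -> cmod (F z - psum (tcoef 0 F) N z) <= K / 2 ^+ N.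
  move=> hz; have := hK N z; rewrite add0r mulr1 divr1 => hh.
  apply: le_trans (hh _) _; first by rewrite (le_trans hz)//; lra.
  rewrite ler_wpM2l// -exprVn lerXn2r ?nnegrE ?cmod_ge0// (le_trans hz)//; lra.
rewrite (_ : F z1 - F z2 = (psum (tcoef 0 F) N z1 - psum (tcoef 0 F) N z2) +
  ((F z1 - psum (tcoef 0 F) N z1) - (F z2 - psum (tcoef 0 F) N z2))); last by ring.
rewrite (le_trans (cmodD _ _))// lerD//; apply: le_trans hN.
rewrite (le_trans (cmodB _ _))//; have := r z1 h1; have := r z2 h2; lra.
Qed.

(* The model function [1 - exp (2 i g z)] is a small perturbation of
   [- 2 i g z] near 0, so [z + F z / (2 i g)] is a contraction. *)
Lemma perturbed_zero (F : C -> C) (g eta : R) : entireS F -> 0 < g -> g <= 1 ->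
  eta <= g / 64 ->
  (forall z, cmod z <= 1 -> cmod (F z - (1 - cexp (2 * 'i * g%:C * z))) <= eta) ->
  exists z, [/\ cmod z <= 1 / 32, F z = 0 &
    forall u, cmod u <= 1 / 32 -> g * cmod u <= cmod (F (z + u))].
Proof.
move=> hF g0 g1 eta_g hb.
pose a : C := 2 * 'i * g%:C.
have ca : cmod a = 2 * g by rewrite !cmodM cmod_i cmod_nat cmodC gtr0_norm// mulr1.
have a0 : a != 0 by rewrite -cmod_gt0 ca mulr_gt0.
have ag0 : 0 < 2 * g by rewrite mulr_gt0.
pose U z := 1 - cexp (a * z).
have eU : entireS U.
  apply: entireB; first exact: entireS_cst.
  apply: (@entire_ext _ _ _ _ (fun z _ => cexp ('i * z * (2 * g)%:C))) => [z _ _|]; last exact: cexp_entire.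
  by congr cexp; rewrite /a rmorphM rmorph_nat /=; ring.
have eta0 : 0 <= eta by rewrite (le_trans (cmod_ge0 _) (hb 0 _))// cmod0.
have Elip := entire_lipschitz (entireB hF eU) hb.
pose u z := z + U z / a.
have ulip z1 z2 : cmod z1 <= 1 / 16 -> cmod z2 <= 1 / 16 -> cmod (u z1 - u z2) <= 1 / 4 * cmod (z1 - z2).
  move=> h1 h2; pose d := z1 - z2.
  have dz : z2 + d = z1 by rewrite /d addrC subrK.
  have h s : cder (fun s : R => u (z2 + d * s%:C)) s (d * (1 - cexp (a * (z2 + d * s%:C)))).
    have d1 : cder (fun s : R => z2 + d * s%:C) s (0 + d) by apply: cderD; [exact: cder_cst|exact: cder_lin].
    have d2 := cderD d1 (cderZ a^-1 (cderB (cder_cst 1 s) (cder_cexp (cderZ a d1)))).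
    apply: cder_ext d2 => [y|]; first by rewrite /u /U [_ / a]mulrC.
    rewrite !add0r; set e := cexp _; have -> : a^-1 * - (a * d * e) = - (a^-1 * a) * d * e by ring.
    by rewrite mulVf//; ring.
  have := @cder_dist_cst R _ _ (1 / 4 * cmod d) 0 1 ler01 (fun s _ => h s).
  rewrite mulr1 mulr0 addr0 dz subr0 mulr1; apply=> s /andP[s0 s1].
  rewrite cmodM mulrC ler_wpM2r ?cmod_ge0//.
  have zs : cmod (z2 + d * s%:C) <= 1 / 16.
    have -> : z2 + d * s%:C = s%:C * z1 + (1 - s)%:C * z2 by rewrite /d rmorphB /=; ring.
    have s1' : 0 <= 1 - s by rewrite subr_ge0.
    rewrite (le_trans (cmodD _ _))// !cmodM !cmodC !ger0_norm//.
    have := ler_wpM2l s0 h1; have := ler_wpM2l s1' h2; lra.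
  have az : cmod (a * (z2 + d * s%:C)) <= 1 / 8.
    rewrite cmodM ca; have := cmod_ge0 (z2 + d * s%:C); nra.
  rewrite cmod_distC (le_trans (cexp_sub1 _))//; lra.
pose Phi z := z + F z / a.
have PhiE z : Phi z = u z + (F z - U z) / a by rewrite /Phi /u; ring.
have Plip z1 z2 : cmod z1 <= 1 / 16 -> cmod z2 <= 1 / 16 -> cmod (Phi z1 - Phi z2) <= 1 / 2 * cmod (z1 - z2).
  move=> h1 h2; have q1 := ulip z1 z2 h1 h2.
  have q2 := Elip z1 z2 ltac:(lra) ltac:(lra).
  rewrite !PhiE (_ : _ - _ = (u z1 - u z2) + ((F z1 - U z1) - (F z2 - U z2)) / a); last by ring.
  rewrite (le_trans (cmodD _ _))// cmod_div ca.
  have q3 : cmod (F z1 - U z1 - (F z2 - U z2)) / (2 * g) <= 1 / 4 * cmod (z1 - z2).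
    rewrite ler_pdivrMr// (le_trans q2)//.
    have := cmod_ge0 (z1 - z2); have : 8 * eta <= g / 8 by lra.
    nra.
  lra.
pose D := eta / (2 * g).
have D0 : 0 <= D by rewrite divr_ge0// ltW.
have D1 : D <= 1 / 128 by rewrite ler_pdivrMr//; lra.
have P0 : cmod (Phi 0) <= D.
  rewrite /Phi add0r cmod_div ca ler_wpM2r ?invr_ge0 ?(ltW ag0)//.
  by have := hb 0; rewrite cmod0 mulr0 cexp0 !subrr subr0; apply.
pose s n := iter n Phi 0.
have hs n : cmod (s n) <= 2 * D - 2 * D / 2 ^+ n /\ cmod (s n.+1 - s n) <= D / 2 ^+ n.
  elim: n => [|n [i1 i2]].
    by split; rewrite /s /= ?cmod0 expr0 divr1 ?subrr ?subr0.
  have pn : 0 < (2 : R) ^+ n by rewrite exprn_gt0.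
  have e : D / 2 ^+ n.+1 = D / 2 ^+ n / 2 by rewrite exprS invfM; ring.
  have dn : 0 <= D / 2 ^+ n by rewrite divr_ge0// ltW.
  have i3 : cmod (s n.+1) <= 2 * D - 2 * D / 2 ^+ n.+1.
    have := cmodD (s n.+1 - s n) (s n); rewrite subrK => /le_trans; apply.
    rewrite -mulrA e; rewrite -mulrA in i1; lra.
  split=> //.
  have b1 : cmod (s n.+1) <= 1 / 16.
    apply: (le_trans i3); rewrite -mulrA e; lra.
  have b2 : cmod (s n) <= 1 / 16.
    apply: (le_trans i1); rewrite -mulrA; lra.
  have := Plip _ _ b1 b2; rewrite e -[Phi (s n.+1)]/(s n.+2) -[Phi (s n)]/(s n.+1); lra.
have [l hl] := complex_geom_lim (fun n => (hs n).2).
have l1 : cmod l <= 1 / 32.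
  have := hl 0%N; rewrite expr0 divr1 /s /= subr0 => /le_trans; apply; lra.
have Pl : Phi l = l.
  apply/eqP; rewrite -subr_eq0; apply/eqP; apply: (@cmod_small_eq0 _ _ 1) => e e0.
  have [n hn] := exists_half_pow (8 * D) e0.
  have b2 : cmod (s n) <= 1 / 16.
    apply: (le_trans (hs n).1); have : 0 <= 2 * D / 2 ^+ n by rewrite divr_ge0 ?exprn_ge0// mulr_ge0.
    lra.
  have q1 := Plip l (s n) ltac:(lra) b2.
  have q2 := hl n; have q3 := hl n.+1.
  rewrite (_ : Phi l - l = (Phi l - Phi (s n)) - (l - s n.+1)); last by rewrite -[s n.+1]/(Phi (s n)); ring.
  rewrite mul1r (le_trans (cmodB _ _))// (le_trans _ hn)//.
  have e1 : 4 * D / 2 ^+ n.+1 = 4 * D / 2 ^+ n / 2 by rewrite exprS invfM; ring.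
  rewrite e1 in q3.
  have e2 : 8 * D / 2 ^+ n = 2 * (4 * D / 2 ^+ n) by ring.
  have := cmod_ge0 (l - s n); rewrite e2; lra.
exists l; split=> //.
  move: Pl; rewrite /Phi => /eqP; rewrite -subr_eq0 addrAC subrr add0r mulf_eq0 invr_eq0 (negbTE a0) orbF.
  by move/eqP.
move=> w w1.
have lw : cmod (l + w) <= 1 / 16 by rewrite (le_trans (cmodD _ _))//; lra.
have := Plip (l + w) l lw ltac:(lra).
rewrite Pl (_ : Phi (l + w) - l = w + F (l + w) / a); last by rewrite /Phi; ring.
rewrite (_ : l + w - l = w); last by ring.
move=> q; have := cmodB (w + F (l + w) / a) (F (l + w) / a); rewrite addrK cmod_div ca => q2.
have q3 : cmod w / 2 <= cmod (F (l + w)) / (2 * g) by lra.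
by move: q3; rewrite ler_pdivlMr//; lra.
Qed.

(* A double zero would contradict the linear lower bound. *)
Lemma simple_zero (W : C -> C) (l0 nu c z : C) (g : R) : entireS W -> 0 < g ->
  nu * W (l0 + z) * cexp (c * z) = 0 -> nu != 0 ->
  (forall u, cmod u <= 1 / 32 -> g * cmod u <= cmod (nu * W (l0 + (z + u)) * cexp (c * (z + u)))) ->
  W (l0 + z) = 0 /\ tcoef (l0 + z) W 1 != 0.
Proof.
move=> hW g0 /eqP; rewrite !mulf_eq0 (negbTE (cexp_neq0 _)) orbF => /orP[/eqP-> /eqP//|/eqP Wz nu0 hlow].
split=> //; apply/eqP => W1.
have [K K0 /(_ tt I)[_ hK]] := entire_taylor2 (l0 + z) hW.
pose B := cmod nu * K * expR (cmod c * (cmod z + 1)) + 1.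
have B0 : 0 < B by rewrite ltr_wpDl// !mulr_ge0 ?cmod_ge0 ?expR_ge0.
pose s := Num.min (1 / 32) (g / (2 * B)).
have s0 : 0 < s by rewrite lt_min !divr_gt0// mulr_gt0.
have s32 : s <= 1 / 32 by rewrite ge_min lexx.
have sB : s * B <= g / 2.
  have : s <= g / (2 * B) by rewrite ge_min lexx orbT.
  by rewrite ler_pdivlMr ?mulr_gt0//; lra.
have cs : cmod (s%:C : C) = s by rewrite cmodC gtr0_norm.
have h1 := hlow s%:C; rewrite cs in h1; have {h1} := h1 s32.
have h2 := hK s%:C; rewrite cs Wz W1 mulr0 !subr0 mulr1 in h2; have {}h2 := h2 ltac:(lra).
rewrite addrA !cmodM cmod_cexp => h1.
have h3 : expR (complex.Re (c * (z + s%:C))) <= expR (cmod c * (cmod z + 1)).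
  rewrite ler_expR (le_trans (ler_norm _))// (le_trans (cmod_Re _))// cmodM ler_wpM2l ?cmod_ge0//.
  by rewrite (le_trans (cmodD _ _))// cs lerD2l; lra.
have h4 : g * s <= B * s ^+ 2.
  apply: (le_trans h1); rewrite /B mulrDl mul1r.
  have q : cmod nu * cmod (W (l0 + z + s%:C)) * expR (complex.Re (c * (z + s%:C))) <=
     cmod nu * (K * s ^+ 2) * expR (cmod c * (cmod z + 1)).
    apply: ler_pM => //; rewrite ?expR_ge0 ?mulr_ge0 ?cmod_ge0//.
    by rewrite ler_wpM2l ?cmod_ge0.
  apply: (le_trans q); rewrite -[leLHS]addr0 lerD ?exprn_ge0 ?(ltW s0)//.
  by rewrite le_eqVlt; apply/orP; left; apply/eqP; ring.
have : B * s ^+ 2 <= g / 2 * s by rewrite expr2 mulrA ler_wpM2r ?(ltW s0)// mulrC.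
nra.
Qed.

End ZeroFinding.

(** * Multiplicity, asymptotics and density of the zeros *)

Section Counting.
Variable R : realType.
Local Notation C := R[i].
Variables (a t : R) (q : C) (M : nat) (z : nat -> C).
Hypotheses (a1 : 1 <= a) (t0 : 0 < t) (hz : forall m, cmod (z m) <= 1 / 32).
Hypothesis hM : 4 * (cmod q + 1) <= a * M%:R.

Let X (m : nat) : R := a * m%:R.

Lemma arith_large (B : R) : exists M0, forall m, (M0 <= m)%N -> B <= X m.
Proof.
exists (Num.truncn B).+1 => m Mm.
have B1 := ltW (truncnS_gt B); rewrite (le_trans B1)// /X.
have m1 : (Num.truncn B).+1%:R <= m%:R :> R by rewrite ler_nat.
by rewrite (le_trans m1)// ler_peMl.
Qed.

Let c0 : R := cmod q + 1.
Let c00 : 1 <= c0. Proof. by rewrite /c0; have := cmod_ge0 q; lra. Qed.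
Let lam (m : nat) : C := lcurve X t q (m + M) (z m).

Let X_ge m : 4 * c0 <= X (m + M).
Proof.
rewrite (le_trans hM)// /X natrD mulrDr lerDr mulr_ge0//.
by have := a1; lra.
Qed.

Let re_lam m : `|complex.Re (lam m) - X (m + M)| <= c0.
Proof.
have -> : complex.Re (lam m) - X (m + M) = complex.Re q + complex.Re (z m).
  rewrite /lam /lcurve; move: (X (m + M)) (z m) => y [u v]; case: (q) => qr qi /=.
  by ring.
have := cmod_Re q; have := cmod_Re (z m); have := hz m.
by rewrite /c0 !ler_norml; lra.
Qed.

Let im_lam m : `|complex.Im (lam m) + t * ln (X (m + M))| <= c0.
Proof.
have -> : complex.Im (lam m) + t * ln (X (m + M)) = complex.Im q + complex.Im (z m).
  rewrite /lam /lcurve; move: (X (m + M)) (z m) => y [u v]; case: (q) => qr qi /=.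
  by ring.
have := cmod_Im q; have := cmod_Im (z m); have := hz m.
by rewrite /c0 !ler_norml; lra.
Qed.

Let re_bounds m : X (m + M) / 2 <= complex.Re (lam m) <= 2 * X (m + M).
Proof. by have := re_lam m; have := X_ge m; rewrite ler_norml; have := c00; lra. Qed.

Lemma lam_re_gt0 m : 0 < complex.Re (lam m).
Proof. by have := re_bounds m; have := X_ge m; have := c00; lra. Qed.

Lemma lam_neq0 m : lam m != 0.
Proof. by apply/eqP => e; have := lam_re_gt0 m; rewrite e ltxx. Qed.

Hypothesis a2 : 2 <= a.

(** Lattice points are at least 2 apart while the local displacements are at most 1/32, so the real
    parts already separate the sequence. *)
Lemma lam_inj m n : lam m = lam n -> m = n.
Proof.
move=> /(congr1 (@complex.Re R)).
have e j : complex.Re (lam j) = X (j + M) + complex.Re q + complex.Re (z j).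
  rewrite /lam /lcurve; move: (X (j + M)) (z j) => y [u v]; case: (q) => qr qi /=.
  by ring.
rewrite !e.
have := cmod_Re (z m); have := cmod_Re (z n); have := hz m; have := hz n.
rewrite !ler_norml => h1 h2 h3 h4 h5.
have w k l : X (k + M) - X (l + M) < 1 -> (k <= l)%N.
  rewrite /X -mulrBr => h; rewrite leqNgt; apply/negP => lk.
  have : 1 <= (k + M)%:R - (l + M)%:R :> R.
    by rewrite lerBrDl natr1 ler_nat ltn_add2r.
  set y := (X in 1 <= X) in h * => y1.
  have : a * 1 <= a * y by rewrite ler_pM2l//; have := a1; lra.
  move: h; rewrite -/y => h; move: h a2; lra.
by apply/eqP; rewrite eqn_leq; apply/andP; split; apply: w; lra.
Qed.

Lemma lam_level m : ([set j | lam j = lam m] #<= `I_1)%card.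
Proof.
have -> : [set j | lam j = lam m] = [set m].
  by apply/seteqP; split => j /= => [/lam_inj|->].
by have /card_eqPle[] := card_set1 (x := m).
Qed.

(** The real part lies between half and twice the lattice point, so its logarithm is off by at most
    1, and the imaginary part is off by at most [c0]; both errors disappear after division by the
    logarithm. *)
Lemma lam_asymptotic : asymptotic_to_log_curve t lam.
Proof.
have large A : \forall m \near \oo, A <= complex.Re (lam m).
  have [M0 h] := arith_large (2 * A).
  near=> m; have /andP[h1 _] := re_bounds m; apply: le_trans h1.
  rewrite ler_pdivlMr// mulrC h// (leq_trans _ (leq_addr _ _))//.
  by near: m; exact: nbhs_infty_ge.
split; first by apply/cvgryPge.
apply/cvgrPdist_le => e e0.
near=> m.
have rp := lam_re_gt0 m.
have Xp : 0 < X (m + M) by have := X_ge m; have := c00; lra.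
have l2 : ln (2 : R) <= 1 by rewrite -[2]/(1 + 1) le_ln1Dx//; lra.
have /andP[r1 r2] := re_bounds m.
have d1 : ln (complex.Re (lam m)) <= 1 + ln (X (m + M)).
  rewrite (@le_trans _ _ (ln (2 * X (m + M))))//; first by rewrite ler_ln// posrE; lra.
  by rewrite lnM ?posrE//; lra.
have d2 : ln (X (m + M)) <= 1 + ln (complex.Re (lam m)).
  rewrite (@le_trans _ _ (ln (2 * complex.Re (lam m))))//; first by rewrite ler_ln// ?posrE; lra.
  by rewrite lnM ?posrE//; lra.
have big : (t + c0) / e <= ln (complex.Re (lam m)).
  rewrite -ler_expR lnK ?posrE//; near: m; exact: large.
have im := im_lam m; move: im d1 d2 big.
set u := complex.Im _; set r := ln (complex.Re _); set y := ln _ => im d1 d2 big.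
have r0 : 0 < r by apply: lt_le_trans big; rewrite divr_gt0// addr_gt0// (lt_le_trans ltr01).
have -> : t - - u / r = (u + t * y + t * (r - y)) / r by field; rewrite gt_eqF.
rewrite normrM normfV [X in _ / X]gtr0_norm// ler_pdivrMr//.
move: big; rewrite ler_pdivrMr// => big.
apply: le_trans (ler_normD _ _) _; rewrite [leRHS]mulrC (le_trans _ big)// addrC lerD//.
by rewrite normrM gtr0_norm// ger_pMr// ler_norml; lra.
Unshelve. all: by end_near. Qed.

Let upper r : [set m | cmod (lam m) < r] `<=` `I_(Num.truncn ((r + c0) / a)).+1.
Proof.
move=> m /= mr; rewrite ltnS; have ap : 0 < a by have := a1; lra.
have : m%:R < (r + c0) / a.
  rewrite ltr_pdivlMr//.
  have : X (m + M) - c0 < r.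
    apply: le_lt_trans mr; apply: le_trans (cmod_Re _).
    apply: le_trans (ler_norm _).
    by have := re_lam m; rewrite ler_norml; lra.
  have : m%:R * a <= X (m + M).
    by rewrite /X natrD mulrDr mulrC lerDl mulr_ge0// ltW.
  lra.
move=> h; have := lt_trans h (truncnS_gt _).
by rewrite ltr_nat ltnS.
Qed.

(** Real parts alone bound the count from above. From below, the modulus divided by the lattice
    point tends to 1; the tolerance [a e / 2] is fixed in advance, and all but at most [M + M1 + 1]
    of the expected points are then inside the disc. *)
Lemma lam_density : linear_density a^-1 lam.
Proof.
have ap : 0 < a by have := a1; lra.
have fin r : finite_set [set m | cmod (lam m) < r].
  by apply: sub_finite_set; [exact: upper|exact: finite_II].
split=> //; apply/cvgrPdist_le => e e0.
have [M1 h1] := lcurve_ratio (x := X) t q arith_large (e := a * e / 2) ltac:(by rewrite divr_gt0// mulr_gt0).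
set ee := a * e / 2 in h1.
have ee0 : 0 < ee by rewrite /ee divr_gt0// mulr_gt0.
near=> r.
have rp : 0 < r by apply: lt_le_trans ltr01 _; near: r; exact: nbhs_pinfty_ge.
set u : R := (size _)%:R.
have up : u <= (r + c0) / a + 1.
  apply: (@le_trans _ _ (Num.truncn ((r + c0) / a)).+1%:R).
    by rewrite ler_nat; apply: geq_card_fset_set; apply: subset_card_le; exact: upper.
  by rewrite -natr1 lerD2r truncn_le// divr_ge0//; have := c00; lra.
have lo : r / ((1 + ee) * a) - (M + M1 + 1)%:R <= u.
  set n := Num.truncn (r / ((1 + ee) * a)).
  have rpos : 0 <= r / ((1 + ee) * a) by rewrite divr_ge0 ?mulr_ge0// ltW// addr_gt0.
  have nle : n%:R <= r / ((1 + ee) * a) by rewrite truncn_le.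
  apply: (@le_trans _ _ ((n - M) - M1)%N%:R).
    have := truncnS_gt (r / ((1 + ee) * a)); rewrite -/n => h.
    have : (n.+1%:R : R) <= ((n - M) - M1)%N%:R + (M + M1 + 1)%:R by rewrite -natrD ler_nat addn1 addnS ltnS addnC -leq_subLR subnDA.
    by lra.
  rewrite ler_nat; apply: leq_card_fset_set => //.
  have /card_eqPle[_ h] := card_IID (n := (n - M)%N) (k := M1).
  apply: card_le_trans h _; apply: subset_card_le => m /= [mn /negP]; rewrite -leqNgt => Mm.
  have Xp : 0 < X (m + M) by have := X_ge m; have := c00; lra.
  have := h1 (m + M)%N (z m) (leq_trans Mm (leq_addr _ _)) (le_trans (hz m) _).
  rewrite -/(lam m) => /(_ ltac:(lra)) hr.
  have : cmod (lam m / (X (m + M))%:C) <= 1 + ee.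
    rewrite -[_ / _](subrK 1) (le_trans (cmodD _ _))// cmod1 addrC lerD2l//.
  rewrite cmod_div cmodC gtr0_norm// ler_pdivrMr// => h2.
  apply: le_lt_trans h2 _.
  have : ((m + M)%:R : R) < r / ((1 + ee) * a).
    by apply: lt_le_trans nle; rewrite ltr_nat addnC -ltn_subRL.
  by rewrite ltr_pdivlMr ?mulr_gt0 ?addr_gt0// /X; lra.
have big : ((c0 / a + 1 + (M + M1 + 1)%:R) * 2) / e <= r.
  by near: r; apply: nbhs_pinfty_ge; exact: num_real.
set k : R := (M + M1 + 1)%:R in lo big; have k0 : 0 <= k by exact: ler0n.
have ca : 0 <= c0 / a by rewrite divr_ge0 ?ltW// (lt_le_trans ltr01).
move: big; rewrite ler_pdivrMr// => big.
have lo2 : r / a - r * (e / 2) <= r / ((1 + ee) * a).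
  have -> : r / ((1 + ee) * a) = r / a - r * (ee / a) / (1 + ee).
    by field; rewrite !gt_eqF// addr_gt0.
  have -> : ee / a = e / 2 by rewrite /ee; field; rewrite gt_eqF.
  rewrite lerD2l lerN2 ler_pdivrMr ?addr_gt0// ler_peMr// ?lerDl ?ltW// mulr_gt0//.
  by rewrite divr_gt0.
have ra : (r + c0) / a = r / a + c0 / a by rewrite mulrDl.
have -> : a^-1 - r^-1 * u = (r / a - u) / r by field; rewrite !gt_eqF.
rewrite normrM normfV [X in _ / X]gtr0_norm// ler_pdivrMr//.
move: ra lo2 up lo big; set ra := r / a; set rca := (r + c0) / a; set w := r / ((1 + ee) * a).
set ca' := c0 / a in ca *.
by rewrite ler_norml => ra_ lo2 up lo big; nra.
Unshelve. all: by end_near. Qed.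
End Counting.

(** * The bump potential *)

Section Potential.
Variable R : realType.
Local Notation C := R[i].
Variables (b : nat -> R) (beta : nat -> nat).
Hypotheses (b0 : b 0%N = 0) (b_incr : forall k, b k < b k.+1) (b_lim : b @ \oo --> (1 : R)).
Hypothesis beta_incr : forall k, (1 <= k)%N -> (beta k < beta k.+1)%N.

Definition bump_poly k : {poly C} :=
  ('X - (b k)%:C%:P) ^+ beta k.+1 * ((b k.+1)%:C%:P - 'X) ^+ beta k.+1.

(** The diagonal choice: piece [k] takes account of the constants of all orders up to [k], a finite
    sum, so for any fixed order all pieces of larger index are under control. *)
Let den k : R := \sum_(n < k.+1) (sig_cst (bump_poly k) n + dsig_cst (bump_poly k) n).

Let sd_ge0 k n : 0 <= sig_cst (bump_poly k) n + dsig_cst (bump_poly k) n.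
Proof. by rewrite addr_ge0 ?sig_cst_ge0 ?dsig_cst_ge0. Qed.

Let den_ge0 k : 0 <= den k. Proof. by apply: sumr_ge0. Qed.

(** [den] bounds the Riccati constants by 1, and the summand with [beta] makes each piece Lipschitz
    with constant 1. The leading 1 keeps the denominator positive. *)
Definition bump_eps k : R := (1 + 2 * (beta k.+1)%:R + den k)^-1.

Lemma bump_eps_gt0 k : 0 < bump_eps k.
Proof. by rewrite invr_gt0 -addrA ltr_pwDl// addr_ge0// mulr_ge0. Qed.

Let eps_le k (c y : R) : 0 <= c -> c <= bump_eps k -> y <= 2 * (beta k.+1)%:R + den k -> c * y <= 1.
Proof.
move=> c0 ce yd.
have d0 : 0 < 1 + 2 * (beta k.+1)%:R + den k by rewrite -invr_gt0 bump_eps_gt0.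
have : c * y <= c * (1 + 2 * (beta k.+1)%:R + den k) by rewrite ler_wpM2l//; lra.
move=> /le_trans; apply; move: ce; rewrite /bump_eps.
by rewrite -[_^-1]mul1r ler_pdivlMr.
Qed.

Lemma bump_eps_sig k n (c : R) : 0 <= c -> c <= bump_eps k -> (n <= k)%N ->
  c * sig_cst (bump_poly k) n <= 1 /\ c * dsig_cst (bump_poly k) n <= 1.
Proof.
move=> c0 ce nk.
have : sig_cst (bump_poly k) n + dsig_cst (bump_poly k) n <= den k.
  rewrite /den (bigD1 (Ordinal (nk : (n < k.+1)%N)))//= lerDl sumr_ge0//.
have := sig_cst_ge0 (bump_poly k) n; have := dsig_cst_ge0 (bump_poly k) n.
have : 0 <= 2 * (beta k.+1)%:R :> R by rewrite mulr_ge0.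
by move=> h1 h2 h3 h4; split; apply: (eps_le c0 ce); lra.
Qed.

Lemma bump_eps_lip k (c : R) : 0 <= c -> c <= bump_eps k -> c * (2 * (beta k.+1)%:R) <= 1.
Proof. by move=> c0 ce; apply: (eps_le c0 ce); rewrite lerDl. Qed.

Lemma expr_dist_le n (x y : R) : 0 <= x <= 1 -> 0 <= y <= 1 -> `|x ^+ n - y ^+ n| <= n%:R * `|x - y|.
Proof.
move=> /andP[x0 x1] /andP[y0 y1]; elim: n => [|n IH]; first by rewrite subrr normr0 mul0r.
have -> : x ^+ n.+1 - y ^+ n.+1 = x * (x ^+ n - y ^+ n) + (x - y) * y ^+ n.
  by rewrite !exprS; ring.
have -> : n.+1%:R = n%:R + 1 :> R by rewrite natr1.
rewrite [leRHS]mulrDl mul1r (le_trans (ler_normD _ _))// !normrM lerD//.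
  by rewrite (ger0_norm x0) (le_trans _ IH)// ler_piMl.
by rewrite ler_piMr// ger0_norm ?exprn_ge0// exprn_ile1.
Qed.

Lemma lipschitz_continuous (f : R -> R) : (forall x y, `|f x - f y| <= `|x - y|) -> continuous f.
Proof.
move=> h x; apply/cvgrPdist_le => e e0; near=> y; apply: (le_trans (h _ _)).
near: y; have := cvgr_dist_le (F := nbhs x) (fun y : R => y) x (@cvg_id _ _) e e0.
apply.
Unshelve. all: by end_near. Qed.

Hypothesis beta1_gt0 : (0 < beta 1)%N.
Variables (B : nat -> C) (V : R -> C).
Hypotheses (B_neq0 : forall k, B k != 0) (B_le1 : forall k, cmod (B k) <= 1)
  (B_eps : forall k, cmod (B k) <= bump_eps k).
Hypothesis V_in : forall k (x : R), b k <= x <= b k.+1 ->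
  V x = B k * ((x - b k) ^+ beta k.+1 * (b k.+1 - x) ^+ beta k.+1)%:C.
Hypothesis V_out : forall x, ~~ (0 < x < 1) -> V x = 0.

Definition piece_poly k : {poly C} := B k *: bump_poly k.

Lemma V_poly k x : b k <= x <= b k.+1 -> V x = (piece_poly k).[x%:C].
Proof.
move=> h; rewrite (V_in h) /piece_poly hornerZ /bump_poly hornerM !horner_exp !hornerE.
by rewrite /= !rmorphM !rmorphXn !rmorphB mulrA.
Qed.

Let bge k : 0 <= b k. Proof. exact: b_ge0. Qed.
Let blt k : b k < 1. Proof. exact: b_lt1. Qed.

Let dist01 k x : b k <= x <= b k.+1 -> (0 <= x - b k <= 1) && (0 <= b k.+1 - x <= 1).
Proof. by move=> h; have := bge k; have := blt k.+1; lra. Qed.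

Let V_lip_piece k x y : b k <= x <= b k.+1 -> b k <= y <= b k.+1 -> cmod (V x - V y) <= `|x - y|.
Proof.
move=> hx hy; rewrite (V_in hx) (V_in hy) -mulrBr -rmorphB cmodM cmodC.
have /andP[x1 x2] := dist01 hx; have /andP[y1 y2] := dist01 hy.
have l1 := expr_dist_le (beta k.+1) x1 y1; have l2 := expr_dist_le (beta k.+1) x2 y2.
have := bump_eps_lip (cmod_ge0 (B k)) (B_eps k).
have e1 : x - b k - (y - b k) = x - y by ring.
have e2 : b k.+1 - x - (b k.+1 - y) = - (x - y) by ring.
rewrite e1 in l1; rewrite e2 normrN in l2.
move: l1 l2; set u := (x - b k) ^+ _; set u' := (y - b k) ^+ _.
set v := (b k.+1 - x) ^+ _; set v' := (b k.+1 - y) ^+ _ => l1 l2 h.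
have u1 : `|u| <= 1.
  by move/andP: x1 => [? ?]; rewrite ger0_norm ?exprn_ge0// exprn_ile1.
have v1 : `|v'| <= 1.
  by move/andP: y2 => [? ?]; rewrite ger0_norm ?exprn_ge0// exprn_ile1.
have -> : u * v - u' * v' = u * (v - v') + (u - u') * v' by ring.
have h2 : `|u * (v - v') + (u - u') * v'| <= 2 * (beta k.+1)%:R * `|x - y|.
  rewrite (le_trans (ler_normD _ _))// !normrM.
  have : `|u| * `|v - v'| <= `|v - v'| by rewrite ler_piMl.
  have : `|u - u'| * `|v'| <= `|u - u'| by rewrite ler_piMr.
  lra.
rewrite (le_trans (ler_wpM2l (cmod_ge0 _) h2))// mulrA ler_piMl//.
Qed.

Lemma expr0_beta k : 0 ^+ beta k.+1 = 0 :> R.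
Proof. by rewrite expr0n; case: (beta k.+1) (beta_ge beta_incr beta1_gt0 k.+1). Qed.

Let V_node k : V (b k) = 0.
Proof.
rewrite (@V_in k); last by rewrite lexx ltW.
by rewrite subrr expr0_beta mul0r mulr0.
Qed.

Let V_edges k x : b k <= x <= b k.+1 -> cmod (V x) <= x - b k /\ cmod (V x) <= b k.+1 - x.
Proof.
move=> h; split.
  have := V_lip_piece h (_ : b k <= b k <= b k.+1); rewrite V_node subr0 lexx ltW// => /(_ isT).
  by rewrite ger0_norm// subr_ge0; case/andP: h.
have := V_lip_piece h (_ : b k <= b k.+1 <= b k.+1); rewrite V_node subr0 lexx ltW// => /(_ isT).
by rewrite distrC ger0_norm// subr_ge0; case/andP: h.
Qed.

Let piece x : 0 < x < 1 -> exists k, b k <= x < b k.+1.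
Proof.
move=> /andP[x0 x1].
have [n _ hn] := b_near b_lim (e := (1 - x) / 2) 0 ltac:(by rewrite divr_gt0// subr_gt0).
have ex : exists n, x < b n by exists n; move: hn; rewrite ler_norml; lra.
case: (ex_minnP ex) => -[|m] xm mmin; first by move: xm; rewrite b0; lra.
exists m; rewrite xm andbT leNgt; apply/negP => /mmin.
by rewrite ltnn.
Qed.

(** Across different pieces both values are compared with the zeros at the nodes in between. A
    constant common to all pieces is what gives continuity at the accumulation point 1. *)
Lemma V_lipschitz x y : x <= y -> cmod (V x - V y) <= y - x.
Proof.
move=> xy.
case: (boolP (0 < x < 1)) => [x01|/[dup] x01 /V_out->]; last first.
  rewrite sub0r cmodN; case: (boolP (0 < y < 1)) => [y01|/V_out->]; last by rewrite cmod0 subr_ge0.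
  have [j /andP[j1 j2]] := piece y01.
  have [h _] := @V_edges j y ltac:(by rewrite j1 ltW).
  rewrite (le_trans h)// lerB//; move: x01; rewrite negb_and -!leNgt => /orP[|]; have := bge j; lra.
have [i /andP[i1 i2]] := piece x01.
have [_ hx] := @V_edges i x ltac:(by rewrite i1 ltW).
case: (boolP (0 < y < 1)) => [y01|/[dup] y01 /V_out->]; last first.
  rewrite subr0 (le_trans hx)// lerB//; have := blt i.+1.
  move: y01; rewrite negb_and -!leNgt => /orP[|]; lra.
have [j /andP[j1 j2]] := piece y01.
have [hy _] := @V_edges j y ltac:(by rewrite j1 ltW).
have [ij|ji|e] := ltngtP i j.
- have := b_mono b_incr ij; have := cmodB (V x) (V y); lra.
- by have := b_mono b_incr ji; lra.
rewrite e in i1 i2; have := @V_lip_piece j x y; rewrite i1 j1 (ltW i2) (ltW j2) => /(_ isT isT).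
by rewrite distrC ger0_norm// subr_ge0.
Qed.

Lemma V_ccont : ccont V.
Proof.
have h x y : cmod (V x - V y) <= `|x - y|.
  have [xy|yx] := leP x y; first by rewrite distrC ger0_norm ?subr_ge0// V_lipschitz.
  by rewrite cmod_distC gtr0_norm ?subr_gt0// V_lipschitz// ltW.
split; apply: lipschitz_continuous => x y.
  have -> : complex.Re (V x) - complex.Re (V y) = complex.Re (V x - V y) by case: (V x) (V y) => ? ? [].
  by rewrite (le_trans (cmod_Re _)).
have -> : complex.Im (V x) - complex.Im (V y) = complex.Im (V x - V y) by case: (V x) (V y) => ? ? [].
by rewrite (le_trans (cmod_Im _)).
Qed.

Lemma V_le1 x : cmod (V x) <= 1.
Proof.
case: (boolP (0 < x < 1)) => [/[dup] x01 /piece[i /andP[i1 i2]]|/V_out->]; last by rewrite cmod0.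
have [h _] := @V_edges i x ltac:(by rewrite i1 ltW).
by have := bge i; lra.
Qed.

Definition piece_left k : {poly C} := B k *: ((b k.+1)%:C%:P - 'X) ^+ beta k.+1.
Definition piece_right k : {poly C} :=
  (B k * (-1) ^+ beta k.+1) *: ('X - (b k)%:C%:P) ^+ beta k.+1.

Lemma piece_leftE k : piece_poly k = ('X - (b k)%:C%:P) ^+ beta k.+1 * piece_left k.
Proof. by rewrite /piece_left -scalerAr. Qed.

Lemma piece_rightE k : piece_poly k = ('X - (b k.+1)%:C%:P) ^+ beta k.+1 * piece_right k.
Proof.
rewrite /piece_right /piece_poly /bump_poly -scalerAr -scalerA; congr (_ *: _).
rewrite -[(b k.+1)%:C%:P - 'X]opprB [in LHS]exprNn.
have -> : (-1) ^+ beta k.+1 = ((-1) ^+ beta k.+1 : C)%:P by rewrite polyC_exp polyCN polyC1.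
by rewrite mulrCA mul_polyC mulrC.
Qed.

Let gap k : (b k.+1)%:C - (b k)%:C != 0 :> C.
Proof. by rewrite -rmorphB fmorph_eq0 subr_eq0 gt_eqF. Qed.

Lemma piece_left_neq0 k : (piece_left k).[(b k)%:C] != 0.
Proof. by rewrite hornerZ horner_exp !hornerE mulf_neq0// expf_neq0. Qed.

Lemma piece_right_neq0 k : (piece_right k).[(b k.+1)%:C] != 0.
Proof. by rewrite hornerZ horner_exp !hornerE mulf_neq0 ?expf_neq0// mulf_neq0// expf_neq0// oppr_eq0 oner_neq0. Qed.

End Potential.

(** * Convexity of the exponents *)

Section Slopes.
Variable R : realType.
Variables (b : nat -> R) (beta : nat -> nat).
Hypotheses (b0 : b 0%N = 0) (b_incr : forall k, b k < b k.+1).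

(** Slopes of the polygon with vertices [(2 b_j, nexp j)]. The numbering starts at 0, so slope [K]
    belongs to the curve number [K + 1]. *)
Definition slope j : R := ((nexp beta j.+1)%:R - (nexp beta j)%:R) / (2 * (b j.+1 - b j)).

Hypothesis slope_lt : forall j, slope j < slope j.+1.

Lemma slope_le i j : (i <= j)%N -> slope i <= slope j.
Proof.
elim: j => [|j IH]; first by rewrite leqn0 => /eqP->.
by rewrite leq_eqVlt => /predU1P[->//|/IH/le_trans]; apply; rewrite ltW.
Qed.

Let gap j : 0 < b j.+1 - b j. Proof. by rewrite subr_gt0. Qed.

Lemma phj_diff t j : phj b beta t j.+1 - phj b beta t j = 2 * (b j.+1 - b j) * (t - slope j).
Proof. by rewrite /phj /slope; have := gap j => g; field; rewrite gt_eqF. Qed.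

Lemma phj_slope K : phj b beta (slope K) K.+1 = phj b beta (slope K) K.
Proof. by apply/eqP; rewrite -subr_eq0 phj_diff subrr mulr0. Qed.

(** By [phj_diff] and the increasing slopes, [phj] strictly increases up to [K], is level from [K]
    to [K + 1] and strictly decreases afterwards. *)
Lemma phj_max K j : j != K -> j != K.+1 -> phj b beta (slope K) j < phj b beta (slope K) K.
Proof.
have up i : (i < K)%N -> phj b beta (slope K) i < phj b beta (slope K) i.+1.
  move=> iK; rewrite -subr_gt0 phj_diff !mulr_gt0// subr_gt0.
  exact: lt_le_trans (slope_lt i) (slope_le iK).
have down i : (K < i)%N -> phj b beta (slope K) i.+1 < phj b beta (slope K) i.
  move=> iK; rewrite -subr_lt0 phj_diff pmulr_rlt0 ?mulr_gt0// subr_lt0.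
  exact: lt_le_trans (slope_lt K) (slope_le iK).
have left d : (d < K)%N -> phj b beta (slope K) (K - d.+1) < phj b beta (slope K) K.
  elim: d => [|d IH] dK; first by rewrite (lt_le_trans (up _ _))// ?subn1 ?prednK// ltn_predL.
  apply: lt_trans (IH (ltnW dK)); rewrite -(subnSK dK); apply: up.
  by rewrite ltn_subrL (leq_ltn_trans _ dK).
have right d : phj b beta (slope K) (K + d.+2) < phj b beta (slope K) K.
  rewrite -phj_slope; elim: d => [|d IH]; first by rewrite addn2; apply: down.
  by apply: lt_trans IH; rewrite (addnS K); apply: down; rewrite -addn1 leq_add2l.
move=> jK jK1; have [lt|gt|e] := ltngtP j K; last by rewrite e eqxx in jK.
  by rewrite -(subKn (ltnW lt)) -(@prednK (K - j)) ?subn_gt0//; apply: left; rewrite prednK ?subn_gt0// leq_subr.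
have lt2 : (K.+2 <= j)%N by rewrite ltn_neqAle eq_sym jK1.
by rewrite -(subnKC lt2) -addn2 -addnA add2n; exact: right.
Qed.

Lemma slope0 : slope 0 = (4 + 2 * (beta 1)%:R) / (2 * b 1).
Proof. by rewrite /slope /= b0 !subr0 !natrD; congr (_ / _); ring. Qed.

Lemma slopeS j : slope j.+1 = ((beta j.+2)%:R - (beta j.+1)%:R) / (2 * (b j.+2 - b j.+1)).
Proof. by rewrite /slope /= !natrD; congr (_ / _); ring. Qed.

Lemma slope_b1 K : 4 <= 2 * slope K * b 1.
Proof.
have b1 : 0 < b 1 by rewrite -b0.
have h : slope 0 * b 1 <= slope K * b 1 by rewrite ler_wpM2r ?(ltW b1)// slope_le.
have : 2 * (slope 0 * b 1) = 4 + 2 * (beta 1)%:R by rewrite slope0; field; rewrite gt_eqF.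
have : 0 <= 2 * (beta 1)%:R :> R by rewrite mulr_ge0.
by rewrite -mulrA; lra.
Qed.

Lemma slope_gt0 K : 0 < slope K.
Proof.
have b1 : 0 < b 1 by rewrite -b0.
have := slope_b1 K; rewrite mulrAC => h; have b2 : 0 < 2 * b 1 by rewrite mulr_gt0.
by rewrite -(pmulr_rgt0 _ b2); lra.
Qed.
End Slopes.

(** * Resonances near each curve *)

Section Assembly.
Variable R : realType.
Local Notation C := R[i].
Variables (b : nat -> R) (beta : nat -> nat).
Hypotheses (b0 : b 0%N = 0) (b_incr : forall k, b k < b k.+1) (b_lim : b @ \oo --> (1 : R)).
Hypotheses (beta1_gt0 : (0 < beta 1)%N) (beta_incr : forall k, (1 <= k)%N -> (beta k < beta k.+1)%N).
Hypothesis slope_lt : forall j, slope b beta j < slope b beta j.+1.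
Variables (B : nat -> C) (V : R -> C).
Hypotheses (B_neq0 : forall k, B k != 0) (B_le1 : forall k, cmod (B k) <= 1)
  (B_eps : forall k, cmod (B k) <= bump_eps b beta k).
Hypothesis V_in : forall k (x : R), b k <= x <= b k.+1 ->
  V x = B k * ((x - b k) ^+ beta k.+1 * (b k.+1 - x) ^+ beta k.+1)%:C.
Hypothesis V_out : forall x, ~~ (0 < x < 1) -> V x = 0.

Let P := piece_poly b beta B.
Let s k n : R := cmod (B k) * sig_cst (bump_poly b beta k) n.
Let g k n : R := cmod (B k) * dsig_cst (bump_poly b beta k) n.

Let s0 k n : 0 <= s k n. Proof. by rewrite mulr_ge0 ?cmod_ge0 ?sig_cst_ge0. Qed.
Let g0 k n : 0 <= g k n. Proof. by rewrite mulr_ge0 ?cmod_ge0 ?dsig_cst_ge0. Qed.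

Let hs k n (u : C) : 1 <= cmod u -> pnorm (sig u (P k) n) <= s k n / cmod u.
Proof. by move=> u1; exact: (pnorm_sig (bump_poly b beta k) (B_le1 k) u1 n). Qed.

Let hg k n (u : C) : 1 <= cmod u ->
  pnorm (sig u (P k) n.+1 - sig u (P k) n) <= g k n / cmod u ^+ n.+1.
Proof. by move=> u1; exact: (pnorm_dsig (bump_poly b beta k) (B_le1 k) u1 n). Qed.

Let s1 k n : (n <= k)%N -> s k n <= 1.
Proof. by move=> nk; have [] := bump_eps_sig (cmod_ge0 (B k)) (B_eps k) nk. Qed.

Let g1 k n : (n <= k)%N -> g k n <= 1.
Proof. by move=> nk; have [] := bump_eps_sig (cmod_ge0 (B k)) (B_eps k) nk. Qed.

Let cb k : cmod (b k)%:C <= 1.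
Proof. by rewrite cmodC ger0_norm ?b_ge0// ltW// b_lt1. Qed.

Let cV : ccont V := V_ccont b0 b_incr b_lim beta_incr beta1_gt0 B_eps V_in V_out.
Let hV : forall x, cmod (V x) <= 1 := V_le1 b0 b_incr b_lim beta_incr beta1_gt0 B_eps V_in V_out.
Let VP : forall k x, b k <= x <= b k.+1 -> V x = (P k).[x%:C] := V_poly V_in.
Let PL := piece_leftE b beta B.
Let PR := piece_rightE b beta B.
Let qL0 := piece_left_neq0 beta b_incr B_neq0.
Let qR0 := piece_right_neq0 beta b_incr B_neq0.

(** The order of the quantifiers matters: the constants do not depend on the order [N] or the
    region. The shift [q] is computed from them, [G] depends on [q], and [N] is fixed only later. *)
Lemma leading_jumps : exists c0 : C, exists c : nat -> C, [/\ c0 != 0, forall j, c j != 0 &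
  forall N T (G : R) j, (T + beta 1 + 3 <= N)%N -> (beta j.+1 < N)%N ->
    bO (Dom b T G) (@kk R) (fun l => tau b P N j l - c j * c0 * (-1) ^+ (beta 1).+1 *
      (cexp (2 * ('i * l) * (b j.+1)%:C) / (2 * ('i * l)) ^+ nexp beta j.+1))
    (fun l => TT b beta j.+1 l / kk l)].
Proof.
have [c0 c0n h0] := sig_lead (g0 0%N) (cb 0) (@hg 0%N) (PL 0%N) (qL0 0%N).
have hj j : exists c : C, c != 0 /\ forall n u, 1 <= cmod u -> (beta j.+1 < n)%N ->
  cmod ((sig u (P j) n).[(b j.+1)%:C] - c * u ^- (beta j.+1).+1) <= (\sum_(i < n) g j i) / cmod u ^+ (beta j.+1).+2.
  by have [c cn h] := sig_lead (g0 j) (cb j.+1) (@hg j) (PR j) (qR0 j); exists c.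
have [c hc] := choice hj.
exists c0, c; split=> //; first by move=> j; have [] := hc j.
move=> N T G j NT jN; have [_ hcj] := hc j.
apply: (tau_lead b0 b_incr b_lim beta_incr PL PR qL0 qR0 g0 hg T G
  (K1 := \sum_(i < N) g j i) (K2 := \sum_(i < N) g 0 i)).
- by apply: sumr_ge0.
- by apply: sumr_ge0.
- by move=> u u1; exact: hcj.
- by move=> u u1; apply: h0 => //; apply: leq_trans NT; rewrite -addnA addnC -addnA -{1}(addn0 (beta 1)) ltn_add2l.
Qed.

Lemma cexp_period (m : nat) : cexp (2 * 'i * (pi * m%:R)%:C) = 1 :> C.
Proof.
have -> : 2 * 'i * (pi * m%:R)%:C = m%:R * (2 * 'i * pi%:C) :> C.
  by rewrite rmorphM rmorph_nat; ring.
rewrite cexpMn; have -> : 2 * 'i * pi%:C = (0 : R) +i* (pi *+ 2) :> C.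
  by apply/eqP; rewrite eq_complex ReM ImM /=; apply/andP; split; apply/eqP; ring.
by rewrite /cexp /= expR0 !mul1r cos2pi sin2pi expr1n.
Qed.

Variable K : nat.
Let t := slope b beta K.
Let gap := b K.+1 - b K.
Let gap0 : 0 < gap. Proof. by rewrite subr_gt0. Qed.
Let gap1 : gap <= 1.
Proof. by have := b_ge0 b0 b_incr K; have := b_lt1 b_incr b_lim K.+1; rewrite /gap; lra. Qed.
(** The period of [exp (2 i gap x)], hence the spacing of the zeros; its inverse is the density. *)
Let a : R := pi / gap.
Let a2 : 2 <= a.
Proof. by rewrite ler_pdivlMr// (le_trans _ (pi_ge2 R))// ler_piMr. Qed.
Let a1 : 1 <= a. Proof. by have := a2; lra. Qed.
Let x (m : nat) : R := a * m%:R.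

Let two_i : 2 * 'i != 0 :> C.
Proof. by rewrite mulf_neq0 ?pnatr_eq0// -cmod_gt0 cmod_i. Qed.

Let lattice m : cexp (2 * 'i * (x m)%:C * gap%:C) = 1.
Proof.
rewrite -mulrA -rmorphM (_ : x m * gap = pi * m%:R) ?cexp_period//.
by rewrite /x /a; field; rewrite gt_eqF.
Qed.

(** Around every lattice point far enough out, the normalised Wronskian is within [gap / 64] of
    [1 - exp (2 i gap z)] on the unit disc, so [perturbed_zero] and [simple_zero] apply there with
    one fixed scale. *)
Lemma zeros_near_curve : exists q M z, 4 * (cmod q + 1) <= a * M%:R /\
  forall m, [/\ cmod (z m) <= 1 / 32, Wr V (lcurve x t q (m + M) (z m)) = 0 &
    tcoef (lcurve x t q (m + M) (z m)) (Wr V) 1 != 0].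
Proof.
have [c0 [c [c0n cn hc]]] := leading_jumps.
pose lc j : C := if j is i.+1 then c i * c0 * (-1) ^+ (beta 1).+1 else 1.
have lcn j : lc j != 0.
  by case: j => [|j]; rewrite /= ?oner_neq0// !mulf_neq0// expf_neq0// oppr_eq0 oner_neq0.
have gC : gap%:C != 0 :> C by rewrite fmorph_eq0 gt_eqF.
(* The value of [exp (2 i q gap)] that turns the quotient of the two leading terms into -1. *)
pose D : C := - (lc K / lc K.+1) * ((2 * 'i) ^+ nexp beta K.+1 / (2 * 'i) ^+ nexp beta K).
have [w hw] : exists w, cexp w = D.
  apply: cexp_surj; apply: mulf_neq0; first by rewrite oppr_eq0; apply: mulf_neq0; rewrite ?invr_eq0.
  by apply: mulf_neq0; rewrite ?invr_eq0; apply: expf_neq0.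
pose q := w / (2 * 'i * gap%:C).
have t0 : 0 < t by apply: slope_gt0.
pose T := (Num.truncn (2 * t)).+1.
pose G := 256 * expR (2 * (cmod q + 1)).
pose N := (T + beta 1 + 3 + K.+1 + beta K.+1)%N.
have G1 : 1 <= G.
  have : 1 <= expR (2 * (cmod q + 1)).
    by rewrite -expR0 ler_expR mulr_ge0// addr_ge0// cmod_ge0.
  by rewrite /G; lra.
have NT : (T + beta 1 + 3 <= N)%N by rewrite /N -(addnA (T + beta 1 + 3)%N) leq_addr.
have KN : (K < N)%N by rewrite /N addnAC leq_addl.
have lim := hfun_lim (b_ge0 b0 b_incr) (b_lt1 b_incr b_lim) b0 (W := Wr V) (tau := tau b P N) (lc := lc)
  (N := N) (T := T) (K := K) (G := G) (x := x) (t := t) (q := q) (arith_large a1) t0 erefl lcn KN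
  (ltW (truncnS_gt _)) (slope_b1 b0 b_incr slope_lt K) (lexx _) (phj_slope beta b_incr K)
  (@phj_max _ b beta b_incr slope_lt K)
  (Wr_approx b0 b_incr b_lim beta_incr beta1_gt0 cV hV VP PL PR qL0 qR0 s0 g0 hs hg s1 g1 G1 NT)
  (tau_small b0 b_incr b_lim beta_incr PL PR qL0 qR0 g0 hg G NT).
have {}lim := lim _ lattice _.
have [|||M1 h1] := lim _ _ (gap / 64).
- move=> j jK; apply: hc => //; rewrite /N.
  have : (beta j.+1 <= beta K.+1)%N by case: jK => [<-|[->]]//; apply: ltnW; apply: beta_incr.
  by move=> /leq_ltn_trans; apply; rewrite -[ltnLHS]add0n ltn_add2r addnS.
- rewrite (_ : 2 * 'i * q * _ = w); last first.
    by rewrite /q -/gap; field; rewrite gC -cmod_gt0 cmod_i ltr01.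
  rewrite hw /D; field.
  by rewrite !lcn !expf_neq0.
- by rewrite divr_gt0.
have [M2 h2] := arith_large a1 (4 * (cmod q + 1)).
(* Beyond [M1] the approximation holds and beyond [M2] the displacement is small against the lattice
   point; the 1 keeps the lattice point away from 0, so that the normalising factor is defined and
   nonzero. *)
pose M := maxn M1 (maxn M2 1).
have M_1 : (0 < M)%N by rewrite !leq_max !orbT.
have zex m : exists z, [/\ cmod z <= 1 / 32, Wr V (lcurve x t q (m + M) z) = 0 &
    tcoef (lcurve x t q (m + M) z) (Wr V) 1 != 0].
  have xm : (x (m + M))%:C != 0 :> C.
    rewrite fmorph_eq0; apply: mulf_neq0; first by rewrite gt_eqF// (lt_le_trans ltr01).
    by rewrite pnatr_eq0 -lt0n addn_gt0 M_1 orbT.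
  pose nu := hnorm b beta lc K x t q (m + M).
  have nun : nu != 0.
    rewrite /nu /hnorm oppr_eq0; apply: mulf_neq0; first apply: mulf_neq0.
    + by rewrite invr_eq0; apply: mulf_neq0.
    + by rewrite fmorph_eq0 gt_eqF// expR_gt0.
    rewrite invr_eq0; apply: mulf_neq0; first by apply: mulf_neq0 => //; exact: cexp_neq0.
    by rewrite invr_eq0 expf_neq0.
  pose l0 := (x (m + M))%:C - 'i * (t * ln (x (m + M)))%:C + q.
  have We := Wr_entire cV hV.
  have Fe : entireS (fun z => nu * Wr V (l0 + z) * cexp (- (2 * 'i * (b K)%:C) * z)).
    apply: entireSM; first by apply: entireSM; [exact: entireS_cst|exact: entireS_shift].
    have := cexp_entire (- (2 * b K)); congr entireS; apply/funext => z; congr cexp.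
    by rewrite rmorphN rmorphM rmorph_nat; ring.
  have hF z : cmod z <= 1 -> cmod (nu * Wr V (l0 + z) * cexp (- (2 * 'i * (b K)%:C) * z) -
      (1 - cexp (2 * 'i * gap%:C * z))) <= gap / 64.
    by apply: h1; rewrite (leq_trans _ (leq_addl _ _))// leq_maxl.
  have [z [z1 Fz lb]] := perturbed_zero Fe gap0 gap1 (lexx _) hF.
  have [W0 W1] := simple_zero We gap0 Fz nun lb.
  by exists z.
have [z hz] := choice zex.
exists q, M, z; split=> //; apply: h2.
by rewrite !leq_max leqnn orbT.
Qed.

Lemma resonances_near_curve : exists lam : nat -> C,
  [/\ resonance_sequence V lam, asymptotic_to_log_curve t lam & linear_density (pi^-1 * gap) lam].
Proof.
have [q [M [z [hM hz]]]] := zeros_near_curve.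
have t0 : 0 < t by apply: slope_gt0.
have z1 m : cmod (z m) <= 1 / 32 by have [] := hz m.
exists (fun m => lcurve x t q (m + M) (z m)); split.
- exists (Tres V); split; first exact: Tres_continuation cV hV V_out.
  move=> m; have [_ W0 W1] := hz m; split.
  + exact: lam_neq0 a1 z1 hM m.
  + exact: simple_zero_pole cV hV V_out _ W0 W1.
  + exists 1%N; split; first exact: simple_zero_multiplicity cV hV V_out _ W0 W1.
    exact: lam_level a1 z1 a2 m.
- exact: lam_asymptotic a1 t0 z1 hM.
- have -> : pi^-1 * gap = a^-1 by rewrite /a invf_div mulrC.
  exact: lam_density a1 z1 hM.
Qed.
End Assembly.

(* [beta 0] is unused. *)
Theorem theorem4p3 (R : realType) (b : nat -> R) (beta : nat -> nat)
    (b0 : b 0%N = 0)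
    (b_incr : forall k, b k < b k.+1)
    (b_lim : b @ \oo --> (1 : R))
    (beta1_gt0 : (0 < beta 1)%N)
    (beta_incr : forall k, (1 <= k)%N -> (beta k < beta k.+1)%N)
    (slope1_lt :
      (4 + 2 * (beta 1%N)%:R) / (2 * b 1%N)
        < ((beta 2%N)%:R - (beta 1%N)%:R) / (2 * (b 2%N - b 1%N)))
    (slope_lt : forall k, (1 <= k)%N ->
      ((beta k.+1)%:R - (beta k)%:R) / (2 * (b k.+1 - b k))
        < ((beta k.+2)%:R - (beta k.+1)%:R) / (2 * (b k.+2 - b k.+1)))
    (slope1_min : forall k, (1 <= k)%N ->
      (4 + 2 * (beta 1%N)%:R) / (2 * b 1%N)
        <= (4 + (beta 1%N)%:R + (beta k)%:R) / (2 * b k))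
    (slope_min : forall p k, (1 <= p)%N -> (p <= k)%N ->
      ((beta p.+1)%:R - (beta p)%:R) / (2 * (b p.+1 - b p))
        <= ((beta k.+1)%:R - (beta p)%:R) / (2 * (b k.+1 - b p))) :
  exists eps : nat -> R, (forall k, 0 < eps k) /\
  forall (B : nat -> R[i]) (V : R -> R[i]),
    (forall k, B k != 0) ->
    (forall k, cmod (B k) <= 1) ->
    (forall k, cmod (B k) <= eps k) ->
    (forall k (x : R), b k <= x <= b k.+1 ->
      V x = B k * ((x - b k) ^+ beta k.+1 * (b k.+1 - x) ^+ beta k.+1)%:C) ->
    (forall x : R, ~~ (0 < x < 1) -> V x = 0) ->
  forall k, (1 <= k)%N ->
  let t : R :=
    if k == 1%N then (4 + 2 * (beta 1%N)%:R) / (2 * b 1%N)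
    else ((beta k)%:R - (beta k.-1)%:R) / (2 * (b k - b k.-1)) in
  exists lam : nat -> R[i],
    [/\ resonance_sequence V lam,
        asymptotic_to_log_curve t lam
      & linear_density (pi^-1 * (b k - b k.-1)) lam].
Proof.
have sl j : slope b beta j < slope b beta j.+1.
  case: j => [|j]; first by rewrite (slope0 _ b0) slopeS.
  by rewrite !slopeS; exact: slope_lt.
exists (bump_eps b beta); split; first exact: bump_eps_gt0.
move=> B V B_neq0 B_le1 B_eps V_in V_out [//|K] _.
have := resonances_near_curve b0 b_incr b_lim beta1_gt0 beta_incr sl B_neq0 B_le1 B_eps V_in V_out K.
case: K => [|K] /=; first by rewrite (slope0 _ b0).
by rewrite slopeS.
Qed.
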